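(* For $f\in\mathcal{A}$ let $H(z)=\dfrac{z^2}{\int_0^z (t/f(t))\,dt}$ for $z\in\mathbb{D}$. Then: (i) If $f\in\mathcal{S}$, then $H\in\mathcal{M}$ in the disk $|z|\leq r_3$, where $r_3$ ($\approx 0.7829$) is the unique positive root in $(0,1)$ of the equation $$\frac{-4+4r^2+r^4}{(1-r^2)^2}-\frac{12}{r^2}\log(1-r^2)-\frac{8}{r^2}\mathrm{Li}_2(r^2)-1=0.$$ (ii) If $f\in\mathcal{M}$, then $H\in\mathcal{M}$ in the unit disk $\mathbb{D}$.
   Context: $\mathbb{D}=\{z\in\mathbb{C}:|z|<1\}$. $\mathcal{A}$ is the family of functions $f$ analytic in $\mathbb{D}$ with $f(0)=0$ and $f'(0)=1$. $\mathcal{S}$ is the set of $f\in\mathcal{A}$ that are univalent (injective) in $\mathbb{D}$. $\mathrm{Li}_2(x)=\sum_{n=1}^\infty x^n/n^2$ is the dilogarithm. $\mathcal{M}$ is the class of $f\in\mathcal{A}$ (with $f(z)\neq 0$ for $z\in\mathbb{D}\setminus\{0\}$, so that $z/f(z)$ is analytic in $\mathbb{D}$ with value $1$ at $0$) such that $$\left|z^2\left(\frac{z}{f(z)}\right)''+f'(z)\left(\frac{z}{f(z)}\right)^2-1\right|\leq 1\quad\text{for all } z\in\mathbb{D}.$$ For $0<r<1$, a function $H$ ''belongs to $\mathcal{M}$ in the disk $|z|\le r$'' if $H$ is analytic there with $H(0)=0$, $H'(0)=1$, $H(z)\ne0$ for $0<|z|\le r$, and the inequality $$\left|z^2\left(\frac{z}{H(z)}\right)''+H'(z)\left(\frac{z}{H(z)}\right)^2-1\right|\leq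 1$$ holds for all $|z|\le r$; ''in the unit disk $\mathbb{D}$'' means simply $H\in\mathcal{M}$. Removable singularities at $0$ are removed. *)

(* Defs.v *)
From Stdlib Require Import Reals.
From Coquelicot Require Import Coquelicot.

Open Scope R_scope.
Open Scope C_scope.

Definition unit_disk (z : C) : Prop := (Cmod z < 1)%R.

Definition closed_disk (r : R) (z : C) : Prop := (Cmod z <= r)%R.

(* [ex_derive] is taken over the scalar field C, so this is complex
   differentiability throughout a neighbourhood of [z]. *)
Definition analytic_at (f : C -> C) (z : C) : Prop :=
  locally z (fun w : C => @ex_derive C_AbsRing C_NormedModule f w).

(* For an arbitrary set [E], "analytic on E" means on some open set containing
   E; functions are total, and their values far from [E] are irrelevant. *)
Definition analytic_on (E : C -> Prop) (f : C -> C) : Prop :=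
  forall z : C, E z -> analytic_at f z.

(* Coquelicot's [C_derive] is a total function; it is the complex derivative at
   points of complex differentiability (lemma [C_derive_correct]), and below it
   is only used together with analyticity. *)
Definition normalized_on (E : C -> Prop) (f : C -> C) : Prop :=
  analytic_on E f /\ f 0 = 0 /\ C_derive f 0 = 1.

Definition class_A (f : C -> C) : Prop := normalized_on unit_disk f.

Definition class_S (f : C -> C) : Prop :=
  class_A f /\
  (forall z w : C, unit_disk z -> unit_disk w -> f z = f w -> z = w).

(* z / f(z), with the removable singularity at 0 filled in, for f(0) = 0 and
   f'(0) = 1. *)
Definition z_over (f : C -> C) (z : C) : C :=
  if Ceq_dec z 0 then 1 else z / f z.

(* z^2 (z/f(z))'' + f'(z) (z/f(z))^2 - 1 *)
Definition M_expr (f : C -> C) (z : C) : C :=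
  z ^ 2 * C_derive (C_derive (z_over f)) z + C_derive f z * z_over f z ^ 2 - 1.

Definition belongs_M_on (E : C -> Prop) (f : C -> C) : Prop :=
  normalized_on E f /\
  (forall z : C, E z -> z <> 0 -> f z <> 0) /\
  (forall z : C, E z -> (Cmod (M_expr f z) <= 1)%R).

Definition class_M (f : C -> C) : Prop := belongs_M_on unit_disk f.

(* Integral of [g] along the straight segment from 0 to [z]; the analytic
   integrands considered here make it path-independent in the disk. *)
Definition int_from_0 (g : C -> C) (z : C) : C :=
  z * RInt (V := C_R_CompleteNormedModule) (fun s : R => g (RtoC s * z)) 0 1.

(* z^2 / int_0^z t/f(t) dt; the integral has a simple zero at 0, so the
   removed singularity has value 0. *)
Definition H_transform (f : C -> C) (z : C) : C :=
  if Ceq_dec z 0 then 0 else z ^ 2 / int_from_0 (z_over f) z.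

Definition Li2 (x : R) : R :=
  Series (fun n : nat => (x ^ S n / INR (S n) ^ 2)%R).

Definition r3_equation (r : R) : Prop :=
  ((- 4 + 4 * r ^ 2 + r ^ 4) / (1 - r ^ 2) ^ 2
   - 12 / r ^ 2 * ln (1 - r ^ 2)
   - 8 / r ^ 2 * Li2 (r ^ 2) - 1 = 0)%R.

(* Main.v *)
Require Import Defs.
From Stdlib Require Import Reals Lra Lia Psatz Compare_dec.
From Coquelicot Require Import Coquelicot.

(* Write z / f(z) = sum b_n z^n. Then z / H(z) = sum b_n z^n / (n + 1), and membership of H in M means
   |sum (n - 1)^2 b_n z^n / (n + 1) - 1| <= 1 together with z / H(z) <> 0.

   (ii) The bound passes from f to H because H averages over the rays from 0. A zero z of z / H(z) is
   excluded by contraction: it would produce a zero of z / f(z) in the disk.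

   (i) By termwise AM-GM and the area theorem sum (n - 1) |b_n|^2 <= 1, the bound holds as soon as
   sum_(n >= 2) (n - 1)^3 / (n + 1)^2 r^(2n) <= 1, which is the equation for r3 in closed form.
   Zeros of z / H(z) in |z| <= 0.783 are excluded by the area theorem for f and for its odd square-root
   transform. The area theorem is derived without Green's formula: the logarithmic kernel log |w - w'|^2
   is conditionally negative, its double mean against the tangent of the curve w = 1 / f(r e^(it)),
   suitably regularised, is therefore nonpositive, and it is evaluated by Parseval's identity. *)

(** * Complex differentiability *)

(** The inequality defining M says nothing about zeros of z / H(z); hence the second argument in
    each half. In (ii) a zero of the average z / H is traded for a zero of z / f at some z / x with
    |x - 2| <= 1. For the area theorem the obstacle is the diagonal, where log |W(p) - W(w)|^2 with
    W = 1 / f is singular, while double means are formed of continuous kernels only. Two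
    regularisations are used. Adding d |1 + a conj b|^2 to |a - b|^2 keeps conditional negativity:
    up to functions of one variable the kernel is log (1 - (1 - d) k), with k and all its powers
    positive semidefinite. Replacing the factor w - p of W(p) - W(w) by p - rho w keeps holomorphy,
    so that the energy can be evaluated by mean values; univalence makes the cofactor zero-free. On
    a circle |p - rho w|^2 = rho (|p - w|^2 + d) for a suitable d, so apart from a constant the two
    kernels differ by at most a multiple of d / (|p - w|^2 + d). This is not uniformly small, but
    the Poisson kernel shows that its mean is of order 1 - rho, which suffices as rho tends to 1. *)

Definition cderiv (f : C -> C) (z l : C) : Prop :=
  forall eps : R, 0 < eps -> exists d : R, 0 < d /\
    forall w : C, Cmod (w - z) < d ->
      Cmod (f w - f z - l * (w - z)) <= eps * Cmod (w - z).

Definition ccont (f : C -> C) (z : C) : Prop :=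
  forall eps : R, 0 < eps -> exists d : R, 0 < d /\
    forall w : C, Cmod (w - z) < d -> Cmod (f w - f z) < eps.

Lemma locally_Cmod (z : C) (P : C -> Prop) :
  locally z P <-> exists d : R, 0 < d /\ forall w, Cmod (w - z) < d -> P w.
Proof.
  split.
  - intros [e He]. exists e. split. apply cond_pos.
    intros w Hw. apply He. apply C_NormedModule_mixin_compat1. exact Hw.
  - intros [d [Hd H]].
    (* The balls of [C] come from the product structure, hence are squares; a square of half-side
       [d / sqrt 2] fits into the disk of radius [d]. *)
    assert (Hs : 0 < d / sqrt 2).
    { apply Rdiv_lt_0_compat; trivial. apply sqrt_lt_R0. lra. }
    exists (mkposreal _ Hs). intros w Hw. apply H.
    apply C_NormedModule_mixin_compat2 in Hw. simpl in Hw.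
    replace d with (sqrt 2 * (d / sqrt 2))%R. exact Hw.
    field. apply Rgt_not_eq. apply sqrt_lt_R0. lra.
Qed.

(** Connects the epsilon-delta form, in which the estimates are made, with the [is_derive] over the
    field C to which the definition of analyticity refers. *)
Lemma cderiv_is_derive (f : C -> C) (z l : C) :
  cderiv f z l <-> @is_derive C_AbsRing C_NormedModule f z l.
Proof.
  split.
  - intros H. split.
    { apply is_linear_scal_l. }
    intros x Hx eps.
    assert (x = z) as ->.
    { symmetry. exact (@is_filter_lim_locally_unique C_AbsRing (AbsRing_NormedModule C_AbsRing) z x Hx). }
    destruct (H eps (cond_pos eps)) as [d [Hd Hw]].
    exists (mkposreal d Hd). intros w Hwd. change (Cmod (w - z) < d) in Hwd.
    specialize (Hw w Hwd).
    replace (w - z)%C with (minus w z) in Hw by reflexivity.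
    change (Cmod (minus (minus (f w) (f z)) (mult (minus w z) l)) <= eps * Cmod (minus w z)).
    replace (minus (minus (f w) (f z)) (mult (minus w z) l)) with (f w - f z - l * (w - z))%C; trivial.
    unfold minus, mult, plus, opp; simpl. ring.
  - intros [_ H] eps Heps.
    specialize (H z (fun P HP => HP) (mkposreal eps Heps)).
    destruct H as [d Hw]. exists d. split; [apply cond_pos|]. intros w Hwd.
    specialize (Hw w Hwd).
    change (Cmod (minus (minus (f w) (f z)) (mult (minus w z) l)) <= eps * Cmod (minus w z)) in Hw.
    replace (f w - f z - l * (w - z))%C with (minus (minus (f w) (f z)) (mult (minus w z) l)); trivial.
    unfold minus, mult, plus, opp; simpl. ring.
Qed.
Lemma ccont_const (c z : C) : ccont (fun _ => c) z.
Proof.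
  intros e He. exists 1. split; [lra|]. intros w _.
  replace (c - c)%C with (RtoC 0) by ring. now rewrite Cmod_0.
Qed.

Lemma ccont_id (z : C) : ccont (fun w => w) z.
Proof. intros e He. exists e. now split. Qed.

Lemma ccont_plus (f g : C -> C) (z : C) :
  ccont f z -> ccont g z -> ccont (fun w => f w + g w)%C z.
Proof.
  intros Hf Hg e He.
  destruct (Hf (e / 2)%R) as [d1 [Hd1 H1]]; [lra|].
  destruct (Hg (e / 2)%R) as [d2 [Hd2 H2]]; [lra|].
  exists (Rmin d1 d2). split. now apply Rmin_glb_lt.
  intros w Hw.
  specialize (H1 w (Rlt_le_trans _ _ _ Hw (Rmin_l _ _))).
  specialize (H2 w (Rlt_le_trans _ _ _ Hw (Rmin_r _ _))).
  replace (f w + g w - (f z + g z))%C with ((f w - f z) + (g w - g z))%C by ring.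
  pose proof (Cmod_triangle (f w - f z) (g w - g z)). lra.
Qed.

Lemma ccont_bound (f : C -> C) (z : C) : ccont f z ->
  exists d : R, 0 < d /\ forall w, Cmod (w - z) < d -> Cmod (f w) <= Cmod (f z) + 1.
Proof.
  intros H. destruct (H 1) as [d [Hd Hw]]; [lra|]. exists d. split; trivial.
  intros w Hwd. specialize (Hw w Hwd).
  pose proof (Cmod_triangle (f w - f z) (f z)).
  replace (f w - f z + f z)%C with (f w) in H0 by ring. lra.
Qed.

Lemma ccont_mult (f g : C -> C) (z : C) :
  ccont f z -> ccont g z -> ccont (fun w => f w * g w)%C z.
Proof.
  intros Hf Hg e He.
  destruct (ccont_bound g z Hg) as [d0 [Hd0 H0]].
  set (A := (Cmod (f z) + Cmod (g z) + 1)%R).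
  pose proof (Cmod_ge_0 (f z)) as Pf. pose proof (Cmod_ge_0 (g z)) as Pg.
  assert (HA : 0 < A) by (unfold A; lra).
  assert (HeA : 0 < e / (2 * A)) by (apply Rdiv_lt_0_compat; lra).
  destruct (Hf _ HeA) as [d1 [Hd1 H1]].
  destruct (Hg _ HeA) as [d2 [Hd2 H2]].
  exists (Rmin d0 (Rmin d1 d2)). split. repeat apply Rmin_glb_lt; trivial.
  intros w Hw.
  pose proof (Rlt_le_trans _ _ _ Hw (Rmin_l _ _)) as Hw0.
  pose proof (Rlt_le_trans _ _ _ Hw (Rmin_r _ _)) as Hw12.
  specialize (H0 w Hw0).
  specialize (H1 w (Rlt_le_trans _ _ _ Hw12 (Rmin_l _ _))).
  specialize (H2 w (Rlt_le_trans _ _ _ Hw12 (Rmin_r _ _))).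
  replace (f w * g w - f z * g z)%C with ((f w - f z) * g w + f z * (g w - g z))%C by ring.
  eapply Rle_lt_trans. apply Cmod_triangle. rewrite !Cmod_mult.
  apply Rle_lt_trans with (e / (2 * A) * A + A * Cmod (g w - g z))%R.
  - apply Rplus_le_compat.
    + apply Rmult_le_compat; try apply Cmod_ge_0. lra. unfold A; lra.
    + apply Rmult_le_compat_r. apply Cmod_ge_0. unfold A; lra.
  - apply Rlt_le_trans with (e / (2 * A) * A + A * (e / (2 * A)))%R.
    + apply Rplus_lt_compat_l. now apply Rmult_lt_compat_l.
    + right. field. lra.
Qed.

Lemma ccont_inv (f : C -> C) (z : C) :
  ccont f z -> f z <> 0%C -> ccont (fun w => / f w)%C z.
Proof.
  intros Hf H0 e He. apply Cmod_gt_0 in H0. set (m := Cmod (f z)) in *.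
  destruct (Hf (Rmin (m / 2) (e * (m * m) / 2))%R) as [d [Hd H]].
  { apply Rmin_glb_lt. lra. apply Rdiv_lt_0_compat; [|lra]. repeat apply Rmult_lt_0_compat; trivial. }
  exists d. split; trivial. intros w Hw. specialize (H w Hw).
  pose proof (Rlt_le_trans _ _ _ H (Rmin_l _ _)) as Ha.
  pose proof (Rlt_le_trans _ _ _ H (Rmin_r _ _)) as Hb.
  assert (Hm : m / 2 < Cmod (f w)).
  { pose proof (Cmod_triangle (- (f w - f z)) (f w)).
    rewrite Cmod_opp in H1. replace (- (f w - f z) + f w)%C with (f z) in H1 by ring.
    fold m in H1. lra. }
  assert (N1 : f w <> 0%C) by (apply Cmod_gt_0; lra).
  assert (N2 : f z <> 0%C) by (apply Cmod_gt_0; trivial).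
  replace (/ f w - / f z)%C with (- (f w - f z) / (f w * f z))%C by (field; now split).
  rewrite Cmod_div by (now apply Cmult_neq_0).
  rewrite Cmod_opp, Cmod_mult. fold m.
  apply Rmult_lt_reg_r with (Cmod (f w) * m)%R. apply Rmult_lt_0_compat; lra.
  unfold Rdiv. rewrite Rmult_assoc, Rinv_l, Rmult_1_r.
  2: apply Rgt_not_eq; apply Rmult_lt_0_compat; lra.
  apply Rlt_le_trans with (1 := Hb).
  assert (0 <= e * m) by (apply Rmult_le_pos; lra). nra.
Qed.

Lemma ccont_comp (f g : C -> C) (z : C) :
  ccont f z -> ccont g (f z) -> ccont (fun w => g (f w)) z.
Proof.
  intros Hf Hg e He. destruct (Hg e He) as [d [Hd H]].
  destruct (Hf d Hd) as [d' [Hd' H']]. exists d'. split; trivial.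
  intros w Hw. apply H. now apply H'.
Qed.

Lemma ccont_ext_loc (f g : C -> C) (z : C) (r : R) :
  0 < r -> (forall w, Cmod (w - z) < r -> f w = g w) -> ccont f z -> ccont g z.
Proof.
  intros Hr E H e He. destruct (H e He) as [d [Hd Hw]].
  exists (Rmin r d). split. now apply Rmin_glb_lt.
  intros w Hwd. rewrite <- !E.
  - apply Hw. eapply Rlt_le_trans. apply Hwd. apply Rmin_r.
  - replace (z - z)%C with (RtoC 0) by ring. now rewrite Cmod_0.
  - eapply Rlt_le_trans. apply Hwd. apply Rmin_l.
Qed.

(** Caratheodory's criterion. With a continuous factor [s] defined everywhere, the sum, product and
    chain rules become algebra plus continuity, without division by [w - z]. *)
Lemma cderiv_slope (f : C -> C) (z l : C) :
  cderiv f z l <->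
  exists s : C -> C, ccont s z /\ s z = l /\ forall w, (f w - f z = s w * (w - z))%C.
Proof.
  split.
  - intros H.
    exists (fun w => if Ceq_dec w z then l else (f w - f z) / (w - z))%C.
    destruct (Ceq_dec z z) as [_|n]; [|now destruct n]. split; [|split; trivial].
    + intros e He. destruct (H (e / 2)%R) as [d [Hd Hw]]; [lra|].
      exists d. split; trivial. intros w Hwd.
      destruct (Ceq_dec z z) as [_|n]; [|now destruct n].
      destruct (Ceq_dec w z) as [->|n].
      * replace (l - l)%C with (RtoC 0) by ring. now rewrite Cmod_0.
      * assert (N : (w - z)%C <> 0%C).
        { intros E. apply n. replace w with (w - z + z)%C by ring. rewrite E. ring. }
        replace ((f w - f z) / (w - z) - l)%C with ((f w - f z - l * (w - z)) / (w - z))%C by (field; trivial).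
        rewrite Cmod_div by trivial. specialize (Hw w Hwd).
        apply Cmod_gt_0 in N.
        apply Rle_lt_trans with (e / 2)%R; [|lra].
        apply Rmult_le_reg_r with (1 := N).
        unfold Rdiv at 1. rewrite Rmult_assoc, Rinv_l by lra. lra.
    + intros w. destruct (Ceq_dec w z) as [->|n]. ring. field.
      intros E. apply n. replace w with (w - z + z)%C by ring. rewrite E. ring.
  - intros [s [Hs [<- H]]] e He. destruct (Hs e He) as [d [Hd Hw]].
    exists d. split; trivial. intros w Hwd. rewrite H.
    replace (s w * (w - z) - s z * (w - z))%C with ((s w - s z) * (w - z))%C by ring.
    rewrite Cmod_mult. apply Rmult_le_compat_r. apply Cmod_ge_0. left. now apply Hw.
Qed.

Lemma cderiv_ccont (f : C -> C) (z l : C) : cderiv f z l -> ccont f z.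
Proof.
  intros H. apply cderiv_slope in H. destruct H as [s [Hs [_ H]]].
  apply (ccont_ext_loc (fun w => s w * (w + - z) + f z)%C _ z 1); [lra| |].
  - intros w _. replace (f w) with (f w - f z + f z)%C by ring. rewrite H. ring.
  - apply ccont_plus; [|apply ccont_const]. apply ccont_mult; trivial.
    apply ccont_plus. apply ccont_id. apply ccont_const.
Qed.

Lemma cderiv_const (c z : C) : cderiv (fun _ => c) z 0.
Proof.
  apply cderiv_slope. exists (fun _ => RtoC 0). repeat split.
  apply ccont_const. intros; ring.
Qed.

Lemma cderiv_id (z : C) : cderiv (fun w => w) z 1.
Proof.
  apply cderiv_slope. exists (fun _ => RtoC 1). repeat split.
  apply ccont_const. intros; ring.
Qed.

Lemma cderiv_plus (f g : C -> C) (z l m : C) :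
  cderiv f z l -> cderiv g z m -> cderiv (fun w => f w + g w)%C z (l + m).
Proof.
  rewrite !cderiv_slope. intros [s [Hs [<- H]]] [t [Ht [<- H']]].
  exists (fun w => s w + t w)%C. repeat split. now apply ccont_plus.
  intros w. replace (f w + g w - (f z + g z))%C with ((f w - f z) + (g w - g z))%C by ring.
  rewrite H, H'. ring.
Qed.

Lemma cderiv_mult (f g : C -> C) (z l m : C) :
  cderiv f z l -> cderiv g z m ->
  cderiv (fun w => f w * g w)%C z (l * g z + f z * m).
Proof.
  intros Hf Hg. pose proof (cderiv_ccont _ _ _ Hg) as Cg. revert Hf Hg.
  rewrite !cderiv_slope. intros [s [Hs [<- H]]] [t [Ht [<- H']]].
  exists (fun w => s w * g w + f z * t w)%C. repeat split.
  - apply ccont_plus; apply ccont_mult; trivial. apply ccont_const.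
  - intros w.
    replace (f w * g w - f z * g z)%C with ((f w - f z) * g w + f z * (g w - g z))%C by ring.
    rewrite H, H'. ring.
Qed.

Lemma cderiv_scal (c : C) (f : C -> C) (z l : C) :
  cderiv f z l -> cderiv (fun w => c * f w)%C z (c * l).
Proof.
  intros H. replace (c * l)%C with (0 * f z + c * l)%C by ring.
  apply (cderiv_mult (fun _ => c)); trivial. apply cderiv_const.
Qed.

Lemma cderiv_opp (f : C -> C) (z l : C) :
  cderiv f z l -> cderiv (fun w => - f w)%C z (- l).
Proof.
  rewrite !cderiv_slope. intros [s [Hs [<- H]]].
  exists (fun w => (- (1)) * s w)%C. split; [|split].
  - apply ccont_mult; trivial. apply ccont_const.
  - ring.
  - intros w. replace (- f w - - f z)%C with (- (f w - f z))%C by ring. rewrite H. ring.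
Qed.

Lemma cderiv_minus (f g : C -> C) (z l m : C) :
  cderiv f z l -> cderiv g z m -> cderiv (fun w => f w - g w)%C z (l - m).
Proof. intros Hf Hg. apply cderiv_plus; trivial. now apply cderiv_opp. Qed.

Lemma cderiv_comp (f g : C -> C) (z l m : C) :
  cderiv f z l -> cderiv g (f z) m -> cderiv (fun w => g (f w)) z (m * l).
Proof.
  intros Hf Hg. pose proof (cderiv_ccont _ _ _ Hf) as Cf. revert Hf Hg.
  rewrite !cderiv_slope. intros [s [Hs [<- H]]] [t [Ht [<- H']]].
  exists (fun w => t (f w) * s w)%C. repeat split.
  - apply ccont_mult; trivial. now apply ccont_comp.
  - intros w. rewrite H', H. ring.
Qed.

Lemma cderiv_inv (f : C -> C) (z l : C) :
  cderiv f z l -> f z <> 0%C -> cderiv (fun w => / f w)%C z (- l / (f z * f z)).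
Proof.
  intros Hf N.
  assert (Hi : cderiv (fun w => / w)%C (f z) (- (1) / (f z * f z))%C).
  { set (a := f z) in *. intros e He.
    assert (Ha : 0 < Cmod a) by now apply Cmod_gt_0.
    assert (Hae : 0 < e * (Cmod a * Cmod a * Cmod a) / 2).
    { apply Rdiv_lt_0_compat; [|lra]. repeat apply Rmult_lt_0_compat; trivial. }
    exists (Rmin (Cmod a / 2) (e * (Cmod a * Cmod a * Cmod a) / 2))%R.
    split. apply Rmin_glb_lt; lra.
    intros w Hw.
    pose proof (Rlt_le_trans _ _ _ Hw (Rmin_l _ _)) as W1.
    pose proof (Rlt_le_trans _ _ _ Hw (Rmin_r _ _)) as W2.
    assert (Hm : Cmod a / 2 < Cmod w).
    { pose proof (Cmod_triangle (- (w - a)) w) as T.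
      rewrite Cmod_opp in T. replace (- (w - a) + w)%C with a in T by ring. lra. }
    assert (Nw : w <> 0%C) by (apply Cmod_gt_0; lra).
    (* The first-order remainder of the inverse is exactly (w - a)^2 / (w a^2); the radius |a| / 2
       keeps |w| above |a| / 2. *)
    replace (/ w - / a - - (1) / (a * a) * (w - a))%C with ((w - a) * (w - a) / (w * (a * a)))%C.
    2: field; now split.
    rewrite Cmod_div by (repeat apply Cmult_neq_0; trivial).
    rewrite !Cmod_mult.
    pose proof (Cmod_ge_0 (w - a)) as P.
    set (u := Cmod (w - a)) in *. set (m := Cmod a) in *. set (v := Cmod w) in *.
    apply Rmult_le_reg_r with (v * (m * m))%R. repeat apply Rmult_lt_0_compat; lra.
    unfold Rdiv at 1. rewrite Rmult_assoc, Rinv_l, Rmult_1_r.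
    2: apply Rgt_not_eq; repeat apply Rmult_lt_0_compat; lra.
    replace (e * u * (v * (m * m)))%R with (u * (e * (m * m) * v))%R by ring.
    apply Rmult_le_compat_l; trivial.
    assert (0 <= e * (m * m)) by (apply Rmult_le_pos; nra). nra. }
  replace (- l / (f z * f z))%C with (- (1) / (f z * f z) * l)%C by (field; trivial).
  now apply (cderiv_comp f (fun w => / w)%C).
Qed.

Lemma cderiv_div (f g : C -> C) (z l m : C) :
  cderiv f z l -> cderiv g z m -> g z <> 0%C ->
  cderiv (fun w => f w / g w)%C z ((l * g z - f z * m) / (g z * g z)).
Proof.
  intros Hf Hg N.
  replace ((l * g z - f z * m) / (g z * g z))%C
    with (l * / g z + f z * (- m / (g z * g z)))%C by (field; trivial).
  apply (cderiv_mult f (fun w => / g w)%C); trivial. now apply cderiv_inv.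
Qed.

Lemma cderiv_ext_loc (f g : C -> C) (z l : C) (r : R) :
  0 < r -> (forall w, Cmod (w - z) < r -> f w = g w) -> cderiv f z l -> cderiv g z l.
Proof.
  intros Hr E H e He. destruct (H e He) as [d [Hd Hw]].
  exists (Rmin r d). split. now apply Rmin_glb_lt.
  intros w Hwd. rewrite <- !E.
  - apply Hw. eapply Rlt_le_trans. apply Hwd. apply Rmin_r.
  - replace (z - z)%C with (RtoC 0) by ring. now rewrite Cmod_0.
  - eapply Rlt_le_trans. apply Hwd. apply Rmin_l.
Qed.

Lemma C_derive_cderiv (f : C -> C) (z l : C) : cderiv f z l -> C_derive f z = l.
Proof. intros H. apply is_C_derive_unique. now apply cderiv_is_derive. Qed.

Lemma cderiv_unique (f : C -> C) (z l m : C) : cderiv f z l -> cderiv f z m -> l = m.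
Proof. intros H1 H2. rewrite <- (C_derive_cderiv f z l H1). now apply C_derive_cderiv. Qed.

Lemma analytic_at_iff (f : C -> C) (z : C) :
  analytic_at f z <->
  exists d : R, 0 < d /\ forall w, Cmod (w - z) < d -> exists l, cderiv f w l.
Proof.
  unfold analytic_at. split.
  - intros H. apply locally_Cmod in H. destruct H as [d [Hd H]].
    exists d. split; trivial. intros w Hw. destruct (H w Hw) as [l Hl].
    exists l. now apply cderiv_is_derive.
  - intros [d [Hd H]]. apply locally_Cmod. exists d. split; trivial.
    intros w Hw. destruct (H w Hw) as [l Hl]. exists l. now apply cderiv_is_derive.
Qed.

(** * Integrals of complex-valued functions *)

(** Continuity of a curve is phrased as [ccont] of the function sending w to [h (Re w)], at a real
    point, so that the closure rules proved for [ccont] carry over directly. *)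
Definition rcont (h : R -> C) (t : R) : Prop := ccont (fun w => h (Re w)) (RtoC t).

Lemma rcont_iff (h : R -> C) (t : R) :
  rcont h t <-> forall e : R, 0 < e -> exists d : R, 0 < d /\
    forall s : R, Rabs (s - t) < d -> Cmod (h s - h t) < e.
Proof.
  split; intros H e He; destruct (H e He) as [d [Hd Hw]]; exists d; split; trivial.
  - intros s Hs. apply (Hw (RtoC s)). rewrite <- RtoC_minus, Cmod_R. exact Hs.
  - intros w Hwd. apply Hw. eapply Rle_lt_trans; [|exact Hwd].
    eapply Rle_trans; [|apply re_le_Cmod]. right. destruct w; simpl. f_equal; ring.
Qed.

Lemma rcont_continuous (h : R -> C) (t : R) :
  rcont h t <-> @continuous R_UniformSpace C_R_CompleteNormedModule h t.
Proof.
  rewrite rcont_iff. split.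
  - intros H P HP. apply (locally_Cmod (h t) P) in HP. destruct HP as [d [Hd HP]].
    destruct (H d Hd) as [d' [Hd' Hw]]. exists (mkposreal d' Hd').
    intros s Hs. apply HP. apply Hw. exact Hs.
  - intros H e He.
    assert (L : locally (h t) (fun w : C => Cmod (w - h t) < e)).
    { apply locally_Cmod. exists e. now split. }
    destruct (H _ L) as [d Hd]. exists d. split. apply cond_pos.
    intros s Hs. apply Hd. exact Hs.
Qed.

Lemma rcont_const (c : C) (t : R) : rcont (fun _ => c) t.
Proof. apply ccont_const. Qed.

Lemma rcont_plus (h k : R -> C) (t : R) :
  rcont h t -> rcont k t -> rcont (fun s => h s + k s)%C t.
Proof. apply ccont_plus. Qed.

Lemma rcont_mult (h k : R -> C) (t : R) :
  rcont h t -> rcont k t -> rcont (fun s => h s * k s)%C t.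
Proof. apply ccont_mult. Qed.

Lemma rcont_opp (h : R -> C) (t : R) : rcont h t -> rcont (fun s => - h s)%C t.
Proof.
  rewrite !rcont_iff. intros H e He. destruct (H e He) as [d [Hd Hw]].
  exists d. split; trivial. intros s Hs.
  replace (- h s - - h t)%C with (- (h s - h t))%C by ring.
  rewrite Cmod_opp. now apply Hw.
Qed.

Lemma rcont_minus (h k : R -> C) (t : R) :
  rcont h t -> rcont k t -> rcont (fun s => h s - k s)%C t.
Proof. intros Hh Hk. apply rcont_plus; trivial. now apply rcont_opp. Qed.

Lemma rcont_inv (h : R -> C) (t : R) :
  rcont h t -> h t <> 0%C -> rcont (fun s => / h s)%C t.
Proof. intros H N. now apply (ccont_inv (fun w => h (Re w))). Qed.

Lemma rcont_comp (f : C -> C) (h : R -> C) (t : R) :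
  rcont h t -> ccont f (h t) -> rcont (fun s => f (h s)) t.
Proof. intros H N. now apply (ccont_comp (fun w => h (Re w))). Qed.

Lemma rcont_conj (h : R -> C) (t : R) : rcont h t -> rcont (fun s => Cconj (h s)) t.
Proof.
  rewrite !rcont_iff. intros H e He. destruct (H e He) as [d [Hd Hw]].
  exists d. split; trivial. intros s Hs.
  replace (Cconj (h s) - Cconj (h t))%C with (Cconj (h s - h t)).
  rewrite Cmod_conj. now apply Hw.
  destruct (h s), (h t). unfold Cconj, Cminus, Cplus, Copp; simpl. f_equal; ring.
Qed.

Lemma rcont_pair (u v : R -> R) (t : R) :
  continuity_pt u t -> continuity_pt v t -> rcont (fun s => (u s, v s)) t.
Proof.
  intros Hu Hv. apply rcont_continuous.
  apply (continuous_comp_2 u v (fun a b => (a, b))).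
  - now apply continuity_pt_filterlim.
  - now apply continuity_pt_filterlim.
  - intros P [e He]. exists e. intros [a b] [H1 H2]. apply He. now split.
Qed.

Lemma rcont_RtoC (u : R -> R) (t : R) : continuity_pt u t -> rcont (fun s => RtoC (u s)) t.
Proof.
  intros Hu. apply rcont_pair; trivial. apply continuity_pt_const. now intros x y.
Qed.

Lemma rcont_fst (h : R -> C) (t : R) : rcont h t -> continuity_pt (fun s => fst (h s)) t.
Proof.
  rewrite rcont_iff. intros H. apply continuity_pt_locally. intros e.
  destruct (H e (cond_pos e)) as [d [Hd Hw]]. exists (mkposreal d Hd).
  intros s Hs. eapply Rle_lt_trans; [|apply (Hw s Hs)].
  apply (re_le_Cmod (h s - h t)).
Qed.

Lemma rcont_snd (h : R -> C) (t : R) : rcont h t -> continuity_pt (fun s => snd (h s)) t.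
Proof.
  rewrite rcont_iff. intros H. apply continuity_pt_locally. intros e.
  destruct (H e (cond_pos e)) as [d [Hd Hw]]. exists (mkposreal d Hd).
  intros s Hs. eapply Rle_lt_trans; [|apply (Hw s Hs)].
  eapply Rle_trans; [|apply Rmax_Cmod]. eapply Rle_trans; [|apply Rmax_r].
  right. destruct (h s), (h t); simpl. reflexivity.
Qed.

(** Caratheodory's form is the definition here, since it gives the rules at once; [rderiv_iff]
    recovers the epsilon-delta form. *)
Definition rderiv (h : R -> C) (t : R) (l : C) : Prop :=
  exists s : R -> C, rcont s t /\ s t = l /\ forall u, (h u - h t = s u * RtoC (u - t))%C.

Lemma rderiv_rcont (h : R -> C) (t : R) (l : C) : rderiv h t l -> rcont h t.
Proof.
  intros [s [Hs [_ H]]].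
  assert (K : rcont (fun u => s u * RtoC (u - t) + h t)%C t).
  { apply rcont_plus; [|apply rcont_const]. apply rcont_mult; trivial.
    apply rcont_RtoC. apply derivable_continuous_pt. reg. }
  revert K. rewrite !rcont_iff. intros K e He. destruct (K e He) as [d [Hd Hw]].
  exists d. split; trivial. intros u Hu. specialize (Hw u Hu).
  rewrite <- !H in Hw. now replace (h u - h t)%C with (h u - h t + h t - (h t - h t + h t))%C by ring.
Qed.

Lemma rderiv_const (c : C) (t : R) : rderiv (fun _ => c) t 0.
Proof. exists (fun _ => RtoC 0). repeat split. apply rcont_const. intros; ring. Qed.

Lemma rderiv_RtoC_id (t : R) : rderiv RtoC t 1.
Proof.
  exists (fun _ => RtoC 1). repeat split. apply rcont_const.
  intros; rewrite RtoC_minus; ring.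
Qed.

Lemma rderiv_plus (h k : R -> C) (t : R) (l m : C) :
  rderiv h t l -> rderiv k t m -> rderiv (fun s => h s + k s)%C t (l + m).
Proof.
  intros [s [Hs [<- H]]] [s' [Hs' [<- H']]].
  exists (fun w => s w + s' w)%C. repeat split. now apply rcont_plus.
  intros w. replace (h w + k w - (h t + k t))%C with ((h w - h t) + (k w - k t))%C by ring.
  rewrite H, H'. ring.
Qed.

Lemma rderiv_mult (h k : R -> C) (t : R) (l m : C) :
  rderiv h t l -> rderiv k t m -> rderiv (fun s => h s * k s)%C t (l * k t + h t * m).
Proof.
  intros Hh Hk. pose proof (rderiv_rcont _ _ _ Hk) as Ck.
  destruct Hh as [s [Hs [<- H]]], Hk as [s' [Hs' [<- H']]].
  exists (fun w => s w * k w + h t * s' w)%C. repeat split.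
  - apply rcont_plus; apply rcont_mult; trivial. apply rcont_const.
  - intros w.
    replace (h w * k w - h t * k t)%C with ((h w - h t) * k w + h t * (k w - k t))%C by ring.
    rewrite H, H'. ring.
Qed.

Lemma rderiv_comp (h : R -> C) (f : C -> C) (t : R) (l m : C) :
  rderiv h t l -> cderiv f (h t) m -> rderiv (fun s => f (h s)) t (m * l).
Proof.
  intros Hh Hf. pose proof (rderiv_rcont _ _ _ Hh) as Ch. apply cderiv_slope in Hf.
  destruct Hh as [s [Hs [<- H]]], Hf as [s' [Hs' [<- H']]].
  exists (fun w => s' (h w) * s w)%C. repeat split.
  - apply rcont_mult; trivial. now apply rcont_comp.
  - intros w. rewrite H', H. ring.
Qed.

Lemma rderiv_scal (c : C) (h : R -> C) (t : R) (l : C) :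
  rderiv h t l -> rderiv (fun s => c * h s)%C t (c * l).
Proof.
  intros H. replace (c * l)%C with (0 * h t + c * l)%C by ring.
  apply (rderiv_mult (fun _ => c)); trivial. apply rderiv_const.
Qed.

Lemma rderiv_iff (h : R -> C) (t : R) (l : C) :
  rderiv h t l <-> forall e : R, 0 < e -> exists d : R, 0 < d /\
    forall u, Rabs (u - t) < d -> Cmod (h u - h t - l * RtoC (u - t)) <= e * Rabs (u - t).
Proof.
  split.
  - intros [s [Hs [<- H]]] e He. rewrite rcont_iff in Hs.
    destruct (Hs e He) as [d [Hd Hw]].
    exists d. split; trivial. intros w Hwd. rewrite H.
    replace (s w * RtoC (w - t) - s t * RtoC (w - t))%C with ((s w - s t) * RtoC (w - t))%C by ring.
    rewrite Cmod_mult, Cmod_R. apply Rmult_le_compat_r. apply Rabs_pos. left. now apply Hw.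
  - intros H.
    exists (fun w => if Req_EM_T w t then l else (h w - h t) / RtoC (w - t))%C.
    destruct (Req_EM_T t t) as [_|n]; [|now destruct n]. split; [|split; trivial].
    + apply rcont_iff. intros e He. destruct (H (e / 2)%R) as [d [Hd Hw]]; [lra|].
      exists d. split; trivial. intros w Hwd.
      destruct (Req_EM_T t t) as [_|n]; [|now destruct n].
      destruct (Req_EM_T w t) as [->|n].
      * replace (l - l)%C with (RtoC 0) by ring. now rewrite Cmod_0.
      * assert (N : RtoC (w - t) <> 0%C).
        { intros E. apply RtoC_inj in E. lra. }
        replace ((h w - h t) / RtoC (w - t) - l)%C with ((h w - h t - l * RtoC (w - t)) / RtoC (w - t))%C by (field; trivial).
        rewrite Cmod_div by trivial. specialize (Hw w Hwd). rewrite Cmod_R.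
        assert (N' : 0 < Rabs (w - t)) by (apply Rabs_pos_lt; lra).
        apply Rle_lt_trans with (e / 2)%R; [|lra].
        apply Rmult_le_reg_r with (1 := N').
        unfold Rdiv at 1. rewrite Rmult_assoc, Rinv_l by lra. lra.
    + intros w. destruct (Req_EM_T w t) as [->|n].
      replace (t - t)%R with 0 by ring. ring. field.
      intros E. apply RtoC_inj in E. lra.
Qed.

Lemma Cmod_C_R_norm (z : C) : @norm R_AbsRing C_R_NormedModule z = Cmod z.
Proof.
  change (sqrt (Rabs (fst z) ^ 2 + Rabs (snd z) ^ 2) = Cmod z).
  unfold Cmod. now rewrite !pow2_abs.
Qed.

Lemma rderiv_is_derive (h : R -> C) (t : R) (l : C) :
  rderiv h t l -> @is_derive R_AbsRing C_R_NormedModule h t l.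
Proof.
  intros H. split.
  { apply is_linear_scal_l. }
  intros x Hx e.
  assert (x = t) as -> by (symmetry; exact (@is_filter_lim_locally_unique R_AbsRing (AbsRing_NormedModule R_AbsRing) t x Hx)).
  destruct (proj1 (rderiv_iff h t l) H e (cond_pos e)) as [d [Hd Hw]].
  exists (mkposreal d Hd). intros u Hu. specialize (Hw u Hu).
  rewrite Cmod_C_R_norm.
  match goal with |- Cmod ?x <= _ => assert (E : x = (h u - h t - l * RtoC (u - t))%C) end.
  { destruct l, (h u), (h t). unfold minus, plus, opp, scal; simpl.
    unfold prod_plus, prod_opp, prod_scal; simpl. unfold plus, opp, scal, mult; simpl.
    unfold mult, Cminus, Cplus, Copp, Cmult, RtoC; simpl. f_equal; ring. }
  rewrite E. exact Hw.
Qed.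

Lemma is_derive_rderiv (u v : R -> R) (t u' v' : R) :
  is_derive u t u' -> is_derive v t v' -> rderiv (fun s => (u s, v s)) t (u', v').
Proof.
  intros Hu Hv. apply rderiv_iff. intros e He.
  destruct Hu as [_ Hu], Hv as [_ Hv].
  assert (He2 : 0 < e / 2) by lra.
  destruct (Hu t (fun P HP => HP) (mkposreal _ He2)) as [d1 H1].
  destruct (Hv t (fun P HP => HP) (mkposreal _ He2)) as [d2 H2].
  exists (Rmin d1 d2). split. apply Rmin_glb_lt; apply cond_pos.
  intros s Hs.
  specialize (H1 s (Rlt_le_trans _ _ _ Hs (Rmin_l _ _))).
  specialize (H2 s (Rlt_le_trans _ _ _ Hs (Rmin_r _ _))).
  change (Rabs (u s - u t - (s - t) * u') <= e / 2 * Rabs (s - t)) in H1.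
  change (Rabs (v s - v t - (s - t) * v') <= e / 2 * Rabs (s - t)) in H2.
  replace ((u s, v s) - (u t, v t) - (u', v') * RtoC (s - t))%C
    with (RtoC (u s - u t - (s - t) * u') + Ci * RtoC (v s - v t - (s - t) * v'))%C.
  2: { unfold Cminus, Cplus, Copp, Cmult, RtoC, Ci; simpl. f_equal; ring. }
  eapply Rle_trans. apply Cmod_triangle. rewrite Cmod_mult, Cmod_Ci, !Cmod_R. lra.
Qed.

Definition cint (h : R -> C) (a b : R) : C := RInt (V := C_R_CompleteNormedModule) h a b.

Definition rcont_on (h : R -> C) (a b : R) : Prop := forall t, a <= t <= b -> rcont h t.

Lemma ex_cint (h : R -> C) (a b : R) : a <= b -> rcont_on h a b ->
  ex_RInt (V := C_R_CompleteNormedModule) h a b.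
Proof.
  intros Hab H. apply ex_RInt_continuous. intros t.
  rewrite Rmin_left, Rmax_right by trivial. intros Ht. apply rcont_continuous. now apply H.
Qed.

Lemma is_cint (h : R -> C) (a b : R) : a <= b -> rcont_on h a b ->
  is_RInt (V := C_R_NormedModule) h a b (cint h a b).
Proof. intros Hab H. exact (RInt_correct _ _ _ (ex_cint h a b Hab H)). Qed.

Lemma cint_unique (h : R -> C) (a b : R) (l : C) :
  is_RInt (V := C_R_NormedModule) h a b l -> cint h a b = l.
Proof. apply (is_RInt_unique (V := C_R_CompleteNormedModule)). Qed.

Lemma cint_ext (h k : R -> C) (a b : R) : a <= b ->
  (forall t, a <= t <= b -> h t = k t) -> cint h a b = cint k a b.
Proof.
  intros Hab H. apply (RInt_ext (V := C_R_CompleteNormedModule)). intros t. rewrite Rmin_left, Rmax_right by trivial.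
  intros Ht. apply H. lra.
Qed.

Lemma cint_pair (h : R -> C) (a b : R) : a <= b -> rcont_on h a b ->
  cint h a b = (RInt (fun t => fst (h t)) a b, RInt (fun t => snd (h t)) a b).
Proof.
  intros Hab H. apply cint_unique.
  apply (is_RInt_fct_extend_pair (U := R_NormedModule) (V := R_NormedModule) h).
  - apply (RInt_correct (V := R_CompleteNormedModule)). apply (ex_RInt_continuous (V := R_CompleteNormedModule)). intros t.
    rewrite Rmin_left, Rmax_right by trivial. intros Ht.
    apply continuity_pt_filterlim. apply rcont_fst. now apply H.
  - apply (RInt_correct (V := R_CompleteNormedModule)). apply (ex_RInt_continuous (V := R_CompleteNormedModule)). intros t.
    rewrite Rmin_left, Rmax_right by trivial. intros Ht.
    apply continuity_pt_filterlim. apply rcont_snd. now apply H.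
Qed.

Lemma cint_plus (h k : R -> C) (a b : R) : a <= b -> rcont_on h a b -> rcont_on k a b ->
  cint (fun t => h t + k t)%C a b = (cint h a b + cint k a b)%C.
Proof.
  intros Hab Hh Hk. apply cint_unique.
  exact (is_RInt_plus _ _ _ _ _ _ (is_cint h a b Hab Hh) (is_cint k a b Hab Hk)).
Qed.

(** The integral is taken in C as a real vector space, where linearity concerns real scalars; a
    complex factor is therefore multiplied out in coordinates. *)
Lemma cint_scal (c : C) (h : R -> C) (a b : R) : a <= b -> rcont_on h a b ->
  cint (fun t => c * h t)%C a b = (c * cint h a b)%C.
Proof.
  intros Hab H.
  assert (E1 : is_RInt (fun t => fst (h t)) a b (fst (cint h a b))).
  { apply (is_RInt_fct_extend_fst (U := R_NormedModule) (V := R_NormedModule) h). now apply is_cint. }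
  assert (E2 : is_RInt (fun t => snd (h t)) a b (snd (cint h a b))).
  { apply (is_RInt_fct_extend_snd (U := R_NormedModule) (V := R_NormedModule) h). now apply is_cint. }
  apply cint_unique. destruct c as [x y].
  apply (is_RInt_fct_extend_pair (U := R_NormedModule) (V := R_NormedModule)
           (fun t => Cmult (x, y) (h t))).
  - exact (is_RInt_minus _ _ _ _ _ _ (is_RInt_scal _ _ _ x _ E1) (is_RInt_scal _ _ _ y _ E2)).
  - exact (is_RInt_plus _ _ _ _ _ _ (is_RInt_scal _ _ _ x _ E2) (is_RInt_scal _ _ _ y _ E1)).
Qed.

Lemma cint_opp (h : R -> C) (a b : R) : a <= b -> rcont_on h a b ->
  cint (fun t => - h t)%C a b = (- cint h a b)%C.
Proof.
  intros Hab H. replace (- cint h a b)%C with (- (1) * cint h a b)%C by ring.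
  rewrite <- cint_scal by trivial. apply cint_ext; trivial. intros; ring.
Qed.

Lemma cint_minus (h k : R -> C) (a b : R) : a <= b -> rcont_on h a b -> rcont_on k a b ->
  cint (fun t => h t - k t)%C a b = (cint h a b - cint k a b)%C.
Proof.
  intros Hab Hh Hk. unfold Cminus. rewrite cint_plus; trivial.
  now rewrite cint_opp. intros t Ht. apply rcont_opp. now apply Hk.
Qed.

Lemma cint_conj (h : R -> C) (a b : R) : a <= b -> rcont_on h a b ->
  cint (fun t => Cconj (h t)) a b = Cconj (cint h a b).
Proof.
  intros Hab H. apply cint_unique.
  apply (is_RInt_fct_extend_pair (U := R_NormedModule) (V := R_NormedModule)
           (fun t => Cconj (h t))).
  - apply (is_RInt_fct_extend_fst (U := R_NormedModule) (V := R_NormedModule) h). now apply is_cint.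
  - apply (is_RInt_opp (V := R_NormedModule) (fun t => snd (h t))).
    apply (is_RInt_fct_extend_snd (U := R_NormedModule) (V := R_NormedModule) h). now apply is_cint.
Qed.

Lemma cint_Chasles (h : R -> C) (a b c : R) : a <= b -> b <= c -> rcont_on h a c ->
  (cint h a b + cint h b c)%C = cint h a c.
Proof.
  intros Hab Hbc H.
  apply (RInt_Chasles (V := C_R_CompleteNormedModule)); apply ex_cint; trivial;
    intros t Ht; apply H; lra.
Qed.

Lemma cint_const (c : C) (a b : R) : cint (fun _ => c) a b = (RtoC (b - a) * c)%C.
Proof.
  unfold cint. rewrite RInt_const. destruct c.
  unfold scal; simpl. unfold prod_scal, scal; simpl. unfold mult; simpl.
  unfold Cmult, RtoC; simpl. f_equal; ring.
Qed.

Lemma cint_norm_le (h : R -> C) (g : R -> R) (a b : R) : a <= b -> rcont_on h a b ->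
  ex_RInt g a b -> (forall t, a <= t <= b -> Cmod (h t) <= g t) ->
  Cmod (cint h a b) <= RInt g a b.
Proof.
  intros Hab Hh Hg H. rewrite <- Cmod_C_R_norm.
  apply (norm_RInt_le (V := C_R_NormedModule) h g a b); trivial.
  - intros t Ht. rewrite Cmod_C_R_norm. now apply H.
  - now apply is_cint.
  - now apply (RInt_correct (V := R_CompleteNormedModule)).
Qed.

Lemma cint_bound (h : R -> C) (a b M : R) : a <= b -> rcont_on h a b ->
  (forall t, a <= t <= b -> Cmod (h t) <= M) -> Cmod (cint h a b) <= M * (b - a).
Proof.
  intros Hab Hh H. eapply Rle_trans.
  apply (cint_norm_le h (fun _ => M)); trivial. apply ex_RInt_const.
  rewrite RInt_const. right. unfold scal; simpl; unfold mult; simpl. ring.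
Qed.

Lemma cint_rderiv (h dh : R -> C) (a b : R) : a <= b ->
  (forall t, a <= t <= b -> rderiv h t (dh t)) -> rcont_on dh a b ->
  cint dh a b = (h b - h a)%C.
Proof.
  intros Hab H Hc. apply cint_unique.
  apply (is_RInt_derive (V := C_R_CompleteNormedModule) h dh).
  - intros t. rewrite Rmin_left, Rmax_right by trivial. intros Ht.
    apply rderiv_is_derive. now apply H.
  - intros t. rewrite Rmin_left, Rmax_right by trivial. intros Ht.
    apply rcont_continuous. now apply Hc.
Qed.

Lemma rcont_on_const (c : C) (a b : R) : rcont_on (fun _ => c) a b.
Proof. intros t _. apply rcont_const. Qed.

(** * Goursat's theorem on rectangles *)

(** The contour integral of h(z) dz, counterclockwise around the rectangle with sides [a, b] and
    [c, d]. *)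
Definition rect_int (h : C -> C) (a b c d : R) : C :=
  (cint (fun x => h (x, c)) a b + Ci * cint (fun y => h (b, y)) c d
   - cint (fun x => h (x, d)) a b - Ci * cint (fun y => h (a, y)) c d)%C.

Lemma rderiv_horizontal (y t : R) : rderiv (fun x => (x, y) : C) t 1.
Proof. apply (is_derive_rderiv (fun x => x) (fun _ => y)). apply (is_derive_id (K := R_AbsRing)). apply (is_derive_const (K := R_AbsRing) (V := R_NormedModule)). Qed.

Lemma rderiv_vertical (x t : R) : rderiv (fun y => (x, y) : C) t Ci.
Proof. apply (is_derive_rderiv (fun _ => x) (fun y => y)). apply (is_derive_const (K := R_AbsRing) (V := R_NormedModule)). apply (is_derive_id (K := R_AbsRing)). Qed.

Definition ccont_rect (h : C -> C) (a b c d : R) : Prop :=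
  forall x y : R, a <= x <= b -> c <= y <= d -> ccont h (x, y).

Lemma ccont_rect_edges (h : C -> C) (a b c d : R) : a <= b -> c <= d ->
  ccont_rect h a b c d ->
  (forall y, c <= y <= d -> rcont_on (fun x => h (x, y)) a b) /\
  (forall x, a <= x <= b -> rcont_on (fun y => h (x, y)) c d).
Proof.
  intros Hab Hcd H. split.
  - intros y Hy t Ht. apply (rcont_comp h (fun x => (x, y) : C)).
    eapply rderiv_rcont. apply rderiv_horizontal. now apply H.
  - intros x Hx t Ht. apply (rcont_comp h (fun y => (x, y) : C)).
    eapply rderiv_rcont. apply rderiv_vertical. now apply H.
Qed.

Lemma rect_int_primitive (A h : C -> C) (a b c d : R) : a <= b -> c <= d ->
  (forall z, cderiv A z (h z)) -> (forall z, ccont h z) -> rect_int h a b c d = 0%C.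
Proof.
  intros Hab Hcd HA Hh. unfold rect_int.
  assert (Hc : ccont_rect h a b c d) by (intros x y _ _; apply Hh).
  destruct (ccont_rect_edges h a b c d Hab Hcd Hc) as [E1 E2].
  assert (EH : forall y, c <= y <= d -> cint (fun x => h (x, y)) a b = (A (b, y) - A (a, y))%C).
  { intros y Hy. apply (cint_rderiv (fun x => A (x, y))); trivial.
    - intros t Ht. rewrite <- (Cmult_1_r (h (t, y))).
      apply (rderiv_comp (fun x => (x, y) : C)). apply rderiv_horizontal. apply HA.
    - now apply E1. }
  assert (EV : forall x, a <= x <= b -> (Ci * cint (fun y => h (x, y)) c d = A (x, d) - A (x, c))%C).
  { intros x Hx. rewrite <- cint_scal; [|trivial|now apply E2].
    apply (cint_rderiv (fun y => A (x, y))); trivial.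
    - intros t Ht. rewrite Cmult_comm.
      apply (rderiv_comp (fun y => (x, y) : C)). apply rderiv_vertical. apply HA.
    - intros t Ht. apply rcont_mult. apply rcont_const. now apply E2. }
  rewrite !EH, !EV by lra. ring.
Qed.

Lemma rect_int_minus (h k : C -> C) (a b c d : R) : a <= b -> c <= d ->
  ccont_rect h a b c d -> ccont_rect k a b c d ->
  rect_int (fun z => h z - k z)%C a b c d = (rect_int h a b c d - rect_int k a b c d)%C.
Proof.
  intros Hab Hcd Hh Hk.
  destruct (ccont_rect_edges h a b c d Hab Hcd Hh) as [E1 E2].
  destruct (ccont_rect_edges k a b c d Hab Hcd Hk) as [F1 F2].
  unfold rect_int. rewrite !cint_minus; trivial; try ring;
    try (apply E1; lra); try (apply E2; lra); try (apply F1; lra); try (apply F2; lra).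
Qed.

Lemma rect_int_bound (h : C -> C) (a b c d M : R) : a <= b -> c <= d ->
  ccont_rect h a b c d ->
  (forall x y, a <= x <= b -> c <= y <= d -> Cmod (h (x, y)) <= M) ->
  Cmod (rect_int h a b c d) <= 2 * M * ((b - a) + (d - c)).
Proof.
  intros Hab Hcd Hh HM.
  destruct (ccont_rect_edges h a b c d Hab Hcd Hh) as [E1 E2].
  unfold rect_int, Cminus.
  pose proof (cint_bound (fun x => h (x, c)) a b M Hab ltac:(apply E1; lra) ltac:(intros; apply HM; lra)).
  pose proof (cint_bound (fun x => h (x, d)) a b M Hab ltac:(apply E1; lra) ltac:(intros; apply HM; lra)).
  pose proof (cint_bound (fun y => h (a, y)) c d M Hcd ltac:(apply E2; lra) ltac:(intros; apply HM; lra)).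
  pose proof (cint_bound (fun y => h (b, y)) c d M Hcd ltac:(apply E2; lra) ltac:(intros; apply HM; lra)).
  eapply Rle_trans. apply Cmod_triangle.
  eapply Rle_trans. apply Rplus_le_compat_r. apply Cmod_triangle.
  eapply Rle_trans. apply Rplus_le_compat_r. apply Rplus_le_compat_r. apply Cmod_triangle.
  rewrite !Cmod_opp, !Cmod_mult, Cmod_Ci. lra.
Qed.

Lemma rect_int_quarters (h : C -> C) (a b c d m n : R) :
  a <= m <= b -> c <= n <= d -> ccont_rect h a b c d ->
  rect_int h a b c d =
    (rect_int h a m c n + rect_int h m b c n + rect_int h a m n d + rect_int h m b n d)%C.
Proof.
  intros Hm Hn Hh. assert (Hab : a <= b) by lra. assert (Hcd : c <= d) by lra.
  destruct (ccont_rect_edges h a b c d Hab Hcd Hh) as [E1 E2].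
  unfold rect_int.
  rewrite <- (cint_Chasles (fun x => h (x, c)) a m b) by (try apply E1; lra).
  rewrite <- (cint_Chasles (fun x => h (x, d)) a m b) by (try apply E1; lra).
  rewrite <- (cint_Chasles (fun y => h (a, y)) c n d) by (try apply E2; lra).
  rewrite <- (cint_Chasles (fun y => h (b, y)) c n d) by (try apply E2; lra).
  ring.
Qed.

(** Each left end is below each right end, so the supremum of the left ends lies in all the
    intervals. *)
Lemma nested_intervals (x w : nat -> R) :
  (forall n, x n <= x (S n)) -> (forall n, x (S n) + w (S n) <= x n + w n) ->
  (forall n, 0 <= w n) -> exists l, forall n, x n <= l <= x n + w n.
Proof.
  intros H1 H2 H3.
  assert (U : forall m n, x m <= x n + w n).
  { intros m n.
    assert (A : forall k p, x p <= x (p + k)%nat).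
    { induction k; intros p. rewrite Nat.add_0_r; lra.
      rewrite Nat.add_succ_r. specialize (IHk p). specialize (H1 (p + k)%nat). lra. }
    assert (B : forall k p, x (p + k)%nat + w (p + k)%nat <= x p + w p).
    { induction k; intros p. rewrite Nat.add_0_r; lra.
      rewrite Nat.add_succ_r. specialize (IHk p). specialize (H2 (p + k)%nat). lra. }
    specialize (A n m). specialize (B m n). specialize (H3 (n + m)%nat).
    rewrite (Nat.add_comm m n) in A. lra. }
  destruct (completeness (fun r => exists n, r = x n)) as [l [L1 L2]].
  - exists (x 0%nat + w 0%nat). intros r [n ->]. apply U.
  - exists (x 0%nat). now exists 0%nat.
  - exists l. intros n. split. apply L1. now exists n.
    apply L2. intros r [m ->]. apply U.
Qed.

(** Mere differentiability suffices, by quartering: some quarter carries at least a quarter of the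
    integral. Near the common point of the nested rectangles [h] is affine up to [e'] times the
    distance, and the affine part has a primitive. Perimeter and diameter both halve, which offsets
    the factor 4 lost at each stage. *)
Theorem goursat_rect (h : C -> C) (a b c d : R) : a <= b -> c <= d ->
  (forall x y, a <= x <= b -> c <= y <= d -> exists l, cderiv h (x, y) l) ->
  rect_int h a b c d = 0%C.
Proof.
  intros Hab Hcd H.
  set (w := (b - a)%R). set (v := (d - c)%R).
  (* [p] is the lower left corner of a rectangle of generation n, with sides [w / 2 ^ n] and
     [v / 2 ^ n]. *)
  set (I := fun n (p : R * R) =>
    Cmod (rect_int h (fst p) (fst p + w / 2 ^ n) (snd p) (snd p + v / 2 ^ n))).
  set (q := fun n (p : R * R) (i j : bool) =>
    (fst p + (if i then w / 2 ^ S n else 0), snd p + (if j then v / 2 ^ S n else 0))%R).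
  (* Takes the first quarter whose integral is large enough. The last one needs no test: if the
     other three fail, the triangle inequality forces it. *)
  set (step := fun n p =>
    if Rle_dec (I n p / 4) (I (S n) (q n p false false)) then q n p false false else
    if Rle_dec (I n p / 4) (I (S n) (q n p true false)) then q n p true false else
    if Rle_dec (I n p / 4) (I (S n) (q n p false true)) then q n p false true else
    q n p true true).
  set (P := fix P n := match n with O => (a, c) | S n => step n (P n) end).
  assert (Hw : 0 <= w) by (unfold w; lra). assert (Hv : 0 <= v) by (unfold v; lra).
  assert (Hp : forall n, 0 < 2 ^ n) by (intros n; apply pow_lt; lra).
  assert (Hh : forall u n, (u / 2 ^ n = u / 2 ^ S n + u / 2 ^ S n)%R).
  { intros u n. simpl. field. apply Rgt_not_eq, Hp. }
  assert (Hwn : forall n, 0 <= w / 2 ^ n) by (intros n; apply Rdiv_le_0_compat; auto).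
  assert (Hvn : forall n, 0 <= v / 2 ^ n) by (intros n; apply Rdiv_le_0_compat; auto).
  assert (Hstep : forall n p, exists i j, step n p = q n p i j).
  { intros n p. unfold step.
    repeat (destruct Rle_dec; [now do 2 eexists|]). now do 2 eexists. }
  assert (Hx : forall n, fst (P n) <= fst (P (S n)) /\
     fst (P (S n)) + w / 2 ^ S n <= fst (P n) + w / 2 ^ n /\
     snd (P n) <= snd (P (S n)) /\
     snd (P (S n)) + v / 2 ^ S n <= snd (P n) + v / 2 ^ n).
  { intros n. change (P (S n)) with (step n (P n)).
    destruct (Hstep n (P n)) as [i [j ->]]. unfold q.
    rewrite (Hh w n), (Hh v n). cbn [fst snd].
    pose proof (Hwn (S n)). pose proof (Hvn (S n)). destruct i, j; lra. }
  assert (Hin : forall n, a <= fst (P n) /\ fst (P n) + w / 2 ^ n <= b /\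
     c <= snd (P n) /\ snd (P n) + v / 2 ^ n <= d).
  { induction n. simpl. unfold w, v. lra. specialize (Hx n). lra. }
  assert (HC : forall n, ccont_rect h (fst (P n)) (fst (P n) + w / 2 ^ n)
      (snd (P n)) (snd (P n) + v / 2 ^ n)).
  { intros n x y Hx1 Hy1. specialize (Hin n).
    destruct (H x y) as [l Hl]; try lra. exact (cderiv_ccont _ _ _ Hl). }
  assert (HI : forall n, I n (P n) / 4 <= I (S n) (P (S n))).
  { intros n. change (P (S n)) with (step n (P n)). unfold step.
    repeat (destruct Rle_dec; [trivial|]).
    specialize (HC n). set (p := P n) in *.
    pose proof (Hwn (S n)) as W. pose proof (Hvn (S n)) as V.
    pose proof (rect_int_quarters h (fst p) (fst p + w / 2 ^ n) (snd p) (snd p + v / 2 ^ n)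
      (fst p + w / 2 ^ S n) (snd p + v / 2 ^ S n)) as Q.
    specialize (Q ltac:(rewrite (Hh w n); lra) ltac:(rewrite (Hh v n); lra) HC).
    apply (f_equal Cmod) in Q.
    assert (T : I n p <= I (S n) (q n p false false) + I (S n) (q n p true false)
      + I (S n) (q n p false true) + I (S n) (q n p true true)).
    { unfold I at 1. rewrite Q. unfold I, q; cbn [fst snd]. rewrite !Rplus_0_r, !Rplus_assoc, <- !Hh.
      eapply Rle_trans. apply Cmod_triangle. rewrite <- !Rplus_assoc. apply Rplus_le_compat_r.
      eapply Rle_trans. apply Cmod_triangle. apply Rplus_le_compat_r.
      apply Cmod_triangle. }
    lra. }
  assert (HI' : forall n, I 0%nat (P 0%nat) / 4 ^ n <= I n (P n)).
  { induction n. simpl. lra. specialize (HI n).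
    replace (I 0%nat (P 0%nat) / 4 ^ S n)%R with (I 0%nat (P 0%nat) / 4 ^ n / 4)%R. lra.
    simpl. field. apply pow_nonzero. lra. }
  destruct (nested_intervals (fun n => fst (P n)) (fun n => w / 2 ^ n)%R) as [x Lx];
    try (intros n; apply Hx); trivial.
  destruct (nested_intervals (fun n => snd (P n)) (fun n => v / 2 ^ n)%R) as [y Ly];
    try (intros n; apply Hx); trivial.
  destruct (H x y) as [l Hl].
  { specialize (Lx 0%nat). specialize (Hin 0%nat). simpl in *. lra. }
  { specialize (Ly 0%nat). specialize (Hin 0%nat). simpl in *. lra. }
  assert (E0 : I 0%nat (P 0%nat) = Cmod (rect_int h a b c d)).
  { unfold I, P; cbn [fst snd]. unfold w, v. do 2 f_equal; simpl; field. }
  apply Cmod_eq_0. rewrite <- E0.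
  apply Rle_antisym; [|apply Cmod_ge_0].
  apply le_epsilon. intros e He. rewrite Rplus_0_l.
  set (B := (w + v)%R).
  (* The final estimate is [2 * e' * (B * B)]; adding 1 keeps the denominator positive even for a
     degenerate rectangle. *)
  set (e' := (e / (2 * (B * B + 1)))%R).
  assert (HB : 0 < B * B + 1) by nra.
  assert (He' : 0 < e') by (apply Rdiv_lt_0_compat; lra).
  destruct (Hl e' He') as [dl [Hdl Hd]].
  assert (exists n, (w + v) / 2 ^ n < dl) as [n Hn].
  { destruct (pow_lt_1_zero (/ 2) ltac:(rewrite Rabs_pos_eq; lra) (dl / (B + 1))%R) as [n Hn].
    apply Rdiv_lt_0_compat; unfold B; lra.
    exists n. specialize (Hn n (le_n n)). rewrite Rabs_pos_eq in Hn by (apply pow_le; lra).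
    rewrite pow_inv in Hn. unfold Rdiv. apply Rle_lt_trans with ((B + 1) * / 2 ^ n)%R.
    apply Rmult_le_compat_r. left. apply Rinv_0_lt_compat, Hp. unfold B; lra.
    apply (Rmult_lt_compat_l (B + 1)) in Hn; [|unfold B; lra].
    replace ((B + 1) * (dl / (B + 1)))%R with dl in Hn by (field; unfold B; lra). exact Hn. }
  specialize (HI' n). specialize (Lx n). specialize (Ly n). specialize (HC n). cbv beta in Lx, Ly.
  specialize (Hwn n). specialize (Hvn n).
  set (wn := (w / 2 ^ n)%R) in *. set (vn := (v / 2 ^ n)%R) in *.
  assert (HN : (w + v) / 2 ^ n = wn + vn) by (unfold wn, vn; field; apply Rgt_not_eq, Hp).
  rewrite HN in Hn.
  set (z := (x, y) : C).
  set (k := fun u : C => (h z + l * (u - z))%C).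
  assert (Ck : forall u, ccont k u).
  { intros u. unfold k. apply ccont_plus. apply ccont_const. apply ccont_mult. apply ccont_const.
    apply ccont_plus. apply ccont_id. apply ccont_const. }
  assert (Ek : rect_int k (fst (P n)) (fst (P n) + wn) (snd (P n)) (snd (P n) + vn) = 0%C).
  { apply (rect_int_primitive (fun u => h z * u + l / 2 * ((u - z) * (u - z)))%C); try lra; trivial.
    intros u. unfold k.
    replace (h z + l * (u - z))%C with (h z * 1 + l / 2 * ((1 - 0) * (u - z) + (u - z) * (1 - 0)))%C.
    2: field.
    apply cderiv_plus. apply cderiv_scal, cderiv_id. apply cderiv_scal.
    assert (D : cderiv (fun u => u - z)%C u (1 - 0)).
    { apply cderiv_minus. apply cderiv_id. apply cderiv_const. }
    exact (cderiv_mult _ _ _ _ _ D D). }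
  assert (Eh : Cmod (rect_int (fun u => h u - k u)%C (fst (P n)) (fst (P n) + wn) (snd (P n)) (snd (P n) + vn))
     <= 2 * (e' * (wn + vn)) * (wn + vn)).
  { eapply Rle_trans. apply rect_int_bound; try lra.
    - intros s t Hs Ht. apply (ccont_plus h (fun u => - k u)%C). now apply HC.
      intros ee Hee. destruct (Ck (s, t) ee Hee) as [dd [Hdd D]]. exists dd. split; trivial.
      intros u Hu. replace (- k u - - k (s, t))%C with (- (k u - k (s, t)))%C by ring.
      rewrite Cmod_opp. now apply D.
    - intros s t Hs Ht.
      assert (Hst : Cmod ((s, t) - z) <= wn + vn).
      { unfold z. replace ((s, t) - (x, y))%C with (RtoC (s - x) + Ci * RtoC (t - y))%C.
        2: { unfold Cminus, RtoC, Ci, Cmult, Cplus, Copp; simpl. f_equal; ring. }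
        eapply Rle_trans. apply Cmod_triangle. rewrite Cmod_mult, Cmod_Ci, !Cmod_R.
        assert (Rabs (s - x) <= wn) by (apply Rabs_le; lra).
        assert (Rabs (t - y) <= vn) by (apply Rabs_le; lra). lra. }
      unfold k. set (st := (s, t) : C) in *. replace (h st - (h z + l * (st - z)))%C with (h st - h z - l * (st - z))%C by ring.
      eapply Rle_trans. apply Hd. fold z. lra.
      apply Rmult_le_compat_l; [lra|]. exact Hst.
    - right. ring. }
  rewrite rect_int_minus in Eh; try lra; trivial.
  2: intros s t _ _; apply Ck.
  rewrite Ek in Eh. unfold Cminus in Eh. rewrite Copp_0, Cplus_0_r in Eh.
  change (I n (P n) <= 2 * (e' * (wn + vn)) * (wn + vn)) in Eh.
  assert (F : I 0%nat (P 0%nat) / 4 ^ n <= 2 * e' * (B * B) / 4 ^ n).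
  { eapply Rle_trans. apply HI'. eapply Rle_trans. apply Eh. right.
    replace (4 ^ n)%R with (2 ^ n * 2 ^ n)%R. 2: rewrite <- Rpow_mult_distr; f_equal; ring.
    rewrite <- HN. unfold B. field. apply Rgt_not_eq, Hp. }
  assert (0 < 4 ^ n) by (apply pow_lt; lra).
  apply Rmult_le_reg_r in F; [|now apply Rinv_0_lt_compat].
  eapply Rle_trans. apply F. unfold e'.
  apply Rmult_le_reg_r with (B * B + 1)%R; trivial.
  replace (2 * (e / (2 * (B * B + 1))) * (B * B) * (B * B + 1))%R with (e * (B * B))%R by (field; lra).
  nra.
Qed.

(** * Exponential and circular means *)

Definition cis (t : R) : C := (cos t, sin t).

Definition Cexp (z : C) : C := (RtoC (exp (fst z)) * cis (snd z))%C.

Lemma Cmod_cis (t : R) : Cmod (cis t) = 1.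
Proof.
  unfold Cmod, cis; cbn [fst snd]. rewrite <- !Rsqr_pow2, Rplus_comm, sin2_cos2.
  apply sqrt_1.
Qed.

Lemma cis_neq_0 (t : R) : cis t <> 0%C.
Proof. apply Cmod_gt_0. rewrite Cmod_cis. lra. Qed.

Lemma cis_plus (s t : R) : cis (s + t) = (cis s * cis t)%C.
Proof. unfold cis, Cmult; simpl. rewrite cos_plus, sin_plus. f_equal; ring. Qed.

Lemma cis_0 : cis 0 = 1%C.
Proof. unfold cis. now rewrite cos_0, sin_0. Qed.

Lemma cis_2PI : cis (2 * PI) = 1%C.
Proof. unfold cis. now rewrite cos_2PI, sin_2PI. Qed.

Lemma cis_conj (t : R) : Cconj (cis t) = (/ cis t)%C.
Proof.
  assert (H : (Cconj (cis t) * cis t = 1)%C).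
  { unfold cis, Cconj, Cmult, RtoC; simpl. f_equal; [|ring].
    pose proof (sin2_cos2 t). unfold Rsqr in H. rewrite <- H. ring. }
  rewrite <- (Cmult_1_r (Cconj (cis t))), <- (Cinv_r (cis t)) by apply cis_neq_0.
  rewrite Cmult_assoc, H. ring.
Qed.

Lemma rderiv_cis_lin (c t : R) :
  rderiv (fun s => cis (c * s)) t (RtoC c * Ci * cis (c * t)).
Proof.
  replace (RtoC c * Ci * cis (c * t))%C with ((- (c * sin (c * t)), c * cos (c * t)) : C).
  2: { unfold RtoC, Ci, cis, Cmult; simpl. f_equal; ring. }
  apply (is_derive_rderiv (fun s => cos (c * s)) (fun s => sin (c * s)));
    auto_derive; trivial; ring.
Qed.

Lemma rderiv_cis (t : R) : rderiv cis t (Ci * cis t).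
Proof.
  replace (Ci * cis t)%C with ((- sin t, cos t) : C).
  2: { unfold RtoC, Ci, cis, Cmult; simpl. f_equal; ring. }
  apply (is_derive_rderiv cos sin); auto_derive; trivial; ring.
Qed.

Lemma rcont_cis (t : R) : rcont cis t.
Proof. exact (rderiv_rcont _ _ _ (rderiv_cis t)). Qed.

Lemma Cexp_plus (z w : C) : Cexp (z + w) = (Cexp z * Cexp w)%C.
Proof.
  unfold Cexp. destruct z, w; simpl. rewrite exp_plus, cis_plus, RtoC_mult. ring.
Qed.

Lemma Cexp_0 : Cexp 0 = 1%C.
Proof. unfold Cexp; simpl. rewrite exp_0, cis_0. ring. Qed.

Lemma Cexp_neq_0 (z : C) : Cexp z <> 0%C.
Proof.
  unfold Cexp. apply Cmult_neq_0; [|apply cis_neq_0].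
  intros E. apply RtoC_inj in E. pose proof (exp_pos (fst z)). lra.
Qed.

Lemma Cmod_Cexp (z : C) : Cmod (Cexp z) = exp (fst z).
Proof.
  unfold Cexp. rewrite Cmod_mult, Cmod_cis, Cmod_R, Rmult_1_r.
  apply Rabs_pos_eq. left. apply exp_pos.
Qed.

Lemma Rabs_snd_Cmod (z : C) : Rabs (snd z) <= Cmod z.
Proof. eapply Rle_trans; [|apply Rmax_Cmod]. apply Rmax_r. Qed.

(** The derivative at 0 comes from those of the real exponential and of [cis]; the functional
    equation carries it to any other point. *)
Lemma cderiv_Cexp (z : C) : cderiv Cexp z (Cexp z).
Proof.
  assert (H0 : cderiv Cexp 0 1).
  { assert (D1 : rderiv (fun x => (exp x, 0) : C) 0 1).
    { apply (is_derive_rderiv exp (fun _ => 0)).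
      - auto_derive; trivial. rewrite exp_0. ring.
      - apply (is_derive_const (K := R_AbsRing) (V := R_NormedModule)). }
    pose proof (rderiv_cis 0) as D2. rewrite cis_0, Cmult_1_r in D2.
    pose proof (proj1 (rcont_iff _ _) (rderiv_rcont _ _ _ D1)) as C1.
    rewrite rderiv_iff in D1, D2. intros e He.
    destruct (D1 (e / 3)%R) as [d1 [Hd1 H1]]; [lra|].
    destruct (D2 (Rmin 1 (e / 3))%R) as [d2 [Hd2 H2]]; [apply Rmin_glb_lt; lra|].
    destruct (C1 (e / 6)%R) as [d3 [Hd3 H3]]; [lra|].
    exists (Rmin d1 (Rmin d2 d3)). split. repeat apply Rmin_glb_lt; trivial.
    intros w Hw. destruct w as [x y].
    replace ((x, y) - 0)%C with ((x, y) : C) in *.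
    2: { unfold Cminus, RtoC, Cplus, Copp; simpl. f_equal; ring. }
    pose proof (re_le_Cmod (x, y)) as Hx. pose proof (Rabs_snd_Cmod (x, y)) as Hy.
    simpl in Hx, Hy.
    pose proof (Rlt_le_trans _ _ _ Hw (Rmin_l _ _)) as Hw1.
    pose proof (Rlt_le_trans _ _ _ Hw (Rmin_r _ _)) as Hw'.
    pose proof (Rlt_le_trans _ _ _ Hw' (Rmin_l _ _)) as Hw2.
    pose proof (Rlt_le_trans _ _ _ Hw' (Rmin_r _ _)) as Hw3.
    specialize (H1 x ltac:(rewrite Rminus_0_r; lra)).
    specialize (H2 y ltac:(rewrite Rminus_0_r; lra)).
    specialize (H3 x ltac:(rewrite Rminus_0_r; lra)).
    rewrite Rminus_0_r in H1, H2. rewrite cis_0 in H2.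
    change (exp x, 0) with (RtoC (exp x)) in H1, H3.
    change (exp 0, 0) with (RtoC (exp 0)) in H1, H3.
    rewrite exp_0 in H1, H3. rewrite Cexp_0.
    unfold Cexp; cbn [fst snd].
    (* The first summand is a product of two small quantities, hence negligible; the other two are
       the remainders of the one-variable derivatives. *)
    replace (RtoC (exp x) * cis y - 1 - 1 * (x, y))%C with
      ((RtoC (exp x) - 1) * (cis y - 1) + (RtoC (exp x) - 1 - 1 * RtoC x)
        + (cis y - 1 - Ci * RtoC y))%C.
    2: { replace ((x, y) : C) with (RtoC x + Ci * RtoC y)%C. ring.
         unfold RtoC, Ci, Cmult, Cplus; simpl. f_equal; ring. }
    eapply Rle_trans. apply Cmod_triangle.
    eapply Rle_trans. apply Rplus_le_compat_r. apply Cmod_triangle.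
    rewrite Cmod_mult.
    assert (H4 : Cmod (cis y - 1) <= 2 * Rabs y).
    { replace (cis y - 1)%C with ((cis y - 1 - Ci * RtoC y) + Ci * RtoC y)%C by ring.
      eapply Rle_trans. apply Cmod_triangle. rewrite Cmod_mult, Cmod_Ci, Cmod_R.
      pose proof (Rmin_l 1 (e / 3)). pose proof (Rabs_pos y). nra. }
    pose proof (Rmin_r 1 (e / 3)). pose proof (Rabs_pos y).
    set (m := Cmod (x, y)) in *.
    assert (Cmod (exp x - 1) * Cmod (cis y - 1) <= e / 6 * (2 * Rabs y)).
    { apply Rmult_le_compat; try apply Cmod_ge_0; lra. }
    nra. }
  intros e He. pose proof (Cexp_neq_0 z) as N. apply Cmod_gt_0 in N.
  destruct (H0 (e / Cmod (Cexp z))%R) as [d [Hd H]].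
  { now apply Rdiv_lt_0_compat. }
  exists d. split; trivial. intros w Hw.
  specialize (H (w - z)%C).
  replace (w - z - 0)%C with (w - z)%C in H by ring. specialize (H Hw).
  rewrite Cexp_0 in H.
  replace (Cexp w) with (Cexp z * Cexp (w - z))%C.
  2: { rewrite <- Cexp_plus. f_equal. ring. }
  replace (Cexp z * Cexp (w - z) - Cexp z - Cexp z * (w - z))%C
    with (Cexp z * (Cexp (w - z) - 1 - 1 * (w - z)))%C by ring.
  rewrite Cmod_mult. apply (Rmult_le_compat_l _ _ _ (Rlt_le _ _ N)) in H.
  eapply Rle_trans. apply H. right. field. lra.
Qed.

(** * Means over circles *)

Definition cmean (h : R -> C) : C := (RtoC (/ (2 * PI)) * cint h 0 (2 * PI))%C.

Definition circ (r t : R) : C := (RtoC r * cis t)%C.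

Definition pcont (h : R -> C) : Prop := rcont_on h 0 (2 * PI).

Lemma two_PI_pos : 0 < 2 * PI.
Proof. pose proof PI_RGT_0. lra. Qed.

Lemma Cmod_circ (r t : R) : 0 <= r -> Cmod (circ r t) = r.
Proof. intros H. unfold circ. rewrite Cmod_mult, Cmod_cis, Cmod_R, Rabs_pos_eq; lra. Qed.

Lemma circ_neq_0 (r t : R) : 0 < r -> circ r t <> 0%C.
Proof. intros H. apply Cmod_gt_0. rewrite Cmod_circ; lra. Qed.

Lemma rderiv_circ (r t : R) : rderiv (circ r) t (Ci * circ r t).
Proof.
  unfold circ. replace (Ci * (RtoC r * cis t))%C with (RtoC r * (Ci * cis t))%C by ring.
  apply rderiv_scal, rderiv_cis.
Qed.

Lemma rcont_circ (r t : R) : rcont (circ r) t.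
Proof. exact (rderiv_rcont _ _ _ (rderiv_circ r t)). Qed.

Lemma cmean_ext (h k : R -> C) :
  (forall t, 0 <= t <= 2 * PI -> h t = k t) -> cmean h = cmean k.
Proof.
  intros H. unfold cmean. f_equal. apply cint_ext; trivial. left; apply two_PI_pos.
Qed.

Lemma cmean_plus (h k : R -> C) : pcont h -> pcont k ->
  cmean (fun t => h t + k t)%C = (cmean h + cmean k)%C.
Proof.
  intros Hh Hk. unfold cmean. rewrite cint_plus; trivial. ring. left; apply two_PI_pos.
Qed.

Lemma cmean_minus (h k : R -> C) : pcont h -> pcont k ->
  cmean (fun t => h t - k t)%C = (cmean h - cmean k)%C.
Proof.
  intros Hh Hk. unfold cmean. rewrite cint_minus; trivial. ring. left; apply two_PI_pos.
Qed.

Lemma cmean_scal (c : C) (h : R -> C) : pcont h ->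
  cmean (fun t => c * h t)%C = (c * cmean h)%C.
Proof.
  intros Hh. unfold cmean. rewrite cint_scal; trivial. ring. left; apply two_PI_pos.
Qed.

Lemma cmean_conj (h : R -> C) : pcont h ->
  cmean (fun t => Cconj (h t)) = Cconj (cmean h).
Proof.
  intros Hh. unfold cmean. rewrite cint_conj; trivial; [|left; apply two_PI_pos].
  rewrite Cmult_conj. f_equal.
  unfold Cconj, RtoC; simpl. f_equal. ring.
Qed.

Lemma cmean_const (c : C) : cmean (fun _ => c) = c.
Proof.
  unfold cmean. rewrite cint_const, Cmult_assoc, <- RtoC_mult.
  replace (/ (2 * PI) * (2 * PI - 0))%R with 1. ring.
  field. pose proof PI_RGT_0. lra.
Qed.

Lemma cmean_bound (h : R -> C) (M : R) : pcont h ->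
  (forall t, 0 <= t <= 2 * PI -> Cmod (h t) <= M) -> Cmod (cmean h) <= M.
Proof.
  intros Hh HM. pose proof two_PI_pos. unfold cmean. rewrite Cmod_mult, Cmod_R.
  rewrite Rabs_pos_eq by (left; now apply Rinv_0_lt_compat).
  pose proof (cint_bound h 0 (2 * PI) M (Rlt_le _ _ H) Hh HM).
  apply Rmult_le_reg_l with (2 * PI)%R; trivial.
  rewrite <- Rmult_assoc, Rinv_r by lra. lra.
Qed.

Lemma cmean_rderiv (h dh : R -> C) :
  (forall t, 0 <= t <= 2 * PI -> rderiv h t (dh t)) -> pcont dh ->
  h 0 = h (2 * PI)%R -> cmean dh = 0%C.
Proof.
  intros H Hc E. unfold cmean. rewrite (cint_rderiv h); trivial.
  rewrite E. ring. left; apply two_PI_pos.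
Qed.

Lemma cis_pow (t : R) (n : nat) : (cis t ^ n)%C = cis (INR n * t).
Proof.
  induction n as [|n IH].
  - simpl. now rewrite Rmult_0_l, cis_0.
  - rewrite S_INR. replace ((INR n + 1) * t)%R with (t + INR n * t)%R by ring.
    rewrite cis_plus, <- IH. reflexivity.
Qed.

Lemma cis_2nPI (n : nat) : cis (INR n * (2 * PI)) = 1%C.
Proof. rewrite <- cis_pow, cis_2PI. apply Cpow_1_l. Qed.

Lemma rcont_pow (h : R -> C) (t : R) (n : nat) : rcont h t -> rcont (fun s => h s ^ n)%C t.
Proof.
  intros H. induction n as [|n IH]. apply (rcont_const 1). now apply rcont_mult.
Qed.

Lemma cmean_cis_pow (n : nat) : (0 < n)%nat -> cmean (fun t => cis t ^ n)%C = 0%C.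
Proof.
  intros Hn.
  assert (N : RtoC (INR n) <> 0%C).
  { intros E. apply RtoC_inj in E. apply (INR_eq _ 0) in E. lia. }
  apply (cmean_rderiv (fun t => / (RtoC (INR n) * Ci) * cis (INR n * t))%C).
  - intros t _. rewrite cis_pow.
    replace (cis (INR n * t)) with (/ (RtoC (INR n) * Ci) * (RtoC (INR n) * Ci * cis (INR n * t)))%C at 1.
    apply rderiv_scal, rderiv_cis_lin.
    field. split; trivial. intros E. injection E. lra.
  - intros t _. apply rcont_pow, rcont_cis.
  - now rewrite Rmult_0_r, cis_0, cis_2nPI.
Qed.

Lemma cmean_cis_inv_pow (n : nat) : (0 < n)%nat -> cmean (fun t => / cis t ^ n)%C = 0%C.
Proof.
  intros Hn.
  rewrite (cmean_ext _ (fun t => Cconj (cis t ^ n))).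
  - rewrite cmean_conj. rewrite cmean_cis_pow by trivial.
    unfold Cconj, RtoC; simpl. f_equal; ring.
    intros t _. apply rcont_pow, rcont_cis.
  - intros t _. rewrite Cpow_conj, cis_conj, Cpow_inv; trivial. apply cis_neq_0.
Qed.

Lemma Cexp_ln_circ (r t : R) : 0 < r -> Cexp (ln r, t) = circ r t.
Proof. intros H. unfold Cexp; simpl. now rewrite exp_ln. Qed.

(** In the coordinates ln |z| and arg z the annulus is a rectangle: Goursat's theorem is applied to
    [h] composed with [Cexp], and the two horizontal sides cancel by periodicity. *)
Theorem cmean_annulus (h : C -> C) (r1 r2 : R) : 0 < r1 <= r2 ->
  (forall z, r1 <= Cmod z <= r2 -> exists l, cderiv h z l) ->
  cmean (fun t => h (circ r1 t)) = cmean (fun t => h (circ r2 t)).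
Proof.
  intros [H1 H12] H.
  assert (Hln : ln r1 <= ln r2).
  { destruct H12 as [H12|<-]. left. now apply ln_increasing. lra. }
  pose proof two_PI_pos as HP.
  pose proof (goursat_rect (fun z => h (Cexp z)) (ln r1) (ln r2) 0 (2 * PI)) as G.
  unfold rect_int in G. unfold cmean. f_equal.
  assert (E : forall r, 0 < r -> cint (fun t => h (circ r t)) 0 (2 * PI)
     = cint (fun y => h (Cexp (ln r, y))) 0 (2 * PI)).
  { intros r Hr. apply cint_ext. lra. intros t _. now rewrite Cexp_ln_circ. }
  rewrite !E by lra.
  assert (E2 : cint (fun x => h (Cexp (x, 2 * PI))) (ln r1) (ln r2)
     = cint (fun x => h (Cexp (x, 0))) (ln r1) (ln r2)).
  { apply cint_ext; trivial. intros t _. unfold Cexp; simpl. now rewrite cis_0, cis_2PI. }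
  rewrite E2 in G.
  set (A := cint (fun y => h (Cexp (ln r2, y))) 0 (2 * PI)) in *.
  set (B := cint (fun y => h (Cexp (ln r1, y))) 0 (2 * PI)) in *.
  set (K := cint (fun x => h (Cexp (x, 0))) (ln r1) (ln r2)) in *.
  assert (G' : (Ci * (A - B) = 0)%C).
  { rewrite <- G; trivial; try lra. ring.
    intros x y Hx Hy. destruct (H (Cexp (x, y))) as [l Hl].
    - rewrite Cmod_Cexp; simpl. split.
      + rewrite <- (exp_ln r1) by trivial. destruct (proj1 Hx) as [L|<-]; [left; now apply exp_increasing|lra].
      + rewrite <- (exp_ln r2) by lra. destruct (proj2 Hx) as [L| ->]; [left; now apply exp_increasing|lra].
    - eexists. apply (cderiv_comp Cexp h). apply cderiv_Cexp. apply Hl. }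
  assert (Ci <> 0%C) by (intros E'; injection E'; lra).
  replace B with (A - (A - B))%C by ring.
  replace (A - B)%C with (/ Ci * (Ci * (A - B)))%C by (field; trivial).
  rewrite G'. ring.
Qed.

(** * Joint continuity in two real variables *)

Definition rcont2 (K : R -> R -> C) (x y : R) : Prop :=
  forall e : R, 0 < e -> exists d : R, 0 < d /\
    forall u v : R, Rabs (u - x) < d -> Rabs (v - y) < d -> Cmod (K u v - K x y) < e.

Lemma rcont2_uniform (K : R -> R -> C) (a b c d : R) :
  (forall x y, a <= x <= b -> c <= y <= d -> rcont2 K x y) ->
  forall e : R, 0 < e -> exists dl : R, 0 < dl /\
    forall x y u v, a <= x <= b -> c <= y <= d -> a <= u <= b -> c <= v <= d ->
      Rabs (u - x) < dl -> Rabs (v - y) < dl -> Cmod (K u v - K x y) < e.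
Proof.
  intros H e He. assert (He2 : 0 < e / 2) by lra.
  destruct (uniform_continuity_2d (fun x y => fst (K x y)) a b c d) with (eps := mkposreal _ He2) as [d1 H1].
  { intros x y Hx Hy ep. destruct (H x y Hx Hy ep (cond_pos ep)) as [dl [Hdl D]].
    exists (mkposreal _ Hdl). intros u v Hu Hv. eapply Rle_lt_trans; [|apply (D u v Hu Hv)].
    apply (re_le_Cmod (K u v - K x y)). }
  destruct (uniform_continuity_2d (fun x y => snd (K x y)) a b c d) with (eps := mkposreal _ He2) as [d2 H2].
  { intros x y Hx Hy ep. destruct (H x y Hx Hy ep (cond_pos ep)) as [dl [Hdl D]].
    exists (mkposreal _ Hdl). intros u v Hu Hv. eapply Rle_lt_trans; [|apply (D u v Hu Hv)].
    apply (Rabs_snd_Cmod (K u v - K x y)). }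
  exists (Rmin d1 d2). split. apply Rmin_glb_lt; apply cond_pos.
  intros x y u v Hx Hy Hu Hv Dx Dy.
  pose proof (Rlt_le_trans _ _ _ Dx (Rmin_l _ _)). pose proof (Rlt_le_trans _ _ _ Dx (Rmin_r _ _)).
  pose proof (Rlt_le_trans _ _ _ Dy (Rmin_l _ _)). pose proof (Rlt_le_trans _ _ _ Dy (Rmin_r _ _)).
  assert (P1 : Rabs (fst (K u v) - fst (K x y)) < e / 2) by (apply H1; trivial).
  assert (P2 : Rabs (snd (K u v) - snd (K x y)) < e / 2) by (apply H2; trivial).
  replace (K u v - K x y)%C with
    (RtoC (fst (K u v) - fst (K x y)) + Ci * RtoC (snd (K u v) - snd (K x y)))%C.
  2: { destruct (K u v), (K x y). unfold Cminus, RtoC, Ci, Cmult, Cplus, Copp; simpl. f_equal; ring. }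
  eapply Rle_lt_trans. apply Cmod_triangle. rewrite Cmod_mult, Cmod_Ci, !Cmod_R. lra.
Qed.

Lemma rcont2_slice (K : R -> R -> C) (x y : R) : rcont2 K x y -> rcont (K x) y.
Proof.
  intros H. apply rcont_iff. intros e He. destruct (H e He) as [d [Hd D]].
  exists d. split; trivial. intros s Hs. apply D; trivial.
  rewrite Rminus_diag. now rewrite Rabs_R0.
Qed.

Lemma rcont2_slice_l (K : R -> R -> C) (x y : R) : rcont2 K x y -> rcont (fun s => K s y) x.
Proof.
  intros H. apply rcont_iff. intros e He. destruct (H e He) as [d [Hd D]].
  exists d. split; trivial. intros s Hs. apply D; trivial.
  rewrite Rminus_diag. now rewrite Rabs_R0.
Qed.

Lemma rcont2_circ (f : C -> C) (r t : R) : ccont f (circ r t) ->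
  rcont2 (fun r t => f (circ r t)) r t.
Proof.
  intros Hf e He. destruct (Hf e He) as [d [Hd D]].
  destruct (proj1 (rcont_iff _ _) (rcont_cis t) (d / (2 * (Rabs r + 1)))%R) as [d' [Hd' D']].
  { apply Rdiv_lt_0_compat; trivial. pose proof (Rabs_pos r). lra. }
  pose proof (Rabs_pos r) as Pr.
  exists (Rmin (Rmin 1 (d / 2)) d'). split. repeat apply Rmin_glb_lt; lra.
  intros u v Hu Hv. apply D.
  pose proof (Rlt_le_trans _ _ _ Hv (Rmin_r _ _)) as Hv'.
  pose proof (Rlt_le_trans _ _ _ Hu (Rmin_l _ _)) as Hu'.
  pose proof (Rlt_le_trans _ _ _ Hu' (Rmin_r _ _)) as Hu2.
  unfold circ. replace (RtoC u * cis v - RtoC r * cis t)%C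
    with (RtoC (u - r) * cis v + RtoC r * (cis v - cis t))%C by (rewrite RtoC_minus; ring).
  eapply Rle_lt_trans. apply Cmod_triangle. rewrite !Cmod_mult, Cmod_cis, !Cmod_R.
  specialize (D' v Hv').
  assert (Rabs r * Cmod (cis v - cis t) <= d / 2).
  { apply Rle_trans with ((Rabs r + 1) * (d / (2 * (Rabs r + 1))))%R.
    - apply Rmult_le_compat; try lra. apply Cmod_ge_0.
    - right. field. lra. }
  lra.
Qed.

(* Includes the degenerate radius [r = 0], where the mean is [f 0]. *)
Lemma cmean_circ_continuous (f : C -> C) (R0 r : R) : 0 <= r < R0 ->
  (forall z, Cmod z < R0 -> ccont f z) ->
  forall e : R, 0 < e -> exists d : R, 0 < d /\
    forall s, 0 <= s < R0 -> Rabs (s - r) < d ->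
      Cmod (cmean (fun t => f (circ s t)) - cmean (fun t => f (circ r t))) <= e.
Proof.
  intros Hr Hf e He. set (b := ((r + R0) / 2)%R).
  destruct (rcont2_uniform (fun r t => f (circ r t)) 0 b 0 (2 * PI)) with (e := e) as [d [Hd D]]; trivial.
  { intros x y Hx _. apply rcont2_circ. apply Hf. rewrite Cmod_circ; unfold b in *; lra. }
  exists (Rmin d ((R0 - r) / 2)). split. apply Rmin_glb_lt; lra.
  intros s Hs Hsr.
  pose proof (Rlt_le_trans _ _ _ Hsr (Rmin_l _ _)) as S1.
  pose proof (Rlt_le_trans _ _ _ Hsr (Rmin_r _ _)) as S2.
  apply Rabs_def2 in S2.
  assert (P : forall s, 0 <= s < R0 -> pcont (fun t => f (circ s t))).
  { intros s' Hs' t _. apply (rcont_comp f (circ s')). apply rcont_circ.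
    apply Hf. rewrite Cmod_circ; lra. }
  rewrite <- cmean_minus by (apply P; lra).
  apply cmean_bound.
  - intros t Ht. apply rcont_minus; apply P; trivial; lra.
  - intros t Ht. left. apply D; trivial; unfold b; try lra.
    rewrite Rminus_diag. now rewrite Rabs_R0.
Qed.

(** * Series of complex numbers *)

Fixpoint csum (u : nat -> C) (n : nat) : C :=
  match n with O => 0%C | S m => (csum u m + u m)%C end.

Definition is_csum (u : nat -> C) (l : C) : Prop :=
  forall e : R, 0 < e -> exists N, forall n, (N <= n)%nat -> Cmod (csum u n - l) < e.

(** Taken by coordinates, so that it is a total function; convergence to it is stated separately, by
    [is_csum]. *)
Definition cseries (u : nat -> C) : C :=
  (Series (fun n => fst (u n)), Series (fun n => snd (u n))).

Lemma csum_ext (u v : nat -> C) (n : nat) :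
  (forall k, (k < n)%nat -> u k = v k) -> csum u n = csum v n.
Proof. induction n; intros H; simpl; trivial. rewrite IHn, H; auto. Qed.

Lemma csum_plus (u v : nat -> C) (n : nat) :
  csum (fun k => u k + v k)%C n = (csum u n + csum v n)%C.
Proof. induction n; simpl. ring. rewrite IHn. ring. Qed.

Lemma csum_scal (c : C) (u : nat -> C) (n : nat) :
  csum (fun k => c * u k)%C n = (c * csum u n)%C.
Proof. induction n; simpl. ring. rewrite IHn. ring. Qed.

Lemma csum_shift (u : nat -> C) (n : nat) :
  csum u (S n) = (u 0%nat + csum (fun k => u (S k)) n)%C.
Proof. induction n. simpl. ring. change (csum u (S (S n))) with (csum u (S n) + u (S n))%C. rewrite IHn. simpl. ring. Qed.

Fixpoint rsum (u : nat -> R) (n : nat) : R :=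
  match n with O => 0 | S m => rsum u m + u m end.

Lemma rsum_scal (c : R) (u : nat -> R) (n : nat) : rsum (fun k => c * u k) n = c * rsum u n.
Proof. induction n; simpl. ring. rewrite IHn. ring. Qed.

Lemma rsum_le (u v : nat -> R) (n : nat) :
  (forall k, (k < n)%nat -> u k <= v k) -> rsum u n <= rsum v n.
Proof. induction n; intros H; simpl. lra. apply Rplus_le_compat; auto. Qed.

Lemma csum_norm_le (u : nat -> C) (n : nat) : Cmod (csum u n) <= rsum (fun k => Cmod (u k)) n.
Proof.
  induction n; simpl. rewrite Cmod_0. lra.
  eapply Rle_trans. apply Cmod_triangle. lra.
Qed.

Lemma rsum_geom_le (q : R) (n : nat) : 0 <= q < 1 -> rsum (fun k => q ^ k) n <= / (1 - q).
Proof.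
  intros Hq.
  assert (E : rsum (fun k => q ^ k) n * (1 - q) = 1 - q ^ n).
  { induction n; simpl. ring. rewrite Rmult_plus_distr_r, IHn. ring. }
  apply Rmult_le_reg_r with (1 - q)%R; [lra|]. rewrite E, Rinv_l by lra.
  pose proof (pow_le q n). lra.
Qed.

Lemma csum_geom_bound (u : nat -> C) (M q : R) (n k : nat) : 0 <= q < 1 ->
  (forall n, Cmod (u n) <= M * q ^ n) ->
  Cmod (csum u (n + k) - csum u n) <= M * q ^ n / (1 - q).
Proof.
  intros Hq H.
  assert (HM : 0 <= M). { specialize (H 0%nat). pose proof (Cmod_ge_0 (u 0%nat)). simpl in H. lra. }
  assert (E : (csum u (n + k) - csum u n = csum (fun j => u (n + j)%nat) k)%C).
  { induction k. rewrite Nat.add_0_r. simpl. ring.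
    rewrite Nat.add_succ_r. simpl. rewrite <- IHk. ring. }
  rewrite E. eapply Rle_trans. apply csum_norm_le.
  eapply Rle_trans. apply (rsum_le _ (fun j => M * q ^ n * q ^ j)).
  - intros j _. eapply Rle_trans. apply H. rewrite pow_add. lra.
  - rewrite rsum_scal. unfold Rdiv. apply Rmult_le_compat_l.
    apply Rmult_le_pos; trivial. apply pow_le; lra. now apply rsum_geom_le.
Qed.

Lemma is_csum_unique (u : nat -> C) (l m : C) : is_csum u l -> is_csum u m -> l = m.
Proof.
  intros H1 H2. replace l with (l - m + m)%C by ring.
  replace (l - m)%C with (RtoC 0). ring. symmetry. apply Cmod_eq_0.
  apply Rle_antisym; [|apply Cmod_ge_0]. apply le_epsilon. intros e He.
  destruct (H1 (e / 2)%R) as [N1 K1]; [lra|]. destruct (H2 (e / 2)%R) as [N2 K2]; [lra|].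
  specialize (K1 (N1 + N2)%nat ltac:(lia)). specialize (K2 (N1 + N2)%nat ltac:(lia)).
  replace (l - m)%C with (- (csum u (N1 + N2) - l) + (csum u (N1 + N2) - m))%C by ring.
  eapply Rle_trans. apply Cmod_triangle. rewrite Cmod_opp. lra.
Qed.

(** [csum u n] has n terms while [sum_n u n] runs up to index n, hence the successor. *)
Lemma csum_fst_snd (u : nat -> C) (n : nat) :
  csum u (S n) = (sum_n (fun k => fst (u k)) n, sum_n (fun k => snd (u k)) n).
Proof.
  induction n.
  - simpl. rewrite !sum_O. destruct (u 0%nat). unfold Cplus, RtoC; simpl. f_equal; ring.
  - change (csum u (S (S n))) with (csum u (S n) + u (S n))%C. rewrite IHn, !sum_Sn.
    destruct (u (S n)). reflexivity.
Qed.

Lemma is_csum_cseries_of (u : nat -> C) :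
  ex_series (fun n => fst (u n)) -> ex_series (fun n => snd (u n)) -> is_csum u (cseries u).
Proof.
  intros H1 H2. apply Series_correct in H1, H2.
  assert (L1 : is_lim_seq (sum_n (fun n => fst (u n))) (Series (fun n => fst (u n)))) by exact H1.
  assert (L2 : is_lim_seq (sum_n (fun n => snd (u n))) (Series (fun n => snd (u n)))) by exact H2.
  clear H1 H2. apply is_lim_seq_spec in L1. apply is_lim_seq_spec in L2. intros e He.
  assert (He2 : 0 < e / 2) by lra.
  destruct (L1 (mkposreal _ He2)) as [N1 K1]. destruct (L2 (mkposreal _ He2)) as [N2 K2].
  exists (S (N1 + N2)). intros [|n] Hn; [lia|]. rewrite csum_fst_snd.
  specialize (K1 n ltac:(lia)). specialize (K2 n ltac:(lia)). simpl in K1, K2.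
  unfold cseries.
  match goal with |- Cmod ((?a, ?b) - (?c, ?d)) < _ =>
    replace ((a, b) - (c, d))%C with (RtoC (a - c) + Ci * RtoC (b - d))%C end.
  2: { unfold Cminus, RtoC, Ci, Cmult, Cplus, Copp; simpl. f_equal; ring. }
  eapply Rle_lt_trans. apply Cmod_triangle. rewrite Cmod_mult, Cmod_Ci, !Cmod_R. lra.
Qed.

Lemma is_csum_geom (u : nat -> C) (M q : R) : 0 <= q < 1 ->
  (forall n, Cmod (u n) <= M * q ^ n) -> is_csum u (cseries u).
Proof.
  intros Hq H.
  assert (G : ex_series (fun n => M * q ^ n)).
  { apply (ex_series_scal_l (V := R_NormedModule) M (fun n => q ^ n)). apply ex_series_geom. rewrite Rabs_pos_eq; lra. }
  apply is_csum_cseries_of; eapply (ex_series_le (K := R_AbsRing) (V := R_CompleteNormedModule)); try exact G; intros n; simpl.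
  - eapply Rle_trans; [|apply (H n)]. apply (re_le_Cmod (u n)).
  - eapply Rle_trans; [|apply (H n)]. apply (Rabs_snd_Cmod (u n)).
Qed.

Lemma is_csum_le (u : nat -> C) (l : C) (M : R) (n : nat) : is_csum u l ->
  (forall m, (n <= m)%nat -> Cmod (csum u m) <= M) -> Cmod l <= M.
Proof.
  intros H HM. apply le_epsilon. intros e He. destruct (H e He) as [N K].
  specialize (K (N + n)%nat ltac:(lia)). specialize (HM (N + n)%nat ltac:(lia)).
  replace l with (csum u (N + n) - (csum u (N + n) - l))%C by ring.
  eapply Rle_trans. apply Cmod_triangle. rewrite Cmod_opp. lra.
Qed.

Lemma is_csum_shift (u : nat -> C) (l : C) :
  is_csum (fun n => u (S n)) l -> is_csum u (u 0%nat + l)%C.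
Proof.
  intros H e He. destruct (H e He) as [N K]. exists (S N). intros [|n] Hn; [lia|].
  rewrite csum_shift. specialize (K n ltac:(lia)).
  replace (u 0%nat + csum (fun k => u (S k)) n - (u 0%nat + l))%C
    with (csum (fun k => u (S k)) n - l)%C by ring. trivial.
Qed.

Lemma is_csum_plus (u v : nat -> C) (l m : C) : is_csum u l -> is_csum v m ->
  is_csum (fun n => u n + v n)%C (l + m)%C.
Proof.
  intros H1 H2 e He.
  destruct (H1 (e / 2)%R) as [N1 K1]; [lra|]. destruct (H2 (e / 2)%R) as [N2 K2]; [lra|].
  exists (N1 + N2)%nat. intros n Hn. rewrite csum_plus.
  specialize (K1 n ltac:(lia)). specialize (K2 n ltac:(lia)).
  replace (csum u n + csum v n - (l + m))%C with ((csum u n - l) + (csum v n - m))%C by ring.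
  eapply Rle_lt_trans. apply Cmod_triangle. lra.
Qed.

Lemma is_csum_scal (c : C) (u : nat -> C) (l : C) : is_csum u l ->
  is_csum (fun n => c * u n)%C (c * l)%C.
Proof.
  intros H e He.
  destruct (H (e / (Cmod c + 1))%R) as [N K].
  { apply Rdiv_lt_0_compat; trivial. pose proof (Cmod_ge_0 c). lra. }
  exists N. intros n Hn. specialize (K n Hn). rewrite csum_scal.
  replace (c * csum u n - c * l)%C with (c * (csum u n - l))%C by ring.
  rewrite Cmod_mult. pose proof (Cmod_ge_0 c). pose proof (Cmod_ge_0 (csum u n - l)).
  apply Rle_lt_trans with ((Cmod c + 1) * Cmod (csum u n - l))%R. nra.
  apply (Rmult_lt_compat_l (Cmod c + 1)) in K; [|lra].
  replace ((Cmod c + 1) * (e / (Cmod c + 1)))%R with e in K by (field; lra). trivial.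
Qed.

(** * Power series on the unit disk *)

(** Radius of convergence at least 1, in Abel's form: at every radius below 1 the terms are bounded.
    This passes easily to sums, shifts, multiples by n and minorised sequences. *)
Definition conv_D (a : nat -> C) : Prop :=
  forall r : R, 0 < r < 1 -> exists M : R, forall n, Cmod (a n) * r ^ n <= M.

Definition ps (a : nat -> C) (z : C) : C := cseries (fun n => a n * z ^ n)%C.

(** Boundedness at the intermediate radius (1 + r) / 2 becomes geometric decay at radius [r]; the
    constants serve all z with |z| <= r at once. *)
Lemma conv_D_geom (a : nat -> C) (r : R) : conv_D a -> 0 <= r < 1 ->
  exists M q : R, 0 <= q < 1 /\ 0 <= M /\
    forall z, Cmod z <= r -> forall n, Cmod (a n * z ^ n) <= M * q ^ n.
Proof.
  intros Ha Hr. destruct (Ha ((1 + r) / 2)%R) as [M HM]; [lra|].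
  exists M, (r / ((1 + r) / 2))%R.
  assert (Hq : 0 <= r / ((1 + r) / 2) < 1).
  { split. apply Rdiv_le_0_compat; lra.
    apply Rmult_lt_reg_r with ((1 + r) / 2)%R. lra.
    unfold Rdiv at 1. rewrite Rmult_assoc, Rinv_l by lra. lra. }
  split; trivial. split.
  { specialize (HM 0%nat). simpl in HM. pose proof (Cmod_ge_0 (a 0%nat)). lra. }
  intros z Hz n. rewrite Cmod_mult, Cmod_pow.
  apply Rle_trans with (Cmod (a n) * r ^ n)%R.
  - apply Rmult_le_compat_l. apply Cmod_ge_0. apply pow_incr. split; trivial. apply Cmod_ge_0.
  - replace (r ^ n)%R with (((1 + r) / 2) ^ n * (r / ((1 + r) / 2)) ^ n)%R.
    rewrite <- Rmult_assoc. apply Rmult_le_compat_r. apply pow_le, Hq. apply HM.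
    rewrite <- Rpow_mult_distr. f_equal. field. lra.
Qed.

Lemma ps_is_csum (a : nat -> C) (z : C) : conv_D a -> Cmod z < 1 ->
  is_csum (fun n => a n * z ^ n)%C (ps a z).
Proof.
  intros Ha Hz. destruct (conv_D_geom a (Cmod z) Ha) as [M [q [Hq [_ H]]]].
  split; trivial. apply Cmod_ge_0.
  apply (is_csum_geom _ M q Hq). apply H. lra.
Qed.

Lemma ps_unique (a : nat -> C) (z l : C) : conv_D a -> Cmod z < 1 ->
  is_csum (fun n => a n * z ^ n)%C l -> ps a z = l.
Proof. intros Ha Hz H. eapply is_csum_unique; [|exact H]. now apply ps_is_csum. Qed.

Lemma ps_uniform (a : nat -> C) (r : R) : conv_D a -> 0 <= r < 1 ->
  forall e : R, 0 < e -> exists N, forall n z, (N <= n)%nat -> Cmod z <= r ->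
    Cmod (csum (fun k => a k * z ^ k)%C n - ps a z) <= e.
Proof.
  intros Ha Hr e He. destruct (conv_D_geom a r Ha Hr) as [M [q [Hq [HM H]]]].
  destruct (pow_lt_1_zero q ltac:(rewrite Rabs_pos_eq; lra) (e * (1 - q) / (M + 1))%R) as [N HN].
  { apply Rdiv_lt_0_compat; [apply Rmult_lt_0_compat|]; lra. }
  exists N. intros n z Hn Hz. specialize (HN n Hn).
  rewrite Rabs_pos_eq in HN by (apply pow_le; lra).
  replace (csum (fun k => a k * z ^ k) n - ps a z)%C with (- (ps a z - csum (fun k => a k * z ^ k) n))%C by ring.
  rewrite Cmod_opp.
  assert (K : M * q ^ n / (1 - q) <= e).
  { apply Rmult_le_reg_r with (1 - q)%R. lra. unfold Rdiv. rewrite Rmult_assoc, Rinv_l, Rmult_1_r by lra.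
    apply Rle_trans with ((M + 1) * (e * (1 - q) / (M + 1)))%R.
    apply Rmult_le_compat; try lra. apply pow_le; lra. right. field. lra. }
  eapply Rle_trans; [|exact K].
  apply le_epsilon. intros e' He'.
  destruct (ps_is_csum a z Ha ltac:(lra) e' He') as [N' HN'].
  specialize (HN' (n + N')%nat ltac:(lia)).
  pose proof (csum_geom_bound _ M q n N' Hq (H z Hz)) as B.
  set (u := fun k => (a k * z ^ k)%C) in *.
  replace (ps a z - csum u n)%C with ((csum u (n + N') - csum u n) - (csum u (n + N') - ps a z))%C by ring.
  eapply Rle_trans. apply Cmod_triangle. rewrite Cmod_opp. lra.
Qed.

(** Bernoulli's inequality for 1 / q = 1 + h gives n h q^n <= 1. *)
Lemma linear_geom_bound (q : R) : 0 <= q < 1 -> exists K : R, forall n : nat, INR n * q ^ n <= K.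
Proof.
  intros Hq. destruct (Req_dec q 0) as [->|N].
  - exists 0. intros [|n]. simpl; lra. simpl; lra.
  - set (h := (/ q - 1)%R).
    assert (Hh : 0 < h). { unfold h. assert (1 < / q) by (rewrite <- Rinv_1; apply Rinv_lt_contravar; lra). lra. }
    exists (/ h)%R. intros n.
    assert (B : 1 + INR n * h <= (/ q) ^ n).
    { induction n. simpl. lra. rewrite S_INR. simpl.
      replace (/ q) with (1 + h)%R at 1 by (unfold h; ring). pose proof (pos_INR n). nra. }
    assert (Hp : 0 < q ^ n) by (apply pow_lt; lra).
    rewrite pow_inv in B. apply (Rmult_le_compat_r (q ^ n)) in B; [|lra]. rewrite Rinv_l in B by lra.
    apply Rmult_le_reg_r with h; trivial. rewrite Rinv_l by lra. lra.
Qed.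

Lemma conv_D_le (a b : nat -> C) (K : R) : conv_D a ->
  (forall n, Cmod (b n) <= K * Cmod (a n)) -> conv_D b.
Proof.
  intros Ha H r Hr. destruct (Ha r Hr) as [M HM].
  exists (Rmax K 0 * Rmax M 0)%R. intros n.
  pose proof (Cmod_ge_0 (a n)). pose proof (pow_lt r n ltac:(lra)).
  apply Rle_trans with (Rmax K 0 * (Cmod (a n) * r ^ n))%R.
  - rewrite <- Rmult_assoc. apply Rmult_le_compat_r. lra.
    eapply Rle_trans. apply H. apply Rmult_le_compat_r; trivial. apply Rmax_l.
  - apply Rmult_le_compat_l. apply Rmax_r. eapply Rle_trans. apply HM. apply Rmax_l.
Qed.

Lemma conv_D_nmul (a : nat -> C) : conv_D a -> conv_D (fun n => RtoC (INR n) * a n)%C.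
Proof.
  intros Ha r Hr. destruct (Ha ((1 + r) / 2)%R) as [M HM]; [lra|].
  set (s := ((1 + r) / 2)%R) in *. assert (Hs : r < s < 1) by (unfold s; lra).
  destruct (linear_geom_bound (r / s)%R) as [K HK].
  { split. apply Rdiv_le_0_compat; lra.
    apply Rmult_lt_reg_r with s. lra. unfold Rdiv. rewrite Rmult_assoc, Rinv_l by lra. lra. }
  exists (M * K)%R. intros n. rewrite Cmod_mult, Cmod_R, Rabs_pos_eq by apply pos_INR.
  replace (r ^ n)%R with (s ^ n * (r / s) ^ n)%R.
  2: { rewrite <- Rpow_mult_distr. f_equal. field. lra. }
  replace (INR n * Cmod (a n) * (s ^ n * (r / s) ^ n))%R
    with ((Cmod (a n) * s ^ n) * (INR n * (r / s) ^ n))%R by ring.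
  assert (0 < r / s) by (apply Rdiv_lt_0_compat; lra).
  apply Rmult_le_compat; trivial.
  - apply Rmult_le_pos. apply Cmod_ge_0. apply pow_le; lra.
  - apply Rmult_le_pos. apply pos_INR. apply pow_le; lra.
Qed.

Lemma conv_D_shift (a : nat -> C) : conv_D a -> conv_D (fun n => a (S n)).
Proof.
  intros Ha r Hr. destruct (Ha r Hr) as [M HM]. exists (M / r)%R. intros n.
  specialize (HM (S n)). simpl in HM. apply Rmult_le_reg_r with r. lra.
  unfold Rdiv. rewrite (Rmult_assoc M), Rinv_l by lra. lra.
Qed.

Lemma conv_D_plus (a b : nat -> C) : conv_D a -> conv_D b -> conv_D (fun n => a n + b n)%C.
Proof.
  intros Ha Hb r Hr. destruct (Ha r Hr) as [M HM]. destruct (Hb r Hr) as [M' HM'].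
  exists (M + M')%R. intros n. specialize (HM n). specialize (HM' n).
  pose proof (pow_lt r n ltac:(lra)). pose proof (Cmod_triangle (a n) (b n)). nra.
Qed.

Lemma conv_D_scal (c : C) (a : nat -> C) : conv_D a -> conv_D (fun n => c * a n)%C.
Proof. intros Ha. apply (conv_D_le a _ (Cmod c) Ha). intros n. rewrite Cmod_mult. lra. Qed.

Lemma conv_D_unshift (a : nat -> C) : conv_D (fun n => a (S n)) -> conv_D a.
Proof.
  intros Ha r Hr. destruct (Ha r Hr) as [M HM]. exists (Rmax (Cmod (a 0%nat)) M). intros [|n].
  - simpl. rewrite Rmult_1_r. apply Rmax_l.
  - eapply Rle_trans; [|apply Rmax_r]. eapply Rle_trans; [|apply (HM n)]. simpl.
    pose proof (pow_lt r n ltac:(lra)). pose proof (Cmod_ge_0 (a (S n))). apply Rmult_le_compat_l; trivial. nra.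
Qed.

Lemma ps_plus (a b : nat -> C) (z : C) : conv_D a -> conv_D b -> Cmod z < 1 ->
  ps (fun n => a n + b n)%C z = (ps a z + ps b z)%C.
Proof.
  intros Ha Hb Hz. apply ps_unique; trivial. now apply conv_D_plus.
  intros e He. destruct (is_csum_plus _ _ _ _ (ps_is_csum a z Ha Hz) (ps_is_csum b z Hb Hz) e He) as [N K].
  exists N. intros n Hn. specialize (K n Hn). erewrite csum_ext. exact K. intros k _; simpl. ring.
Qed.

Lemma ps_scal (c : C) (a : nat -> C) (z : C) : conv_D a -> Cmod z < 1 ->
  ps (fun n => c * a n)%C z = (c * ps a z)%C.
Proof.
  intros Ha Hz. apply ps_unique; trivial. now apply conv_D_scal.
  intros e He. destruct (is_csum_scal c _ _ (ps_is_csum a z Ha Hz) e He) as [N K].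
  exists N. intros n Hn. specialize (K n Hn). erewrite csum_ext. exact K. intros k _; simpl. ring.
Qed.

Lemma ps_shift (a : nat -> C) (z : C) : conv_D a -> Cmod z < 1 ->
  ps a z = (a 0%nat + z * ps (fun n => a (S n)) z)%C.
Proof.
  intros Ha Hz. apply ps_unique; trivial.
  pose proof (is_csum_shift (fun n => a n * z ^ n)%C (z * ps (fun n => a (S n)) z)%C) as S.
  simpl in S. rewrite Cmult_1_r in S. apply S.
  intros e He. destruct (is_csum_scal z _ _ (ps_is_csum _ z (conv_D_shift a Ha) Hz) e He) as [N K].
  exists N. intros n Hn. specialize (K n Hn). erewrite csum_ext. exact K. intros k _; simpl. ring.
Qed.

Lemma ps_0 (a : nat -> C) : conv_D a -> ps a 0 = a 0%nat.
Proof. intros Ha. rewrite ps_shift; trivial. ring. rewrite Cmod_0. lra. Qed.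

Lemma ps_ext (a b : nat -> C) (z : C) : (forall n, a n = b n) -> ps a z = ps b z.
Proof. intros H. unfold ps, cseries. f_equal; apply Series_ext; intros n; now rewrite H. Qed.

(** Second-order Taylor bound for the monomial. The factor [r * r] on the left avoids the exponent n
    - 2, and the crude n^2 in place of n (n - 1) / 2 lets the induction close easily. *)
Lemma pow_second_order (z w : C) (r : R) (n : nat) : 0 < r -> Cmod z <= r -> Cmod w <= r ->
  r * r * Cmod (w ^ n - z ^ n - RtoC (INR n) * z ^ pred n * (w - z))
    <= INR n * INR n * r ^ n * (Cmod (w - z) * Cmod (w - z)).
Proof.
  intros Hr Hz Hw. set (d := Cmod (w - z)). pose proof (Cmod_ge_0 (w - z)) as Pd. fold d in Pd.
  induction n.
  - simpl. replace (1 - 1 - 0 * 1 * (w - z))%C with (RtoC 0) by ring. rewrite Cmod_0. lra.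
  - set (E := (w ^ n - z ^ n - RtoC (INR n) * z ^ pred n * (w - z))%C) in *.
    assert (HE : (w ^ S n - z ^ S n - RtoC (INR (S n)) * z ^ pred (S n) * (w - z)
       = w * E + RtoC (INR n) * z ^ pred n * ((w - z) * (w - z)))%C).
    { unfold E. rewrite S_INR, RtoC_plus. destruct n; simpl; ring. }
    rewrite HE.
    assert (T : Cmod (w * E + RtoC (INR n) * z ^ pred n * ((w - z) * (w - z)))
      <= r * Cmod E + INR n * Cmod z ^ pred n * (d * d)).
    { eapply Rle_trans. apply Cmod_triangle. rewrite !Cmod_mult, Cmod_R, Cmod_pow, Rabs_pos_eq by apply pos_INR.
      fold d. apply Rplus_le_compat_r. apply Rmult_le_compat_r; trivial. apply Cmod_ge_0. }
    assert (U : r * (INR n * Cmod z ^ pred n) <= INR n * r ^ n).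
    { destruct n. simpl; lra. simpl pred. change (r ^ S n)%R with (r * r ^ n)%R.
      assert (Cmod z ^ n <= r ^ n) by (apply pow_incr; split; trivial; apply Cmod_ge_0).
      pose proof (pos_INR (S n)). replace (r * (INR (S n) * Cmod z ^ n))%R with (INR (S n) * r * Cmod z ^ n)%R by ring.
      replace (INR (S n) * (r * r ^ n))%R with (INR (S n) * r * r ^ n)%R by ring.
      apply Rmult_le_compat_l; trivial. apply Rmult_le_pos; lra. }
    apply Rle_trans with (r * (r * r * Cmod E) + r * (r * (INR n * Cmod z ^ pred n)) * (d * d))%R.
    { replace (r * (r * r * Cmod E) + r * (r * (INR n * Cmod z ^ pred n)) * (d * d))%R
        with (r * r * (r * Cmod E + INR n * Cmod z ^ pred n * (d * d)))%R by ring.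
      apply Rmult_le_compat_l; trivial. apply Rmult_le_pos; lra. }
    rewrite S_INR. pose proof (pos_INR n). change (r ^ S n)%R with (r * r ^ n)%R.
    pose proof (pow_lt r n Hr).
    assert (0 <= d * d) by (apply Rmult_le_pos; lra).
    apply Rle_trans with (r * (INR n * INR n * r ^ n * (d * d)) + r * (INR n * r ^ n) * (d * d))%R.
    { apply Rplus_le_compat. apply Rmult_le_compat_l; [lra|exact IHn].
      apply Rmult_le_compat_r; trivial. apply Rmult_le_compat_l; lra. }
    assert (0 <= (INR n + 1) * (r * r ^ n) * (d * d)).
    { repeat apply Rmult_le_pos; lra. }
    nra.
Qed.

Definition dcoef (a : nat -> C) (n : nat) : C := (RtoC (INR (S n)) * a (S n))%C.

Lemma conv_D_dcoef (a : nat -> C) : conv_D a -> conv_D (dcoef a).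
Proof. intros Ha. exact (conv_D_shift _ (conv_D_nmul a Ha)). Qed.

Lemma csum_dcoef (a : nat -> C) (z : C) (n : nat) :
  csum (fun k => dcoef a k * z ^ k)%C n = csum (fun k => a k * (RtoC (INR k) * z ^ pred k))%C (S n).
Proof.
  rewrite csum_shift. change (INR 0) with 0.
  rewrite Cmult_0_l, Cmult_0_r, Cplus_0_l. apply csum_ext.
  intros k _. unfold dcoef. cbn [pred]. ring.
Qed.

(** The bounds of [pow_second_order] are summed: n^2 |a_n| r^n is dominated by a geometric sequence
    for an r between |z| and 1, so the remainder is at most a constant times |w - z|^2. *)
Theorem cderiv_ps (a : nat -> C) (z : C) : conv_D a -> Cmod z < 1 ->
  cderiv (ps a) z (ps (dcoef a) z).
Proof.
  intros Ha Hz. pose proof (Cmod_ge_0 z) as Pz.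
  set (r := ((1 + Cmod z) / 2)%R). assert (Hr : Cmod z < r < 1) by (unfold r; lra).
  destruct (conv_D_geom _ r (conv_D_nmul _ (conv_D_nmul a Ha)) ltac:(lra)) as [M [q [Hq [HM HG]]]].
  specialize (HG (RtoC r)). rewrite Cmod_R, Rabs_pos_eq in HG by lra. specialize (HG (Rle_refl _)).
  set (K := (M / (1 - q) / (r * r))%R).
  assert (Hrr : 0 < r * r) by nra.
  assert (HK : 0 <= K). { apply Rdiv_le_0_compat; trivial. apply Rdiv_le_0_compat; lra. }
  assert (Main : forall w, Cmod w <= r ->
    Cmod (ps a w - ps a z - ps (dcoef a) z * (w - z)) <= K * (Cmod (w - z) * Cmod (w - z))).
  { intros w Hw.
    assert (S : is_csum (fun n => a n * (w ^ n - z ^ n - RtoC (INR n) * z ^ pred n * (w - z)))%C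
      (ps a w - ps a z - ps (dcoef a) z * (w - z))%C).
    { assert (D : is_csum (fun k => a k * (RtoC (INR k) * z ^ pred k))%C (ps (dcoef a) z)).
      { intros e He. destruct (ps_is_csum _ z (conv_D_dcoef a Ha) Hz e He) as [N HN].
        exists (S N). intros [|n] Hn; [lia|]. rewrite <- csum_dcoef. apply HN. lia. }
      pose proof (is_csum_plus _ _ _ _ (is_csum_plus _ _ _ _ (ps_is_csum a w Ha ltac:(lra))
        (is_csum_scal (- (1)) _ _ (ps_is_csum a z Ha Hz))) (is_csum_scal (- (w - z)) _ _ D)) as T.
      intros e He. destruct (T e He) as [N HN]. exists N. intros n Hn. specialize (HN n Hn).
      match goal with |- Cmod (?x - ?y) < _ => match type of HN with Cmod (?x' - ?y') < _ =>
        replace x with x' by (apply csum_ext; intros; ring); replace y with y' by ring end end.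
      exact HN. }
    apply (is_csum_le _ _ _ 0%nat S). intros m _.
    eapply Rle_trans. apply csum_norm_le.
    set (dd := (Cmod (w - z) * Cmod (w - z))%R).
    assert (Hdd : 0 <= dd) by (apply Rmult_le_pos; apply Cmod_ge_0).
    eapply Rle_trans. apply (rsum_le _ (fun k => M * dd / (r * r) * q ^ k)).
    - intros k _. rewrite Cmod_mult.
      pose proof (pow_second_order z w r k ltac:(lra) ltac:(lra) Hw) as B. fold dd in B.
      specialize (HG k). rewrite !Cmod_mult, Cmod_pow, !Cmod_R, !Rabs_pos_eq in HG by (try apply pos_INR; lra).
      set (E := Cmod (w ^ k - z ^ k - INR k * z ^ pred k * (w - z))) in *.
      pose proof (Cmod_ge_0 (a k)).
      apply Rmult_le_reg_l with (r * r)%R; trivial.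
      replace (r * r * (M * dd / (r * r) * q ^ k))%R with (M * q ^ k * dd)%R by (field; lra).
      apply Rle_trans with (INR k * (INR k * Cmod (a k)) * r ^ k * dd)%R.
      + replace (r * r * (Cmod (a k) * E))%R with (Cmod (a k) * (r * r * E))%R by ring.
        replace (INR k * (INR k * Cmod (a k)) * r ^ k * dd)%R with (Cmod (a k) * (INR k * INR k * r ^ k * dd))%R by ring.
        now apply Rmult_le_compat_l.
      + now apply Rmult_le_compat_r.
    - rewrite rsum_scal. pose proof (rsum_geom_le q m Hq).
      replace (K * dd)%R with (M * dd / (r * r) * / (1 - q))%R by (unfold K; field; split; lra).
      apply Rmult_le_compat_l; trivial. apply Rdiv_le_0_compat; trivial. now apply Rmult_le_pos. }
  intros e He. exists (Rmin (r - Cmod z) (e / (K + 1)))%R. split.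
  { apply Rmin_glb_lt. lra. apply Rdiv_lt_0_compat; lra. }
  intros w Hw.
  pose proof (Rlt_le_trans _ _ _ Hw (Rmin_l _ _)) as W1.
  pose proof (Rlt_le_trans _ _ _ Hw (Rmin_r _ _)) as W2.
  eapply Rle_trans. apply Main.
  { replace w with (z + (w - z))%C by ring. eapply Rle_trans. apply Cmod_triangle. lra. }
  pose proof (Cmod_ge_0 (w - z)).
  rewrite <- Rmult_assoc. apply Rmult_le_compat_r; trivial.
  apply Rle_trans with ((K + 1) * (e / (K + 1)))%R. apply Rmult_le_compat; lra.
  right. field. lra.
Qed.

Lemma ccont_ps (a : nat -> C) (z : C) : conv_D a -> Cmod z < 1 -> ccont (ps a) z.
Proof. intros Ha Hz. eapply cderiv_ccont. now apply cderiv_ps. Qed.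

(** * Cauchy formula and Taylor series *)

Definition holo_D (f : C -> C) : Prop := forall z, Cmod z < 1 -> exists l, cderiv f z l.

(** The divided difference of [f] at [p]; [l] is meant to be the derivative there, which removes the
    singularity. *)
Definition slope (f : C -> C) (l p w : C) : C :=
  if Ceq_dec w p then l else ((f w - f p) / (w - p))%C.

Lemma Cminus_neq_0 (a b : C) : a <> b -> (a - b)%C <> 0%C.
Proof. intros N E. apply N. replace a with (a - b + b)%C by ring. rewrite E. ring. Qed.

Lemma slope_at (f : C -> C) (l p : C) : slope f l p p = l.
Proof. unfold slope. destruct (Ceq_dec p p) as [_|N]; trivial. now destruct N. Qed.

Lemma slope_off (f : C -> C) (l p w : C) : w <> p ->
  slope f l p w = ((f w - f p) / (w - p))%C.
Proof. intros N. unfold slope. destruct (Ceq_dec w p); trivial. contradiction. Qed.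

Lemma cderiv_slope_off (f : C -> C) (l p w m : C) : w <> p -> cderiv f w m ->
  cderiv (slope f l p) w ((m * (w - p) - (f w - f p)) / ((w - p) * (w - p))).
Proof.
  intros N Hf. pose proof (Cminus_neq_0 _ _ N) as N'. pose proof N' as N''. apply Cmod_gt_0 in N''.
  apply (cderiv_ext_loc (fun u => (f u - f p) / (u - p))%C _ w _ (Cmod (w - p))); trivial.
  - intros u Hu. rewrite slope_off; trivial. intros ->.
    replace (p - w)%C with (- (w - p))%C in Hu by ring. rewrite Cmod_opp in Hu. lra.
  - replace ((m * (w - p) - (f w - f p)) / ((w - p) * (w - p)))%C
      with (((m - 0) * (w - p) - (f w - f p) * (1 - 0)) / ((w - p) * (w - p)))%C by (field; trivial).
    apply (cderiv_div (fun u => f u - f p)%C (fun u => u - p)%C); trivial.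
    + apply cderiv_minus; trivial. apply cderiv_const.
    + apply cderiv_minus. apply cderiv_id. apply cderiv_const.
Qed.

Lemma ccont_slope_at (f : C -> C) (l p : C) : cderiv f p l -> ccont (slope f l p) p.
Proof.
  intros H. apply (proj1 (cderiv_slope f p l)) in H. destruct H as [s [Hs [E H]]].
  apply (ccont_ext_loc s _ p 1); trivial; [lra|].
  intros w _. unfold slope. destruct (Ceq_dec w p) as [->|N]; trivial.
  rewrite H. field. now apply Cminus_neq_0.
Qed.

(* The mean of [w (f w - f z) / (w - z)] over [|w| = r] vanishes near r = 0 and is constant
   on either side of the exceptional radius |z|, where it is continuous. *)
Lemma cauchy_mean_zero (f : C -> C) (z l : C) (r : R) : holo_D f -> Cmod z < r < 1 ->
  cderiv f z l -> cmean (fun t => circ r t * slope f l z (circ r t))%C = 0%C.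
Proof.
  intros Hf Hr Hl. set (k := fun w => (w * slope f l z w)%C).
  pose proof (Cmod_ge_0 z) as Pz.
  assert (Dk : forall w, Cmod w < 1 -> w <> z -> exists m, cderiv k w m).
  { intros w Hw N. destruct (Hf w Hw) as [m Hm]. eexists.
    apply (cderiv_mult (fun w => w)). apply cderiv_id. apply cderiv_slope_off; trivial. apply Hm. }
  assert (Ck : forall w, Cmod w < 1 -> ccont k w).
  { intros w Hw. destruct (Ceq_dec w z) as [->|N].
    - apply ccont_mult. apply ccont_id. now apply ccont_slope_at.
    - destruct (Dk w Hw N) as [m Hm]. exact (cderiv_ccont _ _ _ Hm). }
  set (M := fun s => cmean (fun t => k (circ s t))).
  change (M r = 0%C).
  assert (CM := fun s Hs => cmean_circ_continuous k 1 s Hs Ck).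
  assert (M0 : M 0 = 0%C).
  { unfold M. rewrite (cmean_ext _ (fun _ => 0%C)). apply cmean_const.
    intros t _. unfold k, circ. ring. }
  assert (closed : forall s1 s2, 0 <= s1 -> s1 < s2 -> s2 < 1 ->
     (forall u v, s1 < u -> u < v -> v < s2 -> M u = M v) -> M s1 = M s2).
  { intros s1 s2 H1 H2 H3 Hc.
    assert (X : (M s1 - M s2 = 0)%C).
    { apply Cmod_eq_0. apply Rle_antisym; [|apply Cmod_ge_0]. apply le_epsilon. intros e He.
      destruct (CM s1 ltac:(lra) (e / 2)%R ltac:(lra)) as [d1 [Hd1 D1]].
      destruct (CM s2 ltac:(lra) (e / 2)%R ltac:(lra)) as [d2 [Hd2 D2]].
      set (h := (Rmin (Rmin d1 d2) (s2 - s1) / 3)%R).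
      assert (Hh : 0 < h /\ h < d1 /\ h < d2 /\ 3 * h <= s2 - s1).
      { unfold h. pose proof (Rmin_l (Rmin d1 d2) (s2 - s1)). pose proof (Rmin_r (Rmin d1 d2) (s2 - s1)).
        pose proof (Rmin_l d1 d2). pose proof (Rmin_r d1 d2).
        assert (0 < Rmin (Rmin d1 d2) (s2 - s1)) by (repeat apply Rmin_glb_lt; lra). lra. }
      specialize (D1 (s1 + h)%R ltac:(lra) ltac:(rewrite Rabs_pos_eq; lra)).
      specialize (D2 (s2 - h)%R ltac:(lra) ltac:(rewrite Rabs_left; lra)).
      fold (M (s1 + h)%R) in D1. fold (M s1) in D1. fold (M (s2 - h)%R) in D2. fold (M s2) in D2.
      rewrite (Hc (s1 + h)%R (s2 - h)%R) in D1 by lra.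
      replace (M s1 - M s2)%C with (- (M (s2 - h)%R - M s1) + (M (s2 - h)%R - M s2))%C by ring.
      eapply Rle_trans. apply Cmod_triangle. rewrite Cmod_opp. lra. }
    replace (M s1) with (M s1 - M s2 + M s2)%C by ring. rewrite X. ring. }
  assert (step : forall u v, 0 < u -> u < v -> v < 1 -> (v < Cmod z \/ Cmod z < u) -> M u = M v).
  { intros u v H1 H2 H3 H4. apply cmean_annulus. lra.
    intros w Hw. apply Dk. lra. intros ->. lra. }
  rewrite <- M0. symmetry. destruct (Req_dec (Cmod z) 0) as [Z|Z].
  - apply closed; try lra. intros; apply step; lra.
  - rewrite (closed 0 (Cmod z)); try lra. apply closed; try lra.
    intros; apply step; lra. intros; apply step; lra.
Qed.

Lemma pcont_bounded (h : R -> C) : pcont h ->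
  exists M, 0 <= M /\ forall t, 0 <= t <= 2 * PI -> Cmod (h t) <= M.
Proof.
  intros H. pose proof two_PI_pos.
  destruct (continuity_ab_maj (fun t => Cmod (h t)) 0 (2 * PI)) as [m [Hm _]]. lra.
  - intros t Ht. apply continuity_pt_locally. intros e.
    destruct (proj1 (rcont_iff _ _) (H t Ht) e (cond_pos e)) as [d [Hd D]].
    exists (mkposreal d Hd). intros s Hs. specialize (D s Hs).
    eapply Rle_lt_trans; [|exact D]. apply Rabs_le.
    pose proof (Cmod_triangle (h s - h t) (h t)) as T1.
    pose proof (Cmod_triangle (- (h s - h t)) (h s)) as T2. rewrite Cmod_opp in T2.
    replace (h s - h t + h t)%C with (h s) in T1 by ring.
    replace (- (h s - h t) + h s)%C with (h t) in T2 by ring. lra.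
  - exists (Cmod (h m)). split. apply Cmod_ge_0. trivial.
Qed.

Lemma pcont_mult (h k : R -> C) : pcont h -> pcont k -> pcont (fun t => h t * k t)%C.
Proof. intros Hh Hk t Ht. apply rcont_mult; auto. Qed.

Lemma pcont_plus (h k : R -> C) : pcont h -> pcont k -> pcont (fun t => h t + k t)%C.
Proof. intros Hh Hk t Ht. apply rcont_plus; auto. Qed.

Lemma pcont_const (c : C) : pcont (fun _ => c).
Proof. intros t _. apply rcont_const. Qed.

Lemma pcont_conj (h : R -> C) : pcont h -> pcont (fun t => Cconj (h t)).
Proof. intros H t Ht. apply rcont_conj; auto. Qed.

Lemma pcont_circ (r : R) : pcont (circ r).
Proof. intros t _. apply rcont_circ. Qed.

Lemma pcont_pow (h : R -> C) (n : nat) : pcont h -> pcont (fun t => h t ^ n)%C.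
Proof. intros H t Ht. apply rcont_pow; auto. Qed.

Lemma pcont_inv (h : R -> C) : pcont h -> (forall t, h t <> 0%C) -> pcont (fun t => / h t)%C.
Proof. intros H N t Ht. apply rcont_inv; auto. Qed.

Lemma pcont_comp_circ (f : C -> C) (r : R) : 0 <= r ->
  (forall z, Cmod z = r -> ccont f z) -> pcont (fun t => f (circ r t)).
Proof.
  intros Hr H t _. apply (rcont_comp f (circ r)). apply rcont_circ. apply H. now apply Cmod_circ.
Qed.

Lemma pcont_csum (u : nat -> R -> C) (n : nat) : (forall k, pcont (u k)) ->
  pcont (fun t => csum (fun k => u k t) n).
Proof. intros H. induction n; simpl. apply pcont_const. now apply pcont_plus. Qed.

Lemma cmean_csum (u : nat -> R -> C) (n : nat) : (forall k, pcont (u k)) ->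
  cmean (fun t => csum (fun k => u k t) n) = csum (fun k => cmean (u k)) n.
Proof.
  intros H. induction n; simpl. apply cmean_const.
  rewrite cmean_plus; trivial. now rewrite IHn. now apply pcont_csum.
Qed.

Lemma is_csum_cmean (u : nat -> R -> C) (s : R -> C) : (forall k, pcont (u k)) -> pcont s ->
  (forall e, 0 < e -> exists N, forall n t, (N <= n)%nat -> 0 <= t <= 2 * PI ->
     Cmod (csum (fun k => u k t) n - s t) <= e) ->
  is_csum (fun k => cmean (u k)) (cmean s).
Proof.
  intros Hu Hs H e He. destruct (H (e / 2)%R) as [N HN]; [lra|].
  exists N. intros n Hn. rewrite <- cmean_csum by trivial.
  pose proof (pcont_csum u n Hu). rewrite <- cmean_minus by trivial.
  apply Rle_lt_trans with (e / 2)%R; [|lra]. apply cmean_bound.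
  - intros t Ht. apply rcont_minus; auto.
  - intros t Ht. now apply HN.
Qed.

Lemma csum_geom (x : C) (n : nat) : (csum (fun k => x ^ k) n * (1 - x) = 1 - x ^ n)%C.
Proof. induction n; simpl. ring. rewrite Cmult_plus_distr_r, IHn. ring. Qed.

(** The geometric series in z / circ r t converges uniformly on the circle and may be integrated
    termwise against any continuous [u]. With u = 1 it gives the mean of the Cauchy kernel, with u =
    f the Taylor series. *)
Lemma cauchy_kernel_expansion (u : R -> C) (r : R) (z : C) : pcont u -> Cmod z < r ->
  is_csum (fun k => cmean (fun t => u t * / circ r t ^ k) * z ^ k)%C
    (cmean (fun t => u t * (circ r t / (circ r t - z)))%C).
Proof.
  intros Hu Hr. pose proof (Cmod_ge_0 z) as Pz.
  assert (Nc : forall t, circ r t <> 0%C) by (intros t; apply circ_neq_0; lra).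
  assert (Nz : forall t, (circ r t - z)%C <> 0%C).
  { intros t. apply Cminus_neq_0. intros E. assert (Cmod z = r) by (rewrite <- E; apply Cmod_circ; lra); lra. }
  destruct (pcont_bounded u Hu) as [M [HM BM]].
  set (q := (Cmod z / r)%R).
  assert (Hq : 0 <= q < 1).
  { unfold q. split. apply Rdiv_le_0_compat; lra. apply Rmult_lt_reg_r with r. lra.
    unfold Rdiv. rewrite Rmult_assoc, Rinv_l; lra. }
  assert (S : is_csum (fun k => cmean (fun t => u t * (z / circ r t) ^ k))%C
    (cmean (fun t => u t * (circ r t / (circ r t - z)))%C)).
  { apply (is_csum_cmean (fun k t => u t * (z / circ r t) ^ k)%C).
    - intros k. apply pcont_mult; trivial. apply pcont_pow. apply pcont_mult. apply pcont_const.
      apply pcont_inv; trivial. apply pcont_circ.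
    - apply pcont_mult; trivial. apply pcont_mult. apply pcont_circ.
      apply pcont_inv; trivial. apply pcont_plus. apply pcont_circ. apply pcont_const.
    - intros e He.
      destruct (pow_lt_1_zero q ltac:(rewrite Rabs_pos_eq; lra) (e * (1 - q) / (M + 1))%R) as [N HN].
      { apply Rdiv_lt_0_compat; [apply Rmult_lt_0_compat|]; lra. }
      exists N. intros n t Hn Ht. specialize (HN n Hn). rewrite Rabs_pos_eq in HN by (apply pow_le; lra).
      rewrite csum_scal. set (x := (z / circ r t)%C).
      assert (Nx : (1 - x)%C <> 0%C).
      { unfold x. replace (1 - z / circ r t)%C with ((circ r t - z) / circ r t)%C by (field; trivial).
        unfold Cdiv. apply Cmult_neq_0; trivial. intros E. apply (Nc t).
        rewrite <- (Cmult_1_r (circ r t)), <- (Cinv_r (circ r t)), E by trivial. ring. }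
      replace (circ r t / (circ r t - z))%C with (/ (1 - x))%C by (unfold x; field; repeat split; trivial).
      pose proof (csum_geom x n) as EG. change (fun k => (x ^ k)%C) with (Cpow x) in *.
      set (G := csum (Cpow x) n) in *.
      replace (u t * G - u t * / (1 - x))%C with (- (u t * x ^ n / (1 - x)))%C.
      2: { replace G with ((1 - x ^ n) / (1 - x))%C.
           field; trivial. rewrite <- EG. field; trivial. }
      rewrite Cmod_opp, Cmod_div, Cmod_mult, Cmod_pow by trivial.
      assert (Hx : Cmod x = q). { unfold x. rewrite Cmod_div by trivial. rewrite Cmod_circ by lra. reflexivity. }
      assert (H1x : 1 - q <= Cmod (1 - x)).
      { pose proof (Cmod_triangle (1 - x) x) as T. replace (1 - x + x)%C with (RtoC 1) in T by ring.
        rewrite Cmod_1 in T. lra. }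
      rewrite Hx. apply Rmult_le_reg_r with (Cmod (1 - x)). lra.
      unfold Rdiv at 1. rewrite Rmult_assoc, Rinv_l, Rmult_1_r by lra.
      apply Rle_trans with (e * (1 - q))%R; [|apply Rmult_le_compat_l; lra].
      apply Rle_trans with ((M + 1) * (e * (1 - q) / (M + 1)))%R; [|right; field; lra].
      apply Rmult_le_compat; try lra. apply Cmod_ge_0. apply pow_le; lra.
      specialize (BM t Ht). lra. }
  intros e He. destruct (S e He) as [N HN]. exists N. intros n Hn. specialize (HN n Hn).
  erewrite csum_ext. exact HN. intros k _. cbv beta. rewrite Cmult_comm, <- cmean_scal.
  - apply cmean_ext. intros t _. unfold Cdiv. rewrite Cpow_mult_l, Cpow_inv by trivial. ring.
  - apply pcont_mult; trivial. apply pcont_inv. apply pcont_pow, pcont_circ. intros t. now apply Cpow_nz.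
Qed.

Lemma cmean_circ_pow_inv (r : R) (n : nat) : 0 < r -> (0 < n)%nat ->
  cmean (fun t => / circ r t ^ n)%C = 0%C.
Proof.
  intros Hr Hn. assert (N : RtoC r <> 0%C) by (intros E; apply RtoC_inj in E; lra).
  rewrite (cmean_ext _ (fun t => / RtoC r ^ n * / cis t ^ n)%C).
  - rewrite cmean_scal. rewrite cmean_cis_inv_pow by trivial. ring.
    apply pcont_inv. apply pcont_pow. intros t _. apply rcont_cis. intros t. apply Cpow_nz, cis_neq_0.
  - intros t _. unfold circ. rewrite Cpow_mult_l. field. split; apply Cpow_nz; trivial. apply cis_neq_0.
Qed.

Lemma cauchy_kernel_mean (r : R) (z : C) : Cmod z < r ->
  cmean (fun t => circ r t / (circ r t - z))%C = 1%C.
Proof.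
  intros Hr. pose proof (Cmod_ge_0 z).
  pose proof (cauchy_kernel_expansion (fun _ => 1%C) r z (pcont_const 1) Hr) as HS.
  rewrite (cmean_ext _ (fun t => circ r t / (circ r t - z))%C) in HS by (intros; ring).
  refine (is_csum_unique _ _ _ HS _). intros e He. exists 1%nat. intros [|n] Hn; [lia|].
  rewrite csum_shift.
  rewrite (csum_ext _ (fun _ => 0 * 0)%C), csum_scal.
  - rewrite (cmean_ext _ (fun _ => 1%C)), cmean_const by (intros; simpl; field; intros E; injection E; lra).
    simpl. match goal with |- Cmod ?x < _ => replace x with (RtoC 0) by ring end. rewrite Cmod_0. trivial.
  - intros k _.
    rewrite (cmean_ext _ (fun t => / circ r t ^ S k)%C) by (intros; ring).
    rewrite cmean_circ_pow_inv by (lra || lia). ring.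
Qed.

Theorem cauchy_formula (f : C -> C) (z : C) (r : R) : holo_D f -> Cmod z < r < 1 ->
  cmean (fun t => f (circ r t) * (circ r t / (circ r t - z)))%C = f z.
Proof.
  intros Hf Hr. pose proof (Cmod_ge_0 z). destruct (Hf z ltac:(lra)) as [l Hl].
  assert (Nz : forall t, circ r t <> z).
  { intros t E. assert (Cmod z = r) by (rewrite <- E; apply Cmod_circ; lra); lra. }
  assert (Pk : pcont (fun t => circ r t / (circ r t - z))%C).
  { apply pcont_mult. apply pcont_circ. apply pcont_inv. apply pcont_plus. apply pcont_circ.
    apply pcont_const. intros t. now apply Cminus_neq_0. }
  pose proof (cauchy_mean_zero f z l r Hf Hr Hl) as Z.
  rewrite (cmean_ext _ (fun t => f (circ r t) * (circ r t / (circ r t - z)) - f z * (circ r t / (circ r t - z))))%C in Z.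
  - rewrite cmean_minus, cmean_scal, cauchy_kernel_mean in Z; trivial; try lra.
    + rewrite Cmult_1_r in Z. replace (f z) with (0 + f z)%C by ring. rewrite <- Z. ring.
    + apply pcont_mult; trivial. apply pcont_comp_circ. lra.
      intros w Hw. destruct (Hf w ltac:(lra)) as [m Hm]. exact (cderiv_ccont _ _ _ Hm).
    + apply pcont_mult; trivial. apply pcont_const.
  - intros t _. rewrite slope_off by trivial. field. now apply Cminus_neq_0.
Qed.

(** The radius 1 / 2 is a mere choice: by [cmean_annulus] all radii in (0, 1) give the same value,
    and radii near 1 give convergence in the whole disk. *)
Definition taylor_coef (f : C -> C) (k : nat) : C :=
  cmean (fun t => f (circ (/ 2) t) * / circ (/ 2) t ^ k)%C.

Lemma cderiv_pow (z : C) (n : nat) : exists l, cderiv (fun w => w ^ n)%C z l.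
Proof.
  induction n as [|n [l Hl]]. eexists; apply (cderiv_const 1).
  eexists. apply (cderiv_mult (fun w => w)). apply cderiv_id. apply Hl.
Qed.

Lemma taylor_coef_radius (f : C -> C) (k : nat) (r : R) : holo_D f -> 0 < r < 1 ->
  taylor_coef f k = cmean (fun t => f (circ r t) * / circ r t ^ k)%C.
Proof.
  intros Hf Hr.
  assert (A : forall r1 r2, 0 < r1 <= r2 -> r2 < 1 ->
    cmean (fun t => f (circ r1 t) * / circ r1 t ^ k)%C = cmean (fun t => f (circ r2 t) * / circ r2 t ^ k)%C).
  { intros r1 r2 H1 H2. apply (cmean_annulus (fun w => f w * / w ^ k)%C); trivial.
    intros w Hw. destruct (Hf w ltac:(lra)) as [l Hl]. destruct (cderiv_pow w k) as [m Hm].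
    eexists. apply cderiv_mult. apply Hl. apply cderiv_inv. apply Hm.
    apply Cpow_nz. apply Cmod_gt_0. lra. }
  unfold taylor_coef. destruct (Rle_dec r (/ 2)). symmetry; apply A; lra. apply A; lra.
Qed.

Theorem taylor_D (f : C -> C) : holo_D f ->
  conv_D (taylor_coef f) /\ forall z, Cmod z < 1 -> f z = ps (taylor_coef f) z.
Proof.
  intros Hf.
  assert (Pf : forall r, 0 <= r < 1 -> pcont (fun t => f (circ r t))).
  { intros r Hr. apply pcont_comp_circ. lra.
    intros w Hw. destruct (Hf w ltac:(lra)) as [m Hm]. exact (cderiv_ccont _ _ _ Hm). }
  assert (Hc : conv_D (taylor_coef f)).
  { intros r Hr. destruct (pcont_bounded _ (Pf r ltac:(lra))) as [M [HM BM]].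
    exists M. intros n. rewrite (taylor_coef_radius f n r Hf Hr).
    assert (Hp : 0 < r ^ n) by (apply pow_lt; lra).
    apply Rmult_le_reg_r with (/ r ^ n)%R. now apply Rinv_0_lt_compat.
    rewrite Rmult_assoc, Rinv_r, Rmult_1_r by lra.
    apply cmean_bound.
    - apply pcont_mult. apply Pf; lra. apply pcont_inv. apply pcont_pow, pcont_circ.
      intros t. apply Cpow_nz, circ_neq_0; lra.
    - intros t Ht. rewrite Cmod_mult, Cmod_inv, Cmod_pow, Cmod_circ by (try (apply Cpow_nz, circ_neq_0); lra).
      apply Rmult_le_compat_r. left; now apply Rinv_0_lt_compat. now apply BM. }
  split; trivial. intros z Hz. symmetry. apply ps_unique; trivial.
  pose proof (Cmod_ge_0 z). set (r := ((1 + Cmod z) / 2)%R). assert (Hr : Cmod z < r < 1) by (unfold r; lra).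
  pose proof (cauchy_kernel_expansion _ r z (Pf r ltac:(lra)) ltac:(lra)) as S.
  cbv beta in S. rewrite cauchy_formula in S by trivial.
  intros e He. destruct (S e He) as [N HN]. exists N. intros n Hn.
  erewrite csum_ext. apply (HN n Hn). intros k _. now rewrite (taylor_coef_radius f k r Hf) by lra.
Qed.

Lemma holo_D_ps (a : nat -> C) : conv_D a -> holo_D (ps a).
Proof. intros Ha z Hz. eexists. now apply cderiv_ps. Qed.

Lemma pcont_ps (a : nat -> C) (r : R) : conv_D a -> 0 <= r < 1 -> pcont (fun t => ps a (circ r t)).
Proof. intros Ha Hr. apply pcont_comp_circ. lra. intros z Hz. apply ccont_ps; trivial. lra. Qed.

Lemma is_csum_cmean_ps (h : R -> C) (a : nat -> C) (r : R) : pcont h -> conv_D a -> 0 <= r < 1 ->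
  is_csum (fun n => a n * cmean (fun t => h t * circ r t ^ n))%C
    (cmean (fun t => h t * ps a (circ r t))%C).
Proof.
  intros Hh Ha Hr. destruct (pcont_bounded h Hh) as [M [HM BM]].
  assert (S : is_csum (fun n => cmean (fun t => h t * (a n * circ r t ^ n)))%C
    (cmean (fun t => h t * ps a (circ r t))%C)).
  { apply (is_csum_cmean (fun n t => h t * (a n * circ r t ^ n))%C).
    - intros k. apply pcont_mult; trivial. apply pcont_mult. apply pcont_const. apply pcont_pow, pcont_circ.
    - apply pcont_mult; trivial. now apply pcont_ps.
    - intros e He. destruct (ps_uniform a r Ha Hr (e / (M + 1))%R) as [N HN].
      { apply Rdiv_lt_0_compat; lra. }
      exists N. intros n t Hn Ht. rewrite csum_scal.
      set (S1 := csum (fun k => a k * circ r t ^ k)%C n).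
      replace (h t * S1 - h t * ps a (circ r t))%C
        with (h t * (S1 - ps a (circ r t)))%C by ring.
      rewrite Cmod_mult. unfold S1. specialize (HN n (circ r t) Hn ltac:(rewrite Cmod_circ; lra)).
      specialize (BM t Ht).
      apply Rle_trans with ((M + 1) * (e / (M + 1)))%R; [|right; field; lra].
      apply Rmult_le_compat; try apply Cmod_ge_0; lra. }
  intros e He. destruct (S e He) as [N HN]. exists N. intros n Hn.
  erewrite csum_ext. apply (HN n Hn). intros k _. cbv beta. rewrite <- cmean_scal.
  apply cmean_ext. intros; ring. apply pcont_mult; trivial. apply pcont_pow, pcont_circ.
Qed.

(** * Maximum modulus and integrated series *)

Lemma RtoC_neq_0 (x : R) : x <> 0 -> RtoC x <> 0%C.
Proof. intros N E. apply RtoC_inj in E. contradiction. Qed.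

Lemma ps_euler (a : nat -> C) (z : C) : conv_D a -> Cmod z < 1 ->
  (z * ps (dcoef a) z)%C = ps (fun n => RtoC (INR n) * a n)%C z.
Proof.
  intros Ha Hz. rewrite (ps_shift (fun n => RtoC (INR n) * a n)%C) by (trivial; now apply conv_D_nmul).
  change (INR 0) with 0. change (fun n => RtoC (INR (S n)) * a (S n))%C with (dcoef a). ring.
Qed.

(** The coefficients of the integral of [t ^ k * ps a (t * z)] over t in [0, 1]. For k = 0 and the
    coefficients of z / f(z) the sum is z / H(z). *)
Definition icoef (k : nat) (a : nat -> C) (n : nat) : C := (RtoC (/ (INR n + INR k + 1)) * a n)%C.

Lemma conv_D_icoef (k : nat) (a : nat -> C) : conv_D a -> conv_D (icoef k a).
Proof.
  intros Ha. apply (conv_D_le a _ 1 Ha). intros n. unfold icoef. rewrite Cmod_mult, Cmod_R.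
  apply Rmult_le_compat_r. apply Cmod_ge_0. pose proof (pos_INR n). pose proof (pos_INR k).
  rewrite Rabs_pos_eq by (left; apply Rinv_0_lt_compat; lra).
  rewrite <- Rinv_1. apply Rinv_le_contravar; lra.
Qed.

Lemma rcont_pow_RtoC (k : nat) (t : R) : rcont (fun s => RtoC s ^ k)%C t.
Proof. apply rcont_pow. apply rcont_RtoC. apply derivable_continuous_pt. reg. Qed.

Lemma rderiv_ray (z : C) (t : R) : rderiv (fun s => RtoC s * z)%C t z.
Proof.
  pose proof (rderiv_mult RtoC (fun _ => z) t 1 0 (rderiv_RtoC_id t) (rderiv_const z t)) as H.
  cbv beta in H. replace (1 * z + RtoC t * 0)%C with z in H by ring. exact H.
Qed.

Lemma Cmod_ray (z : C) (t : R) : 0 <= t <= 1 -> Cmod (RtoC t * z) <= Cmod z.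
Proof.
  intros Ht. rewrite Cmod_mult, Cmod_R, Rabs_pos_eq by lra. pose proof (Cmod_ge_0 z). nra.
Qed.

Lemma rcont_on_ps_ray (a : nat -> C) (z : C) : conv_D a -> Cmod z < 1 ->
  rcont_on (fun t => ps a (RtoC t * z)%C) 0 1.
Proof.
  intros Ha Hz t Ht. apply (rcont_comp (ps a) (fun s => RtoC s * z)%C).
  eapply rderiv_rcont. apply rderiv_ray. apply ccont_ps; trivial.
  pose proof (Cmod_ray z t Ht). lra.
Qed.

Lemma rderiv_pow_RtoC (k : nat) (t : R) :
  rderiv (fun s => RtoC s ^ S k)%C t (RtoC (INR (S k)) * RtoC t ^ k).
Proof.
  induction k as [|k IH].
  - pose proof (rderiv_mult RtoC (fun _ => 1%C) t 1 0 (rderiv_RtoC_id t) (rderiv_const 1 t)) as H.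
    cbv beta in H. simpl. replace (1 * 1 + RtoC t * 0)%C with (1 * 1)%C in H by ring. exact H.
  - replace (RtoC (INR (S (S k))) * RtoC t ^ S k)%C
      with (1 * RtoC t ^ S k + RtoC t * (RtoC (INR (S k)) * RtoC t ^ k))%C.
    apply (rderiv_mult RtoC (fun s => RtoC s ^ S k)%C); trivial. apply rderiv_RtoC_id.
    rewrite (S_INR (S k)), RtoC_plus. simpl. ring.
Qed.

Lemma cint_ps_ray (k : nat) (a : nat -> C) (z : C) : conv_D a -> Cmod z < 1 ->
  cint (fun t => RtoC t ^ k * ps a (RtoC t * z))%C 0 1 = ps (icoef k a) z.
Proof.
  intros Ha Hz. pose proof (conv_D_icoef k a Ha) as Hi.
  set (c := icoef k a) in *.
  (* This function of t is a primitive of the integrand, because (k + 1) c_n + n c_n = a_n. *)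
  rewrite (cint_rderiv (fun t => RtoC t ^ S k * ps c (RtoC t * z))%C).
  - simpl. rewrite !Cpow_1_l, !Cmult_1_l. ring.
  - lra.
  - intros t Ht. pose proof (Cmod_ray z t Ht) as Hw. set (w := (RtoC t * z)%C) in *.
    assert (E : ps a w = (RtoC (INR (S k)) * ps c w + w * ps (dcoef c) w)%C).
    { rewrite ps_euler, <- ps_scal, <- ps_plus; trivial; try lra; try (apply conv_D_nmul; trivial); try (apply conv_D_scal; trivial).
      apply ps_ext. intros n. unfold c, icoef. rewrite Cmult_assoc, (Cmult_assoc (RtoC (INR n))), <- Cmult_plus_distr_r.
      rewrite <- !RtoC_mult, <- RtoC_plus, S_INR.
      replace ((INR k + 1) * / (INR n + INR k + 1) + INR n * / (INR n + INR k + 1))%R with 1. ring.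
      field. pose proof (pos_INR n). pose proof (pos_INR k). lra. }
    rewrite E.
    replace (RtoC t ^ k * (RtoC (INR (S k)) * ps c w + w * ps (dcoef c) w))%C
      with ((RtoC (INR (S k)) * RtoC t ^ k) * ps c w + RtoC t ^ S k * (ps (dcoef c) w * z))%C.
    2: { unfold w. simpl. ring. }
    apply (rderiv_mult (fun t => RtoC t ^ S k)%C (fun t => ps c (RtoC t * z)%C)).
    apply rderiv_pow_RtoC. apply (rderiv_comp (fun s => RtoC s * z)%C). apply rderiv_ray.
    apply cderiv_ps; trivial. fold w. lra.
  - intros t Ht. apply rcont_mult. apply rcont_pow_RtoC. now apply rcont_on_ps_ray.
Qed.

Lemma ps_icoef_bound (k : nat) (a : nat -> C) (z : C) (M : R) : conv_D a -> Cmod z < 1 ->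
  (forall w, Cmod w < 1 -> Cmod (ps a w) <= M) -> Cmod (ps (icoef k a) z) <= M / (INR k + 1).
Proof.
  intros Ha Hz HM. rewrite <- cint_ps_ray by trivial.
  assert (HM0 : 0 <= M). { eapply Rle_trans; [|apply (HM 0%C)]. apply Cmod_ge_0. rewrite Cmod_0. lra. }
  assert (Ek : is_RInt (fun t => M * t ^ k) 0 1 (M / (INR k + 1))).
  { pose proof (pos_INR k).
    replace (M / (INR k + 1))%R with (minus (M / (INR k + 1) * 1 ^ S k) (M / (INR k + 1) * 0 ^ S k)).
    2: { unfold minus, plus, opp; simpl. rewrite pow1. field. lra. }
    apply (is_RInt_derive (V := R_CompleteNormedModule) (fun t => M / (INR k + 1) * t ^ S k)%R).
    - intros t _. auto_derive; trivial. rewrite ?S_INR. simpl pred. destruct k; simpl; field; simpl in *; lra.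
    - intros t _. apply continuity_pt_filterlim. apply derivable_continuous_pt. reg. }
  eapply Rle_trans. apply (cint_norm_le _ (fun t => M * t ^ k)). lra.
  - intros t Ht. apply rcont_mult. apply rcont_pow_RtoC. now apply rcont_on_ps_ray.
  - eexists; apply Ek.
  - intros t Ht. rewrite Cmod_mult, Cmod_pow, Cmod_R, Rabs_pos_eq by lra. rewrite Rmult_comm.
    apply Rmult_le_compat_r. apply pow_le; lra. apply HM. pose proof (Cmod_ray z t Ht). lra.
  - right. now apply is_RInt_unique.
Qed.

Lemma segment_bound (f f' : C -> C) (p q : C) (M : R) :
  (forall t, 0 <= t <= 1 -> let w := (p + RtoC t * (q - p))%C in
     cderiv f w (f' w) /\ ccont f' w /\ Cmod (f' w) <= M) ->
  Cmod (f q - f p) <= M * Cmod (q - p).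
Proof.
  intros H.
  assert (D : forall t, rderiv (fun s => p + RtoC s * (q - p))%C t (q - p)).
  { intros t.
    pose proof (rderiv_plus (fun _ => p) (fun s => RtoC s * (q - p))%C t 0 (q - p) (rderiv_const p t) (rderiv_ray (q - p) t)) as D.
    cbv beta in D. replace (0 + (q - p))%C with (q - p)%C in D by ring. exact D. }
  assert (Cf : rcont_on (fun t => f' (p + RtoC t * (q - p)) * (q - p))%C 0 1).
  { intros t Ht. apply rcont_mult; [|apply rcont_const].
    apply (rcont_comp f' (fun s => p + RtoC s * (q - p))%C). eapply rderiv_rcont. apply D. now apply H. }
  assert (E : cint (fun t => f' (p + RtoC t * (q - p)) * (q - p))%C 0 1 = (f q - f p)%C).
  { rewrite (cint_rderiv (fun t => f (p + RtoC t * (q - p))%C)); trivial; try lra.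
    - f_equal; [|f_equal]; f_equal; ring.
    - intros t Ht. apply (rderiv_comp (fun s => p + RtoC s * (q - p))%C). apply D. now apply H. }
  rewrite <- E. eapply Rle_trans. apply (cint_bound _ 0 1 (M * Cmod (q - p))%R); trivial. lra.
  - intros t Ht. rewrite Cmod_mult. apply Rmult_le_compat_r. apply Cmod_ge_0. now apply H.
  - lra.
Qed.

Lemma Cmod_segment_lt (p q : C) (t r : R) : 0 <= t <= 1 -> Cmod p < r -> Cmod q < r ->
  Cmod (p + RtoC t * (q - p)) < r.
Proof.
  intros Ht Hp Hq. replace (p + RtoC t * (q - p))%C with (RtoC (1 - t) * p + RtoC t * q)%C.
  2: rewrite RtoC_minus; ring.
  eapply Rle_lt_trans. apply Cmod_triangle. rewrite !Cmod_mult, !Cmod_R, !Rabs_pos_eq by lra. destruct (Req_dec t 0) as [->|]; [lra|]. assert (t * Cmod q < t * r) by (apply Rmult_lt_compat_l; lra). assert ((1 - t) * Cmod p <= (1 - t) * r) by (apply Rmult_le_compat_l; lra). lra.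
Qed.

Lemma ps_lipschitz (a : nat -> C) (M : R) (p q : C) : conv_D a ->
  (forall w, Cmod w < 1 -> Cmod (ps (dcoef a) w) <= M) -> Cmod p < 1 -> Cmod q < 1 ->
  Cmod (ps a q - ps a p) <= M * Cmod (q - p).
Proof.
  intros Ha HM Hp Hq. apply (segment_bound (ps a) (ps (dcoef a))). intros t Ht w.
  assert (Hw : Cmod w < 1) by now apply Cmod_segment_lt.
  split; [|split]; auto. now apply cderiv_ps. apply ccont_ps; trivial. now apply conv_D_dcoef.
Qed.

Lemma cderiv_Cpow_fun (f : C -> C) (n : nat) (z : C) : (exists l, cderiv f z l) ->
  exists l, cderiv (fun w => f w ^ n)%C z l.
Proof.
  intros [l Hl]. destruct (cderiv_pow (f z) n) as [m Hm]. eexists.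
  apply (cderiv_comp f (fun w => w ^ n)%C). apply Hl. apply Hm.
Qed.

(* Landau's trick: Cauchy's formula for the powers of [f], then n-th roots. *)
Theorem maximum_modulus (f : C -> C) (z : C) (r M : R) : holo_D f -> Cmod z < r < 1 ->
  (forall w, Cmod w = r -> Cmod (f w) <= M) -> Cmod (f z) <= M.
Proof.
  intros Hf Hr HM. pose proof (Cmod_ge_0 z) as Pz.
  assert (M0 : 0 <= M).
  { eapply Rle_trans; [|apply (HM (RtoC r))]. apply Cmod_ge_0. rewrite Cmod_R, Rabs_pos_eq; lra. }
  set (K := (r / (r - Cmod z))%R).
  assert (B : forall n, Cmod (f z) ^ n <= M ^ n * K).
  { intros n. rewrite <- Cmod_pow.
    rewrite <- (cauchy_formula (fun w => f w ^ n)%C z r); trivial.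
    2: { intros w Hw. apply cderiv_Cpow_fun. now apply Hf. }
    assert (Nz : forall t, circ r t <> z).
    { intros t E. assert (Cmod z = r) by (rewrite <- E; apply Cmod_circ; lra). lra. }
    apply cmean_bound.
    - apply pcont_mult.
      + apply pcont_pow. apply pcont_comp_circ. lra.
        intros w Hw. destruct (Hf w ltac:(lra)) as [m Hm]. exact (cderiv_ccont _ _ _ Hm).
      + apply pcont_mult. apply pcont_circ. apply pcont_inv. apply pcont_plus. apply pcont_circ.
        apply pcont_const. intros t. now apply Cminus_neq_0.
    - intros t _. rewrite Cmod_mult, Cmod_pow, Cmod_div by (now apply Cminus_neq_0).
      rewrite Cmod_circ by lra.
      assert (r - Cmod z <= Cmod (circ r t - z)).
      { pose proof (Cmod_triangle (circ r t - z) z) as T.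
        replace (circ r t - z + z)%C with (circ r t) in T by ring. rewrite Cmod_circ in T; lra. }
      apply Rmult_le_compat.
      + apply pow_le, Cmod_ge_0.
      + apply Rdiv_le_0_compat; lra.
      + apply pow_incr. split. apply Cmod_ge_0. apply HM. apply Cmod_circ; lra.
      + unfold K, Rdiv. apply Rmult_le_compat_l; [lra|]. apply Rinv_le_contravar; lra. }
  (* In place of n-th roots: a ratio |f z| / M > 1 would have unbounded powers. The case M = 0 is
     settled by n = 1. *)
  apply Rnot_lt_le. intros L. destruct (Rle_lt_or_eq_dec _ _ M0) as [P|P].
  - assert (HL : 1 < Cmod (f z) / M).
    { apply Rmult_lt_reg_r with M; trivial. unfold Rdiv. rewrite Rmult_assoc, Rinv_l; lra. }
    destruct (Pow_x_infinity (Cmod (f z) / M)) with (b := (K + 1)%R) as [N HN].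
    { rewrite Rabs_pos_eq; lra. }
    specialize (HN N (le_n N)). rewrite Rabs_pos_eq in HN by (apply pow_le; lra).
    specialize (B N). unfold Rdiv in HN. rewrite Rpow_mult_distr, pow_inv in HN.
    assert (0 < M ^ N) by now apply pow_lt.
    assert (Cmod (f z) ^ N * / M ^ N <= K).
    { apply Rmult_le_reg_r with (M ^ N)%R; trivial. rewrite Rmult_assoc, Rinv_l by lra. lra. }
    lra.
  - specialize (B 1%nat). simpl in B. rewrite <- P in B, L. lra.
Qed.

(** The increments of the iterates from the centre are dominated by a geometric sequence, so the
    limit is obtained as the sum of a series. *)
Theorem banach_disk (T : C -> C) (c : C) (R0 k : R) : 0 <= R0 -> 0 <= k < 1 ->
  (forall x, Cmod (x - c) <= R0 -> Cmod (T x - c) <= R0) ->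
  (forall x y, Cmod (x - c) <= R0 -> Cmod (y - c) <= R0 -> Cmod (T x - T y) <= k * Cmod (x - y)) ->
  exists x, Cmod (x - c) <= R0 /\ T x = x.
Proof.
  intros H0 Hk HT Hc.
  set (x := fun n => Nat.iter n T c).
  assert (Hx : forall n, Cmod (x n - c) <= R0).
  { induction n. simpl. replace (c - c)%C with (RtoC 0) by ring. now rewrite Cmod_0. now apply HT. }
  set (u := fun n => (x (S n) - x n)%C).
  assert (Hu : forall n, Cmod (u n) <= Cmod (u 0%nat) * k ^ n).
  { induction n. simpl; lra. eapply Rle_trans. apply (Hc (x (S n)) (x n)); apply Hx.
    fold (u n). simpl pow.
    apply (Rmult_le_compat_l k) in IHn; lra. }
  pose proof (is_csum_geom u _ k Hk Hu) as HS.
  assert (Eu : forall n, csum u n = (x n - c)%C).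
  { induction n. simpl. ring. change (csum u (S n)) with (csum u n + u n)%C. rewrite IHn. unfold u. ring. }
  set (l := (cseries u + c)%C).
  assert (Hl : forall e, 0 < e -> exists N, forall n, (N <= n)%nat -> Cmod (x n - l) < e).
  { intros e He. destruct (HS e He) as [N HN]. exists N. intros n Hn. specialize (HN n Hn).
    rewrite Eu in HN. unfold l. now replace (x n - (cseries u + c))%C with (x n - c - cseries u)%C by ring. }
  assert (HlR : Cmod (l - c) <= R0).
  { apply le_epsilon. intros e He. destruct (Hl e He) as [N HN]. specialize (HN N (le_n N)). specialize (Hx N).
    replace (l - c)%C with (- (x N - l) + (x N - c))%C by ring.
    eapply Rle_trans. apply Cmod_triangle. rewrite Cmod_opp. lra. }
  exists l. split; trivial.
  replace (T l) with (T l - l + l)%C by ring. replace (T l - l)%C with (RtoC 0). ring.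
  symmetry. apply Cmod_eq_0. apply Rle_antisym; [|apply Cmod_ge_0]. apply le_epsilon. intros e He.
  destruct (Hl (e / 2)%R) as [N HN]; [lra|].
  pose proof (HN N (le_n N)) as A. pose proof (HN (S N) (le_S _ _ (le_n N))) as B.
  pose proof (Hc l (x N) HlR (Hx N)) as D. change (T (x N)) with (x (S N)) in D.
  replace (l - x N)%C with (- (x N - l))%C in D by ring. rewrite Cmod_opp in D.
  replace (T l - l)%C with ((T l - x (S N)) + (x (S N) - l))%C by ring.
  eapply Rle_trans. apply Cmod_triangle. nra.
Qed.

(** * Preservation of the class M *)

Lemma Cmod_near (z w : C) (r : R) : Cmod z < r -> Cmod (w - z) < r - Cmod z -> Cmod w < r.
Proof.
  intros Hz Hw. replace w with (z + (w - z))%C by ring.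
  eapply Rle_lt_trans. apply Cmod_triangle. lra.
Qed.

Lemma holo_D_of_analytic (f : C -> C) : analytic_on unit_disk f -> holo_D f.
Proof.
  intros H z Hz. destruct (proj1 (analytic_at_iff f z) (H z Hz)) as [d [Hd D]].
  apply D. replace (z - z)%C with (RtoC 0) by ring. now rewrite Cmod_0.
Qed.

(** f(z) = z k(z) with k zero-free and k(0) = 1; [b] is the Taylor sequence of 1 / k, on which the
    later arguments operate. *)
Lemma class_A_quotient_ps (f : C -> C) : class_A f ->
  (forall z, Cmod z < 1 -> z <> 0%C -> f z <> 0%C) ->
  exists b, conv_D b /\ b 0%nat = 1%C /\
    forall z, Cmod z < 1 ->
      z_over f z = ps b z /\ ps b z <> 0%C /\ (f z = z / ps b z)%C.
Proof.
  intros [Ha [H0 H1]] Hn. pose proof (holo_D_of_analytic f Ha) as Hf.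
  destruct (taylor_D f Hf) as [Ca Ta]. set (a := taylor_coef f) in *.
  assert (P0 : Cmod 0 < 1) by (rewrite Cmod_0; lra).
  assert (A0 : a 0%nat = 0%C) by (rewrite <- H0, Ta, ps_0; trivial).
  assert (A1 : a 1%nat = 1%C).
  { assert (D : cderiv f 0 (ps (dcoef a) 0)).
    { apply (cderiv_ext_loc (ps a) f 0 _ 1). lra.
      intros w Hw. symmetry. apply Ta. now replace (w - 0)%C with w in Hw by ring.
      now apply cderiv_ps. }
    apply C_derive_cderiv in D. rewrite H1, ps_0 in D by now apply conv_D_dcoef.
    unfold dcoef in D. change (INR 1) with 1 in D. rewrite Cmult_1_l in D. now symmetry. }
  set (k := fun n => a (S n)). pose proof (conv_D_shift a Ca) as Ck. fold k in Ck.
  assert (Fk : forall z, Cmod z < 1 -> f z = (z * ps k z)%C).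
  { intros z Hz. rewrite Ta, ps_shift, A0 by trivial. fold k. ring. }
  assert (Nk : forall z, Cmod z < 1 -> ps k z <> 0%C).
  { intros z Hz E. destruct (Ceq_dec z 0) as [->|N].
    - rewrite ps_0 in E by trivial. unfold k in E. rewrite A1 in E. apply RtoC_inj in E. lra.
    - apply (Hn z Hz N). rewrite Fk, E by trivial. ring. }
  assert (Hg : holo_D (fun z => / ps k z)%C).
  { intros z Hz. eexists. apply cderiv_inv. now apply cderiv_ps. now apply Nk. }
  destruct (taylor_D _ Hg) as [Cb Tb].
  exists (taylor_coef (fun z => / ps k z)%C). split; trivial. split.
  - rewrite <- ps_0, <- Tb, ps_0 by trivial. unfold k. rewrite A1. field; try (apply RtoC_neq_0; lra).
  - intros z Hz. rewrite <- Tb by trivial. pose proof (Nk z Hz). split; [|split].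
    + unfold z_over. destruct (Ceq_dec z 0) as [->|N].
      * rewrite ps_0 by trivial. unfold k. rewrite A1. field; try (apply RtoC_neq_0; lra).
      * rewrite Fk by trivial. field. now split.
    + intros E. apply (RtoC_neq_0 1). lra. rewrite <- (Cinv_r (ps k z)), E by trivial. ring.
    + rewrite Fk by trivial. field; trivial; now split; try (apply RtoC_neq_0; lra).
Qed.

(** With g = z / f one has f' g^2 = g - z g', so the expression defining M, plus 1, is z^2 g'' - z
    g' + g. On the n-th coefficient this acts as n (n - 1) - n + 1 = (n - 1)^2. *)
Definition m_coef (c : nat -> C) (n : nat) : C := (RtoC ((INR n - 1) ^ 2) * c n)%C.

Lemma m_coef_eq (c : nat -> C) (n : nat) :
  m_coef c n = (RtoC (INR n) * (RtoC (INR n) * c n) + (- (2)) * (RtoC (INR n) * c n) + c n)%C.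
Proof. unfold m_coef. simpl. rewrite !RtoC_mult, !RtoC_minus. ring. Qed.

Lemma conv_D_m_coef (c : nat -> C) : conv_D c -> conv_D (m_coef c).
Proof.
  intros Hc. apply (conv_D_le (fun n => RtoC (INR n) * (RtoC (INR n) * c n) + (- (2)) * (RtoC (INR n) * c n) + c n)%C _ 1).
  - apply conv_D_plus; trivial. apply conv_D_plus. now apply conv_D_nmul, conv_D_nmul.
    apply conv_D_scal. now apply conv_D_nmul.
  - intros n. rewrite m_coef_eq. lra.
Qed.

Lemma ps_m_coef (c : nat -> C) (z : C) : conv_D c -> Cmod z < 1 ->
  (z ^ 2 * ps (dcoef (dcoef c)) z - z * ps (dcoef c) z + ps c z = ps (m_coef c) z)%C.
Proof.
  intros Hc Hz. pose proof (conv_D_dcoef c Hc) as Hd. pose proof (conv_D_nmul c Hc) as Hn.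
  rewrite (ps_ext (m_coef c) _ z (m_coef_eq c)).
  rewrite !ps_plus, ps_scal by (trivial; repeat (apply conv_D_plus || apply conv_D_scal || apply conv_D_nmul); trivial).
  rewrite <- !ps_euler by trivial.
  assert (E : ps (dcoef (fun n => RtoC (INR n) * c n)%C) z = (ps (dcoef c) z + z * ps (dcoef (dcoef c)) z)%C).
  { rewrite ps_euler, <- ps_plus by (trivial; now apply conv_D_nmul). apply ps_ext.
    intros n. unfold dcoef. rewrite S_INR, RtoC_plus. ring. }
  rewrite E. simpl. ring.
Qed.

(** [M_expr] contains derivatives of [z_over F], so the representation is needed on a neighbourhood;
    it is asked only near [z], since [ps c] may vanish elsewhere in the disk. *)
Lemma M_expr_ps (F : C -> C) (c : nat -> C) (z : C) (d : R) : conv_D c -> Cmod z < 1 -> 0 < d ->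
  (forall w, Cmod w < 1 -> Cmod (w - z) < d ->
     z_over F w = ps c w /\ ps c w <> 0%C /\ (F w = w / ps c w)%C) ->
  M_expr F z = (ps (m_coef c) z - 1)%C.
Proof.
  intros Hc Hz Hd H. set (e := Rmin d (1 - Cmod z)).
  assert (He : 0 < e) by (apply Rmin_glb_lt; lra).
  assert (HE : forall w, Cmod (w - z) < e -> Cmod w < 1 /\ Cmod (w - z) < d).
  { intros w Hw. split. apply (Cmod_near z); trivial. eapply Rlt_le_trans. apply Hw. apply Rmin_r.
    eapply Rlt_le_trans. apply Hw. apply Rmin_l. }
  assert (Zz : Cmod (z - z) < d) by (replace (z - z)%C with (RtoC 0) by ring; now rewrite Cmod_0).
  destruct (H z Hz Zz) as [Hz1 [Hz2 Hz3]].
  assert (D1 : forall w, Cmod (w - z) < e -> C_derive (z_over F) w = ps (dcoef c) w).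
  { intros w Hw. apply C_derive_cderiv.
    apply (cderiv_ext_loc (ps c) _ w _ (e - Cmod (w - z))). lra.
    - intros u Hu. destruct (HE u) as [U1 U2].
      { replace (u - z)%C with ((u - w) + (w - z))%C by ring. eapply Rle_lt_trans. apply Cmod_triangle. lra. }
      symmetry. now apply H.
    - apply cderiv_ps; trivial. now apply HE. }
  assert (D2 : C_derive (C_derive (z_over F)) z = ps (dcoef (dcoef c)) z).
  { apply C_derive_cderiv. apply (cderiv_ext_loc (ps (dcoef c)) _ z _ e); trivial.
    - intros w Hw. symmetry. now apply D1.
    - apply cderiv_ps; trivial. now apply conv_D_dcoef. }
  assert (D3 : C_derive F z = ((1 * ps c z - z * ps (dcoef c) z) / (ps c z * ps c z))%C).
  { apply C_derive_cderiv. apply (cderiv_ext_loc (fun w => w / ps c w)%C _ z _ e); trivial.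
    - intros w Hw. destruct (HE w Hw). symmetry. now apply H.
    - apply (cderiv_div (fun w => w)); trivial. apply cderiv_id. now apply cderiv_ps. }
  unfold M_expr. rewrite D2, D3, Hz1, <- ps_m_coef by trivial. field. trivial.
Qed.

(** Serves both the open and the closed disk: nonvanishing of [ps c] at a point of [E] extends to a
    neighbourhood by continuity, which yields analyticity at that point. *)
Lemma belongs_M_of_ps (E : C -> Prop) (F : C -> C) (c : nat -> C) :
  (forall z, E z -> Cmod z < 1) -> conv_D c -> c 0%nat = 1%C -> F 0%C = 0%C ->
  (forall z, Cmod z < 1 -> ps c z <> 0%C -> z_over F z = ps c z /\ (F z = z / ps c z)%C) ->
  (forall z, E z -> ps c z <> 0%C) ->
  (forall z, E z -> Cmod (ps (m_coef c) z - 1) <= 1) -> belongs_M_on E F.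
Proof.
  intros HE Hc H0 F0 HF HN HM.
  assert (L : forall z, Cmod z < 1 -> ps c z <> 0%C -> exists d, 0 < d /\
    forall w, Cmod (w - z) < d -> Cmod w < 1 /\ ps c w <> 0%C).
  { intros z Hz Nz. apply Cmod_gt_0 in Nz.
    destruct (ccont_ps c z Hc Hz (Cmod (ps c z)) Nz) as [d [Hd D]].
    exists (Rmin d (1 - Cmod z)). split. apply Rmin_glb_lt; lra.
    intros w Hw. split.
    - apply (Cmod_near z); trivial. eapply Rlt_le_trans. apply Hw. apply Rmin_r.
    - intros Ew. specialize (D w (Rlt_le_trans _ _ _ Hw (Rmin_l _ _))). rewrite Ew in D.
      replace (0 - ps c z)%C with (- ps c z)%C in D by ring. rewrite Cmod_opp in D. lra. }
  assert (Dz : forall z, Cmod z < 1 -> ps c z <> 0%C ->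
    cderiv F z ((1 * ps c z - z * ps (dcoef c) z) / (ps c z * ps c z))).
  { intros z Hz Nz. destruct (L z Hz Nz) as [d [Hd D]].
    apply (cderiv_ext_loc (fun w => w / ps c w)%C _ z _ d); trivial.
    - intros w Hw. symmetry. now apply HF; apply D.
    - apply (cderiv_div (fun w => w)); trivial. apply cderiv_id. now apply cderiv_ps. }
  assert (P0 : Cmod 0 < 1) by (rewrite Cmod_0; lra).
  assert (N1 : (1 : C) <> 0%C) by (apply RtoC_neq_0; lra).
  split; [split; [|split]|split]; trivial.
  - intros z Ez. apply analytic_at_iff. destruct (L z (HE z Ez) (HN z Ez)) as [d [Hd D]].
    exists d. split; trivial. intros w Hw. eexists. now apply Dz; apply D.
  - assert (N0 : ps c 0 <> 0%C) by (rewrite ps_0, H0 by trivial; trivial).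
    rewrite (C_derive_cderiv _ _ _ (Dz 0%C P0 N0)), ps_0, H0 by trivial. field. trivial.
  - intros z Ez Nz. destruct (HF z (HE z Ez) (HN z Ez)) as [_ ->].
    unfold Cdiv. apply Cmult_neq_0; trivial. intros E'. apply N1.
    rewrite <- (Cinv_r (ps c z)), E' by auto. ring.
  - intros z Ez. destruct (L z (HE z Ez) (HN z Ez)) as [d [Hd D]].
    rewrite (M_expr_ps F c z d Hc (HE z Ez) Hd). now apply HM.
    intros w Hw1 Hw. destruct (D w Hw) as [_ Nw]. destruct (HF w Hw1 Nw). now split.
Qed.

Lemma int_from_0_ps (g : C -> C) (b : nat -> C) (z : C) : conv_D b ->
  (forall w, Cmod w < 1 -> g w = ps b w) -> Cmod z < 1 ->
  int_from_0 g z = (z * ps (icoef 0 b) z)%C.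
Proof.
  intros Hb Hg Hz. unfold int_from_0. rewrite <- cint_ps_ray by trivial.
  f_equal. apply (cint_ext (fun s => g (RtoC s * z)%C)). lra.
  intros t Ht. rewrite Hg. simpl. ring. pose proof (Cmod_ray z t Ht). lra.
Qed.

Lemma H_transform_ps (f : C -> C) (b : nat -> C) (z : C) : conv_D b ->
  (forall w, Cmod w < 1 -> z_over f w = ps b w) -> b 0%nat = 1%C ->
  Cmod z < 1 -> ps (icoef 0 b) z <> 0%C ->
  z_over (H_transform f) z = ps (icoef 0 b) z /\ (H_transform f z = z / ps (icoef 0 b) z)%C.
Proof.
  intros Hb Hg H0 Hz Nz. unfold z_over, H_transform. destruct (Ceq_dec z 0) as [->|N].
  - split. rewrite ps_0 by now apply conv_D_icoef. unfold icoef. rewrite H0. simpl.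
    replace (/ (0 + 0 + 1))%R with 1 by field. ring. field. trivial.
  - rewrite (int_from_0_ps _ b) by trivial. split; field; repeat split; trivial.
Qed.

(** Inversion maps the disk |x - 2| <= 1 onto the disk with diameter [1 / 3, 1], all of whose points
    are within 2 / 3 of 1. *)
Lemma half_disk_inverse (x : C) : Cmod (x - 2) <= 1 ->
  1 <= Cmod x /\ Cmod (1 - / x) <= 2 / 3.
Proof.
  intros H. assert (H1 : 1 <= Cmod x).
  { pose proof (Cmod_triangle (- (x - 2)) x) as T. rewrite Cmod_opp in T.
    replace (- (x - 2) + x)%C with (RtoC 2) in T by ring. rewrite Cmod_R, Rabs_pos_eq in T; lra. }
  split; trivial.
  assert (N : x <> 0%C) by (apply Cmod_gt_0; lra).
  replace (1 - / x)%C with ((x - 1) / x)%C by (field; trivial).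
  rewrite Cmod_div by trivial. apply Rmult_le_reg_r with (Cmod x). lra.
  unfold Rdiv at 1. rewrite Rmult_assoc, Rinv_l, Rmult_1_r by lra.
  apply Rsqr_incr_0_var; [|lra].
  assert (H2 : Cmod (x - 2) ^ 2 <= 1 ^ 2) by (apply pow_incr; split; trivial; apply Cmod_ge_0).
  rewrite !Rsqr_pow2, Rpow_mult_distr. rewrite !Cmod2_alt in *. destruct x as [a b]. simpl in *. nra.
Qed.

(* Were [z / H z = ps (icoef 0 b) z] zero, then, writing [ps b w = w (1/w + b_1 + Q w)] with [Q] a
   weak contraction, the map [T] below would have a fixed point x, and [ps b] would vanish at z / x. *)
Lemma class_M_integral_nonzero (b : nat -> C) : conv_D b -> b 0%nat = 1%C ->
  (forall z, Cmod z < 1 -> ps b z <> 0%C) ->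
  (forall z, Cmod z < 1 -> Cmod (ps (m_coef b) z - 1) <= 1) ->
  forall z, Cmod z < 1 -> ps (icoef 0 b) z <> 0%C.
Proof.
  intros Hb H0 HN HM.
  set (chi := fun n => m_coef b (S (S n))).
  pose proof (conv_D_m_coef b Hb) as Hm.
  assert (Hchi : conv_D chi) by (do 2 apply conv_D_shift in Hm; exact Hm).
  assert (E1 : forall z, Cmod z < 1 -> (ps (m_coef b) z - 1 = z * z * ps chi z)%C).
  { intros z Hz. rewrite ps_shift, ps_shift by (try apply conv_D_shift; trivial).
    fold chi. unfold m_coef at 1 2. rewrite H0. simpl INR.
    replace ((0 - 1) ^ 2)%R with 1 by ring. replace ((1 - 1) ^ 2)%R with 0 by ring. ring. }
  assert (Bchi : forall z, Cmod z < 1 -> Cmod (ps chi z) <= 1).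
  { intros z Hz. pose proof (Cmod_ge_0 z) as Pz.
    (* Schwarz's lemma for the double zero at 0: the maximum principle on |w| = r gives the bound 1
       / r^2, and then r tends to 1. *)
    assert (B : forall r, Cmod z < r < 1 -> Cmod (ps chi z) * (r * r) <= 1).
    { intros r Hr. assert (0 < r * r) by nra. apply Rmult_le_reg_r with (/ (r * r))%R. now apply Rinv_0_lt_compat.
      rewrite Rmult_assoc, Rinv_r, Rmult_1_r, Rmult_1_l by lra.
      apply (maximum_modulus (ps chi) z r); trivial. now apply holo_D_ps.
      intros w Hw. specialize (HM w ltac:(lra)). rewrite E1, !Cmod_mult, Hw in HM by lra.
      apply Rmult_le_reg_l with (r * r)%R; trivial. rewrite Rinv_r by lra. lra. }
    apply le_epsilon. intros e He. set (X := Cmod (ps chi z)) in *.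
    assert (PX : 0 <= X) by apply Cmod_ge_0.
    set (r := Rmax ((1 + Cmod z) / 2) (1 - e / (2 * (X + 1)))%R).
    assert (0 < e / (2 * (X + 1))) by (apply Rdiv_lt_0_compat; lra).
    assert (Hr : Cmod z < r < 1).
    { split. eapply Rlt_le_trans; [|apply Rmax_l]. lra. apply Rmax_lub_lt; lra. }
    specialize (B r Hr). assert (Hr2 : 1 - e / (2 * (X + 1)) <= r) by apply Rmax_r.
    assert (X * (1 - r * r) <= e).
    { assert (1 - r * r <= 2 * (e / (2 * (X + 1)))) by nra.
      apply Rle_trans with (X * (e / (X + 1)))%R. apply Rmult_le_compat_l; trivial.
      replace (e / (X + 1))%R with (2 * (e / (2 * (X + 1))))%R by (field; lra). trivial.
      apply Rmult_le_reg_r with (X + 1)%R. lra.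
      replace (X * (e / (X + 1)) * (X + 1))%R with (X * e)%R by (field; lra). nra. }
    lra. }
  set (q := fun n => match n with O => RtoC 0 | S m => b (S (S m)) end).
  assert (Hq : conv_D q).
  { apply conv_D_unshift. do 2 apply conv_D_shift in Hb. exact Hb. }
  (* The derivative of q is the average of [chi] over rays, as dividing (n + 1)^2 b_(n+2) by n + 1
     leaves (n + 1) b_(n+2). Hence it is bounded by 1, and q is 1-Lipschitz. *)
  assert (Ed : forall n, icoef 0 chi n = dcoef q n).
  { intros n. unfold icoef, chi, m_coef, dcoef, q. rewrite Cmult_assoc, <- RtoC_mult. do 2 f_equal.
    rewrite !S_INR. simpl INR. field. pose proof (pos_INR n). lra. }
  assert (Bd : forall z, Cmod z < 1 -> Cmod (ps (dcoef q) z) <= 1).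
  { intros z Hz. rewrite <- (ps_ext _ _ z Ed).
    eapply Rle_trans. apply (ps_icoef_bound 0 chi z 1); trivial. simpl. right; field. }
  assert (Lq : forall p w, Cmod p < 1 -> Cmod w < 1 -> Cmod (ps q w - ps q p) <= Cmod (w - p)).
  { intros p w Hp Hw. rewrite <- (Rmult_1_l (Cmod (w - p))). now apply ps_lipschitz. }
  assert (Eb : forall z, Cmod z < 1 -> (ps b z = 1 + z * (b 1%nat + ps q z))%C).
  { intros z Hz. rewrite ps_shift, H0 by trivial. do 2 f_equal.
    rewrite ps_shift, (ps_shift q) by (trivial; now apply conv_D_shift). simpl. ring. }
  intros z Hz Gz.
  (* Since 2 / (n + 3) = 1 - (n + 1) / (n + 3), doubling the averaged series gives [ps b z + 1] up
     to this error, and |P| <= |z|^2 / 3. *)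
  set (P := (- (z * z * ps (icoef 2 (dcoef q)) z))%C).
  pose proof (conv_D_dcoef q Hq) as Hdq. pose proof (conv_D_icoef 2 _ Hdq) as Hi2.
  assert (BP : Cmod P <= Cmod z * Cmod z * (1 / 3)).
  { unfold P. rewrite Cmod_opp, !Cmod_mult. apply Rmult_le_compat_l.
    apply Rmult_le_pos; apply Cmod_ge_0.
    pose proof (ps_icoef_bound 2 (dcoef q) z 1 Hdq Hz Bd). simpl in H. lra. }
  assert (EG : (2 * ps (icoef 0 b) z = ps b z + 1 + P)%C).
  { pose proof (conv_D_icoef 0 b Hb) as Hi0. unfold P.
    rewrite (ps_shift (icoef 0 b)), (ps_shift (fun n => icoef 0 b (S n))), (ps_shift b), (ps_shift (fun n => b (S n)))
      by (trivial; now apply conv_D_shift).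
    assert (ES : forall z, Cmod z < 1 -> (2 * ps (fun n => icoef 0 b (S (S n))) z
        = ps (fun n => b (S (S n))) z + - (1) * ps (icoef 2 (dcoef q)) z)%C).
    { intros w Hw. rewrite <- !ps_scal, <- ps_plus; trivial.
      - apply ps_ext. intros n. unfold icoef, dcoef, q. set (c := b (S (S n))).
        replace (2 * (RtoC (/ (INR (S (S n)) + INR 0 + 1)) * c))%C with (RtoC (2 * / (INR (S (S n)) + INR 0 + 1)) * c)%C
          by (rewrite RtoC_mult; ring).
        replace (c + - (1) * (RtoC (/ (INR n + INR 2 + 1)) * (RtoC (INR (S n)) * c)))%C
          with (RtoC (1 - / (INR n + INR 2 + 1) * INR (S n)) * c)%C by (rewrite RtoC_minus, RtoC_mult; ring).
        do 2 f_equal. rewrite !S_INR. simpl INR. field. pose proof (pos_INR n). lra.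
      - do 2 apply conv_D_shift in Hb. exact Hb.
      - now apply conv_D_scal.
      - do 2 apply conv_D_shift in Hi0. exact Hi0. }
    specialize (ES z Hz). unfold icoef at 1 2. rewrite H0. simpl INR.
    replace (/ (0 + 0 + 1))%R with 1 by field.
    replace (2 * (1 * 1 + z * (RtoC (/ (1 + 0 + 1)) * b 1%nat + z * ps (fun n => icoef 0 b (S (S n))) z)))%C
      with (2 + z * (RtoC (2 * / (1 + 0 + 1)) * b 1%nat + z * (2 * ps (fun n => icoef 0 b (S (S n))) z)))%C
      by (rewrite RtoC_mult; ring).
    rewrite ES. replace (2 * / (1 + 0 + 1))%R with 1 by field. ring. }
  rewrite Gz, Eb in EG by trivial.
  assert (Nz : z <> 0%C).
  { intros ->. rewrite ps_0 in Gz by now apply conv_D_icoef. unfold icoef in Gz. rewrite H0 in Gz. simpl in Gz.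
    replace (/ (0 + 0 + 1))%R with 1 in Gz by field. rewrite Cmult_1_l in Gz. apply RtoC_inj in Gz. lra. }
  pose proof (proj1 (Cmod_gt_0 z) Nz) as Pz.
  (* [ps b] vanishes at z / x exactly when x = - z (b_1 + q (z / x)); eliminating b_1 through the
     assumed zero at [z] gives x = T x. *)
  set (T := fun x => (2 + P + z * (ps q z - ps q (z / x)))%C).
  assert (Hx : forall x, Cmod (x - 2) <= 1 -> x <> 0%C /\ 1 <= Cmod x /\ Cmod (z / x) < 1).
  { intros x Hx. destruct (half_disk_inverse x Hx) as [X1 _].
    assert (N : x <> 0%C) by (apply Cmod_gt_0; lra). split; [|split]; trivial.
    rewrite Cmod_div by trivial. apply Rmult_lt_reg_r with (Cmod x). lra.
    unfold Rdiv. rewrite Rmult_assoc, Rinv_l by lra. lra. }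
  (* The disk |x - 2| <= 1 is mapped into itself because |z|^2 / 3 + 2 |z|^2 / 3 < 1, and |x y| >= 1
     makes |z|^2 a contraction constant. *)
  destruct (banach_disk T 2 1 (Cmod z * Cmod z)) as [x [Fx Tx]].
  - lra.
  - nra.
  - intros x X. destruct (Hx x X) as [X0 [X1 X2]]. destruct (half_disk_inverse x X) as [_ X3].
    unfold T. replace (2 + P + z * (ps q z - ps q (z / x)) - 2)%C with (P + z * (ps q z - ps q (z / x)))%C by ring.
    eapply Rle_trans. apply Cmod_triangle. rewrite Cmod_mult.
    pose proof (Lq (z / x)%C z X2 Hz) as L.
    replace (z - z / x)%C with (z * (1 - / x))%C in L by (field; trivial). rewrite Cmod_mult in L. nra.
  - intros x y X Y. destruct (Hx x X) as [X0 [X1 X2]]. destruct (Hx y Y) as [Y0 [Y1 Y2]].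
    unfold T. replace (2 + P + z * (ps q z - ps q (z / x)) - (2 + P + z * (ps q z - ps q (z / y))))%C
      with (z * (ps q (z / y) - ps q (z / x)))%C by ring.
    rewrite Cmod_mult, Rmult_assoc. apply Rmult_le_compat_l. lra.
    eapply Rle_trans. apply Lq; trivial.
    replace (z / y - z / x)%C with (z * (x - y) / (x * y))%C by (field; now split).
    rewrite Cmod_div, !Cmod_mult by (now apply Cmult_neq_0).
    assert (PD : 0 <= Cmod z * Cmod (x - y)) by (apply Rmult_le_pos; apply Cmod_ge_0).
    assert (XY : 1 <= Cmod x * Cmod y) by nra.
    apply Rmult_le_reg_r with (Cmod x * Cmod y)%R. lra.
    unfold Rdiv. rewrite Rmult_assoc, Rinv_l by lra. nra.
  - destruct (Hx x Fx) as [X0 [X1 X2]]. apply (HN _ X2). rewrite Eb by trivial.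
    unfold T in Tx.
    assert (EP : (P = - (2) - z * (b 1%nat + ps q z))%C).
    { replace P with (1 + z * (b 1%nat + ps q z) + 1 + P - (1 + z * (b 1%nat + ps q z)) - 1)%C by ring.
      rewrite <- EG. ring. }
    rewrite EP in Tx.
    assert (Ex : (x = - z * (b 1%nat + ps q (z / x)))%C) by (rewrite <- Tx at 1; ring).
    replace (1 + z / x * (b 1%nat + ps q (z / x)))%C with ((x - - z * (b 1%nat + ps q (z / x))) / x)%C by (field; trivial).
    rewrite <- Ex. field. trivial.
Qed.

Theorem class_M_H_transform (f : C -> C) : class_M f -> class_M (H_transform f).
Proof.
  intros [HA [Hn HM]]. destruct (class_A_quotient_ps f HA Hn) as [b [Hb [B0 Hf]]].
  assert (HMb : forall z, Cmod z < 1 -> Cmod (ps (m_coef b) z - 1) <= 1).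
  { intros z Hz. rewrite <- (M_expr_ps f b z 1 Hb Hz). now apply HM. lra.
    intros w Hw _. now apply Hf. }
  assert (Hi := conv_D_icoef 0 b Hb). pose proof (conv_D_m_coef b Hb) as Hm.
  apply (belongs_M_of_ps unit_disk _ (icoef 0 b)); trivial.
  - unfold icoef. rewrite B0. simpl. replace (/ (0 + 0 + 1))%R with 1 by field. ring.
  - unfold H_transform. destruct (Ceq_dec 0 0) as [_|N]; trivial. now destruct N.
  - intros z Hz Nz. apply H_transform_ps; trivial. intros w Hw. now apply Hf.
  - intros z Hz. apply (class_M_integral_nonzero b); trivial. intros w Hw. now apply Hf.
  - intros z Hz.
    rewrite (ps_ext (m_coef (icoef 0 b)) (icoef 0 (m_coef b))).
    2: { intros n. unfold m_coef, icoef. ring. }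
    (* Without its constant term 1 the series is bounded by 1. Averaging over rays keeps this bound
       and leaves the constant term unchanged, so the same subtraction is right for H. *)
    set (c := fun n => match n with O => RtoC 0 | S _ => m_coef b n end).
    assert (Hc : conv_D c) by (apply conv_D_unshift; exact (conv_D_shift _ Hm)).
    assert (E0 : m_coef b 0%nat = 1%C) by (unfold m_coef; rewrite B0; simpl; replace ((0 - 1) * ((0 - 1) * 1))%R with 1 by ring; ring).
    assert (Ec : forall w, Cmod w < 1 -> (ps c w = ps (m_coef b) w - 1)%C).
    { intros w Hw. rewrite ps_shift, (ps_shift (m_coef b)), E0 by trivial. simpl. ring. }
    replace (ps (icoef 0 (m_coef b)) z - 1)%C with (ps (icoef 0 c) z).
    + replace 1 with (1 / (INR 0 + 1))%R by (simpl; field). apply ps_icoef_bound; trivial.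
      intros w Hw. rewrite Ec by trivial. now apply HMb.
    + rewrite ps_shift, (ps_shift (icoef 0 (m_coef b))) by (trivial; now apply conv_D_icoef).
      unfold icoef at 1 3. rewrite E0. simpl INR. replace (/ (0 + 0 + 1))%R with 1 by field.
      unfold icoef, c. ring.
Qed.

(** * The equation for r3 *)

(** The expression inside the modulus, as a function of y, has derivative - y^n / (1 - y) by the
    geometric sum; the mean value theorem on [0, x] does the rest. *)
Lemma ln_partial_sum (x : R) (n : nat) : 0 <= x < 1 ->
  Rabs (rsum (fun k => x ^ S k / INR (S k)) n + ln (1 - x)) <= x ^ n / (1 - x).
Proof.
  intros Hx.
  set (f := fun y => rsum (fun k => y ^ S k / INR (S k)) n + ln (1 - y)).
  set (f' := fun y => rsum (fun k => y ^ k) n - / (1 - y)).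
  assert (D : forall y, 0 <= y <= x -> is_derive f y (f' y)).
  { intros y Hy. unfold f, f', Rminus. apply (is_derive_plus (K := R_AbsRing) (V := R_NormedModule)).
    - clear - n. induction n; simpl rsum.
      + apply (is_derive_const (K := R_AbsRing) (V := R_NormedModule)).
      + apply (is_derive_plus (K := R_AbsRing) (V := R_NormedModule)); trivial.
        assert (N : INR (S n) <> 0) by (apply not_0_INR; lia).
        apply (is_derive_ext (fun y => / INR (S n) * y ^ S n)). intros t; change (/ INR (S n) * t ^ S n = t ^ S n / INR (S n))%R; field; trivial.
        replace (y ^ n)%R with (/ INR (S n) * (INR (S n) * 1 * y ^ pred (S n)))%R by (cbn [pred]; field; trivial).
        apply (is_derive_scal (fun y => y ^ S n)). apply (is_derive_pow (fun y => y)). apply (is_derive_id (K := R_AbsRing)).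
    - auto_derive. lra. field. lra. }
  destruct (MVT_gen f 0 x f') as [c [Hc E]].
  - intros y. rewrite Rmin_left, Rmax_right by lra. intros Hy. apply D. lra.
  - intros y. rewrite Rmin_left, Rmax_right by lra. intros Hy.
    apply derivable_continuous_pt. exists (f' y). apply is_derive_Reals. now apply D.
  - rewrite Rmin_left, Rmax_right in Hc by lra.
    assert (F0 : f 0 = 0).
    { unfold f. rewrite Rminus_0_r, ln_1, Rplus_0_r. clear. induction n as [|n IHn]; cbn [rsum]. trivial.
      rewrite IHn, pow_i by lia. unfold Rdiv. ring. }
    change (Rabs (f x) <= x ^ n / (1 - x)). replace (f x) with (f' c * x)%R by lra.
    assert (Ef : f' c = - (c ^ n / (1 - c))).
    { unfold f'. assert (G : rsum (fun k => c ^ k) n * (1 - c) = 1 - c ^ n).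
      { clear. induction n; simpl. ring. rewrite Rmult_plus_distr_r, IHn. ring. }
      apply Rmult_eq_reg_r with (1 - c)%R; [|lra]. rewrite Rmult_minus_distr_r, G, Rinv_l by lra. field. lra. }
    rewrite Ef, Rabs_mult, Rabs_Ropp, (Rabs_pos_eq x) by lra.
    assert (0 <= c ^ n <= x ^ n) by (split; [apply pow_le|apply pow_incr]; lra).
    rewrite Rabs_pos_eq by (apply Rdiv_le_0_compat; lra).
    assert (c ^ n / (1 - c) <= x ^ n / (1 - x)).
    { unfold Rdiv. apply Rmult_le_compat; try lra. left; apply Rinv_0_lt_compat; lra.
      apply Rinv_le_contravar; lra. }
    assert (0 <= c ^ n / (1 - c)) by (apply Rdiv_le_0_compat; lra). nra.
Qed.

Lemma rsum_sum_n (u : nat -> R) (n : nat) : rsum u (S n) = sum_n u n.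
Proof.
  induction n. simpl. rewrite sum_O. ring. rewrite sum_Sn, <- IHn. reflexivity.
Qed.

Lemma is_series_rsum (u : nat -> R) (l : R) : is_lim_seq (rsum u) l -> is_series u l.
Proof.
  intros H. apply is_lim_seq_incr_1 in H. apply (is_lim_seq_ext _ (sum_n u)) in H. exact H.
  intros n. apply rsum_sum_n.
Qed.

Lemma rsum_is_lim (u : nat -> R) (l : R) : is_series u l -> is_lim_seq (rsum u) l.
Proof.
  intros H. apply is_lim_seq_incr_1. apply (is_lim_seq_ext (sum_n u)).
  intros n. symmetry. apply rsum_sum_n. exact H.
Qed.

Lemma is_series_ln (x : R) : 0 < x < 1 -> is_series (fun n => / INR (S n) * x ^ n) (- ln (1 - x) / x).
Proof.
  intros Hx.
  assert (H : is_series (fun k => x ^ S k / INR (S k)) (- ln (1 - x))).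
  { apply is_series_rsum. apply is_lim_seq_spec. intros e.
    destruct (pow_lt_1_zero x ltac:(rewrite Rabs_pos_eq; lra) (e * (1 - x))%R) as [N HN].
    { apply Rmult_lt_0_compat; [apply cond_pos|lra]. }
    exists N. intros n Hn. specialize (HN n Hn). rewrite Rabs_pos_eq in HN by (apply pow_le; lra).
    unfold Rminus. rewrite Ropp_involutive. eapply Rle_lt_trans. apply ln_partial_sum. lra.
    apply Rmult_lt_reg_r with (1 - x)%R. lra. unfold Rdiv. rewrite Rmult_assoc, Rinv_l by lra. lra. }
  apply (is_series_scal_l (/ x)) in H.
  replace (- ln (1 - x) / x)%R with (/ x * - ln (1 - x))%R by (field; lra).
  revert H. apply is_series_ext. intros n. unfold scal; simpl; unfold mult; simpl. field.
  split; [|lra]. apply (not_0_INR (S n)). lia.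
Qed.

(** For n >= 2 this is ((n - 1)^2 / (n + 1))^2 / (n - 1): the squared factor in [m_coef (icoef 0 b)]
    over the weight of the area theorem. The value -1 at n = 0 absorbs the right-hand side, so the
    equation for r3 reads wsum (r^2) = 0. *)
Definition wcoef (n : nat) : R := (INR n - 1) ^ 3 / (INR n + 1) ^ 2.

Definition wsum (x : R) : R := Series (fun n => wcoef n * x ^ n).

Lemma wcoef_0 : wcoef 0 = -1.
Proof. unfold wcoef. simpl. field. Qed.

Lemma wcoef_nonneg (n : nat) : (1 <= n)%nat -> 0 <= wcoef n.
Proof.
  intros Hn. apply le_INR in Hn. simpl in Hn. unfold wcoef. apply Rdiv_le_0_compat.
  apply pow_le; lra. apply pow_lt; lra.
Qed.

Lemma wcoef_le (n : nat) : wcoef n <= INR n.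
Proof.
  pose proof (pos_INR n). unfold wcoef. apply Rmult_le_reg_r with ((INR n + 1) ^ 2)%R. apply pow_lt; lra.
  unfold Rdiv. rewrite Rmult_assoc, Rinv_l by (apply pow_nonzero; lra). nra.
Qed.

Definition cwcoef (n : nat) : C := RtoC (wcoef n).

Lemma conv_D_one : conv_D (fun _ => 1%C).
Proof.
  intros r Hr. exists 1. intros n. rewrite Cmod_1, Rmult_1_l. rewrite <- (pow1 n). apply pow_incr. lra.
Qed.

Lemma conv_D_cwcoef : conv_D cwcoef.
Proof.
  apply (conv_D_le (fun n => RtoC (INR n) * 1 + 1)%C _ 1).
  - apply conv_D_plus; [|apply conv_D_one]. apply conv_D_nmul, conv_D_one.
  - intros n. rewrite Rmult_1_l. unfold cwcoef. rewrite Cmult_1_r, <- RtoC_plus, !Cmod_R.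
    pose proof (pos_INR n). rewrite (Rabs_pos_eq (INR n + 1)) by lra. destruct n.
    rewrite wcoef_0, Rabs_left by lra. simpl. lra.
    rewrite Rabs_pos_eq by (apply wcoef_nonneg; lia). pose proof (wcoef_le (S n)). lra.
Qed.

Lemma ps_real (c : nat -> R) (x : R) :
  ps (fun n => RtoC (c n)) (RtoC x) = RtoC (Series (fun n => c n * x ^ n)).
Proof.
  unfold ps, cseries. transitivity ((Series (fun n => c n * x ^ n), 0) : C); [|reflexivity]. f_equal.
  - apply Series_ext. intros n. rewrite <- RtoC_pow. simpl. ring.
  - rewrite (Series_ext _ (fun n => 0 * 0)).
    rewrite Series_scal_l. ring. intros n. rewrite <- RtoC_pow. simpl. ring.
Qed.

Lemma is_series_conv_D (c : nat -> R) (x : R) : conv_D (fun n => RtoC (c n)) -> Rabs x < 1 ->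
  is_series (fun n => c n * x ^ n) (Series (fun n => c n * x ^ n)).
Proof.
  intros Hc Hx. apply Series_correct.
  destruct (conv_D_geom _ (Rabs x) Hc) as [M [q [Hq [HM H]]]]. split; trivial. apply Rabs_pos.
  apply (ex_series_le (K := R_AbsRing) (V := R_CompleteNormedModule) _ (fun n => M * q ^ n)%R).
  - intros n. specialize (H (RtoC x)). rewrite Cmod_R in H. specialize (H (Rle_refl _) n).
    rewrite <- RtoC_pow, <- RtoC_mult, Cmod_R in H. exact H.
  - apply (ex_series_scal_l (V := R_NormedModule) M (fun n => q ^ n)). apply ex_series_geom. rewrite Rabs_pos_eq; lra.
Qed.

Lemma is_series_wsum (x : R) : 0 <= x < 1 -> is_series (fun n => wcoef n * x ^ n) (wsum x).
Proof. intros Hx. apply (is_series_conv_D wcoef). apply conv_D_cwcoef. rewrite Rabs_pos_eq; lra. Qed.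

Lemma ps_one (z : C) : Cmod z < 1 -> ps (fun _ => 1%C) z = (/ (1 - z))%C.
Proof.
  intros Hz. pose proof (ps_shift _ z conv_D_one Hz) as E.
  assert (N : (1 - z)%C <> 0%C).
  { apply Cminus_neq_0. intros <-. rewrite Cmod_1 in Hz. lra. }
  set (X := ps (fun _ => 1%C) z) in *.
  replace X with (X * (1 - z) * / (1 - z))%C by (field; trivial).
  replace (X * (1 - z))%C with (X - z * X)%C by ring. rewrite E at 1. field. trivial.
Qed.

Lemma ps_succ (z : C) : Cmod z < 1 -> ps (dcoef (fun _ => 1%C)) z = (/ ((1 - z) * (1 - z)))%C.
Proof.
  intros Hz.
  assert (N : (1 - z)%C <> 0%C).
  { apply Cminus_neq_0. intros <-. rewrite Cmod_1 in Hz. lra. }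
  apply (cderiv_unique (ps (fun _ => 1%C)) z). apply cderiv_ps; trivial. apply conv_D_one.
  replace (/ ((1 - z) * (1 - z)))%C with (- (0 - 1) / ((1 - z) * (1 - z)))%C by (field; trivial).
  apply (cderiv_ext_loc (fun w => / (1 - w))%C _ z _ (1 - Cmod z)). lra.
  - intros w Hw. symmetry. apply ps_one. now apply (Cmod_near z).
  - apply (cderiv_inv (fun w => 1 - w)%C); trivial. apply cderiv_minus. apply cderiv_const. apply cderiv_id.
Qed.

Lemma Series_dilog (x : R) : 0 < x ->
  Series (fun n => / INR (S n) ^ 2 * x ^ n) = Li2 x / x.
Proof.
  intros Hx. unfold Li2. rewrite <- (Rmult_1_l (Series _)). rewrite <- (Rinv_l x) by lra.
  rewrite Rmult_assoc, <- Series_scal_l. unfold Rdiv. rewrite Rmult_comm. f_equal.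
  apply Series_ext. intros n. simpl pow. field. apply (not_0_INR (S n)). lia.
Qed.

Lemma wsum_closed_form (x : R) : 0 < x < 1 ->
  wsum x = (-4 + 4 * x + x ^ 2) / (1 - x) ^ 2 - 12 / x * ln (1 - x) - 8 / x * Li2 x - 1.
Proof.
  intros Hx.
  assert (Hz : Cmod (RtoC x) < 1) by (rewrite Cmod_R, Rabs_pos_eq; lra).
  pose proof conv_D_one as C1. pose proof (conv_D_dcoef _ C1) as Cd.
  assert (C2 : conv_D (fun n => RtoC (/ INR (S n)))).
  { apply (conv_D_le _ _ 1 C1). intros n. rewrite Cmod_1, Cmod_R, Rabs_pos_eq.
    rewrite S_INR. pose proof (pos_INR n). rewrite Rmult_1_l, <- Rinv_1. apply Rinv_le_contravar; lra.
    left. apply Rinv_0_lt_compat, lt_0_INR. lia. }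
  assert (C3 : conv_D (fun n => RtoC (/ INR (S n) ^ 2))).
  { apply (conv_D_le _ _ 1 C2). intros n. rewrite !Cmod_R, <- pow_inv, <- RPow_abs.
    assert (P : 0 < INR (S n)) by (apply lt_0_INR; lia).
    rewrite Rabs_pos_eq by (left; now apply Rinv_0_lt_compat).
    assert (/ INR (S n) <= 1).
    { rewrite <- Rinv_1. apply Rinv_le_contravar. lra. rewrite S_INR. pose proof (pos_INR n). lra. }
    pose proof (Rinv_0_lt_compat _ P). nra. }
  apply RtoC_inj. unfold wsum. rewrite <- ps_real.
  (* Partial fractions in m = n + 1: (m - 2)^3 / m^2 = m - 6 + 12 / m - 8 / m^2. The pieces are two
     rational series, the logarithm and the dilogarithm. *)
  rewrite (ps_ext _ (fun n => dcoef (fun _ => 1) n + (- (6)) * 1 + 12 * RtoC (/ INR (S n)) + (-(8)) * RtoC (/ INR (S n) ^ 2))%C).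
  2: { intros n. unfold dcoef, wcoef. rewrite Cmult_1_r, <- !RtoC_opp, <- !RtoC_mult, <- !RtoC_plus. f_equal.
       rewrite S_INR. pose proof (pos_INR n). field. lra. }
  rewrite !ps_plus, !ps_scal by (trivial; repeat (apply conv_D_plus || apply conv_D_scal); trivial).
  rewrite ps_succ, ps_one by trivial. rewrite !ps_real, Series_dilog by lra.
  rewrite (is_series_unique _ _ (is_series_ln x Hx)).
  rewrite <- !RtoC_minus, <- !RtoC_mult, <- !RtoC_inv, <- !RtoC_opp, <- !RtoC_mult, <- !RtoC_plus by nra.
  f_equal. field. lra.
Qed.

Lemma r3_equation_wsum (r : R) : 0 < r < 1 -> (r3_equation r <-> wsum (r ^ 2) = 0).
Proof.
  intros Hr. unfold r3_equation. rewrite wsum_closed_form.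
  replace ((r ^ 2) ^ 2)%R with (r ^ 4)%R by ring. reflexivity.
  simpl. nra.
Qed.

Lemma is_lim_seq_le_from (u : nat -> R) (l M : R) (N : nat) : is_lim_seq u l ->
  (forall n, (N <= n)%nat -> u n <= M) -> l <= M.
Proof.
  intros H HM.
  assert (E : Rbar_le l M).
  { apply (is_lim_seq_le_loc u (fun _ => M)); trivial. now exists N. apply is_lim_seq_const. }
  exact E.
Qed.

Lemma is_lim_seq_ge_from (u : nat -> R) (l M : R) (N : nat) : is_lim_seq u l ->
  (forall n, (N <= n)%nat -> M <= u n) -> M <= l.
Proof.
  intros H HM.
  assert (E : Rbar_le M l).
  { apply (is_lim_seq_le_loc (fun _ => M) u); trivial. now exists N. apply is_lim_seq_const. }
  exact E.
Qed.

Lemma wsum_partial_le (x : R) (N : nat) : 0 <= x < 1 -> (1 <= N)%nat ->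
  rsum (fun n => wcoef n * x ^ n) N <= wsum x.
Proof.
  intros Hx HN. apply (is_lim_seq_ge_from _ _ _ N (rsum_is_lim _ _ (is_series_wsum x Hx))).
  intros n Hn. induction Hn. lra. simpl.
  pose proof (wcoef_nonneg m ltac:(lia)). pose proof (pow_le x m ltac:(lra)). nra.
Qed.

(** As wcoef n <= n, the tail is at most the sum of n x^n over n >= N; its closed form [B] is
    verified by telescoping. *)
Lemma wsum_le_partial (x : R) (N : nat) : 0 <= x < 1 ->
  wsum x <= rsum (fun n => wcoef n * x ^ n) N + x ^ N * (INR N * (1 - x) + x) / (1 - x) ^ 2.
Proof.
  intros Hx. set (B := fun n => x ^ n * (INR n * (1 - x) + x) / (1 - x) ^ 2).
  assert (HB : forall n, 0 <= B n).
  { intros n. unfold B. apply Rdiv_le_0_compat; [|apply pow_lt; lra].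
    apply Rmult_le_pos. apply pow_le; lra. pose proof (pos_INR n). nra. }
  apply (is_lim_seq_le_from _ _ _ N (rsum_is_lim _ _ (is_series_wsum x Hx))).
  assert (M : forall n, (N <= n)%nat -> rsum (fun n => wcoef n * x ^ n) n + B n
     <= rsum (fun n => wcoef n * x ^ n) N + B N).
  { intros n Hn. induction Hn. lra. eapply Rle_trans; [|exact IHHn]. simpl rsum.
    assert (E : B m - B (S m) = INR m * x ^ m).
    { unfold B. rewrite S_INR. simpl. field. lra. }
    pose proof (wcoef_le m). pose proof (pow_le x m ltac:(lra)).
    assert (wcoef m * x ^ m <= INR m * x ^ m) by now apply Rmult_le_compat_r. lra. }
  intros n Hn. specialize (M n Hn). specialize (HB n). unfold B in *. lra.
Qed.

Lemma wsum_increasing (x y : R) : 0 <= x -> x < y -> y < 1 -> wsum x < wsum y.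
Proof.
  intros H0 Hxy H1.
  (* The terms n = 0 and n = 1 do not depend on x; n = 2 is the first that increases strictly, and
     the later ones do not decrease. *)
  assert (P : wcoef 2 * (y ^ 2 - x ^ 2) <= wsum y - wsum x).
  { pose proof (is_series_minus _ _ _ _ (is_series_wsum y ltac:(lra)) (is_series_wsum x ltac:(lra))) as D.
    apply rsum_is_lim in D.
    change (is_lim_seq (rsum (fun n => wcoef n * y ^ n + - (wcoef n * x ^ n))) (wsum y - wsum x)) in D.
    apply (is_lim_seq_ge_from _ _ _ 3%nat D).
    intros n Hn. induction Hn.
    - cbn [rsum]. rewrite wcoef_0. unfold wcoef; simpl. right. field.
    - simpl rsum. pose proof (wcoef_nonneg m ltac:(lia)). pose proof (pow_incr x y m ltac:(lra)).
      nra. }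
  assert (0 < wcoef 2) by (unfold wcoef; simpl; lra).
  assert (0 < y ^ 2 - x ^ 2) by nra. nra.
Qed.

(** 0.6129 and 0.613 lie strictly between the squares of 0.78285 and 0.78295, so a sign change
    between them locates r3 to four decimals. *)
Lemma wsum_lower : wsum (6129 / 10000) < 0.
Proof.
  eapply Rle_lt_trans. apply (wsum_le_partial _ 30). lra.
  unfold wcoef. cbn [rsum]. rewrite !INR_IZR_INZ. cbn -[IZR pow Rmult]. lra.
Qed.

(** From below no tail estimate is needed, all terms from n = 1 on being nonnegative. *)
Lemma wsum_upper : 0 < wsum (613 / 1000).
Proof.
  eapply Rlt_le_trans; [|apply (wsum_partial_le _ 28); [lra|lia]].
  unfold wcoef. cbn [rsum]. rewrite !INR_IZR_INZ. cbn -[IZR pow Rmult]. lra.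
Qed.

Lemma continuity_wsum (x : R) : 0 <= x < 1 -> continuity_pt wsum x.
Proof.
  intros Hx.
  assert (H : rcont (fun t => ps cwcoef (RtoC t)) x).
  { apply (rcont_comp (ps cwcoef) RtoC). apply (rderiv_rcont _ _ 1), rderiv_RtoC_id.
    apply ccont_ps. apply conv_D_cwcoef. rewrite Cmod_R, Rabs_pos_eq; lra. }
  apply rcont_fst in H. revert H. apply continuity_pt_ext.
  intros t. unfold cwcoef. rewrite ps_real. reflexivity.
Qed.

Theorem r3_exists : exists r3 : R,
  unique (fun r : R => 0 < r < 1 /\ r3_equation r) r3 /\
  Rabs (r3 - 7829 / 10000) < 5 / 100000 /\ 0 < r3 < 7830 / 10000 /\ wsum (r3 ^ 2) = 0.
Proof.
  pose proof wsum_lower as L. pose proof wsum_upper as U.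
  destruct (IVT_Rbar_incr wsum (6129 / 10000) (613 / 1000) (wsum (6129 / 10000)) (wsum (613 / 1000)) 0) as [x [X1 [X2 X3]]].
  - apply is_lim_continuity, continuity_wsum. lra.
  - apply is_lim_continuity, continuity_wsum. lra.
  - intros t T1 T2. simpl in T1, T2. apply continuity_wsum. lra.
  - simpl. lra.
  - simpl. lra.
  - simpl in X1, X2.
    assert (Hs : sqrt x ^ 2 = x) by (apply pow2_sqrt; lra).
    assert (S1 : 78285 / 100000 < sqrt x).
    { rewrite <- (sqrt_pow2 (78285 / 100000)) by lra. apply sqrt_lt_1_alt. simpl. lra. }
    assert (S2 : sqrt x < 78295 / 100000).
    { rewrite <- (sqrt_pow2 (78295 / 100000)) by lra. apply sqrt_lt_1_alt. simpl. lra. }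
    exists (sqrt x). repeat split; try lra.
    + apply r3_equation_wsum. lra. now rewrite Hs.
    + intros r [Hr Er]. apply r3_equation_wsum in Er; trivial.
      assert (R1 : 0 <= r ^ 2 < 1) by (simpl; nra).
      destruct (Rtotal_order (sqrt x ^ 2) (r ^ 2)) as [T|[T|T]].
      * apply wsum_increasing in T; try lra. rewrite Hs, X3, Er in T. lra.
      * rewrite <- (sqrt_pow2 r), <- T, Hs by lra. reflexivity.
      * apply wsum_increasing in T; try lra. rewrite Hs, X3, Er in T. lra.
    + apply Rabs_def1; lra.
    + now rewrite Hs.
Qed.

(** * Double circular means *)

Lemma rcont2_iff (K : R -> R -> C) (x y : R) :
  rcont2 K x y <-> ccont (fun w => K (fst w) (snd w)) (x, y).
Proof.
  split; intros H e He; destruct (H e He) as [d [Hd D]].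
  - exists d. split; trivial. intros [u v] Hw. simpl. apply D.
    + eapply Rle_lt_trans; [|exact Hw]. apply (re_le_Cmod ((u, v) - (x, y))).
    + eapply Rle_lt_trans; [|exact Hw]. apply (Rabs_snd_Cmod ((u, v) - (x, y))).
  - exists (d / 2)%R. split. lra. intros u v Hu Hv. apply (D (u, v)).
    replace ((u, v) - (x, y))%C with (RtoC (u - x) + Ci * RtoC (v - y))%C.
    2: { unfold Cminus, RtoC, Ci, Cmult, Cplus, Copp; simpl. f_equal; ring. }
    eapply Rle_lt_trans. apply Cmod_triangle. rewrite Cmod_mult, Cmod_Ci, !Cmod_R. lra.
Qed.

Definition pcont2 (K : R -> R -> C) : Prop :=
  forall x y, 0 <= x <= 2 * PI -> 0 <= y <= 2 * PI -> rcont2 K x y.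

Lemma pcont2_const (c : C) : pcont2 (fun _ _ => c).
Proof. intros x y _ _. apply rcont2_iff. apply ccont_const. Qed.

Lemma pcont2_plus (K L : R -> R -> C) : pcont2 K -> pcont2 L -> pcont2 (fun x y => K x y + L x y)%C.
Proof.
  intros HK HL x y Hx Hy. apply rcont2_iff.
  apply (ccont_plus (fun w => K (fst w) (snd w)) (fun w => L (fst w) (snd w))); apply rcont2_iff; auto.
Qed.

Lemma pcont2_mult (K L : R -> R -> C) : pcont2 K -> pcont2 L -> pcont2 (fun x y => K x y * L x y)%C.
Proof.
  intros HK HL x y Hx Hy. apply rcont2_iff.
  apply (ccont_mult (fun w => K (fst w) (snd w)) (fun w => L (fst w) (snd w))); apply rcont2_iff; auto.
Qed.

Lemma pcont2_comp (f : C -> C) (K : R -> R -> C) : pcont2 K ->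
  (forall x y, 0 <= x <= 2 * PI -> 0 <= y <= 2 * PI -> ccont f (K x y)) ->
  pcont2 (fun x y => f (K x y)).
Proof.
  intros HK Hf x y Hx Hy. apply rcont2_iff.
  apply (ccont_comp (fun w => K (fst w) (snd w)) f). apply rcont2_iff; auto. simpl. auto.
Qed.

Lemma pcont2_inv (K : R -> R -> C) : pcont2 K ->
  (forall x y, 0 <= x <= 2 * PI -> 0 <= y <= 2 * PI -> K x y <> 0%C) ->
  pcont2 (fun x y => / K x y)%C.
Proof.
  intros HK HN. apply (pcont2_comp (fun w => / w)%C); trivial.
  intros x y Hx Hy. apply (ccont_inv (fun w => w)). apply ccont_id. auto.
Qed.

Lemma pcont2_ext (K L : R -> R -> C) : (forall x y, K x y = L x y) -> pcont2 K -> pcont2 L.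
Proof.
  intros E HK x y Hx Hy e He. destruct (HK x y Hx Hy e He) as [d [Hd D]].
  exists d. split; trivial. intros u v Hu Hv. rewrite <- !E. now apply D.
Qed.

Lemma ccont_conj (z : C) : ccont Cconj z.
Proof.
  intros e He. exists e. split; trivial. intros w Hw. now rewrite <- Cminus_conj, Cmod_conj.
Qed.

Lemma pcont2_conj (K : R -> R -> C) : pcont2 K -> pcont2 (fun x y => Cconj (K x y)).
Proof. intros HK. apply (pcont2_comp Cconj); trivial. intros; apply ccont_conj. Qed.

Lemma pcont2_opp (K : R -> R -> C) : pcont2 K -> pcont2 (fun x y => - K x y)%C.
Proof.
  intros HK. apply (pcont2_ext (fun x y => - (1) * K x y)%C). intros; ring.
  apply pcont2_mult; trivial. apply pcont2_const.
Qed.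

Lemma pcont2_l (h : R -> C) : pcont h -> pcont2 (fun x _ => h x).
Proof.
  intros H x y Hx Hy e He. destruct (proj1 (rcont_iff _ _) (H x Hx) e He) as [d [Hd D]].
  exists d. split; trivial. intros; now apply D.
Qed.

Lemma pcont2_r (h : R -> C) : pcont h -> pcont2 (fun _ y => h y).
Proof.
  intros H x y Hx Hy e He. destruct (proj1 (rcont_iff _ _) (H y Hy) e He) as [d [Hd D]].
  exists d. split; trivial. intros; now apply D.
Qed.

Lemma ccont_RtoC_fun (g : R -> R) (z : C) : continuity_pt g (fst z) ->
  ccont (fun w => RtoC (g (fst w))) z.
Proof.
  intros H e He. destruct (proj1 (rcont_iff _ _) (rcont_RtoC g (fst z) H) e He) as [d [Hd D]].
  exists d. split; trivial. intros w Hw. apply D. eapply Rle_lt_trans; [|exact Hw].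
  apply (re_le_Cmod (w - z)).
Qed.

Lemma pcont2_ln (u : R -> R -> R) : pcont2 (fun x y => RtoC (u x y)) ->
  (forall x y, 0 <= x <= 2 * PI -> 0 <= y <= 2 * PI -> 0 < u x y) ->
  pcont2 (fun x y => RtoC (ln (u x y))).
Proof.
  intros Hu Hp. apply (pcont2_comp (fun w => RtoC (ln (fst w))) (fun x y => RtoC (u x y))); trivial.
  intros x y Hx Hy. apply (ccont_RtoC_fun ln). simpl. apply derivable_continuous_pt.
  eexists. apply derivable_pt_lim_ln. auto.
Qed.

Lemma pcont_slice (K : R -> R -> C) (x : R) : 0 <= x <= 2 * PI -> pcont2 K -> pcont (K x).
Proof. intros Hx HK y Hy. apply rcont2_slice. auto. Qed.

Lemma pcont_slice_l (K : R -> R -> C) (y : R) : 0 <= y <= 2 * PI -> pcont2 K -> pcont (fun x => K x y).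
Proof. intros Hy HK x Hx. apply rcont2_slice_l. auto. Qed.

Lemma pcont2_swap (K : R -> R -> C) : pcont2 K -> pcont2 (fun x y => K y x).
Proof.
  intros HK x y Hx Hy e He. destruct (HK y x Hy Hx e He) as [d [Hd D]].
  exists d. split; trivial. intros; now apply D.
Qed.

(* Continuity only relative to the square, which is what uniform continuity yields at its edges. *)
Lemma pcont2_bounded (K : R -> R -> C) : pcont2 K ->
  exists M, 0 <= M /\ forall x y, 0 <= x <= 2 * PI -> 0 <= y <= 2 * PI -> Cmod (K x y) <= M.
Proof.
  intros HK. pose proof two_PI_pos.
  destruct (rcont2_uniform K 0 (2 * PI) 0 (2 * PI) HK 1 Rlt_0_1) as [d [Hd D]].
  assert (B : forall n x y, 0 <= x <= 2 * PI -> 0 <= y <= 2 * PI ->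
    x <= INR n * (d / 2) -> y <= INR n * (d / 2) -> Cmod (K x y) <= Cmod (K 0 0) + INR n).
  { induction n; intros x y Hx Hy Lx Ly.
    - simpl in Lx, Ly. assert (x = 0) as -> by lra. assert (y = 0) as -> by lra. simpl. lra.
    - rewrite S_INR in *.
      assert (HD : forall s, 0 <= s <= 2 * PI -> s <= (INR n + 1) * (d / 2) ->
        exists s', 0 <= s' <= 2 * PI /\ s' <= INR n * (d / 2) /\ Rabs (s - s') < d).
      { intros s Hs Ls. pose proof (pos_INR n). destruct (Rle_dec s (d / 2)).
        - exists 0. repeat split; try lra. apply Rmult_le_pos; lra. rewrite Rabs_pos_eq; lra.
        - exists (s - d / 2)%R. repeat split; try lra.
          replace (s - (s - d / 2))%R with (d / 2)%R by ring. rewrite Rabs_pos_eq; lra. }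
      destruct (HD x Hx Lx) as [x' [X1 [X2 X3]]]. destruct (HD y Hy Ly) as [y' [Y1 [Y2 Y3]]].
      specialize (IHn x' y' X1 Y1 X2 Y2). specialize (D x' y' x y X1 Y1 Hx Hy X3 Y3).
      replace (K x y) with (K x' y' + (K x y - K x' y'))%C by ring.
      eapply Rle_trans. apply Cmod_triangle. lra. }
  destruct (archimed_cor1 (d / 2 / (2 * PI))) as [n [Hn Hn0]].
  { apply Rdiv_lt_0_compat; lra. }
  exists (Cmod (K 0 0) + INR n). split. pose proof (Cmod_ge_0 (K 0 0)). pose proof (pos_INR n). lra.
  assert (L : 2 * PI <= INR n * (d / 2)).
  { assert (P : 0 < INR n) by now apply lt_0_INR.
    apply Rmult_lt_compat_l with (r := (INR n * (2 * PI))%R) in Hn; [|now apply Rmult_lt_0_compat].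
    replace (INR n * (2 * PI) * / INR n)%R with (2 * PI)%R in Hn by (field; lra).
    replace (INR n * (2 * PI) * (d / 2 / (2 * PI)))%R with (INR n * (d / 2))%R in Hn by (field; apply PI_neq0). lra. }
  intros x y Hx Hy. apply B; trivial; lra.
Qed.

Lemma rcont_on_cint (K : R -> R -> C) (a b : R) : 0 <= a <= b -> b <= 2 * PI -> pcont2 K ->
  forall h, 0 < h -> exists d, 0 < d /\ forall x y, 0 <= x <= 2 * PI -> 0 <= y <= 2 * PI ->
    Rabs (y - x) < d -> Cmod (cint (K y) a b - cint (K x) a b) <= h * (b - a).
Proof.
  intros Ha Hb HK h Hh.
  destruct (rcont2_uniform K 0 (2 * PI) 0 (2 * PI) HK h Hh) as [d [Hd D]].
  exists d. split; trivial. intros x y Hx Hy Hxy.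
  assert (P : forall x, 0 <= x <= 2 * PI -> rcont_on (K x) a b).
  { intros u Hu t Ht. apply rcont2_slice. apply HK; lra. }
  rewrite <- cint_minus by (auto; lra). apply cint_bound. lra.
  - intros t Ht. apply rcont_minus; apply P; trivial.
  - intros t Ht. left. apply D; trivial; try lra. rewrite Rminus_diag, Rabs_R0. trivial.
Qed.

(* Extends a function from [0, 2 pi] to the line by its boundary values, so that continuity at
   the end points makes sense two-sidedly. *)
Definition clamp (x : R) : R := Rmax 0 (Rmin x (2 * PI)).

Lemma clamp_id (x : R) : 0 <= x <= 2 * PI -> clamp x = x.
Proof. intros H. unfold clamp. rewrite Rmin_left, Rmax_right; lra. Qed.

Lemma clamp_range (x : R) : 0 <= clamp x <= 2 * PI.
Proof.
  pose proof two_PI_pos. unfold clamp. split. apply Rmax_l. apply Rmax_lub. lra. apply Rmin_r.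
Qed.

Lemma clamp_lip (x y : R) : Rabs (clamp x - clamp y) <= Rabs (x - y).
Proof.
  unfold clamp, Rmax, Rmin.
  repeat destruct Rle_dec; apply Rabs_le; split_Rabs; lra.
Qed.

Lemma rcont_clamp_cint (K : R -> R -> C) (a b t : R) : 0 <= a <= b -> b <= 2 * PI -> pcont2 K ->
  rcont (fun x => cint (K (clamp x)) a b) t.
Proof.
  intros Ha Hb HK. apply rcont_iff. intros e He.
  destruct (rcont_on_cint K a b Ha Hb HK (e / (2 * (b - a + 1)))%R) as [d [Hd D]].
  { apply Rdiv_lt_0_compat; lra. }
  exists d. split; trivial. intros s Hs.
  eapply Rle_lt_trans. apply D; try apply clamp_range. eapply Rle_lt_trans. apply clamp_lip. trivial.
  apply Rmult_lt_reg_r with (2 * (b - a + 1))%R. lra.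
  replace (e / (2 * (b - a + 1)) * (b - a) * (2 * (b - a + 1)))%R with (e * (b - a))%R by (field; lra). nra.
Qed.

Definition dmean (K : R -> R -> C) : C := cmean (fun x => cmean (K x)).

Lemma dmean_ext (K L : R -> R -> C) :
  (forall x y, 0 <= x <= 2 * PI -> 0 <= y <= 2 * PI -> K x y = L x y) -> dmean K = dmean L.
Proof. intros H. apply cmean_ext. intros x Hx. apply cmean_ext. auto. Qed.

Lemma pcont_clamp_cmean (K : R -> R -> C) : pcont2 K -> pcont (fun x => cmean (K (clamp x))).
Proof.
  intros HK t Ht. unfold cmean.
  apply (rcont_mult (fun _ => RtoC (/ (2 * PI))) (fun x => cint (K (clamp x)) 0 (2 * PI))).
  apply rcont_const. apply rcont_clamp_cint; trivial; lra.
Qed.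

Lemma dmean_clamp (K : R -> R -> C) : dmean K = cmean (fun x => cmean (K (clamp x))).
Proof. apply cmean_ext. intros t Ht. now rewrite clamp_id. Qed.

Lemma dmean_plus (K L : R -> R -> C) : pcont2 K -> pcont2 L ->
  dmean (fun x y => K x y + L x y)%C = (dmean K + dmean L)%C.
Proof.
  intros HK HL. rewrite !dmean_clamp, <- cmean_plus by now apply pcont_clamp_cmean.
  apply cmean_ext. intros t Ht. apply cmean_plus; apply pcont_slice; trivial; apply clamp_range.
Qed.

Lemma dmean_scal (c : C) (K : R -> R -> C) : pcont2 K ->
  dmean (fun x y => c * K x y)%C = (c * dmean K)%C.
Proof.
  intros HK. rewrite !dmean_clamp, <- cmean_scal by now apply pcont_clamp_cmean.
  apply cmean_ext. intros t Ht. apply cmean_scal; apply pcont_slice; trivial; apply clamp_range.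
Qed.

Lemma dmean_bound (K : R -> R -> C) (M : R) : pcont2 K ->
  (forall x y, 0 <= x <= 2 * PI -> 0 <= y <= 2 * PI -> Cmod (K x y) <= M) -> Cmod (dmean K) <= M.
Proof.
  intros HK HM. rewrite dmean_clamp. apply cmean_bound. now apply pcont_clamp_cmean.
  intros t Ht. apply cmean_bound. apply pcont_slice; trivial; apply clamp_range.
  intros s Hs. apply HM; trivial. apply clamp_range.
Qed.

Lemma dmean_prod (h k : R -> C) : pcont h -> pcont k ->
  dmean (fun x y => h x * k y)%C = (cmean h * cmean k)%C.
Proof.
  intros Hh Hk. unfold dmean.
  rewrite (cmean_ext _ (fun x => cmean k * h x)%C).
  - rewrite cmean_scal by trivial. ring.
  - intros t Ht. rewrite cmean_scal by trivial. ring.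
Qed.

(** Both iterated integrals over a thin strip are compared with b - a times the integral of [K a];
    uniform continuity makes each error at most e times the area of the strip. *)
Lemma fubini_cell (K : R -> R -> C) (a b d e : R) : pcont2 K -> 0 <= a <= b -> b <= 2 * PI -> 0 <= e ->
  b - a < d ->
  (forall x y u v, 0 <= x <= 2 * PI -> 0 <= y <= 2 * PI -> 0 <= u <= 2 * PI -> 0 <= v <= 2 * PI ->
      Rabs (u - x) < d -> Rabs (v - y) < d -> Cmod (K u v - K x y) < e) ->
  Cmod (cint (fun x => cint (K (clamp x)) 0 (2 * PI)) a b -
        cint (fun y => cint (fun x => K x (clamp y)) a b) 0 (2 * PI)) <= 2 * (e * (2 * PI) * (b - a)).
Proof.
  intros HK Ha Hb He Hd D.
  set (V := cint (K a) 0 (2 * PI)).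
  assert (Pa : forall x, 0 <= x <= 2 * PI -> rcont_on (K x) 0 (2 * PI)).
  { intros x Hx t Ht. apply rcont2_slice. now apply HK. }
  assert (Pl : forall y, 0 <= y <= 2 * PI -> rcont_on (fun x => K x y) a b).
  { intros y Hy t Ht. apply (rcont2_slice_l K). apply HK; trivial; lra. }
  assert (C1 : rcont_on (fun x => cint (K (clamp x)) 0 (2 * PI)) a b).
  { intros t Ht. apply rcont_clamp_cint; trivial; lra. }
  assert (C2 : rcont_on (fun y => cint (fun x => K x (clamp y)) a b) 0 (2 * PI)).
  { intros t Ht. apply (rcont_clamp_cint (fun y x => K x y)); trivial; try lra. now apply pcont2_swap. }
  assert (B1 : Cmod (cint (fun x => cint (K (clamp x)) 0 (2 * PI)) a b - RtoC (b - a) * V) <= e * (2 * PI) * (b - a)).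
  { rewrite <- cint_const, <- cint_minus; try lra; trivial; [|apply rcont_on_const].
    apply cint_bound. lra. intros t Ht. apply rcont_minus. now apply C1. apply rcont_const.
    intros t Ht. unfold V. rewrite clamp_id by lra. rewrite <- cint_minus by (try lra; apply Pa; lra).
    replace (e * (2 * PI))%R with (e * (2 * PI - 0))%R by ring.
    apply cint_bound. lra. intros s Hs. apply rcont_minus; apply Pa; lra.
    intros s Hs. left. apply D; try lra. rewrite Rabs_pos_eq; lra. rewrite Rminus_diag, Rabs_R0. lra. }
  assert (B2 : Cmod (cint (fun y => cint (fun x => K x (clamp y)) a b) 0 (2 * PI) - RtoC (b - a) * V) <= e * (2 * PI) * (b - a)).
  { unfold V. rewrite <- cint_scal by (try lra; apply Pa; lra).
    rewrite <- cint_minus; try lra; trivial.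
    2: { intros t Ht. apply rcont_mult. apply rcont_const. apply Pa; lra. }
    replace (e * (2 * PI) * (b - a))%R with (e * (b - a) * (2 * PI - 0))%R by ring.
    apply cint_bound. lra. intros t Ht. apply rcont_minus. now apply C2.
    apply rcont_mult. apply rcont_const. apply Pa; lra.
    intros t Ht. rewrite clamp_id by lra. rewrite <- cint_const, <- cint_minus; try lra; [|now apply Pl|apply rcont_on_const].
    apply cint_bound. lra. intros s Hs. apply rcont_minus. now apply Pl. apply rcont_const.
    intros s Hs. left. apply D; try lra. rewrite Rabs_pos_eq; lra. rewrite Rminus_diag, Rabs_R0. lra. }
  match goal with |- Cmod (?X - ?Y) <= _ =>
    replace (X - Y)%C with ((X - RtoC (b - a) * V) - (Y - RtoC (b - a) * V))%C by ring end.
  eapply Rle_trans. apply Cmod_triangle. rewrite Cmod_opp. lra.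
Qed.

(** The square is cut into n strips narrower than the modulus of continuity for [e']; the errors of
    [fubini_cell] add up to 2 e' (2 pi)^2 = e. *)
Theorem dmean_fubini (K : R -> R -> C) : pcont2 K -> dmean K = dmean (fun x y => K y x).
Proof.
  intros HK. pose proof two_PI_pos as HP.
  set (I1 := fun b => cint (fun x => cint (K (clamp x)) 0 (2 * PI)) 0 b).
  set (I2 := fun b => cint (fun y => cint (fun x => K x (clamp y)) 0 b) 0 (2 * PI)).
  assert (Main : I1 (2 * PI)%R = I2 (2 * PI)%R).
  { assert (X : (I1 (2 * PI)%R - I2 (2 * PI)%R = 0)%C).
    { apply Cmod_eq_0. apply Rle_antisym; [|apply Cmod_ge_0]. apply le_epsilon. intros e He.
      set (e' := (e / (2 * (2 * PI) * (2 * PI)))%R).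
      assert (He' : 0 < e').
      { apply Rdiv_lt_0_compat; trivial. apply Rmult_lt_0_compat; [apply Rmult_lt_0_compat|]; lra. }
      destruct (rcont2_uniform K 0 (2 * PI) 0 (2 * PI) HK e' He') as [d [Hd D]].
      destruct (archimed_cor1 (d / (2 * PI))) as [n [Hn Hn0]]. now apply Rdiv_lt_0_compat.
      assert (Pn : 0 < INR n) by now apply lt_0_INR.
      set (h := (2 * PI / INR n)%R).
      assert (Hh : 0 < h < d).
      { split. now apply Rdiv_lt_0_compat. unfold h, Rdiv.
        apply (Rmult_lt_compat_l (2 * PI)) in Hn; trivial.
        replace (2 * PI * (d / (2 * PI)))%R with d in Hn by (field; apply PI_neq0). trivial. }
      assert (St : forall k, (k <= n)%nat -> Cmod (I1 (INR k * h)%R - I2 (INR k * h)%R) <= 2 * (e' * (2 * PI) * (INR k * h))).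
      { induction k; intros Hk.
        - simpl INR. rewrite Rmult_0_l. unfold I1, I2.
          assert (Z : forall u : R -> C, cint u 0 0 = 0%C) by (intros u; apply (RInt_point (V := C_R_CompleteNormedModule))).
          rewrite Z. rewrite (cint_ext _ (fun _ => 0%C)) by (try lra; intros; apply Z).
          rewrite cint_const. replace (0 - RtoC (2 * PI - 0) * 0)%C with (RtoC 0) by ring. rewrite Cmod_0. lra.
        - specialize (IHk ltac:(lia)). rewrite S_INR.
          assert (Hk' : INR (S k) * h <= 2 * PI).
          { apply le_INR in Hk. unfold h. apply Rmult_le_reg_r with (INR n); trivial.
            replace (INR (S k) * (2 * PI / INR n) * INR n)%R with (INR (S k) * (2 * PI))%R by (field; lra). nra. }
          rewrite S_INR in Hk'. pose proof (pos_INR k) as Pk.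
          assert (P0 : 0 <= INR k * h) by (apply Rmult_le_pos; lra).
          set (a := (INR k * h)%R) in *. replace ((INR k + 1) * h)%R with (a + h)%R in * by (unfold a; ring).
          pose proof (fubini_cell K a (a + h) d e' HK ltac:(lra) Hk' ltac:(lra) ltac:(lra) D) as F.
          assert (E1 : I1 (a + h)%R = (I1 a + cint (fun x => cint (K (clamp x)) 0 (2 * PI)) a (a + h))%C).
          { unfold I1. rewrite cint_Chasles; trivial; try lra. intros t Ht. apply rcont_clamp_cint; trivial; lra. }
          assert (E2 : I2 (a + h)%R = (I2 a + cint (fun y => cint (fun x => K x (clamp y)) a (a + h)) 0 (2 * PI))%C).
          { unfold I2. rewrite <- cint_plus; try lra.
            - apply cint_ext. lra. intros t Ht. rewrite cint_Chasles; trivial; try lra.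
              intros s Hs. apply (rcont2_slice_l K). apply HK. lra. apply clamp_range.
            - intros t Ht. apply (rcont_clamp_cint (fun y x => K x y)); try lra. now apply pcont2_swap.
            - intros t Ht. apply (rcont_clamp_cint (fun y x => K x y)); try lra. now apply pcont2_swap. }
          rewrite E1, E2.
          match goal with |- Cmod (?A + ?B - (?A' + ?B')) <= _ =>
            replace (A + B - (A' + B'))%C with ((A - A') + (B - B'))%C by ring end.
          eapply Rle_trans. apply Cmod_triangle. replace (a + h - a)%R with h in F by ring. lra. }
      specialize (St n (le_n n)). replace (INR n * h)%R with (2 * PI)%R in St by (unfold h; field; lra).
      eapply Rle_trans. apply St. right. unfold e'. field. apply PI_neq0. }
    replace (I1 (2 * PI)%R) with (I1 (2 * PI)%R - I2 (2 * PI)%R + I2 (2 * PI)%R)%C by ring. rewrite X. ring. }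
  rewrite !dmean_clamp. unfold cmean.
  rewrite !cint_scal; try lra.
  - exact (f_equal (fun X => RtoC (/ (2 * PI)) * (RtoC (/ (2 * PI)) * X))%C Main).
  - intros t Ht. apply (rcont_clamp_cint (fun x y => K y x)); try lra. now apply pcont2_swap.
  - intros t Ht. apply rcont_clamp_cint; trivial; lra.
Qed.

(** * Conditional negativity of the logarithmic energy *)

(** The squared modulus of the inner product of the unit vectors along (1, w x) and (1, w y) in C^2.
    On the Riemann sphere of diameter 1, the squared chordal distance is 1 minus this. *)
Definition sphere_kernel (w : R -> C) (x y : R) : R :=
  Cmod (1 + w x * Cconj (w y)) ^ 2 / ((1 + Cmod (w x) ^ 2) * (1 + Cmod (w y) ^ 2)).

Lemma Cmod_pow2_pos (z : C) : 0 < 1 + Cmod z ^ 2.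
Proof. pose proof (pow2_ge_0 (Cmod z)). lra. Qed.

Lemma chordal_identity (a b : C) :
  (1 + Cmod a ^ 2) * (1 + Cmod b ^ 2) - Cmod (1 + a * Cconj b) ^ 2 = Cmod (a - b) ^ 2.
Proof. rewrite !Cmod2_alt. destruct a, b. simpl. ring. Qed.

Lemma sphere_kernel_range (w : R -> C) (x y : R) : 0 <= sphere_kernel w x y <= 1.
Proof.
  unfold sphere_kernel. pose proof (Cmod_pow2_pos (w x)). pose proof (Cmod_pow2_pos (w y)).
  assert (P : 0 < (1 + Cmod (w x) ^ 2) * (1 + Cmod (w y) ^ 2)) by now apply Rmult_lt_0_compat.
  split.
  - apply Rdiv_le_0_compat; trivial. apply pow2_ge_0.
  - apply Rmult_le_reg_r with (1 := P). unfold Rdiv. rewrite Rmult_assoc, Rinv_l by lra.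
    pose proof (chordal_identity (w x) (w y)). pose proof (pow2_ge_0 (Cmod (w x - w y))). lra.
Qed.

Definition bilin (c : R -> C) (K : R -> R -> C) : C :=
  dmean (fun x y => Cconj (c x) * c y * K x y)%C.

Lemma pcont2_bilin (c : R -> C) (K : R -> R -> C) : pcont c -> pcont2 K ->
  pcont2 (fun x y => Cconj (c x) * c y * K x y)%C.
Proof.
  intros Hc HK. apply pcont2_mult; trivial. apply pcont2_mult.
  - apply (pcont2_l (fun x => Cconj (c x))). now apply pcont_conj.
  - now apply (pcont2_r c).
Qed.

Lemma bilin_plus (c : R -> C) (K L : R -> R -> C) : pcont c -> pcont2 K -> pcont2 L ->
  bilin c (fun x y => K x y + L x y)%C = (bilin c K + bilin c L)%C.
Proof.
  intros Hc HK HL. unfold bilin. rewrite <- dmean_plus by now apply pcont2_bilin.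
  apply dmean_ext. intros; ring.
Qed.

Lemma bilin_scal (a : C) (c : R -> C) (K : R -> R -> C) : pcont c -> pcont2 K ->
  bilin c (fun x y => a * K x y)%C = (a * bilin c K)%C.
Proof.
  intros Hc HK. unfold bilin. rewrite <- dmean_scal by now apply pcont2_bilin.
  apply dmean_ext. intros; ring.
Qed.

Lemma bilin_ext (c : R -> C) (K L : R -> R -> C) :
  (forall x y, 0 <= x <= 2 * PI -> 0 <= y <= 2 * PI -> K x y = L x y) -> bilin c K = bilin c L.
Proof.
  intros H. unfold bilin. apply dmean_ext. intros x y Hx Hy. rewrite (H x y Hx Hy). reflexivity.
Qed.

Lemma bilin_bound (c : R -> C) (K : R -> R -> C) (A M : R) : pcont c -> pcont2 K ->
  (forall x, 0 <= x <= 2 * PI -> Cmod (c x) <= A) ->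
  (forall x y, 0 <= x <= 2 * PI -> 0 <= y <= 2 * PI -> Cmod (K x y) <= M) ->
  Cmod (bilin c K) <= A * A * M.
Proof.
  intros Hc HK HA HM. unfold bilin. apply dmean_bound. now apply pcont2_bilin.
  intros x y Hx Hy. rewrite !Cmod_mult, Cmod_conj.
  apply Rmult_le_compat; try apply Cmod_ge_0; auto.
  apply Rmult_le_pos; apply Cmod_ge_0. apply Rmult_le_compat; try apply Cmod_ge_0; auto.
Qed.

Lemma pcont2_RtoC_Cmod2 (K : R -> R -> C) : pcont2 K -> pcont2 (fun x y => RtoC (Cmod (K x y) ^ 2)).
Proof.
  intros HK. apply (pcont2_ext (fun x y => K x y * Cconj (K x y))%C).
  intros. now rewrite Cmod2_conj. apply pcont2_mult; trivial. now apply pcont2_conj.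
Qed.

Lemma pcont2_sphere_kernel (w : R -> C) : pcont w -> pcont2 (fun x y => RtoC (sphere_kernel w x y)).
Proof.
  intros Hw.
  assert (N : forall z, RtoC (1 + Cmod z ^ 2) <> 0%C).
  { intros z. apply RtoC_neq_0. pose proof (Cmod_pow2_pos z). lra. }
  apply (pcont2_ext (fun x y => RtoC (Cmod (1 + w x * Cconj (w y)) ^ 2) *
     / ((1 + RtoC (Cmod (w x) ^ 2)) * (1 + RtoC (Cmod (w y) ^ 2))))%C).
  - intros x y. unfold sphere_kernel. pose proof (Cmod_pow2_pos (w x)). pose proof (Cmod_pow2_pos (w y)).
    rewrite <- !RtoC_plus, <- RtoC_mult, <- RtoC_inv, <- RtoC_mult. reflexivity.
    apply Rgt_not_eq, Rmult_lt_0_compat; trivial.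
  - pose proof (pcont2_l w Hw) as P1. pose proof (pcont2_r w Hw) as P2.
    apply pcont2_mult.
    + apply pcont2_RtoC_Cmod2. apply pcont2_plus. apply pcont2_const. apply pcont2_mult; trivial.
      now apply (pcont2_conj (fun _ y => w y)).
    + apply pcont2_inv.
      * apply pcont2_mult; (apply pcont2_plus; [apply pcont2_const|]).
        now apply (pcont2_RtoC_Cmod2 (fun x _ => w x)). now apply (pcont2_RtoC_Cmod2 (fun _ y => w y)).
      * intros x y _ _. apply Cmult_neq_0; rewrite <- RtoC_plus; apply N.
Qed.

Lemma pcont2_pow (K : R -> R -> C) (n : nat) : pcont2 K -> pcont2 (fun x y => K x y ^ n)%C.
Proof. intros HK. induction n. apply (pcont2_const 1). now apply pcont2_mult. Qed.

(* |1 + a conj b|^2 is the sum over u in {1, a, conj a, |a|^2} of products u(x) conj (u(y)), so that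
   multiplying by the kernel only replaces [c] by four other densities. *)
Lemma sphere_kernel_pow_nonneg (w : R -> C) (n : nat) : pcont w ->
  forall c, pcont c -> 0 <= Re (bilin c (fun x y => RtoC (sphere_kernel w x y) ^ n)%C).
Proof.
  intros Hw. pose proof (pcont2_sphere_kernel w Hw) as HK.
  induction n as [|n IH]; intros c Hc.
  - unfold bilin. rewrite (dmean_ext _ (fun x y => Cconj (c x) * c y)%C) by (intros; simpl; ring).
    rewrite (dmean_prod (fun x => Cconj (c x))) by (trivial; now apply pcont_conj).
    rewrite cmean_conj, Cmult_comm, <- Cmod2_conj by trivial. apply (pow2_ge_0 (Cmod (cmean c))).
  - set (s := fun x => RtoC (/ (1 + Cmod (w x) ^ 2))).
    assert (Ps : pcont s).
    { intros x Hx. apply rcont_iff. intros e He.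
      assert (Q : rcont (fun x => / (1 + w x * Cconj (w x)))%C x).
      { apply rcont_inv. apply rcont_plus. apply rcont_const. apply rcont_mult; auto. apply rcont_conj; auto.
        rewrite <- Cmod2_conj, <- RtoC_plus. apply RtoC_neq_0. pose proof (Cmod_pow2_pos (w x)). lra. }
      destruct (proj1 (rcont_iff _ _) Q e He) as [d [Hd D]]. exists d. split; trivial.
      assert (E : forall x, s x = (/ (1 + w x * Cconj (w x)))%C).
      { intros u. unfold s. rewrite RtoC_inv, RtoC_plus, Cmod2_conj. reflexivity.
        pose proof (Cmod_pow2_pos (w u)). lra. }
      intros u Hu. rewrite !E. now apply D. }
    pose proof (pcont2_pow _ n HK) as HKn.
    set (Kn := fun x y => (RtoC (sphere_kernel w x y) ^ n)%C) in *.
    assert (Pc : pcont (fun x => Cconj (w x))) by now apply pcont_conj.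
    assert (P1 : pcont (fun x => c x * s x)%C) by now apply pcont_mult.
    assert (P2 : pcont (fun x => c x * s x * w x)%C) by now apply pcont_mult.
    assert (P3 : pcont (fun x => c x * s x * Cconj (w x))%C) by (apply pcont_mult; trivial).
    assert (P4 : pcont (fun x => c x * s x * w x * Cconj (w x))%C) by (apply pcont_mult; trivial).
    pose proof (IH _ P1) as I1. pose proof (IH _ P2) as I2. pose proof (IH _ P3) as I3. pose proof (IH _ P4) as I4.
    assert (E : bilin c (fun x y => RtoC (sphere_kernel w x y) ^ S n)%C =
      (bilin (fun x => c x * s x)%C Kn + bilin (fun x => c x * s x * w x)%C Kn +
       bilin (fun x => c x * s x * Cconj (w x))%C Kn + bilin (fun x => c x * s x * w x * Cconj (w x))%C Kn)%C).
    { unfold bilin. rewrite <- !dmean_plus by (repeat apply pcont2_plus; apply pcont2_bilin; trivial).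
      apply dmean_ext. intros x y _ _. rewrite Cpow_S. fold (Kn x y).
      replace (RtoC (sphere_kernel w x y)) with
        ((1 + w x * Cconj (w y)) * (1 + Cconj (w x) * w y) * s x * s y)%C.
      - rewrite !Cmult_conj, !Cconj_conj. unfold s.
        assert (Es : forall u, Cconj (RtoC u) = RtoC u).
        { intros u. unfold Cconj, RtoC; simpl. f_equal. ring. }
        rewrite !Es. ring.
      - unfold sphere_kernel, s.
        unfold Rdiv. rewrite RtoC_mult, Cmod2_conj, Cplus_conj, Cmult_conj, Cconj_conj, Rinv_mult, RtoC_mult.
        replace (Cconj 1) with (RtoC 1). ring. unfold Cconj, RtoC; simpl. f_equal. ring. }
    rewrite E, !re_plus. unfold Kn in *. lra.
Qed.

(** A density of mean zero annihilates functions of one variable; this is the condition in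
    conditional negativity. *)
Lemma bilin_l_zero (c h : R -> C) : pcont c -> pcont h -> cmean c = 0%C ->
  bilin c (fun x _ => h x) = 0%C.
Proof.
  intros Hc Hh H0. unfold bilin.
  rewrite (dmean_ext _ (fun x y => (Cconj (c x) * h x) * c y)%C) by (intros; ring).
  rewrite (dmean_prod (fun x => Cconj (c x) * h x)%C), H0. ring.
  apply pcont_mult; trivial. now apply pcont_conj. trivial.
Qed.

Lemma bilin_r_zero (c h : R -> C) : pcont c -> pcont h -> cmean c = 0%C ->
  bilin c (fun _ y => h y) = 0%C.
Proof.
  intros Hc Hh H0. unfold bilin.
  rewrite (dmean_ext _ (fun x y => Cconj (c x) * (c y * h y))%C) by (intros; ring).
  rewrite (dmean_prod (fun x => Cconj (c x)) (fun y => c y * h y)%C), cmean_conj, H0; trivial.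
  replace (Cconj 0) with (RtoC 0). ring. unfold Cconj, RtoC; simpl. f_equal. ring.
  now apply pcont_conj. now apply pcont_mult.
Qed.

(** - ln (1 - p k) is the sum of p^n k^n / n, and every power of the kernel k is positive
    semidefinite. The factor p < 1 makes the convergence uniform, so that the sign passes to the
    limit. *)
Lemma sphere_kernel_log_nonneg (w c : R -> C) (p : R) : pcont w -> pcont c -> 0 < p < 1 ->
  Re (bilin c (fun x y => RtoC (ln (1 - p * sphere_kernel w x y)))) <= 0.
Proof.
  intros Hw Hc Hp. pose proof (pcont2_sphere_kernel w Hw) as HK.
  destruct (pcont_bounded c Hc) as [A [HA BA]].
  set (L := fun x y => RtoC (ln (1 - p * sphere_kernel w x y))).
  assert (Rg : forall x y, 0 <= p * sphere_kernel w x y <= p).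
  { intros x y. pose proof (sphere_kernel_range w x y). nra. }
  assert (HL : pcont2 L).
  { apply pcont2_ln.
    - apply (pcont2_ext (fun x y => 1 + (- RtoC p) * RtoC (sphere_kernel w x y))%C).
      intros x y. rewrite RtoC_minus, RtoC_mult. ring.
      apply pcont2_plus. apply pcont2_const. apply pcont2_mult; trivial. apply pcont2_const.
    - intros x y _ _. specialize (Rg x y). lra. }
  set (T := fun n x y => RtoC (rsum (fun k => (p * sphere_kernel w x y) ^ S k / INR (S k)) n)).
  assert (TS : forall n x y, T (S n) x y =
     (T n x y + RtoC (p ^ S n / INR (S n)) * RtoC (sphere_kernel w x y) ^ S n)%C).
  { intros n x y. unfold T. cbn [rsum]. rewrite RtoC_plus, <- RtoC_pow, <- RtoC_mult. do 2 f_equal.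
    rewrite Rpow_mult_distr. unfold Rdiv. ring. }
  assert (HT : forall n, pcont2 (T n) /\ 0 <= Re (bilin c (T n))).
  { induction n as [|n [I1 I2]].
    - assert (E : forall x y, RtoC 0 = T 0%nat x y) by reflexivity. split.
      apply (pcont2_ext _ _ E). apply pcont2_const.
      rewrite <- (bilin_ext c _ _ (fun x y _ _ => E x y)).
      rewrite (bilin_ext c _ (fun x y => 0 * 1)%C) by (intros; ring).
      rewrite bilin_scal by (trivial; apply pcont2_const). rewrite Cmult_0_l. simpl. lra.
    - pose proof (pcont2_pow _ (S n) HK) as Q.
      assert (Q' : pcont2 (fun x y => RtoC (p ^ S n / INR (S n)) * RtoC (sphere_kernel w x y) ^ S n)%C).
      { apply pcont2_mult; trivial. apply pcont2_const. }
      split.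
      + apply (pcont2_ext _ _ (fun x y => eq_sym (TS n x y))). now apply pcont2_plus.
      + rewrite (bilin_ext c _ _ (fun x y _ _ => TS n x y)), bilin_plus, bilin_scal, re_plus, re_scal_l; trivial.
        pose proof (sphere_kernel_pow_nonneg w (S n) Hw c Hc).
        assert (0 <= p ^ S n / INR (S n)).
        { apply Rdiv_le_0_compat. apply pow_le; lra. apply lt_0_INR. lia. }
        assert (0 <= p ^ S n / INR (S n) * Re (bilin c (fun x y => RtoC (sphere_kernel w x y) ^ S n)%C)) by now apply Rmult_le_pos.
        lra. }
  apply le_epsilon. intros e He. rewrite Rplus_0_l.
  destruct (pow_lt_1_zero p ltac:(rewrite Rabs_pos_eq; lra) (e * (1 - p) / (A * A + 1))%R) as [N HN].
  { apply Rdiv_lt_0_compat; nra. }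
  specialize (HN N (le_n N)). rewrite Rabs_pos_eq in HN by (apply pow_le; lra).
  destruct (HT N) as [H1 H2].
  assert (B : Cmod (bilin c (fun x y => T N x y + L x y)%C) <= A * A * (p ^ N / (1 - p))).
  { apply bilin_bound; trivial. now apply pcont2_plus.
    intros x y _ _. unfold T, L. rewrite <- RtoC_plus, Cmod_R. specialize (Rg x y).
    set (k := (p * sphere_kernel w x y)%R) in *.
    eapply Rle_trans. apply ln_partial_sum. lra.
    assert (0 <= k ^ N <= p ^ N) by (split; [apply pow_le; lra|apply pow_incr; lra]).
    unfold Rdiv. apply Rmult_le_compat; try lra. left; apply Rinv_0_lt_compat; lra.
    apply Rinv_le_contravar; lra. }
  rewrite bilin_plus in B by trivial.
  assert (B2 : A * A * (p ^ N / (1 - p)) <= e).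
  { apply Rmult_le_reg_r with (1 - p)%R. lra.
    replace (A * A * (p ^ N / (1 - p)) * (1 - p))%R with (A * A * p ^ N)%R by (field; lra).
    apply Rle_trans with ((A * A + 1) * (e * (1 - p) / (A * A + 1)))%R; [|right; field; nra].
    apply Rmult_le_compat; try nra. apply pow_le; lra. }
  pose proof (re_le_Cmod (bilin c (T N) + bilin c L)) as R1. rewrite re_plus in R1.
  change (Re (bilin c L) <= e).
  pose proof (Rle_abs (Re (bilin c (T N)) + Re (bilin c L))). lra.
Qed.

(* The regularised logarithmic kernel is conditionally negative: [log |a - b|^2] differs from the
   logarithm of the squared chordal distance [1 - sphere_kernel] by a function of [a] plus one of [b]. *)
Theorem log_energy_nonpos (w c : R -> C) (d : R) : pcont w -> pcont c -> cmean c = 0%C -> 0 < d < 1 ->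
  Re (bilin c (fun x y => RtoC (ln (Cmod (w x - w y) ^ 2 + d * Cmod (1 + w x * Cconj (w y)) ^ 2)))) <= 0.
Proof.
  intros Hw Hc H0 Hd. pose proof (pcont2_sphere_kernel w Hw) as HK.
  set (h := fun x => RtoC (ln (1 + Cmod (w x) ^ 2))).
  assert (Hh2 : pcont2 (fun x _ => h x)).
  { apply (pcont2_ln (fun x _ => 1 + Cmod (w x) ^ 2)).
    - apply (pcont2_ext (fun x _ => 1 + RtoC (Cmod (w x) ^ 2))%C). intros; now rewrite RtoC_plus.
      apply pcont2_plus. apply pcont2_const. now apply (pcont2_RtoC_Cmod2 (fun x _ => w x)), (pcont2_l w).
    - intros. apply Cmod_pow2_pos. }
  assert (Hh : pcont h).
  { intros x Hx. apply (rcont2_slice_l (fun x _ => h x) x 0). apply Hh2; lra. }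
  set (L := fun x y => RtoC (ln (1 - (1 - d) * sphere_kernel w x y))).
  assert (HL : pcont2 L).
  { apply pcont2_ln.
    - apply (pcont2_ext (fun x y => 1 + (- RtoC (1 - d)) * RtoC (sphere_kernel w x y))%C).
      intros x y. rewrite (RtoC_minus 1 (_ * _)), RtoC_mult. ring.
      apply pcont2_plus. apply pcont2_const. apply pcont2_mult; trivial. apply pcont2_const.
    - intros x y _ _. pose proof (sphere_kernel_range w x y). nra. }
  (* By the chordal identity |a - b|^2 + d |1 + a conj b|^2 = (1 + |a|^2) (1 + |b|^2) (1 - (1 - d)
     k), which is the reason for this form of the regularising term. *)
  rewrite (bilin_ext c _ (fun x y => h x + h y + L x y)%C).
  - rewrite !bilin_plus; trivial.
    + rewrite bilin_l_zero, bilin_r_zero by trivial.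
      replace (0 + 0 + bilin c L)%C with (bilin c L) by ring.
      apply sphere_kernel_log_nonneg; trivial. lra.
    + now apply (pcont2_r h).
    + apply pcont2_plus; trivial. now apply (pcont2_r h).
  - intros x y _ _. unfold h, L. rewrite <- !RtoC_plus. f_equal.
    pose proof (Cmod_pow2_pos (w x)) as P1. pose proof (Cmod_pow2_pos (w y)) as P2.
    pose proof (sphere_kernel_range w x y) as Rg.
    rewrite <- ln_mult by trivial. rewrite <- ln_mult; [|now apply Rmult_lt_0_compat|nra].
    f_equal. pose proof (chordal_identity (w x) (w y)) as I. unfold sphere_kernel.
    field_simplify; [|lra]. rewrite <- I. ring.
Qed.

(** * Slopes of holomorphic functions *)

Lemma Cmod_segment_near (p q c : C) (t d : R) : 0 <= t <= 1 -> Cmod (p - c) < d -> Cmod (q - c) < d ->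
  Cmod (p + RtoC t * (q - p) - c) < d.
Proof.
  intros Ht Hp Hq.
  replace (p + RtoC t * (q - p) - c)%C with ((p - c) + RtoC t * ((q - c) - (p - c)))%C by ring.
  now apply Cmod_segment_lt.
Qed.

Lemma ps_near (a : nat -> C) (c : C) (e : R) : conv_D a -> Cmod c < 1 -> 0 < e ->
  exists d, 0 < d /\ forall w, Cmod (w - c) < d -> Cmod w < 1 /\ Cmod (ps a w - ps a c) < e.
Proof.
  intros Ha Hc He. destruct (ccont_ps a c Ha Hc e He) as [d [Hd D]].
  exists (Rmin d (1 - Cmod c)). split. apply Rmin_glb_lt; lra.
  intros w Hw. split. apply (Cmod_near c); trivial. eapply Rlt_le_trans; [exact Hw|apply Rmin_r].
  apply D. eapply Rlt_le_trans; [exact Hw|apply Rmin_l].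
Qed.

(** Strict differentiability: both points move near [c]. This is what makes the divided difference
    jointly continuous on the diagonal. *)
Lemma ps_first_order (a : nat -> C) (c : C) (e : R) : conv_D a -> Cmod c < 1 -> 0 < e ->
  exists d, 0 < d /\ forall p w, Cmod (p - c) < d -> Cmod (w - c) < d ->
    Cmod (ps a w - ps a p - ps (dcoef a) c * (w - p)) <= e * Cmod (w - p).
Proof.
  intros Ha Hc He. pose proof (conv_D_dcoef a Ha) as Hd'.
  destruct (ps_near (dcoef a) c e Hd' Hc He) as [d [Hd D]]. exists d. split; trivial.
  intros p w Hp Hw. set (k := ps (dcoef a) c) in *.
  replace (ps a w - ps a p - k * (w - p))%C with ((ps a w - k * w) - (ps a p - k * p))%C by ring.
  apply (segment_bound (fun x => ps a x - k * x)%C (fun x => ps (dcoef a) x - k)%C).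
  intros t Ht x. destruct (D x) as [D1 D2]. now apply Cmod_segment_near. split; [|split].
  - replace (ps (dcoef a) x - k)%C with (ps (dcoef a) x - k * 1)%C by ring.
    apply cderiv_minus. now apply cderiv_ps. apply cderiv_scal, cderiv_id.
  - apply (ccont_plus (ps (dcoef a)) (fun _ => - k)%C). now apply ccont_ps. apply ccont_const.
  - lra.
Qed.

Lemma ps_second_order (a : nat -> C) (c : C) (e : R) : conv_D a -> Cmod c < 1 -> 0 < e ->
  exists d, 0 < d /\ forall p w, Cmod (p - c) < d -> Cmod (w - c) < d ->
    Cmod (ps a w - ps a p - ps (dcoef a) p * (w - p)
          - ps (dcoef (dcoef a)) c / 2 * ((w - p) * (w - p))) <= e * (Cmod (w - p) * Cmod (w - p)).
Proof.
  intros Ha Hc He. pose proof (conv_D_dcoef a Ha) as Hd'.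
  destruct (ps_first_order (dcoef a) c e Hd' Hc He) as [d1 [Hd1 D1]].
  destruct (ps_near (dcoef a) c e Hd' Hc He) as [d2 [Hd2 D2]].
  exists (Rmin d1 d2). split. now apply Rmin_glb_lt.
  intros p w Hp Hw. set (k := ps (dcoef (dcoef a)) c) in *. set (l := ps (dcoef a) p).
  replace (ps a w - ps a p - l * (w - p) - k / 2 * ((w - p) * (w - p)))%C
    with ((ps a w - l * w - k / 2 * ((w - p) * (w - p))) - (ps a p - l * p - k / 2 * ((p - p) * (p - p))))%C.
  2: { field. }
  rewrite <- Rmult_assoc.
  apply (segment_bound (fun x => ps a x - l * x - k / 2 * ((x - p) * (x - p)))%C
    (fun x => ps (dcoef a) x - l - k * (x - p))%C).
  intros t Ht x.
  assert (Hx : Cmod (x - c) < Rmin d1 d2) by now apply Cmod_segment_near.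
  pose proof (Rlt_le_trans _ _ _ Hx (Rmin_l _ _)) as X1. pose proof (Rlt_le_trans _ _ _ Hx (Rmin_r _ _)) as X2.
  destruct (D2 x X2) as [X3 _]. split; [|split].
  - replace (ps (dcoef a) x - l - k * (x - p))%C
      with (ps (dcoef a) x - l * 1 - k / 2 * ((1 - 0) * (x - p) + (x - p) * (1 - 0)))%C by field.
    apply cderiv_minus; [apply cderiv_minus|].
    + now apply cderiv_ps.
    + apply cderiv_scal, cderiv_id.
    + apply cderiv_scal. assert (D : cderiv (fun x => x - p)%C x (1 - 0)).
      { apply cderiv_minus. apply cderiv_id. apply cderiv_const. }
      exact (cderiv_mult _ _ _ _ _ D D).
  - apply (cderiv_ccont _ _ (ps (dcoef (dcoef a)) x - 0 - k * (1 - 0))%C).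
    apply cderiv_minus; [apply cderiv_minus|].
    + apply cderiv_ps; trivial.
    + apply cderiv_const.
    + apply cderiv_scal. apply cderiv_minus. apply cderiv_id. apply cderiv_const.
  - pose proof (Rlt_le_trans _ _ _ Hp (Rmin_l _ _)) as P1.
    eapply Rle_trans. apply (D1 p x P1 X1). apply Rmult_le_compat_l. lra.
    unfold x. replace (p + RtoC t * (w - p) - p)%C with (RtoC t * (w - p))%C by ring.
    now apply Cmod_ray.
Qed.

Lemma cderiv_slope_at (f : C -> C) (l p k : C) :
  (forall e, 0 < e -> exists d, 0 < d /\ forall w, Cmod (w - p) < d ->
     Cmod (f w - f p - l * (w - p) - k * ((w - p) * (w - p))) <= e * (Cmod (w - p) * Cmod (w - p))) ->
  cderiv (slope f l p) p k.
Proof.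
  intros H e He. destruct (H e He) as [d [Hd D]]. exists d. split; trivial. intros w Hw.
  destruct (Ceq_dec w p) as [->|N].
  - replace (slope f l p p - slope f l p p - k * (p - p))%C with (RtoC 0) by ring.
    rewrite Cmod_0. replace (p - p)%C with (RtoC 0) by ring. rewrite Cmod_0. lra.
  - pose proof (Cminus_neq_0 _ _ N) as N'. rewrite slope_at, slope_off by trivial.
    replace ((f w - f p) / (w - p) - l - k * (w - p))%C
      with ((f w - f p - l * (w - p) - k * ((w - p) * (w - p))) / (w - p))%C by (field; trivial).
    rewrite Cmod_div by trivial. specialize (D w Hw). apply Cmod_gt_0 in N'.
    apply Rmult_le_reg_r with (1 := N'). unfold Rdiv. rewrite Rmult_assoc, Rinv_l by lra. lra.
Qed.

(** The singularity at [p] is removed through the second-order expansion: the slope has derivative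
    f''(p) / 2 there. *)
Lemma holo_slope (f : C -> C) (l p : C) : holo_D f -> Cmod p < 1 -> cderiv f p l -> holo_D (slope f l p).
Proof.
  intros Hf Hp Hl z Hz. destruct (Ceq_dec z p) as [->|N].
  - destruct (taylor_D f Hf) as [Ca Ta]. set (a := taylor_coef f) in *.
    assert (E : l = ps (dcoef a) p).
    { apply (cderiv_unique f p); trivial. apply (cderiv_ext_loc (ps a) _ p _ (1 - Cmod p)). lra.
      intros w Hw. symmetry. apply Ta. now apply (Cmod_near p). now apply cderiv_ps. }
    exists (ps (dcoef (dcoef a)) p / 2)%C. apply cderiv_slope_at. intros e He.
    destruct (ps_second_order a p e Ca Hp He) as [d [Hd D]].
    exists (Rmin d (1 - Cmod p)). split. apply Rmin_glb_lt; lra.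
    intros w Hw. pose proof (Rlt_le_trans _ _ _ Hw (Rmin_l _ _)) as W1.
    pose proof (Rlt_le_trans _ _ _ Hw (Rmin_r _ _)) as W2.
    rewrite !Ta, E by (trivial; now apply (Cmod_near p)). apply D; trivial.
    replace (p - p)%C with (RtoC 0) by ring. now rewrite Cmod_0.
  - destruct (Hf z Hz) as [m Hm]. eexists. now apply cderiv_slope_off with (m := m).
Qed.

(* If f' z0 = 0, then the maximum principle for the zero-free functions [1 / slope f p], p near z0,
   bounds |f' p| from below wherever f' p <> 0; hence f' vanishes near z0. *)
Theorem injective_derivative_neq_0 (f : C -> C) (z0 l : C) : holo_D f ->
  (forall z w, Cmod z < 1 -> Cmod w < 1 -> f z = f w -> z = w) ->
  Cmod z0 < 1 -> cderiv f z0 l -> l <> 0%C.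
Proof.
  intros Hf Inj Hz0 Hl E0. subst l.
  destruct (taylor_D f Hf) as [Ca Ta]. set (a := taylor_coef f) in *.
  assert (Df : forall z, Cmod z < 1 -> cderiv f z (ps (dcoef a) z)).
  { intros z Hz. apply (cderiv_ext_loc (ps a) _ z _ (1 - Cmod z)). lra.
    intros w Hw. symmetry. apply Ta. now apply (Cmod_near z). now apply cderiv_ps. }
  assert (F0 : ps (dcoef a) z0 = 0%C) by (apply (cderiv_unique f z0); auto).
  set (s := (1 - Cmod z0)%R). assert (Hs : 0 < s) by (unfold s; lra).
  assert (Nrs : RtoC s <> 0%C) by (apply RtoC_neq_0; lra).
  (* Maps the unit disk onto the disk |w - z0| < s, so that the maximum principle on |u| = 1 / 2
     applies around [z0]. *)
  set (A := fun u => (z0 + RtoC s * u)%C).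
  assert (HA : forall u, Cmod u < 1 -> Cmod (A u) < 1).
  { intros u Hu. apply (Cmod_near z0); trivial. unfold A. replace (z0 + RtoC s * u - z0)%C with (RtoC s * u)%C by ring.
    rewrite Cmod_mult, Cmod_R, Rabs_pos_eq by lra. fold s. nra. }
  assert (DA : forall u, cderiv A u (RtoC s)).
  { intros u. pose proof (cderiv_plus _ _ u _ _ (cderiv_const z0 u) (cderiv_scal (RtoC s) _ u _ (cderiv_id u))) as D.
    now replace (0 + RtoC s * 1)%C with (RtoC s) in D by ring. }
  assert (Hc1 : forall t, Cmod (circ (/ 2) t) < 1) by (intros t; rewrite Cmod_circ; lra).
  assert (Nc : forall t, (f (A (circ (/ 2) t)) - f z0)%C <> 0%C).
  { intros t E. assert (E' : A (circ (/ 2) t) = z0).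
    { apply Inj; auto. replace (f z0) with (f z0 + (f (A (circ (/ 2) t)) - f z0))%C by (rewrite E; ring). ring. }
    unfold A in E'. apply (Cmult_neq_0 (RtoC s) (circ (/ 2) t)); trivial. apply circ_neq_0; lra.
    replace (RtoC s * circ (/ 2) t)%C with (z0 + RtoC s * circ (/ 2) t - z0)%C by ring. rewrite E'. ring. }
  destruct (pcont_bounded (fun t => / (f (A (circ (/ 2) t)) - f z0))%C) as [M [HM BM]].
  { apply pcont_inv; trivial. apply pcont_plus; [|apply pcont_const].
    apply (pcont_comp_circ (fun u => f (A u))). lra. intros u Hu.
    apply (ccont_comp A f). exact (cderiv_ccont _ _ _ (DA u)).
    apply (cderiv_ccont _ _ _ (Df (A u) (HA u ltac:(lra)))). }
  set (mu := (/ (M + 1))%R). assert (Hmu : 0 < mu) by (apply Rinv_0_lt_compat; lra).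
  (* By injectivity f - f z0 has no zero on the circle |w - z0| = s / 2; compactness gives the
     positive lower bound [mu]. *)
  assert (Bmu : forall u, Cmod u = / 2 -> mu <= Cmod (f (A u) - f z0)).
  { intros u Hu.
    assert (exists t, 0 <= t <= 2 * PI /\ u = circ (/ 2) t) as [t [Ht ->]].
    { destruct u as [x y].
      assert (Hxy : (2 * x) * (2 * x) + (2 * y) * (2 * y) = 1).
      { pose proof (Cmod2_alt (x, y)) as Q. rewrite Hu in Q. simpl in Q. lra. }
      assert (Hx : -1 <= 2 * x <= 1) by nra.
      pose proof (acos_bound (2 * x)) as AB. pose proof (cos_acos (2 * x) Hx) as CA.
      assert (SA : (2 * y) * (2 * y) = sin (acos (2 * x)) * sin (acos (2 * x))).
      { pose proof (sin2_cos2 (acos (2 * x))) as SC. rewrite CA in SC. unfold Rsqr in SC. lra. }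
      assert (SP : 0 <= sin (acos (2 * x))) by (apply sin_ge_0; lra).
      destruct (Rle_dec 0 y).
      - exists (acos (2 * x)). split. lra.
        unfold circ, cis, Cmult, RtoC; simpl. rewrite CA.
        assert (2 * y = sin (acos (2 * x))) by nra. f_equal; lra.
      - exists (2 * PI - acos (2 * x))%R. split. lra.
        unfold circ, cis, Cmult, RtoC; simpl. rewrite cos_minus, sin_minus, cos_2PI, sin_2PI, CA.
        assert (2 * y = - sin (acos (2 * x))) by nra. f_equal; lra. }
    specialize (BM t Ht). cbv beta in BM. rewrite Cmod_inv in BM by apply Nc.
    set (X := Cmod (f (A (circ (/ 2) t)) - f z0)) in *.
    assert (0 < X) by (apply Cmod_gt_0, Nc).
    unfold mu. rewrite <- (Rinv_inv X). apply Rinv_le_contravar. now apply Rinv_0_lt_compat. lra. }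
  (* The slope at [p] is zero-free by injectivity and at least (mu / 2) / s on the circle; the
     maximum principle for its inverse transfers this bound to its value f'(p) at [p]. *)
  assert (Low : forall p, Cmod p < 1 -> Cmod (p - z0) < s / 2 -> Cmod (f p - f z0) < mu / 2 ->
     ps (dcoef a) p <> 0%C -> mu / (2 * s) <= Cmod (ps (dcoef a) p)).
  { intros p Hp Hp1 Hp2 Np. set (k := ps (dcoef a) p) in *.
    set (S1 := slope f k p).
    assert (NS : forall w, Cmod w < 1 -> S1 w <> 0%C).
    { intros w Hw. unfold S1. destruct (Ceq_dec w p) as [->|N]. now rewrite slope_at.
      rewrite slope_off by trivial. unfold Cdiv. apply Cmult_neq_0.
      - apply Cminus_neq_0. intros E. apply N. now apply Inj.
      - intros E. apply (RtoC_neq_0 1). lra. rewrite <- (Cinv_r (w - p)), E by now apply Cminus_neq_0. ring. }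
    assert (HS : holo_D S1) by (apply holo_slope; trivial; now apply Df).
    set (u1 := ((p - z0) / RtoC s)%C).
    assert (Hu1 : Cmod u1 < / 2).
    { unfold u1. rewrite Cmod_div, Cmod_R, Rabs_pos_eq by (trivial; lra).
      apply Rmult_lt_reg_r with s; trivial. unfold Rdiv. rewrite Rmult_assoc, Rinv_l by lra. lra. }
    assert (Au1 : A u1 = p) by (unfold A, u1; field; trivial).
    assert (B : Cmod (/ S1 (A u1)) <= 2 * s / mu).
    { apply (maximum_modulus (fun u => / S1 (A u))%C u1 (/ 2)); try lra.
      - intros u Hu. destruct (HS (A u) (HA u Hu)) as [m Hm]. eexists.
        apply (cderiv_inv (fun u => S1 (A u))). apply (cderiv_comp A S1). apply DA. apply Hm. now apply NS, HA.
      - intros u Hu. assert (Hw := HA u ltac:(lra)). rewrite Cmod_inv by now apply NS.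
        assert (LS : mu / (2 * s) <= Cmod (S1 (A u))).
        { assert (Nw : A u <> p).
          { intros E. rewrite <- Au1 in E. unfold A in E.
            assert (u = u1).
            { replace u with ((z0 + RtoC s * u - z0) / RtoC s)%C by (field; trivial). rewrite E. field. trivial. }
            subst u. lra. }
          unfold S1. rewrite slope_off by trivial. rewrite Cmod_div by now apply Cminus_neq_0.
          pose proof (Bmu u Hu) as B1.
          assert (B2 : mu / 2 <= Cmod (f (A u) - f p)).
          { pose proof (Cmod_triangle (f (A u) - f p) (f p - f z0)) as T.
            replace (f (A u) - f p + (f p - f z0))%C with (f (A u) - f z0)%C in T by ring. lra. }
          assert (B3 : Cmod (A u - p) <= s).
          { replace (A u - p)%C with (RtoC s * u - (p - z0))%C by (unfold A; ring).
            eapply Rle_trans. apply Cmod_triangle. rewrite Cmod_opp, Cmod_mult, Cmod_R, Rabs_pos_eq, Hu by lra. lra. }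
          assert (P4 : 0 < Cmod (A u - p)) by (apply Cmod_gt_0; now apply Cminus_neq_0).
          apply Rmult_le_reg_r with (1 := P4). unfold Rdiv at 2. rewrite Rmult_assoc, Rinv_l, Rmult_1_r by lra.
          eapply Rle_trans; [|exact B2].
          apply Rle_trans with (mu / (2 * s) * s)%R.
          apply Rmult_le_compat_l; trivial. apply Rdiv_le_0_compat; lra. right. field. lra. }
        replace (2 * s / mu)%R with (/ (mu / (2 * s)))%R by (field; split; lra).
        apply Rinv_le_contravar; trivial. apply Rdiv_lt_0_compat; lra. }
    rewrite Au1 in B. unfold S1 in B. rewrite slope_at, Cmod_inv in B by trivial.
    apply Cmod_gt_0 in Np.
    replace (mu / (2 * s))%R with (/ (2 * s / mu))%R by (field; split; lra).
    rewrite <- (Rinv_inv (Cmod k)). apply Rinv_le_contravar; trivial. now apply Rinv_0_lt_compat. }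
  destruct (ps_near (dcoef a) z0 (mu / (2 * s)) (conv_D_dcoef a Ca) Hz0) as [d1 [Hd1 D1]].
  { apply Rdiv_lt_0_compat; lra. }
  destruct (ps_near a z0 (mu / 2) Ca Hz0 ltac:(lra)) as [d2 [Hd2 D2]].
  set (d := Rmin (s / 2) (Rmin d1 d2)).
  assert (Hd : 0 < d) by (repeat apply Rmin_glb_lt; lra).
  assert (Z : forall p, Cmod (p - z0) < d -> Cmod p < 1 /\ ps (dcoef a) p = 0%C).
  { intros p Hp.
    pose proof (Rlt_le_trans _ _ _ Hp (Rmin_l _ _)) as P1. pose proof (Rlt_le_trans _ _ _ Hp (Rmin_r _ _)) as P'.
    pose proof (Rlt_le_trans _ _ _ P' (Rmin_l _ _)) as P2. pose proof (Rlt_le_trans _ _ _ P' (Rmin_r _ _)) as P3.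
    destruct (D1 p P2) as [X1 X2]. destruct (D2 p P3) as [_ X3]. split; trivial.
    destruct (Ceq_dec (ps (dcoef a) p) 0) as [E|N]; trivial. exfalso.
    rewrite <- !Ta in X3 by trivial. pose proof (Low p X1 P1 X3 N) as L.
    rewrite F0 in X2. replace (ps (dcoef a) p - 0)%C with (ps (dcoef a) p) in X2 by ring. lra. }
  (* As f' vanishes near [z0], f takes the same value at this second point, against injectivity. *)
  set (p := (z0 + RtoC (d / 2))%C).
  assert (Hp : Cmod (p - z0) < d).
  { unfold p. replace (z0 + RtoC (d / 2) - z0)%C with (RtoC (d / 2)) by ring. rewrite Cmod_R, Rabs_pos_eq; lra. }
  assert (Hz : Cmod (z0 - z0) < d) by (replace (z0 - z0)%C with (RtoC 0) by ring; now rewrite Cmod_0).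
  pose proof (segment_bound f (ps (dcoef a)) z0 p 0) as SB.
  assert (E : f p = f z0).
  { assert (X : (f p - f z0 = 0)%C).
    { apply Cmod_eq_0. apply Rle_antisym; [|apply Cmod_ge_0]. rewrite Rmult_0_l in SB. apply SB.
      intros t Ht w. destruct (Z w) as [W1 W2]. now apply Cmod_segment_near. split; [|split].
      now apply Df. apply ccont_ps; trivial. now apply conv_D_dcoef. rewrite W2, Cmod_0. lra. }
    replace (f p) with (f p - f z0 + f z0)%C by ring. rewrite X. ring. }
  apply Inj in E; trivial; [|now apply Z].
  apply (RtoC_neq_0 (d / 2)). lra. replace (RtoC (d / 2)) with (p - z0)%C by (unfold p; ring). rewrite E. ring.
Qed.

(** First divided difference of [ps b] at the nodes p, w; [Gam2] is the second one, with the node p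
    doubled. Both are holomorphic in w across w = p. *)
Definition Gam (b : nat -> C) (p w : C) : C := slope (ps b) (ps (dcoef b) p) p w.

Definition Gam2 (b : nat -> C) (p w : C) : C := slope (Gam b p) (ps (dcoef (dcoef b)) p / 2) p w.

Lemma cderiv_Gam_at (b : nat -> C) (p : C) : conv_D b -> Cmod p < 1 ->
  cderiv (Gam b p) p (ps (dcoef (dcoef b)) p / 2).
Proof.
  intros Hb Hp. apply cderiv_slope_at. intros e He.
  destruct (ps_second_order b p e Hb Hp He) as [d [Hd D]]. exists d. split; trivial.
  intros w Hw. apply D; trivial. replace (p - p)%C with (RtoC 0) by ring. now rewrite Cmod_0.
Qed.

Lemma holo_Gam (b : nat -> C) (p : C) : conv_D b -> Cmod p < 1 -> holo_D (Gam b p).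
Proof. intros Hb Hp. apply holo_slope; trivial. now apply holo_D_ps. now apply cderiv_ps. Qed.

Lemma holo_Gam2 (b : nat -> C) (p : C) : conv_D b -> Cmod p < 1 -> holo_D (Gam2 b p).
Proof. intros Hb Hp. apply holo_slope; trivial. now apply holo_Gam. now apply cderiv_Gam_at. Qed.

Lemma rcont2_ext_loc (K L : R -> R -> C) (x y d : R) : 0 < d ->
  (forall u v, Rabs (u - x) < d -> Rabs (v - y) < d -> K u v = L u v) -> rcont2 K x y -> rcont2 L x y.
Proof.
  intros Hd E H e He. destruct (H e He) as [d' [Hd' D]]. exists (Rmin d d'). split. now apply Rmin_glb_lt.
  intros u v Hu Hv. rewrite <- !E.
  - apply D; (eapply Rlt_le_trans; [eassumption|apply Rmin_r]).
  - rewrite Rminus_diag, Rabs_R0; trivial.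
  - rewrite Rminus_diag, Rabs_R0; trivial.
  - eapply Rlt_le_trans; [eassumption|apply Rmin_l].
  - eapply Rlt_le_trans; [eassumption|apply Rmin_l].
Qed.

Lemma circ_apart (r x y : R) : circ r x <> circ r y ->
  exists d, 0 < d /\ forall u v, Rabs (u - x) < d -> Rabs (v - y) < d -> circ r u <> circ r v.
Proof.
  intros N. pose proof (Cminus_neq_0 _ _ N) as N'. apply Cmod_gt_0 in N'.
  set (e := Cmod (circ r x - circ r y)) in *.
  destruct (proj1 (rcont_iff _ _) (rcont_circ r x) (e / 2)%R ltac:(lra)) as [d1 [Hd1 D1]].
  destruct (proj1 (rcont_iff _ _) (rcont_circ r y) (e / 2)%R ltac:(lra)) as [d2 [Hd2 D2]].
  exists (Rmin d1 d2). split. now apply Rmin_glb_lt. intros u v Hu Hv E.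
  specialize (D1 u (Rlt_le_trans _ _ _ Hu (Rmin_l _ _))). specialize (D2 v (Rlt_le_trans _ _ _ Hv (Rmin_r _ _))).
  rewrite <- E in D2.
  pose proof (Cmod_triangle (- (circ r u - circ r x)) (circ r u - circ r y)) as T. rewrite Cmod_opp in T.
  replace (- (circ r u - circ r x) + (circ r u - circ r y))%C with (circ r x - circ r y)%C in T by ring.
  fold e in T. lra.
Qed.

Lemma rcont2_slope_off (f : C -> C -> C) (l : C -> C) (r x y : R) : circ r x <> circ r y ->
  rcont2 (fun u v => f (circ r u) (circ r v)) x y ->
  rcont2 (fun u v => f (circ r u) (circ r u)) x y ->
  rcont2 (fun u v => slope (f (circ r u)) (l (circ r u)) (circ r u) (circ r v)) x y.
Proof.
  intros N H1 H2. destruct (circ_apart r x y N) as [d [Hd D]].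
  apply (rcont2_ext_loc (fun u v => (f (circ r u) (circ r v) + - (1) * f (circ r u) (circ r u))
     * / (circ r v + - (1) * circ r u))%C _ x y d Hd).
  - intros u v Hu Hv. specialize (D u v Hu Hv). rewrite slope_off by now apply not_eq_sym. unfold Cdiv.
    f_equal. ring. f_equal. ring.
  - apply rcont2_iff in H1, H2.
    assert (C1 : ccont (fun w => circ r (fst w)) (x, y)).
    { apply (proj1 (rcont2_iff (fun u _ => circ r u) x y)). intros e He.
      destruct (proj1 (rcont_iff _ _) (rcont_circ r x) e He) as [d' [Hd' D']]. exists d'. split; auto. }
    assert (C2 : ccont (fun w => circ r (snd w)) (x, y)).
    { apply (proj1 (rcont2_iff (fun _ v => circ r v) x y)). intros e He.
      destruct (proj1 (rcont_iff _ _) (rcont_circ r y) e He) as [d' [Hd' D']]. exists d'. split; auto. }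
    apply rcont2_iff.
    apply (ccont_mult (fun w => f (circ r (fst w)) (circ r (snd w)) + - (1) * f (circ r (fst w)) (circ r (fst w)))%C
      (fun w => / (circ r (snd w) + - (1) * circ r (fst w)))%C).
    + apply ccont_plus; trivial. apply ccont_mult; trivial. apply ccont_const.
    + apply ccont_inv. apply ccont_plus; trivial. apply ccont_mult; trivial. apply ccont_const.
      cbn [fst snd]. replace (circ r y + - (1) * circ r x)%C with (circ r y - circ r x)%C by ring.
      now apply Cminus_neq_0, not_eq_sym.
Qed.

Lemma pcont2_circ_l (f : C -> C) (r : R) : 0 <= r -> (forall z, Cmod z = r -> ccont f z) ->
  pcont2 (fun u _ => f (circ r u)).
Proof. intros Hr Hf. apply (pcont2_l (fun u => f (circ r u))). now apply pcont_comp_circ. Qed.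

Lemma pcont2_circ_r (f : C -> C) (r : R) : 0 <= r -> (forall z, Cmod z = r -> ccont f z) ->
  pcont2 (fun _ v => f (circ r v)).
Proof. intros Hr Hf. apply (pcont2_r (fun u => f (circ r u))). now apply pcont_comp_circ. Qed.

(** The diagonal is circ r x = circ r y rather than x = y, because the angles 0 and 2 pi give the
    same point. *)
Lemma rcont2_diag (G : C -> C -> C) (r x y : R) : circ r x = circ r y ->
  (forall e, 0 < e -> exists d, 0 < d /\ forall p w, Cmod (p - circ r x) < d -> Cmod (w - circ r x) < d ->
     Cmod (G p w - G (circ r x) (circ r x)) < e) ->
  rcont2 (fun u v => G (circ r u) (circ r v)) x y.
Proof.
  intros E H e He. destruct (H e He) as [d [Hd D]].
  destruct (proj1 (rcont_iff _ _) (rcont_circ r x) d Hd) as [d1 [Hd1 D1]].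
  destruct (proj1 (rcont_iff _ _) (rcont_circ r y) d Hd) as [d2 [Hd2 D2]].
  exists (Rmin d1 d2). split. now apply Rmin_glb_lt. intros u v Hu Hv. rewrite <- E. apply D.
  - apply D1. eapply Rlt_le_trans; [eassumption|apply Rmin_l].
  - rewrite E. apply D2. eapply Rlt_le_trans; [eassumption|apply Rmin_r].
Qed.

Lemma pcont2_Gam (b : nat -> C) (r : R) : conv_D b -> 0 <= r < 1 ->
  pcont2 (fun u v => Gam b (circ r u) (circ r v)).
Proof.
  intros Hb Hr x y Hx Hy. assert (Hz : Cmod (circ r x) < 1) by (rewrite Cmod_circ; lra).
  destruct (Ceq_dec (circ r x) (circ r y)) as [E|N].
  - apply rcont2_diag; trivial. intros e He.
    destruct (ps_first_order b (circ r x) (e / 2) Hb Hz ltac:(lra)) as [d1 [Hd1 D1]].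
    destruct (ps_near (dcoef b) (circ r x) e (conv_D_dcoef b Hb) Hz He) as [d2 [Hd2 D2]].
    exists (Rmin d1 d2). split. now apply Rmin_glb_lt. intros p w Hp Hw. unfold Gam. rewrite slope_at.
    destruct (Ceq_dec w p) as [->|N].
    + rewrite slope_at. apply D2. eapply Rlt_le_trans; [eassumption|apply Rmin_r].
    + pose proof (Cminus_neq_0 _ _ N) as N'. rewrite slope_off by trivial.
      specialize (D1 p w (Rlt_le_trans _ _ _ Hp (Rmin_l _ _)) (Rlt_le_trans _ _ _ Hw (Rmin_l _ _))).
      set (k := ps (dcoef b) (circ r x)) in *.
      replace ((ps b w - ps b p) / (w - p) - k)%C with ((ps b w - ps b p - k * (w - p)) / (w - p))%C by (field; trivial).
      rewrite Cmod_div by trivial. apply Cmod_gt_0 in N'.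
      apply Rle_lt_trans with (e / 2)%R; [|lra].
      apply Rmult_le_reg_r with (1 := N'). unfold Rdiv at 1. rewrite Rmult_assoc, Rinv_l by lra. lra.
  - apply (rcont2_slope_off (fun _ => ps b) (ps (dcoef b))); trivial.
    + apply (pcont2_circ_r (ps b)); trivial; try lra. intros; apply ccont_ps; trivial; lra.
    + apply (pcont2_circ_l (ps b)); trivial; try lra. intros; apply ccont_ps; trivial; lra.
Qed.

Lemma pcont2_Gam2 (b : nat -> C) (r : R) : conv_D b -> 0 <= r < 1 ->
  pcont2 (fun u v => Gam2 b (circ r u) (circ r v)).
Proof.
  intros Hb Hr x y Hx Hy. assert (Hz : Cmod (circ r x) < 1) by (rewrite Cmod_circ; lra).
  pose proof (conv_D_dcoef b Hb) as Hd'. pose proof (conv_D_dcoef _ Hd') as Hd''.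
  destruct (Ceq_dec (circ r x) (circ r y)) as [E|N].
  - apply rcont2_diag; trivial. intros e He.
    destruct (ps_second_order b (circ r x) (e / 2) Hb Hz ltac:(lra)) as [d1 [Hd1 D1]].
    destruct (ps_near (dcoef (dcoef b)) (circ r x) e Hd'' Hz He) as [d2 [Hd2 D2]].
    exists (Rmin d1 d2). split. now apply Rmin_glb_lt. intros p w Hp Hw. unfold Gam2. rewrite slope_at.
    set (k := ps (dcoef (dcoef b)) (circ r x)) in *.
    destruct (Ceq_dec w p) as [->|N].
    + rewrite slope_at.
      replace (ps (dcoef (dcoef b)) p / 2 - k / 2)%C with ((ps (dcoef (dcoef b)) p - k) / 2)%C by field.
      assert (N2 : RtoC 2 <> 0%C) by (apply RtoC_neq_0; lra).
      rewrite Cmod_div by trivial. rewrite Cmod_R, Rabs_pos_eq by lra.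
      destruct (D2 p) as [_ D3]. eapply Rlt_le_trans; [eassumption|apply Rmin_r].
      lra.
    + pose proof (Cminus_neq_0 _ _ N) as N'. rewrite slope_off by trivial. unfold Gam at 1 2.
      rewrite slope_at, slope_off by trivial.
      specialize (D1 p w (Rlt_le_trans _ _ _ Hp (Rmin_l _ _)) (Rlt_le_trans _ _ _ Hw (Rmin_l _ _))).
      set (l := ps (dcoef b) p) in *.
      replace (((ps b w - ps b p) / (w - p) - l) / (w - p) - k / 2)%C
        with ((ps b w - ps b p - l * (w - p) - k / 2 * ((w - p) * (w - p))) / ((w - p) * (w - p)))%C by (field; trivial).
      rewrite Cmod_div by now apply Cmult_neq_0. rewrite Cmod_mult. apply Cmod_gt_0 in N'.
      apply Rle_lt_trans with (e / 2)%R; [|lra].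
      apply Rmult_le_reg_r with (Cmod (w - p) * Cmod (w - p))%R. now apply Rmult_lt_0_compat.
      unfold Rdiv at 1. rewrite Rmult_assoc, Rinv_l by (apply Rgt_not_eq; now apply Rmult_lt_0_compat). lra.
  - apply (rcont2_slope_off (Gam b) (fun p => ps (dcoef (dcoef b)) p / 2)%C); trivial.
    + now apply pcont2_Gam.
    + apply (rcont2_ext_loc (fun u v => ps (dcoef b) (circ r u)) _ x y 1). lra.
      intros u v _ _. unfold Gam. now rewrite slope_at.
      apply (pcont2_circ_l (ps (dcoef b))); trivial; try lra. intros; apply ccont_ps; trivial; lra.
Qed.

(** * Parseval identity *)

Lemma cmean_holo (h : C -> C) (r : R) : holo_D h -> 0 < r < 1 -> cmean (fun t => h (circ r t)) = h 0%C.
Proof.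
  intros Hh Hr. rewrite <- (cauchy_formula h 0%C r) by (trivial; rewrite Cmod_0; lra).
  apply cmean_ext. intros t _. field. apply circ_neq_0; lra.
Qed.

Lemma rderiv_conj (h : R -> C) (t : R) (l : C) : rderiv h t l -> rderiv (fun s => Cconj (h s)) t (Cconj l).
Proof.
  rewrite !rderiv_iff. intros H e He. destruct (H e He) as [d [Hd D]]. exists d. split; trivial.
  intros u Hu. specialize (D u Hu).
  replace (Cconj (h u) - Cconj (h t) - Cconj l * RtoC (u - t))%C with (Cconj (h u - h t - l * RtoC (u - t))).
  now rewrite Cmod_conj. rewrite !Cminus_conj, Cmult_conj. do 2 f_equal.
  unfold Cconj, RtoC; simpl. f_equal. ring.
Qed.

Lemma rderiv_RtoC_is_derive (u : R -> R) (t l : R) :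
  rderiv (fun s => RtoC (u s)) t (RtoC l) -> is_derive u t l.
Proof.
  intros H. apply rderiv_is_derive in H.
  apply (filterdiff_ext_lin _ (fun y => fst (scal (K := R_AbsRing) (V := C_R_NormedModule) y (RtoC l)))).
  - apply (filterdiff_comp' (fun s => RtoC (u s)) (fst : C_R_NormedModule -> R)).
    exact H. apply filterdiff_linear. apply is_linear_fst.
  - intros y. reflexivity.
Qed.

(** No branch of the logarithm is chosen: h conj h is differentiated. The result is a term plus its
    conjugate, which are averaged in different ways when the energy is evaluated. *)
Lemma rderiv_ln_Cmod2 (h : R -> C) (t : R) (m : C) : rderiv h t m -> h t <> 0%C ->
  rderiv (fun s => RtoC (ln (Cmod (h s) ^ 2))) t (m / h t + Cconj (m / h t)).
Proof.
  intros H N.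
  assert (P : 0 < Cmod (h t) ^ 2) by (apply pow_lt; now apply Cmod_gt_0).
  set (l := (2 * Re (m * Cconj (h t)))%R).
  assert (El : RtoC l = (m * Cconj (h t) + h t * Cconj m)%C).
  { unfold l. destruct m, (h t). unfold RtoC, Cconj, Cmult, Cplus, Re; simpl. f_equal; ring. }
  assert (D : is_derive (fun s => Cmod (h s) ^ 2) t l).
  { apply rderiv_RtoC_is_derive. rewrite El.
    pose proof (rderiv_mult _ _ _ _ _ H (rderiv_conj _ _ _ H)) as D.
    destruct D as [s [D1 [D2 D3]]]. exists s. split; [|split]; trivial.
    intros u. rewrite !Cmod2_conj. apply D3. }
  assert (D2 : is_derive (fun s => ln (Cmod (h s) ^ 2)) t (l * / Cmod (h t) ^ 2)).
  { apply (is_derive_comp ln (fun s => Cmod (h s) ^ 2)); trivial. now apply is_derive_ln. }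
  replace (m / h t + Cconj (m / h t))%C with (RtoC (l * / Cmod (h t) ^ 2)).
  - apply (is_derive_rderiv _ (fun _ => 0)); trivial. apply (is_derive_const (K := R_AbsRing) (V := R_NormedModule)).
  - assert (N2 : Cconj (h t) <> 0%C) by (apply Cmod_gt_0; rewrite Cmod_conj; now apply Cmod_gt_0).
    rewrite RtoC_mult, RtoC_inv, Cmod2_conj, El, Cdiv_conj by (trivial; lra). field. now split.
Qed.

Lemma cmean_by_parts (h k dh dk : R -> C) :
  (forall t, 0 <= t <= 2 * PI -> rderiv h t (dh t)) -> (forall t, 0 <= t <= 2 * PI -> rderiv k t (dk t)) ->
  pcont dh -> pcont dk -> h 0 = h (2 * PI)%R -> k 0 = k (2 * PI)%R ->
  cmean (fun t => dh t * k t)%C = (- cmean (fun t => h t * dk t))%C.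
Proof.
  intros Hh Hk Ch Ck Eh Ek.
  assert (Ph : pcont h) by (intros t Ht; exact (rderiv_rcont _ _ _ (Hh t Ht))).
  assert (Pk : pcont k) by (intros t Ht; exact (rderiv_rcont _ _ _ (Hk t Ht))).
  assert (Z : cmean (fun t => dh t * k t + h t * dk t)%C = 0%C).
  { apply (cmean_rderiv (fun t => h t * k t)%C).
    - intros t Ht. apply rderiv_mult; auto.
    - apply pcont_plus; now apply pcont_mult.
    - now rewrite Eh, Ek. }
  rewrite cmean_plus in Z by now apply pcont_mult.
  replace (cmean (fun t => dh t * k t)%C) with (cmean (fun t => dh t * k t)%C + cmean (fun t => h t * dk t)%C - cmean (fun t => h t * dk t)%C)%C by ring.
  rewrite Z. ring.
Qed.

Lemma circ_periodic (r : R) : circ r 0 = circ r (2 * PI).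
Proof. unfold circ. now rewrite cis_0, cis_2PI. Qed.

Lemma Re_cmean_nonneg (h : R -> C) : pcont h -> (forall t, 0 <= t <= 2 * PI -> 0 <= Re (h t)) -> 0 <= Re (cmean h).
Proof.
  intros Hh Hp. pose proof two_PI_pos. unfold cmean. rewrite cint_pair by (trivial; lra).
  rewrite re_scal_l. apply Rmult_le_pos. left. now apply Rinv_0_lt_compat.
  apply (RInt_ge_0 (fun t => fst (h t))). lra.
  - apply (ex_RInt_continuous (V := R_CompleteNormedModule)). intros t. rewrite Rmin_left, Rmax_right by lra.
    intros Ht. apply continuity_pt_filterlim. apply rcont_fst. now apply Hh.
  - intros t Ht. apply Hp. lra.
Qed.

(** Multiplication by a unimodular constant makes the mean real and nonnegative; then real parts are
    compared pointwise. *)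
Lemma cmean_norm_le (h : R -> C) (g : R -> R) : pcont h -> pcont (fun t => RtoC (g t)) ->
  (forall t, 0 <= t <= 2 * PI -> Cmod (h t) <= g t) -> Cmod (cmean h) <= Re (cmean (fun t => RtoC (g t))).
Proof.
  intros Hh Hg H. set (m := cmean h).
  destruct (Ceq_dec m 0) as [E|N].
  - rewrite E, Cmod_0. apply Re_cmean_nonneg; trivial. intros t Ht. simpl.
    eapply Rle_trans; [apply Cmod_ge_0|now apply H].
  - set (u := (Cconj m / RtoC (Cmod m))%C). pose proof (proj1 (Cmod_gt_0 m) N) as P.
    assert (Nm : RtoC (Cmod m) <> 0%C) by (apply RtoC_neq_0; lra).
    assert (Hu : Cmod u = 1).
    { unfold u. rewrite Cmod_div, Cmod_conj, Cmod_R, Rabs_pos_eq by (trivial; lra). field. lra. }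
    assert (E : (u * m)%C = RtoC (Cmod m)).
    { unfold u. replace (Cconj m / RtoC (Cmod m) * m)%C with (m * Cconj m / RtoC (Cmod m))%C by (field; trivial).
      rewrite <- Cmod2_conj. simpl. rewrite Rmult_1_r, RtoC_mult. field. trivial. }
    assert (Q : 0 <= Re (cmean (fun t => RtoC (g t) - u * h t)%C)).
    { apply Re_cmean_nonneg.
      - intros t Ht. apply rcont_minus; auto. apply rcont_mult; auto. apply rcont_const.
      - intros t Ht. unfold Cminus. rewrite re_plus, re_opp. simpl (Re (RtoC _)).
        pose proof (re_le_Cmod (u * h t)) as R1. rewrite Cmod_mult, Hu, Rmult_1_l in R1.
        pose proof (Rle_abs (Re (u * h t))). specialize (H t Ht). lra. }
    rewrite cmean_minus, cmean_scal in Q; trivial.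
    + fold m in Q. rewrite E in Q. unfold Cminus in Q. rewrite re_plus, re_opp in Q. simpl (Re (RtoC (Cmod m))) in Q. lra.
    + apply pcont_mult; trivial. apply pcont_const.
Qed.

Lemma dmean_norm_le (K : R -> R -> C) (G : R -> R -> R) : pcont2 K -> pcont2 (fun x y => RtoC (G x y)) ->
  (forall x y, 0 <= x <= 2 * PI -> 0 <= y <= 2 * PI -> Cmod (K x y) <= G x y) ->
  Cmod (dmean K) <= Re (dmean (fun x y => RtoC (G x y))).
Proof.
  intros HK HG H. rewrite !dmean_clamp.
  set (g := fun x => Re (cmean (fun y => RtoC (G (clamp x) y)))).
  assert (E : forall x, cmean (fun y => RtoC (G (clamp x) y)) = RtoC (g x)).
  { intros x. unfold g.
    assert (I : Im (cmean (fun y => RtoC (G (clamp x) y))) = 0).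
    { assert (Q : cmean (fun y => RtoC (G (clamp x) y)) = Cconj (cmean (fun y => RtoC (G (clamp x) y)))).
      { rewrite <- cmean_conj. apply cmean_ext. intros t _. unfold Cconj, RtoC; simpl. f_equal. ring.
        apply (pcont_slice (fun x y => RtoC (G x y))); trivial. apply clamp_range. }
      apply (f_equal Im) in Q. rewrite im_conj in Q. lra. }
    destruct (cmean (fun y => RtoC (G (clamp x) y))) as [p q]. simpl in *. now rewrite I. }
  rewrite (cmean_ext (fun x => cmean (fun y => RtoC (G (clamp x) y))) (fun x => RtoC (g x))) by (intros; apply E).
  pose proof (pcont_clamp_cmean _ HG) as PG.
  apply cmean_norm_le.
  - now apply pcont_clamp_cmean.
  - intros t Ht. specialize (PG t Ht). apply rcont_iff. intros e He.
    destruct (proj1 (rcont_iff _ _) PG e He) as [d [Hd D]]. exists d. split; trivial.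
    intros s Hs. rewrite <- !E. now apply D.
  - intros x Hx. apply cmean_norm_le.
    + apply pcont_slice; trivial. apply clamp_range.
    + apply (pcont_slice (fun x y => RtoC (G x y))); trivial. apply clamp_range.
    + intros y Hy. apply H; trivial. apply clamp_range.
Qed.

(** Turns conjugates on the circle into multiples of 1 / z, which combine with the holomorphic
    factors. *)
Lemma circ_conj (r t : R) : 0 < r -> Cconj (circ r t) = (RtoC (r * r) / circ r t)%C.
Proof.
  intros Hr. pose proof (circ_neq_0 r t Hr) as N.
  replace (RtoC (r * r)) with (circ r t * Cconj (circ r t))%C. field; trivial.
  rewrite <- Cmod2_conj, Cmod_circ by lra. f_equal. ring.
Qed.

Lemma cmean_circ_orth (r : R) (n k : nat) : 0 < r ->
  cmean (fun t => Cconj (circ r t ^ n) * circ r t ^ k)%C = if Nat.eq_dec n k then RtoC (r ^ (2 * n)) else 0%C.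
Proof.
  intros Hr.
  assert (E : forall t, (Cconj (circ r t ^ n) * circ r t ^ k = RtoC (r ^ n * r ^ k) * (cis t ^ k / cis t ^ n))%C).
  { intros t. unfold circ. rewrite !Cpow_mult_l, Cmult_conj, !Cpow_conj, cis_conj, Cpow_inv by apply cis_neq_0.
    replace (Cconj (RtoC r)) with (RtoC r) by (unfold Cconj, RtoC; simpl; f_equal; ring).
    rewrite RtoC_mult, !RtoC_pow. unfold Cdiv. ring. }
  rewrite (cmean_ext _ _ (fun t _ => E t)).
  assert (Pc : forall j, pcont (fun t => cis t ^ j)%C) by (intros j t _; apply rcont_pow, rcont_cis).
  assert (Nj : forall t j, (cis t ^ j)%C <> 0%C) by (intros; apply Cpow_nz, cis_neq_0).
  rewrite cmean_scal by (apply pcont_mult; trivial; apply pcont_inv; auto).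
  destruct (Nat.eq_dec n k) as [<-|N].
  - rewrite (cmean_ext _ (fun _ => 1%C)), cmean_const by (intros; field; apply Nj).
    rewrite <- pow_add. replace (n + n)%nat with (2 * n)%nat by lia. ring.
  - destruct (Nat.lt_ge_cases n k) as [L|L].
    + rewrite (cmean_ext _ (fun t => cis t ^ (k - n))%C). rewrite cmean_cis_pow by lia. ring.
      intros t _. replace k with (k - n + n)%nat at 1 by lia. rewrite Cpow_add_r. field. apply Nj.
    + rewrite (cmean_ext _ (fun t => / cis t ^ (n - k))%C). rewrite cmean_cis_inv_pow by lia. ring.
      intros t _. replace n with (n - k + k)%nat at 1 by lia. rewrite Cpow_add_r. field. split; apply Nj.
Qed.

Lemma cmean_conj_pow_ps (a : nat -> C) (r : R) (n : nat) : conv_D a -> 0 < r < 1 ->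
  cmean (fun t => Cconj (circ r t ^ n) * ps a (circ r t))%C = (a n * RtoC (r ^ (2 * n)))%C.
Proof.
  intros Ha Hr.
  assert (Ph : pcont (fun t => Cconj (circ r t ^ n))) by (apply pcont_conj, pcont_pow, pcont_circ).
  refine (is_csum_unique _ _ _ (is_csum_cmean_ps _ a r Ph Ha ltac:(lra)) _).
  intros e He. exists (S n). intros m Hm.
  rewrite (csum_ext _ (fun k => if Nat.eq_dec n k then a n * RtoC (r ^ (2 * n)) else 0)%C).
  - assert (Q : forall m, csum (fun k => if Nat.eq_dec n k then a n * RtoC (r ^ (2 * n)) else 0)%C m =
      if Compare_dec.le_dec (S n) m then (a n * RtoC (r ^ (2 * n)))%C else 0%C).
    { clear. induction m as [|m IH]; cbn [csum]. destruct Compare_dec.le_dec; trivial; lia. rewrite IH.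
      destruct (Compare_dec.le_dec (S n) m), (Compare_dec.le_dec (S n) (S m)), (Nat.eq_dec n m); try lia; ring. }
    rewrite Q. destruct Compare_dec.le_dec; [|lia].
    match goal with |- Cmod ?x < _ => replace x with (RtoC 0) by ring end. now rewrite Cmod_0.
  - intros k _. rewrite cmean_circ_orth by lra. destruct Nat.eq_dec as [->|]; ring.
Qed.

Lemma parseval (a b : nat -> C) (r : R) : conv_D a -> conv_D b -> 0 < r < 1 ->
  is_csum (fun n => b n * Cconj (a n) * RtoC (r ^ (2 * n)))%C
    (cmean (fun t => Cconj (ps a (circ r t)) * ps b (circ r t))%C).
Proof.
  intros Ha Hb Hr.
  assert (Ph : pcont (fun t => Cconj (ps a (circ r t)))) by (apply pcont_conj, pcont_ps; trivial; lra).
  intros e He. destruct (is_csum_cmean_ps _ b r Ph Hb ltac:(lra) e He) as [N HN].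
  exists N. intros n Hn. erewrite csum_ext. apply (HN n Hn). intros k _. cbv beta.
  rewrite (cmean_ext (fun t => Cconj (ps a (circ r t)) * circ r t ^ k)%C
    (fun t => Cconj (Cconj (circ r t ^ k) * ps a (circ r t)))).
  - rewrite cmean_conj.
    2: { apply pcont_mult. apply pcont_conj, pcont_pow, pcont_circ. apply pcont_ps; trivial; lra. }
    rewrite cmean_conj_pow_ps, Cmult_conj by trivial.
    replace (Cconj (RtoC (r ^ (2 * k)))) with (RtoC (r ^ (2 * k))) by (unfold Cconj, RtoC; simpl; f_equal; ring).
    ring.
  - intros t _. rewrite Cmult_conj, Cconj_conj. ring.
Qed.

(** * The area theorem *)

(** 1 / f(z) = 1 / z + b_1 + q(z), with q vanishing at 0. The index is shifted: n |q_n|^2 is (m - 1)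
    |b_m|^2 for m = n + 1. [tcoef] belongs to z q'(z). *)
Definition qcoef (b : nat -> C) (n : nat) : C := match n with O => RtoC 0 | S m => b (S (S m)) end.

Definition tcoef (b : nat -> C) (n : nat) : C := (RtoC (INR n) * qcoef b n)%C.

Lemma conv_D_qcoef (b : nat -> C) : conv_D b -> conv_D (qcoef b).
Proof. intros Hb. apply conv_D_unshift. do 2 apply conv_D_shift in Hb. exact Hb. Qed.

Lemma conv_D_tcoef (b : nat -> C) : conv_D b -> conv_D (tcoef b).
Proof. intros Hb. now apply conv_D_nmul, conv_D_qcoef. Qed.

Lemma ps_qcoef (b : nat -> C) (z : C) : conv_D b -> b 0%nat = 1%C -> Cmod z < 1 ->
  ps b z = (1 + z * (b 1%nat + ps (qcoef b) z))%C.
Proof.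
  intros Hb H0 Hz. rewrite ps_shift, H0 by trivial. f_equal. f_equal.
  rewrite ps_shift, (ps_shift (qcoef b)) by (trivial; now (apply conv_D_shift || apply conv_D_qcoef)).
  simpl. ring.
Qed.

Lemma ps_dcoef_qcoef (b : nat -> C) (z : C) : conv_D b -> b 0%nat = 1%C -> Cmod z < 1 ->
  ps (dcoef b) z = (b 1%nat + ps (qcoef b) z + ps (tcoef b) z)%C.
Proof.
  intros Hb H0 Hz. pose proof (conv_D_qcoef b Hb) as Hq. unfold tcoef. rewrite <- ps_euler by trivial.
  apply (cderiv_unique (ps b) z). now apply cderiv_ps.
  apply (cderiv_ext_loc (fun w => 1 + w * (b 1%nat + ps (qcoef b) w))%C _ z _ (1 - Cmod z)). lra.
  - intros w Hw. symmetry. apply ps_qcoef; trivial. now apply (Cmod_near z).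
  - replace (b 1%nat + ps (qcoef b) z + z * ps (dcoef (qcoef b)) z)%C
      with (0 + (1 * (b 1%nat + ps (qcoef b) z) + z * (0 + ps (dcoef (qcoef b)) z)))%C by ring.
    exact (cderiv_plus _ _ _ _ _ (cderiv_const 1 z) (cderiv_mult _ _ _ _ _ (cderiv_id z)
      (cderiv_plus _ _ _ _ _ (cderiv_const (b 1%nat) z) (cderiv_ps _ _ Hq Hz)))).
Qed.

(* [b] are the coefficients of z / f(z) for a univalent f: the function [ps b z / z] = 1 / f(z) is
   injective on the punctured disk and its derivative does not vanish. *)
Definition univalent_recip (b : nat -> C) : Prop :=
  conv_D b /\ b 0%nat = 1%C /\
  (forall z w, Cmod z < 1 -> Cmod w < 1 -> z <> 0%C -> w <> 0%C -> (ps b z / z = ps b w / w)%C -> z = w) /\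
  (forall z, Cmod z < 1 -> z <> 0%C -> (ps b z / z - ps (dcoef b) z)%C <> 0%C).

(* For w <> p this is w (ps b p / p - ps b w / w) / (w - p). *)
Definition Sk (b : nat -> C) (p w : C) : C := (ps b p / p - Gam b p w)%C.

Lemma Sk_off (b : nat -> C) (p w : C) : p <> 0%C -> w <> p ->
  Sk b p w = ((w * (ps b p / p) - ps b w) / (w - p))%C.
Proof.
  intros Np Nw. unfold Sk, Gam. rewrite slope_off by trivial. field.
  split; trivial. now apply Cminus_neq_0.
Qed.

(** Off the diagonal this is the injectivity of 1 / f, on the diagonal its nonvanishing derivative,
    and at w = 0 the value is 1 / p. *)
Lemma Sk_neq_0 (b : nat -> C) (p w : C) : univalent_recip b -> Cmod p < 1 -> p <> 0%C -> Cmod w < 1 ->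
  Sk b p w <> 0%C.
Proof.
  intros [Hb [H0 [Inj Der]]] Hp Np Hw. destruct (Ceq_dec w p) as [->|N].
  - unfold Sk, Gam. rewrite slope_at. now apply Der.
  - rewrite Sk_off by trivial. unfold Cdiv at 1. apply Cmult_neq_0.
    + destruct (Ceq_dec w 0) as [->|Nw].
      * rewrite ps_0, H0 by trivial. replace (0 * (ps b p / p) - 1)%C with (- (1))%C by ring.
        intros E. apply (RtoC_neq_0 1). lra. replace (RtoC 1) with (- (- (1)))%C by ring. rewrite E. ring.
      * intros E. apply N. apply Inj; trivial.
        replace (ps b w) with (w * (ps b p / p) - (w * (ps b p / p) - ps b w))%C by ring. rewrite E. field. now split.
    + intros E. apply (RtoC_neq_0 1). lra. rewrite <- (Cinv_r (w - p)), E by now apply Cminus_neq_0. ring.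
Qed.

Lemma holo_Sk (b : nat -> C) (p : C) : conv_D b -> Cmod p < 1 -> holo_D (Sk b p).
Proof.
  intros Hb Hp z Hz. destruct (holo_Gam b p Hb Hp z Hz) as [l Hl]. eexists.
  apply cderiv_minus. apply cderiv_const. apply Hl.
Qed.

(** Rests on the symmetry of Sk b p w / w in p and w. The left side is holomorphic in w for fixed p,
    the right side in p for fixed w including p = 0, so mean values can be taken in either
    variable. *)
Lemma Sk_log_derivative_sym (b : nat -> C) (p w m : C) : univalent_recip b ->
  Cmod p < 1 -> p <> 0%C -> Cmod w < 1 -> w <> 0%C -> cderiv (Sk b p) w m ->
  (w * (m / Sk b p w) = p * (- Gam2 b w p / Sk b w p))%C.
Proof.
  intros U Hp Np Hw Nw Hm. pose proof (Sk_neq_0 b p w U Hp Np Hw) as N1.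
  pose proof (Sk_neq_0 b w p U Hw Nw Hp) as N2. destruct U as [Hb [H0 [Inj Der]]].
  destruct (Ceq_dec w p) as [->|N].
  - assert (E : m = (- Gam2 b p p)%C); [|now rewrite E].
    apply (cderiv_unique (Sk b p) p); trivial.
    replace (- Gam2 b p p)%C with (0 - Gam2 b p p)%C by ring.
    apply cderiv_minus. apply cderiv_const. unfold Gam2. rewrite slope_at. now apply cderiv_Gam_at.
  - assert (N' : p <> w) by now apply not_eq_sym.
    pose proof (Cminus_neq_0 _ _ N) as D1. pose proof (Cminus_neq_0 _ _ N') as D2.
    set (g0 := ps b p) in *. set (g1 := ps b w) in *. set (d := ps (dcoef b) w).
    assert (E : m = (- ((d * (w - p) - (g1 - g0)) / ((w - p) * (w - p))))%C).
    { apply (cderiv_unique (Sk b p) w); trivial.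
      replace (- ((d * (w - p) - (g1 - g0)) / ((w - p) * (w - p))))%C
        with (0 - ((d * (w - p) - (g1 - g0)) / ((w - p) * (w - p))))%C by ring.
      apply cderiv_minus. apply cderiv_const. apply cderiv_slope_off; trivial. now apply cderiv_ps. }
    rewrite Sk_off in N1 |- * by trivial. rewrite Sk_off in N2 |- * by trivial.
    fold g0 g1 in N1, N2 |- *. rewrite E. unfold Gam2, Gam. rewrite slope_off, slope_at, slope_off by trivial.
    fold g0 g1 d.
    assert (N3 : (w * g0 - p * g1)%C <> 0%C).
    { intros Z. apply N1. replace ((w * (g0 / p) - g1) / (w - p))%C with ((w * g0 - p * g1) / (p * (w - p)))%C by (field; now split).
      rewrite Z. field. now split. }
    assert (N4 : (p * g1 - w * g0)%C <> 0%C).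
    { intros Z. apply N3. replace (w * g0 - p * g1)%C with (- (p * g1 - w * g0))%C by ring. rewrite Z. ring. }
    field. repeat split; trivial; [now rewrite (Cmult_comm g0)|now rewrite (Cmult_comm g1)].
Qed.

(** w times the logarithmic derivative in w of [Sk b p w * (p - rho * w)], its first term written in
    the form that is holomorphic in p. On a circle the angular derivative of the logarithmic kernel
    is [Ci * Nk] plus its conjugate. *)
Definition Nk (b : nat -> C) (rho : R) (p w : C) : C :=
  (p * (- Gam2 b w p / Sk b w p) - RtoC rho * w / (p - RtoC rho * w))%C.

Lemma shrink_neq (rho : R) (p w : C) : 0 < rho < 1 -> p <> 0%C -> Cmod w <= Cmod p -> (p - RtoC rho * w)%C <> 0%C.
Proof.
  intros Hr Np Hw. apply Cminus_neq_0. intros E. apply Cmod_gt_0 in Np.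
  apply (f_equal Cmod) in E. rewrite Cmod_mult, Cmod_R, Rabs_pos_eq in E by lra. nra.
Qed.

Definition Wf (b : nat -> C) (z : C) : C := (ps b z / z)%C.

(** The angular derivative i z W'(z) = i (z q'(z) - 1 / z) of W = 1 / f on circles, that is, the
    tangent of the curve. Being a derivative along a closed curve, it has mean zero. *)
Definition cf (b : nat -> C) (z : C) : C := (Ci * (ps (tcoef b) z - / z))%C.

Lemma rderiv_Wf (b : nat -> C) (r t : R) : conv_D b -> b 0%nat = 1%C -> 0 < r < 1 ->
  rderiv (fun s => Wf b (circ r s)) t (cf b (circ r t)).
Proof.
  intros Hb H0 Hr. set (z := circ r t).
  assert (Nz : z <> 0%C) by (apply circ_neq_0; lra).
  assert (Hz : Cmod z < 1) by (unfold z; rewrite Cmod_circ; lra).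
  replace (cf b z) with ((ps (dcoef b) z * z - ps b z * 1) / (z * z) * (Ci * z))%C.
  - apply (rderiv_comp (circ r)). apply rderiv_circ. apply (cderiv_div (ps b) (fun z => z)); trivial.
    now apply cderiv_ps. apply cderiv_id.
  - unfold cf. rewrite ps_dcoef_qcoef, (ps_qcoef b z) by trivial. field. trivial.
Qed.

Lemma pcont_Wf (b : nat -> C) (r : R) : conv_D b -> 0 < r < 1 -> pcont (fun t => Wf b (circ r t)).
Proof.
  intros Hb Hr. apply pcont_mult. apply pcont_ps; trivial; lra. apply pcont_inv. apply pcont_circ.
  intros; apply circ_neq_0; lra.
Qed.

Lemma pcont_circ_inv (r : R) : 0 < r -> pcont (fun t => / circ r t)%C.
Proof. intros Hr. apply pcont_inv. apply pcont_circ. intros; now apply circ_neq_0. Qed.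

Lemma pcont_cf (b : nat -> C) (r : R) : conv_D b -> 0 < r < 1 -> pcont (fun t => cf b (circ r t)).
Proof.
  intros Hb Hr. apply pcont_mult. apply pcont_const. intros t Ht. apply rcont_minus.
  apply (pcont_ps _ r (conv_D_tcoef b Hb)); trivial; lra. apply pcont_circ_inv; trivial; lra.
Qed.

Lemma cmean_cf (b : nat -> C) (r : R) : conv_D b -> b 0%nat = 1%C -> 0 < r < 1 ->
  cmean (fun t => cf b (circ r t)) = 0%C.
Proof.
  intros Hb H0 Hr. apply (cmean_rderiv (fun s => Wf b (circ r s))).
  - intros t _. now apply rderiv_Wf.
  - now apply pcont_cf.
  - now rewrite circ_periodic.
Qed.

Lemma pcont2_Sk (b : nat -> C) (r : R) : conv_D b -> 0 < r < 1 ->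
  pcont2 (fun u v => Sk b (circ r u) (circ r v)).
Proof.
  intros Hb Hr. apply (pcont2_plus (fun u v => Wf b (circ r u)) (fun u v => - Gam b (circ r u) (circ r v))%C).
  - apply (pcont2_l (fun u => Wf b (circ r u))). now apply pcont_Wf.
  - apply pcont2_opp. apply pcont2_Gam; trivial. lra.
Qed.

Lemma pcont2_shrink (rho r : R) : pcont2 (fun u v => circ r u - RtoC rho * circ r v)%C.
Proof.
  apply (pcont2_plus (fun u _ => circ r u) (fun _ v => - (RtoC rho * circ r v))%C).
  - apply pcont2_l, pcont_circ.
  - apply pcont2_opp. apply pcont2_mult. apply pcont2_const. apply (pcont2_r (circ r)), pcont_circ.
Qed.

Lemma pcont2_Nk (b : nat -> C) (rho r : R) : univalent_recip b -> 0 < r < 1 -> 0 < rho < 1 ->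
  pcont2 (fun u v => Nk b rho (circ r u) (circ r v)).
Proof.
  intros U Hr Hrho. pose proof (proj1 U) as Hb.
  assert (Hc : forall t, Cmod (circ r t) = r) by (intros; apply Cmod_circ; lra).
  assert (Nc : forall t, circ r t <> 0%C) by (intros; apply circ_neq_0; lra).
  apply (pcont2_plus (fun u v => circ r u * (- Gam2 b (circ r v) (circ r u) / Sk b (circ r v) (circ r u)))%C
    (fun u v => - (RtoC rho * circ r v / (circ r u - RtoC rho * circ r v)))%C).
  - apply pcont2_mult. apply pcont2_l, pcont_circ. apply pcont2_mult.
    + apply pcont2_opp. apply (pcont2_swap (fun u v => Gam2 b (circ r u) (circ r v))). apply pcont2_Gam2; trivial. lra.
    + apply pcont2_inv. apply (pcont2_swap (fun u v => Sk b (circ r u) (circ r v))). now apply pcont2_Sk.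
      intros x y _ _. apply Sk_neq_0; trivial; rewrite Hc; lra.
  - apply pcont2_opp. apply pcont2_mult.
    + apply pcont2_mult. apply pcont2_const. apply (pcont2_r (circ r)), pcont_circ.
    + apply pcont2_inv. apply pcont2_shrink.
      intros x y _ _. apply shrink_neq; trivial. rewrite !Hc. lra.
Qed.

(** The factor p - rho w vanishes at a point with |w| = |p| / rho, possibly inside the unit disk, so
    the mean value property is needed on smaller disks. *)
Lemma cmean_holo_radius (h : C -> C) (r R0 : R) : 0 < r < R0 ->
  (forall z, Cmod z < R0 -> exists l, cderiv h z l) -> cmean (fun t => h (circ r t)) = h 0%C.
Proof.
  intros Hr Hh.
  rewrite (cmean_ext _ (fun t => h (RtoC R0 * circ (r / R0) t)%C)).
  - rewrite (cmean_holo (fun u => h (RtoC R0 * u)%C)).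
    + f_equal. ring.
    + intros u Hu. destruct (Hh (RtoC R0 * u)%C) as [l Hl].
      { rewrite Cmod_mult, Cmod_R, Rabs_pos_eq by lra. nra. }
      eexists. apply (cderiv_comp (fun u => RtoC R0 * u)%C h). apply cderiv_scal, cderiv_id. apply Hl.
    + split. apply Rdiv_lt_0_compat; lra. apply Rmult_lt_reg_r with R0. lra.
      unfold Rdiv. rewrite Rmult_assoc, Rinv_l; lra.
  - intros t _. f_equal. unfold circ. rewrite Cmult_assoc, <- RtoC_mult. do 2 f_equal. field. lra.
Qed.

(** In the variable w the pole of 1 / f at 0 is cancelled by the factor w in [Nk]; the integrand
    extends holomorphically, and its mean is its value at 0. *)
Lemma mean_W_Nk (b : nat -> C) (rho r : R) (z : C) : univalent_recip b -> 0 < r < 1 -> 0 < rho < 1 ->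
  Cmod z = r -> cmean (fun t => Wf b (circ r t) * Nk b rho z (circ r t))%C = (- (ps (qcoef b) z + RtoC rho / z))%C.
Proof.
  intros U Hr Hrho Hz. pose proof U as [Hb [H0 _]].
  assert (Nz : z <> 0%C) by (apply Cmod_gt_0; lra).
  assert (Hz1 : Cmod z < 1) by lra.
  destruct (taylor_D _ (holo_Sk b z Hb Hz1)) as [Ca Ta]. set (a := taylor_coef (Sk b z)) in *.
  assert (DS : forall w, Cmod w < 1 -> cderiv (Sk b z) w (ps (dcoef a) w)).
  { intros w Hw. apply (cderiv_ext_loc (ps a) _ w _ (1 - Cmod w)). lra.
    intros u Hu. symmetry. apply Ta. now apply (Cmod_near w). now apply cderiv_ps. }
  set (R0 := Rmin 1 (r / rho)).
  assert (HR : r < R0).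
  { apply Rmin_glb_lt. lra. apply Rmult_lt_reg_r with rho. lra. unfold Rdiv. rewrite Rmult_assoc, Rinv_l by lra. nra. }
  assert (HRw : forall w, Cmod w < R0 -> Cmod w < 1 /\ (z - RtoC rho * w)%C <> 0%C).
  { intros w Hw. split. eapply Rlt_le_trans. apply Hw. apply Rmin_l.
    apply Cminus_neq_0. intros E. apply (f_equal Cmod) in E. rewrite Cmod_mult, Cmod_R, Rabs_pos_eq, Hz in E by lra.
    pose proof (Rlt_le_trans _ _ _ Hw (Rmin_r _ _)) as L. apply (Rmult_lt_compat_l rho) in L; [|lra].
    replace (rho * (r / rho))%R with r in L by (field; lra). lra. }
  set (h := fun w => (ps b w * (ps (dcoef a) w / Sk b z w - RtoC rho / (z - RtoC rho * w)))%C).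
  rewrite (cmean_ext _ (fun t => h (circ r t))).
  - assert (Hh : forall w, Cmod w < R0 -> exists l, cderiv h w l).
    { intros w Hw. destruct (HRw w Hw) as [W1 W2]. unfold h. eexists. apply cderiv_mult. now apply cderiv_ps.
      apply cderiv_minus.
      - apply cderiv_div. apply cderiv_ps; trivial. now apply conv_D_dcoef. now apply DS. now apply Sk_neq_0.
      - apply (cderiv_div (fun _ => RtoC rho) (fun w => z - RtoC rho * w)%C); trivial. apply cderiv_const.
        apply cderiv_minus. apply cderiv_const. apply cderiv_scal, cderiv_id. }
    rewrite (cmean_holo_radius h r R0) by (trivial; lra).
    unfold h. rewrite ps_0, H0 by trivial.
    assert (P0 : Cmod 0 < 1) by (rewrite Cmod_0; lra).
    assert (N0 : (0 : C) <> z) by now apply not_eq_sym.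
    assert (D0 : ps (dcoef a) 0 = (0 - (ps (dcoef b) 0 * (0 - z) - (ps b 0 - ps b z)) / ((0 - z) * (0 - z)))%C).
    { apply (cderiv_unique (Sk b z) 0). now apply DS.
      apply cderiv_minus. apply cderiv_const. apply cderiv_slope_off; trivial. now apply cderiv_ps. }
    rewrite D0, Sk_off by trivial. rewrite (ps_0 b), (ps_0 (dcoef b)) by (trivial; now apply conv_D_dcoef).
    unfold dcoef. rewrite H0. rewrite (ps_qcoef b z) by trivial. change (INR 1) with 1.
    field. repeat split; trivial.
    + replace (z - rho * 0)%C with z by ring. trivial.
  - intros t _. assert (Nc : circ r t <> 0%C) by (apply circ_neq_0; lra).
    assert (Hc : Cmod (circ r t) = r) by (apply Cmod_circ; lra).
    destruct (HRw (circ r t)) as [W1 W2]. lra.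
    unfold Nk, h, Wf. rewrite <- (Sk_log_derivative_sym b z (circ r t) _ U Hz1 Nz W1 Nc (DS _ W1)).
    field. repeat split; trivial. now apply Sk_neq_0.
Qed.

Lemma Cconj_RtoC (x : R) : Cconj (RtoC x) = RtoC x.
Proof. unfold Cconj, RtoC; simpl. f_equal. ring. Qed.

Lemma Cconj_Ci : Cconj Ci = (- Ci)%C.
Proof. unfold Cconj, Ci, Copp; simpl. f_equal; ring. Qed.

Lemma Ci_sqr : (Ci * Ci = - (1))%C.
Proof. unfold Ci, Cmult, Copp, RtoC; simpl. f_equal; ring. Qed.

Lemma holo_const (c : C) : holo_D (fun _ => c).
Proof. intros z _. eexists. apply cderiv_const. Qed.

Lemma holo_id : holo_D (fun z => z).
Proof. intros z _. eexists. apply cderiv_id. Qed.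

Lemma holo_mult (f g : C -> C) : holo_D f -> holo_D g -> holo_D (fun z => f z * g z)%C.
Proof.
  intros Hf Hg z Hz. destruct (Hf z Hz) as [l Hl], (Hg z Hz) as [m Hm]. eexists.
  apply cderiv_mult. apply Hl. apply Hm.
Qed.

Lemma holo_minus (f g : C -> C) : holo_D f -> holo_D g -> holo_D (fun z => f z - g z)%C.
Proof.
  intros Hf Hg z Hz. destruct (Hf z Hz) as [l Hl], (Hg z Hz) as [m Hm]. eexists.
  apply cderiv_minus. apply Hl. apply Hm.
Qed.

Lemma pcont_holo (f : C -> C) (r : R) : holo_D f -> 0 <= r < 1 -> pcont (fun t => f (circ r t)).
Proof.
  intros Hf Hr. apply pcont_comp_circ. lra. intros z Hz. destruct (Hf z ltac:(lra)) as [l Hl].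
  exact (cderiv_ccont _ _ _ Hl).
Qed.

Lemma ps_tcoef_0 (b : nat -> C) : conv_D b -> ps (tcoef b) 0 = 0%C.
Proof. intros Hb. rewrite ps_0 by now apply conv_D_tcoef. unfold tcoef. simpl. ring. Qed.

(** In the first variable the symmetric form of the logarithmic derivative is holomorphic, while p -
    rho w contributes a Cauchy kernel at the inner point rho w; hence the value of z q' at the
    shrunken point. *)
Lemma mean_cf_Nk (b : nat -> C) (rho r : R) (w : C) : univalent_recip b -> 0 < r < 1 -> 0 < rho < 1 ->
  Cmod w = r ->
  cmean (fun t => cf b (circ r t) * Nk b rho (circ r t) w)%C
    = (Ci * (ps (tcoef b) w - ps (tcoef b) (RtoC rho * w)))%C.
Proof.
  intros U Hr Hrho Hw. pose proof U as [Hb [H0 _]].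
  assert (Nw : w <> 0%C) by (apply Cmod_gt_0; lra). assert (Hw1 : Cmod w < 1) by lra.
  pose proof (conv_D_tcoef b Hb) as Ht.
  set (T := ps (tcoef b)). set (p := (RtoC rho * w)%C).
  assert (Nrho : RtoC rho <> 0%C) by (apply RtoC_neq_0; lra).
  assert (Np : p <> 0%C) by now apply Cmult_neq_0.
  assert (Hp : Cmod p < r) by (unfold p; rewrite Cmod_mult, Cmod_R, Rabs_pos_eq, Hw by lra; nra).
  set (D := fun z => (- Gam2 b w z / Sk b w z)%C).
  assert (HD : holo_D D).
  { intros z Hz. destruct (holo_Gam2 b w Hb Hw1 z Hz) as [l Hl]. destruct (holo_Sk b w Hb Hw1 z Hz) as [m Hm].
    eexists. apply cderiv_div. apply cderiv_opp. apply Hl. apply Hm. now apply Sk_neq_0. }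
  assert (HT : holo_D T) by now apply holo_D_ps.
  assert (D0 : D 0%C = (- T w)%C).
  { assert (N0 : (0 : C) <> w) by now apply not_eq_sym.
    unfold D, T. rewrite Sk_off by trivial. unfold Gam2. rewrite slope_off by trivial.
    unfold Gam. rewrite slope_at, slope_off, ps_0, H0, ps_dcoef_qcoef, (ps_qcoef b w) by trivial.
    field. repeat split; trivial. }
  assert (Nc : forall t, circ r t <> 0%C) by (intros; apply circ_neq_0; lra).
  assert (Npc : forall t, (circ r t - p)%C <> 0%C).
  { intros t. apply Cminus_neq_0. intros E. rewrite <- E, Cmod_circ in Hp; lra. }
  assert (Pk : pcont (fun t => circ r t / (circ r t - p))%C).
  { apply pcont_mult. apply pcont_circ. apply pcont_inv; trivial. apply pcont_plus. apply pcont_circ. apply pcont_const. }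
  assert (PT : pcont (fun t => T (circ r t))) by (apply pcont_holo; trivial; lra).
  assert (Pi : pcont (fun t => / circ r t)%C) by (apply pcont_circ_inv; lra).
  set (F1 := fun z => ((z * T z - 1) * D z)%C).
  assert (HF1 : holo_D F1).
  { apply (holo_mult (fun z => z * T z - 1)%C D); trivial. apply (holo_minus (fun z => z * T z)%C).
    apply holo_mult; trivial. apply holo_id. apply holo_const. }
  assert (PF1 : pcont (fun t => F1 (circ r t))) by (apply pcont_holo; trivial; lra).
  (* Partial fractions in z = circ r t: what remains are holomorphic functions, products with the
     Cauchy kernel z / (z - p), a constant and 1 / z. *)
  rewrite (cmean_ext _ (fun t => Ci * (F1 (circ r t) + (- (1)) * (T (circ r t) * (circ r t / (circ r t - p)))
     + T (circ r t) + / p * (circ r t / (circ r t - p)) + - / p + (- (1)) * / circ r t))%C).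
  - assert (PTk : pcont (fun t => T (circ r t) * (circ r t / (circ r t - p)))%C) by now apply pcont_mult.
    assert (Q1 : pcont (fun t => (- (1)) * (T (circ r t) * (circ r t / (circ r t - p))))%C) by (apply pcont_mult; trivial; apply pcont_const).
    assert (Q2 : pcont (fun t => / p * (circ r t / (circ r t - p)))%C) by (apply pcont_mult; trivial; apply pcont_const).
    assert (Q3 : pcont (fun t => (- (1)) * / circ r t)%C) by (apply pcont_mult; trivial; apply pcont_const).
    pose proof (pcont_const (- / p)) as Q4.
    pose proof (pcont_plus _ _ PF1 Q1) as R1. pose proof (pcont_plus _ _ R1 PT) as R2.
    pose proof (pcont_plus _ _ R2 Q2) as R3. pose proof (pcont_plus _ _ R3 Q4) as R4. pose proof (pcont_plus _ _ R4 Q3) as R5.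
    rewrite cmean_scal by exact R5.
    rewrite (cmean_plus _ _ R4 Q3), (cmean_plus _ _ R3 Q4), (cmean_plus _ _ R2 Q2), (cmean_plus _ _ R1 PT), (cmean_plus _ _ PF1 Q1).
    rewrite !cmean_scal, cmean_const by trivial.
    rewrite (cauchy_formula T p r HT) by lra. rewrite cauchy_kernel_mean by trivial.
    rewrite (cmean_holo F1 r HF1 Hr), (cmean_holo T r HT Hr).
    rewrite (cmean_ext (fun t => / circ r t)%C (fun t => / circ r t ^ 1)%C) by (intros; simpl; f_equal; ring).
    rewrite cmean_circ_pow_inv by (lra || lia).
    unfold F1. rewrite D0. replace (T 0%C) with (RtoC 0) by (unfold T; now rewrite ps_tcoef_0). ring.
  - intros t _. unfold cf, Nk. fold T p. fold (D (circ r t)). unfold F1. field.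
    repeat split; trivial.
Qed.

Lemma pcont2_log_kernel (b : nat -> C) (rho r : R) : univalent_recip b -> 0 < r < 1 -> 0 < rho < 1 ->
  pcont2 (fun x y => RtoC (ln (Cmod (Sk b (circ r x) (circ r y) * (circ r x - RtoC rho * circ r y)) ^ 2))).
Proof.
  intros U Hr Hrho. pose proof (proj1 U) as Hb. apply pcont2_ln.
  - apply pcont2_RtoC_Cmod2. apply pcont2_mult. now apply pcont2_Sk. apply pcont2_shrink.
  - intros x y _ _. apply pow_lt. apply Cmod_gt_0. apply Cmult_neq_0.
    + apply Sk_neq_0; trivial. rewrite Cmod_circ; lra. apply circ_neq_0; lra. rewrite Cmod_circ; lra.
    + apply shrink_neq; trivial. apply circ_neq_0; lra. rewrite !Cmod_circ; lra.
Qed.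

(** [cf] is the derivative of [Wf], so integration by parts replaces the logarithm by [Ci * Nk] and
    its conjugate. The first piece is evaluated at once by [mean_W_Nk]; the conjugate one waits for
    the other variable. *)
Lemma inner_by_parts (b : nat -> C) (rho r : R) (x : R) : univalent_recip b -> 0 < r < 1 -> 0 < rho < 1 ->
  0 <= x <= 2 * PI ->
  cmean (fun y => cf b (circ r y) *
     RtoC (ln (Cmod (Sk b (circ r x) (circ r y) * (circ r x - RtoC rho * circ r y)) ^ 2)))%C
  = (Ci * (ps (qcoef b) (circ r x) + RtoC rho / circ r x)
     + Ci * cmean (fun y => Wf b (circ r y) * Cconj (Nk b rho (circ r x) (circ r y))))%C.
Proof.
  intros U Hr Hrho Hx. pose proof U as [Hb [H0 _]]. set (z := circ r x).
  assert (Hz : Cmod z = r) by (apply Cmod_circ; lra). assert (Hz1 : Cmod z < 1) by lra.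
  assert (Nz : z <> 0%C) by (apply circ_neq_0; lra).
  assert (Hc : forall t, Cmod (circ r t) = r) by (intros; apply Cmod_circ; lra).
  assert (Hc1 : forall t, Cmod (circ r t) < 1) by (intros; rewrite Hc; lra).
  assert (Nc : forall t, circ r t <> 0%C) by (intros; apply circ_neq_0; lra).
  assert (Nsh : forall t, (z - RtoC rho * circ r t)%C <> 0%C).
  { intros t. apply shrink_neq; trivial. rewrite Hc. lra. }
  assert (NS : forall t, Sk b z (circ r t) <> 0%C) by (intros; now apply Sk_neq_0).
  pose proof (pcont_slice (fun u v => Nk b rho (circ r u) (circ r v)) x Hx (pcont2_Nk b rho r U Hr Hrho)) as PN.
  cbv beta in PN. fold z in PN.
  pose proof (pcont_Wf b r Hb Hr) as PW.
  set (N := fun y => Nk b rho z (circ r y)) in *.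
  assert (PN1 : pcont (fun y => Ci * N y + Cconj (Ci * N y))%C).
  { apply pcont_plus. apply pcont_mult; trivial. apply pcont_const.
    apply pcont_conj, pcont_mult; trivial. apply pcont_const. }
  rewrite (cmean_by_parts (fun y => Wf b (circ r y)) _ _ (fun y => Ci * N y + Cconj (Ci * N y))%C).
  - rewrite (cmean_ext _ (fun y => Ci * (Wf b (circ r y) * N y) + (- Ci) * (Wf b (circ r y) * Cconj (N y))))%C.
    2: { intros t _. rewrite Cmult_conj, Cconj_Ci. ring. }
    assert (Q1 : pcont (fun y => Wf b (circ r y) * N y)%C) by now apply pcont_mult.
    assert (Q2 : pcont (fun y => Wf b (circ r y) * Cconj (N y))%C) by (apply pcont_mult; trivial; now apply pcont_conj).
    rewrite cmean_plus by (apply pcont_mult; trivial; apply pcont_const).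
    rewrite !cmean_scal by trivial. unfold N at 1. rewrite (mean_W_Nk b rho r z U Hr Hrho Hz).
    unfold N. ring.
  - intros t _. now apply rderiv_Wf.
  - intros t _. destruct (holo_Sk b z Hb Hz1 (circ r t) (Hc1 t)) as [m Hm].
    assert (D1 : cderiv (fun w => Sk b z w * (z - RtoC rho * w))%C (circ r t)
      (m * (z - RtoC rho * circ r t) + Sk b z (circ r t) * (0 - RtoC rho * 1))).
    { exact (cderiv_mult _ _ _ _ _ Hm
        (cderiv_minus _ _ _ _ _ (cderiv_const z _) (cderiv_scal (RtoC rho) _ _ _ (cderiv_id _)))). }
    pose proof (rderiv_comp (circ r) _ t _ _ (rderiv_circ r t) D1) as D2.
    apply rderiv_ln_Cmod2 in D2; [|now apply Cmult_neq_0].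
    match type of D2 with rderiv _ _ (?q + Cconj ?q)%C => replace (Ci * N t)%C with q end. exact D2.
    unfold N, Nk. rewrite <- (Sk_log_derivative_sym b z (circ r t) m U Hz1 Nz (Hc1 t) (Nc t) Hm). field.
    now split.
  - now apply pcont_cf.
  - trivial.
  - now rewrite circ_periodic.
  - now rewrite circ_periodic.
Qed.

Definition shrink_coef (rho : R) (a : nat -> C) (n : nat) : C := (RtoC (rho ^ n) * a n)%C.

Lemma conv_D_shrink (rho : R) (a : nat -> C) : 0 <= rho <= 1 -> conv_D a -> conv_D (shrink_coef rho a).
Proof.
  intros Hr Ha. apply (conv_D_le a _ 1 Ha). intros n. unfold shrink_coef. rewrite Cmod_mult, Cmod_R.
  apply Rmult_le_compat_r. apply Cmod_ge_0. rewrite Rabs_pos_eq by (apply pow_le; lra).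
  rewrite <- (pow1 n). apply pow_incr. lra.
Qed.

Lemma ps_shrink (rho : R) (a : nat -> C) (z : C) : ps a (RtoC rho * z) = ps (shrink_coef rho a) z.
Proof.
  unfold ps, cseries. f_equal; apply Series_ext; intros n; unfold shrink_coef;
    rewrite Cpow_mult_l, RtoC_pow; f_equal; ring.
Qed.

Lemma cmean_circ_ps (a : nat -> C) (r : R) : conv_D a -> 0 < r < 1 ->
  cmean (fun t => circ r t * ps a (circ r t))%C = 0%C.
Proof.
  intros Ha Hr. rewrite (cmean_holo (fun z => z * ps a z)%C); trivial. ring.
  apply holo_mult. apply holo_id. now apply holo_D_ps.
Qed.

(** After integration by parts the conjugate piece is averaged first in the other variable, by
    Fubini and [mean_cf_Nk]. As rho tends to 1 the value tends to the sum of n |q_n|^2 r^(2n) minus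
    1 / r^2, which is minus the area enclosed by the curve, divided by pi. *)
Lemma log_energy_value (b : nat -> C) (rho r : R) : univalent_recip b -> 0 < r < 1 -> 0 < rho < 1 ->
  bilin (fun t => cf b (circ r t))
    (fun x y => RtoC (ln (Cmod (Sk b (circ r x) (circ r y) * (circ r x - RtoC rho * circ r y)) ^ 2)))
  = (2 * cmean (fun t => Cconj (ps (tcoef b) (circ r t)) * ps (qcoef b) (circ r t))
     - cmean (fun t => Cconj (ps (shrink_coef rho (tcoef b)) (circ r t)) * ps (qcoef b) (circ r t))
     - RtoC (rho / (r * r)))%C.
Proof.
  intros U Hr Hrho. pose proof U as [Hb [H0 _]].
  pose proof (conv_D_tcoef b Hb) as Ht. pose proof (conv_D_qcoef b Hb) as Hq.
  pose proof (conv_D_shrink rho _ ltac:(lra) Ht) as Hs.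
  set (c := fun t => cf b (circ r t)).
  pose proof (pcont_cf b r Hb Hr : pcont c) as Pc.
  pose proof (pcont_Wf b r Hb Hr) as PW.
  pose proof (pcont2_Nk b rho r U Hr Hrho) as PN.
  pose proof (pcont_conj c Pc) as Pcc.
  assert (PQ : pcont (fun t => ps (qcoef b) (circ r t))) by (apply pcont_ps; trivial; lra).
  assert (PT : pcont (fun t => ps (tcoef b) (circ r t))) by (apply pcont_ps; trivial; lra).
  assert (PS : pcont (fun t => ps (shrink_coef rho (tcoef b)) (circ r t))) by (apply pcont_ps; trivial; lra).
  pose proof (pcont_circ_inv r (proj1 Hr)) as Pi.
  assert (Nc : forall t, circ r t <> 0%C) by (intros; apply circ_neq_0; lra).
  assert (Hr2 : r * r <> 0) by nra.
  assert (Nr2 : RtoC (r * r) <> 0%C) by now apply RtoC_neq_0.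
  set (A := cmean (fun t => Cconj (ps (tcoef b) (circ r t)) * ps (qcoef b) (circ r t))%C).
  set (B := cmean (fun t => Cconj (ps (shrink_coef rho (tcoef b)) (circ r t)) * ps (qcoef b) (circ r t))%C).
  set (h1 := fun x => (Cconj (c x) * (Ci * (ps (qcoef b) (circ r x) + RtoC rho / circ r x)))%C).
  assert (P1 : pcont h1).
  { apply pcont_mult; trivial. apply pcont_mult. apply pcont_const. apply pcont_plus; trivial.
    apply pcont_mult; trivial. apply pcont_const. }
  set (L2 := fun x y => (Cconj (c x) * (Ci * (Wf b (circ r y) * Cconj (Nk b rho (circ r x) (circ r y)))))%C).
  assert (P2 : pcont2 L2).
  { apply pcont2_mult. now apply (pcont2_l (fun x => Cconj (c x))). apply pcont2_mult. apply pcont2_const.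
    apply pcont2_mult. now apply (pcont2_r (fun y => Wf b (circ r y))). now apply pcont2_conj. }
  assert (E : bilin c (fun x y => RtoC (ln (Cmod (Sk b (circ r x) (circ r y) * (circ r x - RtoC rho * circ r y)) ^ 2)))
     = (cmean h1 + dmean L2)%C).
  { replace (cmean h1) with (dmean (fun x _ => h1 x)) by (apply cmean_ext; intros; apply cmean_const).
    rewrite <- (dmean_plus _ L2 (pcont2_l h1 P1) P2).
    unfold bilin, dmean. apply cmean_ext. intros x Hx.
    pose proof (pcont_slice _ x Hx (pcont2_log_kernel b rho r U Hr Hrho)) as PK.
    rewrite (cmean_ext _ (fun y => Cconj (c x) * (c y * RtoC (ln (Cmod (Sk b (circ r x) (circ r y) * (circ r x - RtoC rho * circ r y)) ^ 2))))%C)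
      by (intros; ring).
    rewrite cmean_scal by now apply pcont_mult.
    unfold c at 2. rewrite inner_by_parts by trivial.
    assert (PN' : pcont (fun y => Wf b (circ r y) * Cconj (Nk b rho (circ r x) (circ r y)))%C).
    { apply pcont_mult; trivial. apply pcont_conj. now apply (pcont_slice _ x Hx PN). }
    rewrite cmean_plus, cmean_const; [|apply pcont_const|now apply (pcont_slice L2)].
    unfold L2. rewrite cmean_scal, cmean_scal; trivial. 2: { apply pcont_mult; trivial. apply pcont_const. }
    unfold h1. ring. }
  rewrite E.
  assert (Cc : forall t, Cconj (c t) = (- Ci * (Cconj (ps (tcoef b) (circ r t)) - circ r t / RtoC (r * r)))%C).
  { intros t. unfold c, cf. rewrite Cmult_conj, Cconj_Ci, Cminus_conj. do 2 f_equal.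
    rewrite Cinv_conj, circ_conj by (trivial; lra). field. now split. }
  assert (E1 : cmean h1 = (A - RtoC (rho / (r * r)))%C).
  { rewrite (cmean_ext _ (fun t => Cconj (ps (tcoef b) (circ r t)) * ps (qcoef b) (circ r t)
      + RtoC (rho / (r * r)) * Cconj (circ r t * ps (tcoef b) (circ r t))
      + RtoC (- / (r * r)) * (circ r t * ps (qcoef b) (circ r t)) + - RtoC (rho / (r * r)))%C).
    - assert (Q1 : pcont (fun t => Cconj (ps (tcoef b) (circ r t)) * ps (qcoef b) (circ r t))%C) by (apply pcont_mult; trivial; now apply pcont_conj).
      assert (Q2' : pcont (fun t => circ r t * ps (tcoef b) (circ r t))%C) by (apply pcont_mult; trivial; apply pcont_circ).
      pose proof (pcont_conj _ Q2') as Q2.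
      assert (Q3 : pcont (fun t => circ r t * ps (qcoef b) (circ r t))%C) by (apply pcont_mult; trivial; apply pcont_circ).
      pose proof (pcont_mult _ _ (pcont_const (RtoC (rho / (r * r)))) Q2) as R2.
      pose proof (pcont_mult _ _ (pcont_const (RtoC (- / (r * r)))) Q3) as R3.
      pose proof (pcont_plus _ _ Q1 R2) as R4. pose proof (pcont_plus _ _ R4 R3) as R5.
      rewrite (cmean_plus _ _ R5 (pcont_const _)), (cmean_plus _ _ R4 R3), (cmean_plus _ _ Q1 R2).
      rewrite !cmean_scal, cmean_const, cmean_conj, !cmean_circ_ps by trivial. rewrite Cconj_RtoC.
      fold A. ring.
    - intros t _. unfold h1. rewrite Cc, Cmult_conj.
      rewrite circ_conj, !RtoC_div, RtoC_opp, RtoC_inv by (trivial; lra).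
      replace (- Ci * (Cconj (ps (tcoef b) (circ r t)) - circ r t / RtoC (r * r)) *
         (Ci * (ps (qcoef b) (circ r t) + RtoC rho / circ r t)))%C
       with (- (Ci * Ci) * ((Cconj (ps (tcoef b) (circ r t)) - circ r t / RtoC (r * r)) *
         (ps (qcoef b) (circ r t) + RtoC rho / circ r t)))%C by ring.
      rewrite Ci_sqr. field. split; trivial. }
  assert (E2 : dmean L2 = (A - B)%C).
  { rewrite dmean_fubini by trivial. unfold dmean.
    rewrite (cmean_ext _ (fun y => Wf b (circ r y) *
       Cconj (ps (tcoef b) (circ r y) - ps (shrink_coef rho (tcoef b)) (circ r y)))%C).
    - rewrite (cmean_ext _ (fun t => Cconj (ps (tcoef b) (circ r t)) * ps (qcoef b) (circ r t)
        + (- (1)) * (Cconj (ps (shrink_coef rho (tcoef b)) (circ r t)) * ps (qcoef b) (circ r t))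
        + RtoC (/ (r * r)) * Cconj (circ r t * ps (tcoef b) (circ r t))
        + RtoC (- / (r * r)) * Cconj (circ r t * ps (shrink_coef rho (tcoef b)) (circ r t))
        + b 1%nat * Cconj (ps (tcoef b) (circ r t))
        + (- b 1%nat) * Cconj (ps (shrink_coef rho (tcoef b)) (circ r t)))%C).
      + assert (Q1 : pcont (fun t => Cconj (ps (tcoef b) (circ r t)) * ps (qcoef b) (circ r t))%C) by (apply pcont_mult; trivial; now apply pcont_conj).
        assert (Q2 : pcont (fun t => Cconj (ps (shrink_coef rho (tcoef b)) (circ r t)) * ps (qcoef b) (circ r t))%C) by (apply pcont_mult; trivial; now apply pcont_conj).
        assert (Q3 : pcont (fun t => circ r t * ps (tcoef b) (circ r t))%C) by (apply pcont_mult; trivial; apply pcont_circ).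
        assert (Q4 : pcont (fun t => circ r t * ps (shrink_coef rho (tcoef b)) (circ r t))%C) by (apply pcont_mult; trivial; apply pcont_circ).
        pose proof (pcont_conj _ Q3) as Q3'. pose proof (pcont_conj _ Q4) as Q4'.
        pose proof (pcont_conj _ PT) as Q5. pose proof (pcont_conj _ PS) as Q6.
        pose proof (pcont_mult _ _ (pcont_const (- (1))%C) Q2) as R2.
        pose proof (pcont_mult _ _ (pcont_const (RtoC (/ (r * r)))) Q3') as R3.
        pose proof (pcont_mult _ _ (pcont_const (RtoC (- / (r * r)))) Q4') as R4.
        pose proof (pcont_mult _ _ (pcont_const (b 1%nat)) Q5) as R5.
        pose proof (pcont_mult _ _ (pcont_const (- b 1%nat)%C) Q6) as R6.
        pose proof (pcont_plus _ _ Q1 R2) as S2. pose proof (pcont_plus _ _ S2 R3) as S3.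
        pose proof (pcont_plus _ _ S3 R4) as S4. pose proof (pcont_plus _ _ S4 R5) as S5.
        rewrite (cmean_plus _ _ S5 R6), (cmean_plus _ _ S4 R5), (cmean_plus _ _ S3 R4), (cmean_plus _ _ S2 R3), (cmean_plus _ _ Q1 R2).
        rewrite !cmean_scal, !cmean_conj, !cmean_circ_ps by trivial.
        rewrite (cmean_holo (ps (tcoef b))), (cmean_holo (ps (shrink_coef rho (tcoef b)))) by (trivial; now apply holo_D_ps).
        rewrite ps_tcoef_0, (ps_0 (shrink_coef rho (tcoef b))) by trivial. unfold shrink_coef at 2, tcoef at 3. simpl INR.
        rewrite !Cmult_0_l, !Cmult_0_r, !Cconj_RtoC. fold A B. ring.
      + intros t _. unfold Wf. rewrite (ps_qcoef b (circ r t)) by (trivial; rewrite Cmod_circ; lra).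
        rewrite !Cmult_conj, Cminus_conj, circ_conj, RtoC_opp, RtoC_inv by (trivial; lra). field. split; trivial.
    - intros y Hy. unfold L2.
      pose proof (pcont_slice_l _ y Hy PN) as PNy. cbv beta in PNy.
      rewrite (cmean_ext _ (fun x => (Ci * Wf b (circ r y)) * Cconj (c x * Nk b rho (circ r x) (circ r y)))%C).
      2: { intros x _. rewrite Cmult_conj. ring. }
      assert (Q : pcont (fun x => c x * Nk b rho (circ r x) (circ r y))%C) by now apply pcont_mult.
      rewrite cmean_scal, cmean_conj by (trivial; now apply pcont_conj).
      unfold c. rewrite mean_cf_Nk by (trivial; apply Cmod_circ; lra). rewrite ps_shrink, Cmult_conj, Cconj_Ci.
      replace (Ci * Wf b (circ r y) * (- Ci * Cconj (ps (tcoef b) (circ r y) - ps (shrink_coef rho (tcoef b)) (circ r y))))%C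
        with (- (Ci * Ci) * (Wf b (circ r y) * Cconj (ps (tcoef b) (circ r y) - ps (shrink_coef rho (tcoef b)) (circ r y))))%C by ring.
      rewrite Ci_sqr. ring. }
  rewrite E1, E2. ring.
Qed.

Lemma ln_le_minus_1 (x : R) : 0 < x -> ln x <= x - 1.
Proof. intros Hx. pose proof (exp_ineq1_le (ln x)) as H. rewrite exp_ln in H; lra. Qed.

(** ln x <= x - 1 is applied to the ratio and to its inverse. The factor d / (t + d) is 1 at t = 0,
    so only its mean is small. The range of [nu] is that of |1 + a conj b|^2 for |a|, |b| <= 1 /
    2. *)
Lemma log_ratio_bound (t d m nu m0 m1 : R) : 0 <= t -> 0 < d -> 0 < m0 -> m0 <= m <= m1 ->
  9 / 16 <= nu <= 25 / 16 ->
  Rabs (ln (t * m + d * nu) - ln (m * (t + d))) <= (25 / 16 / m0 + 1 + 16 / 9 * m1) * (d / (t + d)).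
Proof.
  intros Ht Hd Hm0 Hm Hnu.
  assert (P1 : 0 < t * m + d * nu) by nra. assert (P2 : 0 < m * (t + d)) by nra.
  assert (Ptd : 0 < t + d) by lra.
  assert (U1 : ln (t * m + d * nu) - ln (m * (t + d)) <= 25 / 16 / m0 * (d / (t + d))).
  { rewrite <- ln_div by trivial. eapply Rle_trans. apply ln_le_minus_1. now apply Rdiv_lt_0_compat.
    replace ((t * m + d * nu) / (m * (t + d)) - 1)%R with ((nu / m - 1) * (d / (t + d)))%R by (field; split; lra).
    apply Rmult_le_compat_r. apply Rdiv_le_0_compat; lra.
    assert (nu / m <= 25 / 16 / m0).
    { unfold Rdiv at 1 2. apply Rmult_le_compat; try lra. left; apply Rinv_0_lt_compat; lra. apply Rinv_le_contravar; lra. }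
    lra. }
  assert (U2 : ln (m * (t + d)) - ln (t * m + d * nu) <= (1 + 16 / 9 * m1) * (d / (t + d))).
  { rewrite <- ln_div by trivial. eapply Rle_trans. apply ln_le_minus_1. now apply Rdiv_lt_0_compat.
    replace (m * (t + d) / (t * m + d * nu) - 1)%R with (d * (m - nu) / (t * m + d * nu))%R by (field; lra).
    apply Rmult_le_reg_r with (t * m + d * nu)%R; trivial. unfold Rdiv at 1. rewrite Rmult_assoc, Rinv_l, Rmult_1_r by lra.
    apply Rmult_le_reg_r with (t + d)%R; trivial.
    replace ((1 + 16 / 9 * m1) * (d / (t + d)) * (t * m + d * nu) * (t + d))%R
      with (d * ((1 + 16 / 9 * m1) * (t * m + d * nu)))%R by (field; lra).
    rewrite Rmult_assoc. apply Rmult_le_compat_l. lra.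
    assert (Q : m * (t + d) <= (1 + 16 / 9 * m1) * (t * m + d * nu)).
    { assert (0 <= m1 * (t * m)) by (repeat apply Rmult_le_pos; lra).
      assert (m1 * d * (9 / 16) <= m1 * d * nu) by (apply Rmult_le_compat_l; [apply Rmult_le_pos; lra|lra]).
      assert (m * d <= m1 * d) by (apply Rmult_le_compat_r; lra). nra. }
    nra. }
  assert (0 < 25 / 16 / m0) by (apply Rdiv_lt_0_compat; lra).
  apply Rabs_le. nra.
Qed.

(** On a circle, shrinking one of the points amounts to adding a constant to the squared distance,
    up to the factor rho; this matches the two regularisations. *)
Lemma shrink_norm (r rho x y : R) : 0 < r -> 0 < rho < 1 ->
  Cmod (circ r x - RtoC rho * circ r y) ^ 2
    = rho * (Cmod (circ r y - circ r x) ^ 2 + r * r * ((1 - rho) * (1 - rho)) / rho).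
Proof.
  intros Hr Hrho.
  pose proof (Cmod_circ r x ltac:(lra)) as E1. pose proof (Cmod_circ r y ltac:(lra)) as E2.
  apply (f_equal (fun u => u ^ 2)) in E1. apply (f_equal (fun u => u ^ 2)) in E2.
  rewrite Cmod2_alt in E1, E2. rewrite !Cmod2_alt.
  destruct (circ r x) as [a b], (circ r y) as [c d]. simpl in E1, E2 |- *.
  field_simplify; [|lra]. nra.
Qed.

(** The Poisson kernel r^2 (1 - rho^2) / |z - rho w|^2 has mean 1; the numerator here is smaller by
    the factor (1 - rho) / (1 + rho). *)
Lemma mean_poisson_error (r rho : R) (z : C) : 0 < r < 1 -> 0 < rho < 1 -> Cmod z = r ->
  cmean (fun t => RtoC (r * r * ((1 - rho) * (1 - rho)) / Cmod (z - RtoC rho * circ r t) ^ 2))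
    = RtoC ((1 - rho) / (1 + rho)).
Proof.
  intros Hr Hrho Hz. assert (Nz : z <> 0%C) by (apply Cmod_gt_0; lra).
  set (u := fun w => (RtoC rho * w / (z - RtoC rho * w))%C).
  assert (HR : r < r / rho).
  { apply Rmult_lt_reg_r with rho. lra. unfold Rdiv. rewrite Rmult_assoc, Rinv_l by lra. nra. }
  assert (Ns : forall w, Cmod w < r / rho -> (z - RtoC rho * w)%C <> 0%C).
  { intros w Hw. apply Cminus_neq_0. intros E. apply (f_equal Cmod) in E.
    rewrite Cmod_mult, Cmod_R, Rabs_pos_eq, Hz in E by lra. apply (Rmult_lt_compat_l rho) in Hw; [|lra].
    replace (rho * (r / rho))%R with r in Hw by (field; lra). lra. }
  assert (Hu : forall w, Cmod w < r / rho -> exists l, cderiv u w l).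
  { intros w Hw. eexists. apply (cderiv_div (fun w => RtoC rho * w)%C (fun w => z - RtoC rho * w)%C); [| |now apply Ns].
    apply cderiv_scal, cderiv_id. apply cderiv_minus. apply cderiv_const. apply cderiv_scal, cderiv_id. }
  assert (Pu : pcont (fun t => u (circ r t))).
  { apply pcont_comp_circ. lra. intros w Hw. destruct (Hu w ltac:(lra)) as [l Hl]. exact (cderiv_ccont _ _ _ Hl). }
  assert (Mu : cmean (fun t => u (circ r t)) = 0%C).
  { rewrite (cmean_holo_radius u r (r / rho)) by (trivial; lra). unfold u. field.
    replace (z - RtoC rho * 0)%C with z by ring. trivial. }
  rewrite (cmean_ext _ (fun t => RtoC ((1 - rho) / (1 + rho)) * (1 + (u (circ r t) + Cconj (u (circ r t)))))%C).
  - pose proof (pcont_conj _ Pu) as Pc. pose proof (pcont_plus _ _ Pu Pc) as Puc.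
    rewrite cmean_scal by exact (pcont_plus _ _ (pcont_const 1) Puc).
    rewrite (cmean_plus _ _ (pcont_const 1) Puc), (cmean_plus _ _ Pu Pc), cmean_conj, Mu, cmean_const, Cconj_RtoC by exact Pu. ring.
  - intros t _. assert (Hc : Cmod (circ r t) = r) by (apply Cmod_circ; lra).
    pose proof (Ns (circ r t) ltac:(lra)) as N. set (w := circ r t) in *. set (v := (z - RtoC rho * w)%C) in *.
    assert (Nv : Cconj v <> 0%C) by (apply Cmod_gt_0; rewrite Cmod_conj; now apply Cmod_gt_0).
    assert (Pv : 0 < Cmod v ^ 2) by (apply pow_lt; now apply Cmod_gt_0).
    assert (K : (v * Cconj v + RtoC rho * w * Cconj v + Cconj (RtoC rho * w) * v)%C = RtoC (r * r * (1 - rho * rho))).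
    { replace (v * Cconj v + RtoC rho * w * Cconj v + Cconj (RtoC rho * w) * v)%C
        with (z * Cconj z - RtoC (rho * rho) * (w * Cconj w))%C.
      - rewrite <- !Cmod2_conj, Hz, Hc, <- RtoC_mult, <- RtoC_minus. f_equal. ring.
      - unfold v. rewrite !Cminus_conj, !Cmult_conj, Cconj_RtoC, RtoC_mult. ring. }
    replace (1 + (u w + Cconj (u w)))%C with (RtoC (r * r * (1 - rho * rho)) / RtoC (Cmod v ^ 2))%C.
    + rewrite <- RtoC_div, <- RtoC_mult by lra. f_equal. field. split; try lra; apply Rgt_not_eq; now apply Cmod_gt_0.
    + rewrite <- K, Cmod2_conj. unfold u. fold v. rewrite Cdiv_conj by trivial. field. now split.
Qed.

(** Nonvanishing is assumed on the square only; continuity spreads it to a neighbourhood, on which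
    real and complex inverses agree. *)
Lemma pcont2_RtoC_div (K : R -> R -> C) (k : R) : pcont2 K ->
  (forall x y, 0 <= x <= 2 * PI -> 0 <= y <= 2 * PI -> K x y <> 0%C) ->
  pcont2 (fun x y => RtoC (k / Cmod (K x y) ^ 2)).
Proof.
  intros HK N x y Hx Hy. apply rcont2_iff.
  assert (C1 : ccont (fun w => RtoC (Cmod (K (fst w) (snd w)) ^ 2)) (x, y)).
  { apply (proj1 (rcont2_iff (fun x y => RtoC (Cmod (K x y) ^ 2)) x y)). now apply pcont2_RtoC_Cmod2. }
  assert (P : 0 < Cmod (K x y) ^ 2) by (apply pow_lt; apply Cmod_gt_0; auto).
  assert (C2 := ccont_mult _ _ _ (ccont_const (RtoC k) (x, y)) (ccont_inv _ _ C1 (RtoC_neq_0 _ (Rgt_not_eq _ _ P)))).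
  destruct (HK x y Hx Hy (Cmod (K x y)) (proj1 (Cmod_gt_0 _) (N x y Hx Hy))) as [d [Hd D]].
  apply (ccont_ext_loc _ _ _ d Hd) with (2 := C2).
  intros w Hw. unfold Rdiv. rewrite RtoC_mult. f_equal. symmetry. apply RtoC_inv.
  apply pow_nonzero. intros E. apply Cmod_eq_0 in E.
  assert (Q : Cmod (K (fst w) (snd w) - K x y) < Cmod (K x y)).
  { apply D; (eapply Rle_lt_trans; [|exact Hw]). apply (re_le_Cmod (w - (x, y))). apply (Rabs_snd_Cmod (w - (x, y))). }
  rewrite E in Q. replace (0 - K x y)%C with (- K x y)%C in Q by ring. rewrite Cmod_opp in Q. lra.
Qed.

(** Separates the singular factor w - p of the difference from the zero-free factor [Sk]. *)
Lemma Wf_difference (b : nat -> C) (p w : C) : p <> 0%C -> w <> 0%C ->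
  (Wf b p - Wf b w = (w - p) * Sk b p w / w)%C.
Proof.
  intros Np Nw. destruct (Ceq_dec w p) as [->|N].
  - field. trivial.
  - rewrite Sk_off by trivial. unfold Wf. field. repeat split; trivial. now apply Cminus_neq_0.
Qed.

(** The shrunken kernel is compared with the spherical one, whose energy is nonpositive: they differ
    by a constant, which the zero mean of [cf] kills, and by a function whose absolute mean is O(1 -
    rho). *)
Lemma log_energy_upper_bound (b : nat -> C) (r : R) : univalent_recip b -> 0 < r < 1 ->
  exists C0, 0 <= C0 /\ forall rho, 1 / 2 < rho < 1 ->
   Re (bilin (fun t => cf b (circ r t))
    (fun x y => RtoC (ln (Cmod (Sk b (circ r x) (circ r y) * (circ r x - RtoC rho * circ r y)) ^ 2))))
   <= C0 * (1 - rho).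
Proof.
  intros U Hr. pose proof U as [Hb [H0 _]].
  assert (Hc : forall t, Cmod (circ r t) = r) by (intros; apply Cmod_circ; lra).
  assert (Nc : forall t, circ r t <> 0%C) by (intros; apply circ_neq_0; lra).
  pose proof (pcont_Wf b r Hb Hr) as PW. pose proof (pcont_cf b r Hb Hr) as Pc.
  destruct (pcont_bounded _ PW) as [MW [HMW BW]]. destruct (pcont_bounded _ Pc) as [A [HA BA]].
  pose proof (pcont2_Sk b r Hb Hr) as PS.
  assert (NS : forall x y, Sk b (circ r x) (circ r y) <> 0%C) by (intros; apply Sk_neq_0; trivial; rewrite Hc; lra).
  destruct (pcont2_bounded _ PS) as [M2 [HM2 B2]].
  destruct (pcont2_bounded _ (pcont2_inv _ PS (fun x y _ _ => NS x y))) as [M1 [HM1 B1]].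
  (* The curve is scaled into |w| <= 1 / 2, which keeps |1 + a conj b|^2 between 9 / 16 and 25 /
     16. *)
  set (L := (2 * MW + 1)%R). assert (HL : 0 < L) by (unfold L; lra).
  set (w := fun t => (RtoC (/ L) * Wf b (circ r t))%C).
  assert (Pw : pcont w) by exact (pcont_mult _ _ (pcont_const _) PW).
  assert (Hw : forall t, 0 <= t <= 2 * PI -> Cmod (w t) <= 1 / 2).
  { intros t Ht. unfold w. rewrite Cmod_mult, Cmod_R, Rabs_pos_eq by (left; now apply Rinv_0_lt_compat).
    specialize (BW t Ht). apply Rmult_le_reg_l with L; trivial. rewrite <- Rmult_assoc, Rinv_r by lra. unfold L. lra. }
  set (s := fun x y => Cmod (Sk b (circ r x) (circ r y)) ^ 2).
  (* Collects the constants in |w x - w y|^2 = t s(x, y) / q, where t is the squared distance of the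
     two points on the circle. *)
  set (q := (r * r * (L * L))%R). assert (Hq : 0 < q) by (unfold q; repeat apply Rmult_lt_0_compat; lra).
  set (m0 := (/ ((M1 + 1) ^ 2) / q)%R). set (m1 := (M2 ^ 2 / q)%R).
  assert (HM1' : 0 < (M1 + 1) ^ 2) by (apply pow_lt; lra).
  assert (Hm0 : 0 < m0) by (apply Rdiv_lt_0_compat; trivial; now apply Rinv_0_lt_compat).
  assert (Hm : forall x y, 0 <= x <= 2 * PI -> 0 <= y <= 2 * PI -> m0 <= s x y / q <= m1).
  { intros x y Hx Hy. specialize (B1 x y Hx Hy). specialize (B2 x y Hx Hy). cbv beta in B1.
    rewrite Cmod_inv in B1 by apply NS. pose proof (proj1 (Cmod_gt_0 _) (NS x y)) as P.
    set (X := Cmod (Sk b (circ r x) (circ r y))) in *.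
    unfold m0, m1, s. fold X. split; unfold Rdiv; apply Rmult_le_compat_r; try (left; now apply Rinv_0_lt_compat).
    - rewrite <- (Rinv_inv (X ^ 2)). apply Rinv_le_contravar. apply Rinv_0_lt_compat. now apply pow_lt.
      rewrite <- pow_inv. apply pow_incr. split. left; now apply Rinv_0_lt_compat. lra.
    - apply pow_incr. lra. }
  set (C1 := (25 / 16 / m0 + 1 + 16 / 9 * m1)%R).
  assert (Hm1 : 0 <= m1). { pose proof two_PI_pos. specialize (Hm 0 0 ltac:(lra) ltac:(lra)). lra. }
  assert (HC1 : 0 <= C1).
  { assert (0 < 25 / 16 / m0) by (apply Rdiv_lt_0_compat; lra). unfold C1. lra. }
  exists (A * A * C1)%R. split. { apply Rmult_le_pos; trivial. now apply Rmult_le_pos. }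
  intros rho Hrho. assert (Hrho' : 0 < rho < 1) by lra.
  (* The value for which |p - rho w|^2 = rho (|p - w|^2 + d); it is below 1 since rho > 1 / 2. *)
  set (d := (r * r * ((1 - rho) * (1 - rho)) / rho)%R).
  assert (Hd : 0 < d < 1).
  { assert (0 < (1 - rho) * (1 - rho)) by (apply Rmult_lt_0_compat; lra). unfold d. split.
    - apply Rdiv_lt_0_compat; [|lra]. apply Rmult_lt_0_compat; trivial. nra.
    - apply Rmult_lt_reg_r with rho. lra. unfold Rdiv. rewrite Rmult_assoc, Rinv_l by lra. nra. }
  set (c := fun t => cf b (circ r t)) in *.
  pose proof (log_energy_nonpos w c d Pw Pc (cmean_cf b r Hb H0 Hr) Hd) as EN.
  set (K := fun x y => RtoC (ln (Cmod (Sk b (circ r x) (circ r y) * (circ r x - RtoC rho * circ r y)) ^ 2))).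
  set (Kd := fun x y => RtoC (ln (Cmod (w x - w y) ^ 2 + d * Cmod (1 + w x * Cconj (w y)) ^ 2))) in *.
  assert (PK : pcont2 K) by exact (pcont2_log_kernel b rho r U Hr Hrho').
  assert (Bnu : forall x y, 0 <= x <= 2 * PI -> 0 <= y <= 2 * PI -> 9 / 16 <= Cmod (1 + w x * Cconj (w y)) ^ 2 <= 25 / 16).
  { intros x y Hx Hy. pose proof (Hw x Hx) as W1. pose proof (Hw y Hy) as W2.
    assert (W3 : Cmod (w x * Cconj (w y)) <= 1 / 4).
    { rewrite Cmod_mult, Cmod_conj. pose proof (Cmod_ge_0 (w y)). nra. }
    pose proof (Cmod_triangle 1 (w x * Cconj (w y))) as T1. rewrite Cmod_1 in T1.
    pose proof (Cmod_triangle (1 + w x * Cconj (w y)) (- (w x * Cconj (w y)))) as T2. rewrite Cmod_opp in T2.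
    replace (1 + w x * Cconj (w y) + - (w x * Cconj (w y)))%C with (RtoC 1) in T2 by ring. rewrite Cmod_1 in T2.
    set (X := Cmod (1 + w x * Cconj (w y))) in *. simpl. nra. }
  assert (PKd : pcont2 Kd).
  { apply pcont2_ln.
    - apply (pcont2_ext (fun x y => RtoC (Cmod (w x - w y) ^ 2) + RtoC d * RtoC (Cmod (1 + w x * Cconj (w y)) ^ 2))%C).
      intros x y. now rewrite RtoC_plus, RtoC_mult.
      pose proof (pcont2_l w Pw) as Q1. pose proof (pcont2_r w Pw) as Q2.
      apply pcont2_plus.
      + exact (pcont2_RtoC_Cmod2 _ (pcont2_plus _ _ Q1 (pcont2_opp _ Q2))).
      + apply pcont2_mult. apply pcont2_const.
        exact (pcont2_RtoC_Cmod2 _ (pcont2_plus _ _ (pcont2_const 1) (pcont2_mult _ _ Q1 (pcont2_conj _ Q2)))).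
    - intros x y Hx Hy. specialize (Bnu x y Hx Hy). nra. }
  (* [ln (rho * q)] is the constant that separates the two kernels; its energy is zero. *)
  set (E := fun x y => (Kd x y - K x y + RtoC (ln (rho * q)))%C).
  assert (PE : pcont2 E) by exact (pcont2_plus _ _ (pcont2_plus _ _ PKd (pcont2_opp _ PK)) (pcont2_const _)).
  assert (BE : forall x y, 0 <= x <= 2 * PI -> 0 <= y <= 2 * PI ->
     Cmod (E x y) <= C1 * (r * r * ((1 - rho) * (1 - rho)) / Cmod (circ r x - RtoC rho * circ r y) ^ 2)).
  { intros x y Hx Hy. unfold E, Kd, K. rewrite <- RtoC_minus, <- RtoC_plus, Cmod_R.
    set (t := Cmod (circ r y - circ r x) ^ 2). assert (Ht : 0 <= t) by apply pow2_ge_0.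
    assert (Es : Cmod (circ r x - RtoC rho * circ r y) ^ 2 = rho * (t + d)) by (apply shrink_norm; lra).
    specialize (Hm x y Hx Hy). specialize (Bnu x y Hx Hy). set (nu := Cmod (1 + w x * Cconj (w y)) ^ 2) in *.
    assert (Ew : Cmod (w x - w y) ^ 2 = t * (s x y / q)).
    { unfold w. replace (RtoC (/ L) * Wf b (circ r x) - RtoC (/ L) * Wf b (circ r y))%C
        with (RtoC (/ L) * (Wf b (circ r x) - Wf b (circ r y)))%C by ring.
      rewrite Wf_difference by trivial. rewrite Cmod_mult, Cmod_div, Cmod_mult, Hc, Cmod_R by trivial.
      rewrite Rabs_pos_eq by (left; now apply Rinv_0_lt_compat). unfold t, s, q. field. lra. }
    rewrite Ew, Cmod_mult, Rpow_mult_distr, Es. fold (s x y).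
    assert (Ps : 0 < s x y).
    { apply pow_lt. apply Cmod_gt_0, NS. }
    set (m := (s x y / q)%R) in *.
    assert (El : ln (s x y * (rho * (t + d))) = ln (m * (t + d)) + ln (rho * q)).
    { assert (0 < m * (t + d)) by (apply Rmult_lt_0_compat; lra).
      assert (0 < rho * q) by (apply Rmult_lt_0_compat; lra).
      rewrite <- ln_mult by trivial. f_equal. unfold m. field. lra. }
    rewrite El.
    replace (ln (t * m + d * nu) - (ln (m * (t + d)) + ln (rho * q)) + ln (rho * q))%R
      with (ln (t * m + d * nu) - ln (m * (t + d)))%R by ring.
    replace (r * r * ((1 - rho) * (1 - rho)) / (rho * (t + d)))%R with (d / (t + d))%R.
    2: { replace (r * r * ((1 - rho) * (1 - rho)))%R with (rho * d)%R by (unfold d; field; lra). field. lra. }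
    apply log_ratio_bound; lra. }
  assert (EK : bilin c K = (bilin c Kd - bilin c E)%C).
  { assert (Q : bilin c E = (bilin c Kd + (- (1)) * bilin c K + 0)%C).
    { rewrite <- (bilin_l_zero c (fun _ => RtoC (ln (rho * q))) Pc (pcont_const _) (cmean_cf b r Hb H0 Hr)).
      rewrite <- (bilin_scal (- (1))%C c K Pc PK).
      assert (PK' : pcont2 (fun x y => - (1) * K x y)%C) by exact (pcont2_mult _ _ (pcont2_const _) PK).
      rewrite <- (bilin_plus c _ _ Pc PKd PK').
      rewrite <- (bilin_plus c _ _ Pc (pcont2_plus _ _ PKd PK') (pcont2_const _)).
      apply bilin_ext. intros x y _ _. unfold E. ring. }
    rewrite Q. ring. }
  rewrite EK. unfold Cminus. rewrite re_plus, re_opp.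
  assert (Nsh : forall x y, 0 <= x <= 2 * PI -> 0 <= y <= 2 * PI -> (circ r x - RtoC rho * circ r y)%C <> 0%C).
  { intros x y _ _. apply shrink_neq; trivial. rewrite !Hc. lra. }
  pose proof (pcont2_RtoC_div _ (r * r * ((1 - rho) * (1 - rho))) (pcont2_shrink rho r) Nsh) as PG.
  assert (BD : Cmod (bilin c E) <= A * A * C1 * (1 - rho)).
  { set (G := fun x y => (A * A * C1 * (r * r * ((1 - rho) * (1 - rho)) / Cmod (circ r x - RtoC rho * circ r y) ^ 2))%R).
    assert (PG' : pcont2 (fun x y => RtoC (G x y))).
    { apply (pcont2_ext (fun x y => RtoC (A * A * C1) * RtoC (r * r * ((1 - rho) * (1 - rho)) / Cmod (circ r x - RtoC rho * circ r y) ^ 2))%C).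
      intros x y. unfold G. now rewrite <- RtoC_mult. exact (pcont2_mult _ _ (pcont2_const _) PG). }
    unfold bilin. eapply Rle_trans. apply (dmean_norm_le _ G (pcont2_bilin c E Pc PE) PG').
    - intros x y Hx Hy. rewrite !Cmod_mult, Cmod_conj. unfold G. rewrite Rmult_assoc.
      specialize (BE x y Hx Hy). rewrite <- !(Rmult_assoc (Cmod (c x))).
      rewrite (Rmult_assoc (A * A)). apply Rmult_le_compat; trivial; try apply Cmod_ge_0.
      apply Rmult_le_pos; apply Cmod_ge_0.
      apply Rmult_le_compat; [apply Cmod_ge_0|apply Cmod_ge_0|exact (BA x Hx)|exact (BA y Hy)].
    - rewrite (dmean_ext _ (fun x y => RtoC (A * A * C1) * RtoC (r * r * ((1 - rho) * (1 - rho)) / Cmod (circ r x - RtoC rho * circ r y) ^ 2))%C).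
      2: { intros x y _ _. unfold G. now rewrite <- RtoC_mult. }
      rewrite (dmean_scal _ _ PG).
      unfold dmean. rewrite (cmean_ext _ (fun _ => RtoC ((1 - rho) / (1 + rho)))).
      2: { intros x _. apply mean_poisson_error; trivial. }
      rewrite cmean_const, <- RtoC_mult. simpl.
      apply Rmult_le_compat_l. { apply Rmult_le_pos; trivial. now apply Rmult_le_pos. }
      apply Rmult_le_reg_r with (1 + rho)%R. lra. unfold Rdiv. rewrite Rmult_assoc, Rinv_l by lra. nra. }
  pose proof (re_le_Cmod (bilin c E)) as R1. pose proof (Rle_abs (- Re (bilin c E))) as R2. rewrite Rabs_Ropp in R2.
  lra.
Qed.

Lemma csum_RtoC (u : nat -> R) (n : nat) : csum (fun k => RtoC (u k)) n = RtoC (rsum u n).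
Proof. induction n; simpl. trivial. now rewrite IHn, <- RtoC_plus. Qed.

Lemma is_csum_Re_ge (u : nat -> R) (l : C) (n : nat) : is_csum (fun k => RtoC (u k)) l ->
  (forall k, 0 <= u k) -> rsum u n <= Re l.
Proof.
  intros H Hu. apply le_epsilon. intros e He. destruct (H e He) as [N HN].
  specialize (HN (N + n)%nat ltac:(lia)). rewrite csum_RtoC in HN.
  assert (M : forall k, rsum u n <= rsum u (k + n)).
  { induction k; simpl. lra. specialize (Hu (k + n)%nat). lra. }
  specialize (M N). pose proof (re_le_Cmod (RtoC (rsum u (N + n)) - l)) as R1.
  unfold Cminus in R1. rewrite re_plus, re_opp in R1. simpl (Re (RtoC _)) in R1.
  pose proof (Rle_abs (rsum u (N + n) + - Re l)). unfold Cminus in HN. lra.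
Qed.

(** Value and upper bound of the energy give, on each circle, that the sum of n |q_n|^2 r^(2n) is at
    most 1 / r^2; for a partial sum r may then tend to 1. *)
Theorem area_theorem (b : nat -> C) : univalent_recip b ->
  forall N, rsum (fun n => INR n * Cmod (qcoef b n) ^ 2) N <= 1.
Proof.
  intros U N. pose proof U as [Hb [H0 _]].
  pose proof (conv_D_tcoef b Hb) as Ht. pose proof (conv_D_qcoef b Hb) as Hq.
  set (al := fun n => INR n * Cmod (qcoef b n) ^ 2).
  assert (Pal : forall n, 0 <= al n) by (intros n; apply Rmult_le_pos; [apply pos_INR|apply pow2_ge_0]).
  assert (Step : forall r, 0 < r < 1 -> rsum (fun n => al n * r ^ (2 * n)) N <= 1 / (r * r)).
  { intros r Hr. destruct (log_energy_upper_bound b r U Hr) as [C0 [HC0 UB]].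
    assert (Pr : forall n, 0 <= r ^ n) by (intros; apply pow_le; lra).
    apply le_epsilon. intros e He.
    set (rho := Rmax (3 / 4) (1 - e / (C0 + 1))).
    assert (0 < e / (C0 + 1)) by (apply Rdiv_lt_0_compat; lra).
    assert (Hrho : 1 / 2 < rho < 1).
    { split. eapply Rlt_le_trans; [|apply Rmax_l]. lra. apply Rmax_lub_lt; lra. }
    assert (He2 : C0 * (1 - rho) <= e).
    { assert (1 - e / (C0 + 1) <= rho) by apply Rmax_r.
      apply Rle_trans with (C0 * (e / (C0 + 1)))%R. apply Rmult_le_compat_l; lra.
      apply Rmult_le_reg_r with (C0 + 1)%R. lra. replace (C0 * (e / (C0 + 1)) * (C0 + 1))%R with (C0 * e)%R by (field; lra). nra. }
    specialize (UB rho Hrho). rewrite log_energy_value in UB by (trivial; lra).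
    pose proof (parseval _ _ r Ht Hq Hr) as PA.
    pose proof (parseval _ _ r (conv_D_shrink rho _ ltac:(lra) Ht) Hq Hr) as PB.
    set (A := cmean (fun t => Cconj (ps (tcoef b) (circ r t)) * ps (qcoef b) (circ r t))%C) in *.
    set (B := cmean (fun t => Cconj (ps (shrink_coef rho (tcoef b)) (circ r t)) * ps (qcoef b) (circ r t))%C) in *.
    assert (Eq : forall n, (qcoef b n * Cconj (tcoef b n) = RtoC (al n))%C).
    { intros n. unfold tcoef, al. rewrite Cmult_conj, Cconj_RtoC, RtoC_mult, Cmod2_conj. ring. }
    assert (SA : is_csum (fun n => RtoC (al n * r ^ (2 * n))) A).
    { intros e' He'. destruct (PA e' He') as [K HK]. exists K. intros n Hn. erewrite csum_ext. apply (HK n Hn).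
      intros k _. cbv beta. now rewrite Eq, <- RtoC_mult. }
    assert (SAB : is_csum (fun n => RtoC (al n * r ^ (2 * n) * (1 - rho ^ n))) (A + - (1) * B)%C).
    { intros e' He'. destruct (is_csum_plus _ _ _ _ SA (is_csum_scal (- (1)) _ _ PB) e' He') as [K HK].
      exists K. intros n Hn. erewrite csum_ext. apply (HK n Hn).
      intros k _. cbv beta. unfold shrink_coef. rewrite Cmult_conj, Cconj_RtoC.
      replace (qcoef b k * (RtoC (rho ^ k) * Cconj (tcoef b k)))%C with (RtoC (rho ^ k) * (qcoef b k * Cconj (tcoef b k)))%C by ring.
      rewrite Eq, <- !RtoC_mult, <- RtoC_opp, <- RtoC_mult, <- RtoC_plus. f_equal. ring. }
    pose proof (is_csum_Re_ge _ _ N SA (fun n => Rmult_le_pos _ _ (Pal n) (Pr _))) as G1.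
    (* Termwise rho^n <= 1, so A - B has nonnegative real part and 2 A - B may be replaced by A,
       without a limit of [B]. *)
    assert (G2 : 0 <= Re (A + - (1) * B)%C).
    { apply (is_csum_Re_ge _ _ 0%nat SAB). intros n. apply Rmult_le_pos. apply Rmult_le_pos; auto.
      assert (rho ^ n <= 1) by (rewrite <- (pow1 n); apply pow_incr; lra). lra. }
    assert (UB' : Re (A + (A + - (1) * B))%C - rho / (r * r) <= C0 * (1 - rho)).
    { replace (2 * A - B - RtoC (rho / (r * r)))%C with ((A + (A + - (1) * B)) + - RtoC (rho / (r * r)))%C in UB by ring.
      rewrite re_plus, re_opp in UB. simpl (Re (RtoC _)) in UB. lra. }
    rewrite re_plus in UB'.
    assert (rho / (r * r) <= 1 / (r * r)).
    { unfold Rdiv. apply Rmult_le_compat_r. left; apply Rinv_0_lt_compat; nra. lra. }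
    lra. }
  set (X := rsum al N).
  assert (PX : 0 <= X).
  { unfold X. clear - Pal. induction N; simpl. lra. specialize (Pal N). lra. }
  assert (Low : forall r, 0 < r < 1 -> X * r ^ (2 * N + 2) <= 1).
  { intros r Hr. specialize (Step r Hr).
    assert (Q : r ^ (2 * N) * X <= rsum (fun n => al n * r ^ (2 * n)) N).
    { unfold X. rewrite <- rsum_scal. apply rsum_le. intros k Hk. rewrite Rmult_comm. apply Rmult_le_compat_l; auto.
      replace (2 * N)%nat with (2 * k + (2 * N - 2 * k))%nat by lia. rewrite pow_add.
      rewrite <- (Rmult_1_r (r ^ (2 * k))) at 2. apply Rmult_le_compat_l. apply pow_le; lra.
      rewrite <- (pow1 (2 * N - 2 * k)). apply pow_incr. lra. }
    assert (0 < r * r) by nra.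
    apply (Rmult_le_compat_r (r * r)) in Step; [|lra]. apply (Rmult_le_compat_r (r * r)) in Q; [|lra].
    replace (1 / (r * r) * (r * r))%R with 1 in Step by (field; lra).
    rewrite pow_add. simpl (r ^ 2). lra. }
  apply le_epsilon. intros e He.
  (* With r = 1 - h and h small against 1 / k, Bernoulli's inequality bounds the loss in r^k by k
     h. *)
  set (k := (2 * N + 2)%nat) in *.
  assert (Pk : 0 < INR k) by (apply lt_0_INR; unfold k; lia).
  set (h := Rmin (1 / 2) (e / (INR k * (X + 1)))).
  assert (Hh0 : 0 < e / (INR k * (X + 1))) by (apply Rdiv_lt_0_compat; trivial; apply Rmult_lt_0_compat; lra).
  assert (Hh : 0 < h <= 1 / 2) by (split; [apply Rmin_glb_lt; lra|apply Rmin_l]).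
  specialize (Low (1 - h)%R ltac:(lra)).
  assert (Bern : forall n, 1 - INR n * h <= (1 - h) ^ n).
  { induction n. simpl. lra. rewrite S_INR. simpl. pose proof (pos_INR n).
    assert ((1 - h) * (1 - INR n * h) <= (1 - h) * (1 - h) ^ n) by (apply Rmult_le_compat_l; lra). nra. }
  specialize (Bern k).
  assert (X * (1 - INR k * h) <= X * (1 - h) ^ k) by now apply Rmult_le_compat_l.
  assert (h <= e / (INR k * (X + 1))) by apply Rmin_r.
  assert (INR k * X * h <= e).
  { apply Rle_trans with (INR k * X * (e / (INR k * (X + 1))))%R. apply Rmult_le_compat_l; trivial. apply Rmult_le_pos; lra.
    apply Rmult_le_reg_r with (X + 1)%R. lra.
    replace (INR k * X * (e / (INR k * (X + 1))) * (X + 1))%R with (X * e)%R by (field; split; lra). nra. }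
  fold X. lra.
Qed.

(** * Square-root transform *)

(** With g = ps b one has f' = (g - z g') / g^2, so the derivative condition says that f' does not
    vanish, which injectivity implies. *)
Lemma univalent_recip_intro (f : C -> C) (b : nat -> C) :
  (forall z w, Cmod z < 1 -> Cmod w < 1 -> f z = f w -> z = w) -> conv_D b -> b 0%nat = 1%C ->
  (forall z, Cmod z < 1 -> ps b z <> 0%C /\ f z = (z / ps b z)%C) -> univalent_recip b.
Proof.
  intros Inj Hb H0 Hf.
  assert (Df : forall z, Cmod z < 1 -> cderiv f z ((1 * ps b z - z * ps (dcoef b) z) / (ps b z * ps b z))).
  { intros z Hz. apply (cderiv_ext_loc (fun w => w / ps b w)%C _ z _ (1 - Cmod z)). lra.
    - intros w Hw. symmetry. apply Hf. now apply (Cmod_near z).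
    - apply (cderiv_div (fun w => w)). apply cderiv_id. now apply cderiv_ps. now apply Hf. }
  split; [|split; [|split]]; trivial.
  - intros z w Hz Hw Nz Nw E. apply Inj; trivial. destruct (Hf z Hz) as [N1 ->], (Hf w Hw) as [N2 ->].
    replace (z / ps b z)%C with (/ (ps b z / z))%C by (field; now split). rewrite E. field. now split.
  - intros z Hz Nz E. destruct (Hf z Hz) as [N1 _].
    apply (injective_derivative_neq_0 f z _ (fun w Hw => ex_intro _ _ (Df w Hw)) Inj Hz (Df z Hz)).
    replace (1 * ps b z - z * ps (dcoef b) z)%C with (z * (ps b z / z - ps (dcoef b) z))%C by (field; trivial).
    rewrite E. field. trivial.
Qed.

Lemma zero_derivative_constant (f : C -> C) (z : C) : (forall w, Cmod w < 1 -> cderiv f w 0) ->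
  Cmod z < 1 -> f z = f 0%C.
Proof.
  intros H Hz.
  assert (B : Cmod (f z - f 0%C) <= 0 * Cmod (z - 0)).
  { apply (segment_bound f (fun _ => 0%C)). intros t Ht w. split; [|split].
    - apply H. apply Cmod_segment_lt; trivial. rewrite Cmod_0. lra.
    - apply ccont_const.
    - rewrite Cmod_0. lra. }
  rewrite Rmult_0_l in B.
  assert (E : (f z - f 0 = 0)%C) by (apply Cmod_eq_0; apply Rle_antisym; trivial; apply Cmod_ge_0).
  replace (f z) with (f z - f 0 + f 0)%C by ring. rewrite E. ring.
Qed.

(** With g = ps b, the root is the exponential of half a primitive of g' / g; the exponential of
    that primitive, divided by g, has zero derivative and value 1 at 0. *)
Lemma ps_square_root (b : nat -> C) : conv_D b -> b 0%nat = 1%C ->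
  (forall z, Cmod z < 1 -> ps b z <> 0%C) ->
  exists c, conv_D c /\ c 0%nat = 1%C /\ forall z, Cmod z < 1 -> (ps c z * ps c z = ps b z)%C.
Proof.
  intros Hb H0 HN.
  assert (P0 : Cmod 0 < 1) by (rewrite Cmod_0; lra).
  assert (Hl : holo_D (fun z => ps (dcoef b) z / ps b z)%C).
  { intros z Hz. eexists. apply cderiv_div. apply cderiv_ps; trivial. now apply conv_D_dcoef.
    now apply cderiv_ps. now apply HN. }
  destruct (taylor_D _ Hl) as [Ca Ta]. set (a := taylor_coef (fun z => ps (dcoef b) z / ps b z)%C) in *.
  set (p := fun n => match n with O => RtoC 0 | S m => (RtoC (/ INR (S m)) * a m)%C end).
  assert (Hp : conv_D p).
  { apply conv_D_unshift. apply (conv_D_le a _ 1 Ca). intros n. unfold p. rewrite Cmod_mult, Cmod_R.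
    apply Rmult_le_compat_r. apply Cmod_ge_0. assert (0 < INR (S n)) by (apply lt_0_INR; lia).
    rewrite Rabs_pos_eq by (left; now apply Rinv_0_lt_compat).
    rewrite <- Rinv_1. apply Rinv_le_contravar. lra. rewrite S_INR. pose proof (pos_INR n). lra. }
  assert (Ed : forall n, dcoef p n = a n).
  { intros n. unfold dcoef, p. rewrite Cmult_assoc, <- RtoC_mult, Rinv_r. ring. apply not_0_INR. lia. }
  assert (Dp : forall z, Cmod z < 1 -> cderiv (ps p) z (ps (dcoef b) z / ps b z)).
  { intros z Hz. rewrite Ta by trivial. rewrite <- (ps_ext _ _ z Ed). now apply cderiv_ps. }
  set (s := fun z => Cexp (/ 2 * ps p z)%C).
  assert (Hs : holo_D s).
  { intros z Hz. eexists. apply (cderiv_comp (fun z => / 2 * ps p z)%C Cexp).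
    apply cderiv_scal. now apply Dp. apply cderiv_Cexp. }
  assert (Es : forall z, (s z * s z = Cexp (ps p z))%C).
  { intros z. unfold s. rewrite <- Cexp_plus. f_equal. field. }
  assert (s0 : s 0%C = 1%C).
  { unfold s. rewrite ps_0 by trivial. change (p 0%nat) with (RtoC 0). rewrite Cmult_0_r. apply Cexp_0. }
  destruct (taylor_D s Hs) as [Cc Tc]. exists (taylor_coef s). split; trivial. split.
  - now rewrite <- ps_0, <- Tc.
  - intros z Hz. rewrite <- Tc, Es by trivial.
    assert (E : (Cexp (ps p z) / ps b z = Cexp (ps p 0) / ps b 0)%C).
    { apply (zero_derivative_constant (fun z => Cexp (ps p z) / ps b z)%C); trivial.
      intros w Hw. pose proof (HN w Hw) as N.
      replace (RtoC 0) with ((Cexp (ps p w) * (ps (dcoef b) w / ps b w) * ps b w - Cexp (ps p w) * ps (dcoef b) w) / (ps b w * ps b w))%C by (field; trivial).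
      apply (cderiv_div (fun z => Cexp (ps p z)) (ps b)); trivial.
      apply (cderiv_comp (ps p) Cexp). now apply Dp. apply cderiv_Cexp. now apply cderiv_ps. }
    rewrite (ps_0 p), (ps_0 b), H0 in E by trivial. change (p 0%nat) with (RtoC 0) in E. rewrite Cexp_0 in E.
    replace (Cexp (ps p z)) with (Cexp (ps p z) / ps b z * ps b z)%C by (field; now apply HN).
    rewrite E. field.
Qed.

(** The coefficients of [ps c (z * z)]; dividing z by this even function gives the odd transform. *)
Definition even_coef (c : nat -> C) (n : nat) : C :=
  if Nat.even n then c (Nat.div2 n) else RtoC 0.

Lemma even_coef_double (c : nat -> C) (k : nat) :
  even_coef c (2 * k) = c k /\ even_coef c (S (2 * k)) = RtoC 0.
Proof.
  unfold even_coef. rewrite Nat.even_succ, <- Nat.negb_even, Nat.even_even, Nat.div2_even. now split.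
Qed.

Lemma conv_D_even (c : nat -> C) : conv_D c -> conv_D (even_coef c).
Proof.
  intros Hc r Hr. destruct (Hc (r * r)%R) as [M HM]; [nra|].
  exists (Rmax M 0). intros n.
  destruct (Nat.Even_or_Odd n) as [[k ->]|[k ->]].
  - rewrite (proj1 (even_coef_double c k)), pow_mult. eapply Rle_trans; [|apply Rmax_l].
    specialize (HM k). replace (r ^ 2)%R with (r * r)%R by ring. trivial.
  - replace (2 * k + 1)%nat with (S (2 * k)) by lia. rewrite (proj2 (even_coef_double c k)), Cmod_0, Rmult_0_l. apply Rmax_r.
Qed.

Lemma ps_even (c : nat -> C) (z : C) : conv_D c -> Cmod z < 1 -> ps (even_coef c) z = ps c (z * z)%C.
Proof.
  intros Hc Hz. assert (Hzz : Cmod (z * z) < 1).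
  { rewrite Cmod_mult. pose proof (Cmod_ge_0 z). nra. }
  set (u := fun n => (even_coef c n * z ^ n)%C).
  assert (E : forall n, csum u (2 * n) = csum (fun k => c k * (z * z) ^ k)%C n).
  { induction n. reflexivity. replace (2 * S n)%nat with (S (S (2 * n))) by lia. cbn [csum]. rewrite IHn.
    unfold u. destruct (even_coef_double c n) as [-> ->].
    replace (z ^ (2 * n))%C with ((z * z) ^ n)%C. ring. rewrite Cpow_mult_r. f_equal. ring. }
  pose proof (ps_is_csum _ z (conv_D_even c Hc) Hz) as S1. pose proof (ps_is_csum c _ Hc Hzz) as S2.
  apply (is_csum_unique (fun k => c k * (z * z) ^ k)%C); trivial.
  intros e He. destruct (S1 e He) as [N HN]. exists N. intros n Hn. rewrite <- E. apply HN. lia.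
Qed.

(* Area theorem for the odd square-root transform z / sqrt (ps b (z^2)) of f. *)
Lemma square_root_coefficients (f : C -> C) (b : nat -> C) :
  (forall z w, Cmod z < 1 -> Cmod w < 1 -> f z = f w -> z = w) -> conv_D b -> b 0%nat = 1%C ->
  (forall z, Cmod z < 1 -> ps b z <> 0%C /\ f z = (z / ps b z)%C) ->
  exists c1 c2 : C, b 1%nat = (2 * c1)%C /\ b 2%nat = (2 * c2 + c1 * c1)%C /\
    Cmod c1 ^ 2 + 3 * Cmod c2 ^ 2 <= 1.
Proof.
  intros Inj Hb H0 Hf.
  destruct (ps_square_root b Hb H0 (fun z Hz => proj1 (Hf z Hz))) as [c [Hc [C0 Hsq]]].
  exists (c 1%nat), (c 2%nat).
  assert (P0 : Cmod 0 < 1) by (rewrite Cmod_0; lra).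
  pose proof (conv_D_dcoef b Hb) as Hdb. pose proof (conv_D_dcoef c Hc) as Hdc.
  assert (D1 : forall z, Cmod z < 1 -> ps (dcoef b) z = (ps (dcoef c) z * ps c z + ps c z * ps (dcoef c) z)%C).
  { intros z Hz. apply (cderiv_unique (ps b) z). now apply cderiv_ps.
    apply (cderiv_ext_loc (fun w => ps c w * ps c w)%C _ z _ (1 - Cmod z)). lra.
    intros w Hw. apply Hsq. now apply (Cmod_near z). apply cderiv_mult; now apply cderiv_ps. }
  assert (D2 : ps (dcoef (dcoef b)) 0 = (ps (dcoef (dcoef c)) 0 * ps c 0 + ps (dcoef c) 0 * ps (dcoef c) 0
      + (ps (dcoef c) 0 * ps (dcoef c) 0 + ps c 0 * ps (dcoef (dcoef c)) 0))%C).
  { apply (cderiv_unique (ps (dcoef b)) 0). now apply cderiv_ps.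
    apply (cderiv_ext_loc (fun z => ps (dcoef c) z * ps c z + ps c z * ps (dcoef c) z)%C _ 0 _ 1). lra.
    - intros w Hw. symmetry. apply D1. now replace (w - 0)%C with w in Hw by ring.
    - apply cderiv_plus; apply cderiv_mult; now apply cderiv_ps. }
  specialize (D1 0%C P0). rewrite !ps_0, C0 in D1 by trivial. unfold dcoef in D1. change (INR 1) with 1 in D1.
  rewrite !ps_0, C0 in D2 by (trivial; now apply conv_D_dcoef). unfold dcoef in D2.
  replace (INR 2) with 2 in D2 by (simpl; ring). change (INR 1) with 1 in D2.
  assert (B1 : b 1%nat = (2 * c 1%nat)%C) by (transitivity (1 * b 1%nat)%C; [ring|rewrite D1; ring]).
  assert (B2 : b 2%nat = (2 * c 2%nat + c 1%nat * c 1%nat)%C).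
  { transitivity (1 * (2 * b 2%nat) / 2)%C. field. rewrite D2. field. }
  split; [|split]; trivial.
  assert (U : univalent_recip (even_coef c)).
  { assert (HS : forall z, Cmod z < 1 -> Cmod (z * z) < 1).
    { intros z Hz. rewrite Cmod_mult. pose proof (Cmod_ge_0 z). nra. }
    assert (NS : forall z, Cmod z < 1 -> ps c (z * z) <> 0%C).
    { intros z Hz E. apply (proj1 (Hf _ (HS z Hz))). rewrite <- Hsq, E by auto. ring. }
    apply (univalent_recip_intro (fun z => z / ps c (z * z))%C).
    (* Squaring equal values of the odd transform gives z^2 = w^2 by injectivity of f; then the
       denominators agree, hence z = w. *)
    - intros z w Hz Hw E. pose proof (NS z Hz) as N1. pose proof (NS w Hw) as N2.
      assert (E2 : (z * z = w * w)%C).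
      { apply Inj; auto. destruct (Hf _ (HS z Hz)) as [_ ->], (Hf _ (HS w Hw)) as [_ ->].
        rewrite <- !Hsq by auto.
        replace (z * z / (ps c (z * z) * ps c (z * z)))%C with ((z / ps c (z * z)) * (z / ps c (z * z)))%C by (field; trivial).
        rewrite E. field. trivial. }
      rewrite E2 in E. replace z with (z / ps c (w * w) * ps c (w * w))%C by (field; trivial).
      rewrite E. field. trivial.
    - now apply conv_D_even.
    - exact (eq_trans (proj1 (even_coef_double c 0)) C0).
    - intros z Hz. rewrite ps_even by trivial. split; trivial. now apply NS. }
  (* Only the even coefficients survive: the terms n = 1 and n = 3 of the sum are |c_1|^2 and 3
     |c_2|^2. *)
  pose proof (area_theorem _ U 4) as A. cbn [rsum qcoef] in A.
  change (even_coef c 2) with (c 1%nat) in A. change (even_coef c 3) with (RtoC 0) in A.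
  change (even_coef c 4) with (c 2%nat) in A. rewrite Cmod_0 in A. simpl INR in A. lra.
Qed.

Lemma is_csum_tail (u : nat -> C) (l : C) : is_csum u l -> is_csum (fun n => u (S n)) (l - u 0%nat)%C.
Proof.
  intros H e He. destruct (H e He) as [N HN]. exists N. intros n Hn. specialize (HN (S n) ltac:(lia)).
  rewrite csum_shift in HN.
  now replace (csum (fun k => u (S k)) n - (l - u 0%nat))%C with (u 0%nat + csum (fun k => u (S k)) n - l)%C by ring.
Qed.

(** The minimum on |w| = r is at w = - r: with x = Re w, the difference of the squares of the two
    sides is 2/3 (x + r) (1 - r) (3 - r) + 4/3 (x + r)^2, and x + r >= 0. *)
Lemma quadratic_lower_bound (w : C) : Cmod w <= 1 ->
  1 - Cmod w + Cmod w ^ 2 / 3 <= Cmod (1 + w + w * w / 3).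
Proof.
  intros Hw. pose proof (re_le_Cmod w) as Rw.
  apply Rsqr_incr_0_var; [|apply Cmod_ge_0].
  rewrite !Rsqr_pow2.
  pose proof (Cmod2_alt w) as Ew. set (r := Cmod w) in *. destruct w as [x y]. simpl in Rw.
  replace (1 + (x, y) + (x, y) * (x, y) / 3)%C with ((1 + x + (x * x - y * y) / 3, y + 2 * x * y / 3) : C).
  2: { replace ((x, y) * (x, y) / 3)%C with (RtoC (/ 3) * ((x, y) * (x, y)))%C.
       unfold RtoC, Cmult, Cplus; simpl. f_equal; field. rewrite RtoC_inv by lra. field. }
  rewrite Cmod2_alt. simpl in Ew |- *.
  assert (Hx : - r <= x) by (apply Rabs_le_between in Rw; lra).
  assert (Ey : y * y = r * r - x * x) by lra.
  assert (K : 0 <= (x + r) * ((1 - r) * (3 - r))) by (repeat apply Rmult_le_pos; lra).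
  assert (K2 : 0 <= (x + r) * (x + r)) by apply Rle_0_sqr.
  assert (Id : (1 + x + (x * x - y * y) / 3) * (1 + x + (x * x - y * y) / 3) + (y + 2 * x * y / 3) * (y + 2 * x * y / 3)
     = (1 - r + r * r / 3) * (1 - r + r * r / 3) + 2 / 3 * ((x + r) * ((1 - r) * (3 - r))) + 4 / 3 * ((x + r) * (x + r))).
  { replace ((y + 2 * x * y / 3) * (y + 2 * x * y / 3))%R with ((y * y) * ((1 + 2 * x / 3) * (1 + 2 * x / 3)))%R by field.
    rewrite Ey. field. }
  lra.
Qed.

(** * Univalent functions *)

Lemma rsum_shift (u : nat -> R) (n : nat) : rsum u (S n) = u 0%nat + rsum (fun k => u (S k)) n.
Proof. induction n. simpl. ring. cbn [rsum] in *. rewrite IHn. ring. Qed.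

Lemma rsum_plus (u v : nat -> R) (n : nat) : rsum (fun k => u k + v k) n = rsum u n + rsum v n.
Proof. induction n; simpl. ring. rewrite IHn. ring. Qed.

(** AM-GM splits each term into half a term of the area sum and half a term of [wsum]. The first sum
    is at most 1, and so is the second if wsum <= 0, because its term at index 0 is -1. *)
Lemma m_expr_univalent_bound (b : nat -> C) (z : C) : univalent_recip b -> Cmod z < 1 ->
  wsum (Cmod z ^ 2) <= 0 -> Cmod (ps (m_coef (icoef 0 b)) z - 1) <= 1.
Proof.
  intros Hu Hz Hw. pose proof (proj1 Hu) as Hb. pose proof (proj1 (proj2 Hu)) as B0.
  pose proof (Cmod_ge_0 z) as Pz.
  pose proof (is_csum_tail _ _ (ps_is_csum _ z (conv_D_m_coef _ (conv_D_icoef 0 b Hb)) Hz)) as T.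
  replace (ps (m_coef (icoef 0 b)) z - 1)%C with (ps (m_coef (icoef 0 b)) z - m_coef (icoef 0 b) 0 * z ^ 0)%C.
  2: { unfold m_coef, icoef. rewrite B0. simpl. replace ((0 - 1) * ((0 - 1) * 1) )%R with 1 by ring.
       replace (/ (0 + 0 + 1))%R with 1 by field. ring. }
  apply (is_csum_le _ _ _ 0%nat T). intros N _.
  eapply Rle_trans. apply csum_norm_le.
  set (x := (Cmod z ^ 2)%R).
  eapply Rle_trans. apply (rsum_le _ (fun n => / 2 * (INR n * Cmod (qcoef b n) ^ 2) + / 2 * (wcoef (S n) * x ^ S n))).
  { intros n _. unfold m_coef, icoef. rewrite !Cmod_mult, Cmod_pow, !Cmod_R, S_INR. simpl (INR 0).
    pose proof (pos_INR n) as Pn.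
    rewrite Rabs_pos_eq by apply pow2_ge_0. rewrite Rabs_pos_eq by (left; apply Rinv_0_lt_compat; lra).
    replace (x ^ S n)%R with ((Cmod z ^ S n) ^ 2)%R by (unfold x; rewrite <- !pow_mult; f_equal; lia).
    unfold wcoef. rewrite S_INR. set (s := (Cmod z ^ S n)%R).
    destruct n as [|n].
    - simpl. lra.
    - change (qcoef b (S n)) with (b (S (S n))). set (k := INR (S n)) in *. set (q := Cmod (b (S (S n)))).
      assert (0 <= k * (q - k / (k + 2) * s) ^ 2) by (apply Rmult_le_pos; [trivial|apply pow2_ge_0]).
      replace ((k + 1 - 1) ^ 2 * (/ (k + 1 + 0 + 1) * q) * s)%R with (k ^ 2 / (k + 2) * q * s)%R by (field; lra).
      replace ((k + 1 - 1) ^ 3 / (k + 1 + 1) ^ 2)%R with (k ^ 3 / (k + 2) ^ 2)%R by (field; lra).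
      replace (k * (q - k / (k + 2) * s) ^ 2)%R
        with (k * q ^ 2 + k ^ 3 / (k + 2) ^ 2 * s ^ 2 - 2 * (k ^ 2 / (k + 2) * q * s))%R in H by (field; lra).
      lra. }
  rewrite rsum_plus, !rsum_scal.
  pose proof (area_theorem b Hu N) as A.
  assert (Hx : 0 <= x < 1) by (unfold x; nra).
  pose proof (wsum_partial_le x (S N) Hx ltac:(lia)) as W. rewrite rsum_shift, wcoef_0 in W.
  fold x in Hw. simpl (x ^ 0) in W.
  lra.
Qed.

(** With |b_1| <= 2 and |b_2| <= 1 taken separately, the first three terms would leave only 1 -
    0.783 - 0.614 / 3, about 0.012. The square-root transform ties b_2 to b_1: they become 1 + w +
    w^2 / 3 with w = c_1 z, at least 0.421 in modulus, plus 2 c_2 z^2 / 3, at most 0.237; the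
    difference 0.184 exceeds the tail bound 0.138. *)
Lemma integral_univalent_neq_0 (f : C -> C) (b : nat -> C) (z : C) :
  (forall z w, Cmod z < 1 -> Cmod w < 1 -> f z = f w -> z = w) -> conv_D b -> b 0%nat = 1%C ->
  (forall z, Cmod z < 1 -> ps b z <> 0%C /\ f z = (z / ps b z)%C) ->
  Cmod z <= 783 / 1000 -> ps (icoef 0 b) z <> 0%C.
Proof.
  intros Inj Hb B0 Hf Hz E.
  destruct (square_root_coefficients f b Inj Hb B0 Hf) as [c1 [c2 [E1 [E2 Hc]]]].
  pose proof (univalent_recip_intro f b Inj Hb B0 Hf) as Hu.
  assert (Hz1 : Cmod z < 1) by lra. pose proof (Cmod_ge_0 z) as Pz.
  pose proof (is_csum_tail _ _ (is_csum_tail _ _ (is_csum_tail _ _ (ps_is_csum _ z (conv_D_icoef 0 b Hb) Hz1)))) as T.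
  rewrite E in T. cbv beta in T.
  assert (U0 : (icoef 0 b 0 * z ^ 0 = 1)%C).
  { unfold icoef. rewrite B0. simpl. replace (/ (0 + 0 + 1))%R with 1 by field. ring. }
  assert (U1 : (icoef 0 b 1 * z ^ 1 = c1 * z)%C).
  { unfold icoef. rewrite E1. simpl. replace (/ (1 + 0 + 1))%R with (/ 2) by field. rewrite RtoC_inv by lra. field. }
  assert (U2 : (icoef 0 b 2 * z ^ 2 = (c1 * z) * (c1 * z) / 3 + RtoC (2 / 3) * (c2 * (z * z)))%C).
  { unfold icoef. rewrite E2. simpl. replace (/ (1 + 1 + 0 + 1))%R with (/ 3) by field.
    rewrite RtoC_div, RtoC_inv by lra. field. }
  rewrite U0, U1, U2 in T.
  (* The terms from index 3 on: the area sum contributes 0.07 and the geometric series 0.614^3 (25 /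
     224) / 0.386 < 0.067. Here 25 / 224 is 1 / (4 * 0.07) times the bound 1 / 32 for 1 / ((k + 2)
     (k + 4)^2). *)
  assert (B : Cmod (0 - 1 - c1 * z - ((c1 * z) * (c1 * z) / 3 + RtoC (2 / 3) * (c2 * (z * z)))) <= 138 / 1000).
  { apply (is_csum_le _ _ _ 0%nat T). intros N _. eapply Rle_trans. apply csum_norm_le.
    set (x := (Cmod z ^ 2)%R). assert (Hx : 0 <= x <= 614 / 1000) by (unfold x; nra).
    (* AM-GM with weight 7/100 *)
    eapply Rle_trans. apply (rsum_le _ (fun n => 7 / 100 * (INR (S (S n)) * Cmod (qcoef b (S (S n))) ^ 2)
      + x ^ 3 * (25 / 224) * x ^ n)).
    { intros n _. unfold icoef. rewrite !Cmod_mult, Cmod_pow, !Cmod_R. simpl (INR 0).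
      change (qcoef b (S (S n))) with (b (S (S (S n)))). rewrite !S_INR. pose proof (pos_INR n) as Pn.
      replace (x ^ 3 * (25 / 224) * x ^ n)%R with (25 / 224 * (Cmod z ^ S (S (S n))) ^ 2)%R
        by (unfold x; rewrite <- !pow_mult, (Rmult_comm _ (25 / 224)), Rmult_assoc, <- pow_add; do 2 f_equal; lia).
      set (s := (Cmod z ^ S (S (S n)))%R). set (q := Cmod (b (S (S (S n))))). set (k := INR n) in *.
      rewrite Rabs_pos_eq by (left; apply Rinv_0_lt_compat; lra).
      assert (K : 0 <= 7 / 100 * (k + 2) * (q - 50 / 7 / ((k + 2) * (k + 4)) * s) ^ 2).
      { apply Rmult_le_pos. lra. apply pow2_ge_0. }
      replace (7 / 100 * (k + 2) * (q - 50 / 7 / ((k + 2) * (k + 4)) * s) ^ 2)%R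
        with (7 / 100 * (k + 2) * q ^ 2 + 25 / 7 * / ((k + 2) * (k + 4) ^ 2) * s ^ 2 - / (k + 4) * q * s)%R in K by (field; lra).
      assert (I : / ((k + 2) * (k + 4) ^ 2) <= / 32) by (apply Rinv_le_contravar; nra).
      apply (Rmult_le_compat_r (s ^ 2)) in I; [|apply pow2_ge_0].
      replace (k + 1 + 1 + 1 + 0 + 1)%R with (k + 4)%R by ring. lra. }
    rewrite rsum_plus, !rsum_scal.
    pose proof (area_theorem b Hu (S (S N))) as A. rewrite !rsum_shift in A. cbv beta in A.
    assert (0 <= INR 0 * Cmod (qcoef b 0) ^ 2 /\ 0 <= INR 1 * Cmod (qcoef b 1) ^ 2) as [A0 A1]
      by (split; apply Rmult_le_pos; try apply pos_INR; apply pow2_ge_0).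
    pose proof (rsum_geom_le x N ltac:(lra) : rsum (pow x) N <= _) as G.
    assert (G2 : / (1 - x) <= / (386 / 1000)) by (apply Rinv_le_contravar; lra).
    assert (X3 : 0 <= x ^ 3 <= (614 / 1000) ^ 3) by (split; [apply pow_le; lra | apply pow_incr; lra]).
    assert (x ^ 3 * rsum (pow x) N <= (614 / 1000) ^ 3 * / (386 / 1000)).
    { apply (Rle_trans _ (x ^ 3 * / (386 / 1000))). apply Rmult_le_compat_l; lra. apply Rmult_le_compat_r; lra. }
    lra. }
  assert (C1 : Cmod c1 <= 1) by (pose proof (pow2_ge_0 (Cmod c2)); pose proof (Cmod_ge_0 c1); nra).
  (* 0.578 is just above 1 / sqrt 3. *)
  assert (C2 : Cmod c2 <= 578 / 1000) by (pose proof (pow2_ge_0 (Cmod c1)); pose proof (Cmod_ge_0 c2); nra).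
  assert (W : Cmod (c1 * z) <= 783 / 1000).
  { rewrite Cmod_mult. pose proof (Cmod_ge_0 c1). nra. }
  pose proof (quadratic_lower_bound (c1 * z) ltac:(lra)) as L.
  pose proof (Cmod_ge_0 (c1 * z)) as W0.
  assert (L2 : 421 / 1000 <= 1 - Cmod (c1 * z) + Cmod (c1 * z) ^ 2 / 3) by nra.
  assert (Q : Cmod (RtoC (2 / 3) * (c2 * (z * z))) <= 237 / 1000).
  { rewrite !Cmod_mult, Cmod_R, Rabs_pos_eq by lra. pose proof (Cmod_ge_0 c2).
    assert (Cmod z * Cmod z <= 614 / 1000) by nra. nra. }
  pose proof (Cmod_triangle (- (0 - 1 - c1 * z - ((c1 * z) * (c1 * z) / 3 + RtoC (2 / 3) * (c2 * (z * z)))))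
    (- (RtoC (2 / 3) * (c2 * (z * z))))) as Tr.
  rewrite !Cmod_opp in Tr.
  replace (- (0 - 1 - c1 * z - ((c1 * z) * (c1 * z) / 3 + RtoC (2 / 3) * (c2 * (z * z))))
    + - (RtoC (2 / 3) * (c2 * (z * z))))%C with (1 + c1 * z + (c1 * z) * (c1 * z) / 3)%C in Tr by ring.
  lra.
Qed.

(** [wsum] increases, so its sign at r^2 covers the whole closed disk; zeros are excluded up to the
    rounded radius 0.783, which lies slightly above r3. *)
Theorem class_S_H_transform (f : C -> C) (r : R) : r <= 783 / 1000 -> wsum (r ^ 2) <= 0 ->
  class_S f -> belongs_M_on (closed_disk r) (H_transform f).
Proof.
  intros Hr Hw [HA Inj]. unfold unit_disk in Inj.
  assert (P0 : Cmod 0 < 1) by (rewrite Cmod_0; lra).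
  assert (Hn : forall z, Cmod z < 1 -> z <> 0%C -> f z <> 0%C).
  { intros z Hz Nz E. apply Nz, Inj; trivial. rewrite E. symmetry. apply HA. }
  destruct (class_A_quotient_ps f HA Hn) as [b [Hb [B0 Hf]]].
  assert (Hi := conv_D_icoef 0 b Hb).
  assert (HI : forall z, closed_disk r z -> Cmod z <= 783 / 1000) by (intros z; unfold closed_disk; lra).
  assert (Hf' : forall z, Cmod z < 1 -> ps b z <> 0%C /\ f z = (z / ps b z)%C) by (intros z Hz; now apply Hf).
  apply (belongs_M_of_ps _ _ (icoef 0 b)); trivial.
  - intros z Hz. specialize (HI z Hz). lra.
  - unfold icoef. rewrite B0. simpl. replace (/ (0 + 0 + 1))%R with 1 by field. ring.
  - unfold H_transform. destruct (Ceq_dec 0 0) as [_|N]; trivial. now destruct N.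
  - intros z Hz Nz. apply H_transform_ps; trivial. intros w Hz'. now apply Hf.
  - intros z Hz. apply (integral_univalent_neq_0 f); auto.
  - intros z Hz. specialize (HI z Hz). unfold closed_disk in Hz. pose proof (Cmod_ge_0 z).
    apply m_expr_univalent_bound. now apply (univalent_recip_intro f). lra.
    destruct (Req_dec (Cmod z) r) as [->|N]; trivial.
    eapply Rle_trans; [left; apply (wsum_increasing _ (r ^ 2)%R); nra|trivial].
Qed.

Theorem theorem4p4 :
  exists r3 : R,
    unique (fun r : R => (0 < r < 1)%R /\ r3_equation r) r3 /\
    (Rabs (r3 - 7829 / 10000) < 5 / 100000)%R /\
    (forall f : C -> C,
        class_S f -> belongs_M_on (closed_disk r3) (H_transform f)) /\
    (forall f : C -> C, class_M f -> class_M (H_transform f)).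
Proof.
  destruct r3_exists as [r3 [Hu [Ha [Hr Hw]]]]. exists r3. split; [|split; [|split]]; trivial.
  - intros f. apply class_S_H_transform; lra.
  - exact class_M_H_transform.
Qed.
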